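(* Let $E$ be an abelian Anderson $A$-module of dimension $d$ and rank $r$ over $R$. Then the semilinear operator $\mathfrak f^*:\mathbf H(E)_K\to\mathbf H(E)_K$ is a bijection. In particular, $(\mathbf H_\delta(E),\mathfrak f^* )$ forms a $z$-isocrystal.
   Context: Setting. $q$ is a prime power, $\mathcal C$ a smooth projective geometrically connected curve over $\mathbb F_q$, $\infty\in\mathcal C$ an $\mathbb F_q$-rational point, $A$ the ring of functions regular outside $\infty$. Fix a maximal ideal $\mathfrak p\subset A$ of degree $f$ and $z\in\mathfrak p\setminus\mathfrak p^2$ with $A$ separable over $\mathbb F_q[z]$. $\hat A$ is the $\mathfrak p$-adic completion of $A$, $\pi$ is the image of $z$ in $\hat A$, $\hat q=q^f=|A/\mathfrak p|$. $R$ is a flat $\hat A$-algebra which is a $\mathfrak p$-adically complete discrete valuation ring, with characteristic map $\theta:A\to\hat A\to R$; $K=\mathrm{Frac}\,R$, $l$ the residue field, and $R\simeq l[[z]]$, $K\simeq l((z))$ with $z$ corresponding to $\pi$. $\phi:R\to R$ is a fixed $\hat A$-algebra endomorphism with $\phi(x)\equiv x^{\hat q}\bmod\mathfrak pR$; under $R\simeq l[[z]]$ it is $z\mapsto z$, $a\mapsto a^{\hat q}$ for $a\in l$. $S=\mathrm{Spf}\,R$; $M_K:=M\otimes_RK$. Anderson modules. An $A$-module scheme is a smooth $\pi$-formal group scheme $E$ over $S$ with a ring map $\varphi_E:A\to\mathrm{End}_R(E)$. $\hat{\mathbb G}_a$ denotes the $\pi$-formal additive group with $A$-action through $\theta$.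 An abelian Anderson $A$-module of rank $r$ and dimension $d$ is an affine $A$-module scheme $E$ of relative dimension $d$ such that (i) $E\cong\hat{\mathbb G}_a^d$ as $\mathbb F_q$-module schemes; (ii) $(\varphi_{\mathrm{Lie}E}(a)-\theta(a))^d=0$ for all $a\in A$; (iii) $M(E)=\mathrm{Hom}_{R,\mathbb F_q}(E,\hat{\mathbb G}_a)$ is a locally free $A\otimes_{\mathbb F_q}R$-module of rank $r$, where $(a\otimes b)m=b\circ m\circ\varphi_E(a)$. Jet spaces. $W_n(B)$ is the ring of $\pi$-typical Witt vectors of length $n+1$ of a $\pi$-adically complete $R$-algebra $B$ (ghost components $w_i=x_0^{\hat q^i}+\pi x_1^{\hat q^{i-1}}+\dots+\pi^i x_i$). $J^nE(B)=E(W_n(B))$; $u:J^nE\to J^{n-1}E$ is induced by truncation, $\phi:J^nE\to J^{n-1}E$ by Witt Frobenius $F$. $N^n:=\ker(J^nE\to E)$ with inclusion $i:N^n\to J^nE$ ($A$-linear). Identifying $J^nE\cong\mathbb W_n^d$ (additive Witt vectors of length $n+1$) and, via Verschiebung, $N^n\cong\mathbb W_{n-1}^d$ as group schemes, the lateral Frobenius $\mathfrak f:N^{n+1}\to N^{n}$ is the Witt Frobenius $F:\mathbb W_n^d\to\mathbb W_{n-1}^d$; it is $A$-linear, lies over $\phi$ on $S$, and $\phi\circ i\circ\mathfrak f=\phi\circ\phi\circ i$. Put $\mathbf X_n(E)=\mathrm{Hom}_A(J^nE,\hat{\mathbb G}_a)$ and $\mathbf X(N^n)=\mathrm{Hom}_A(N^n,\hat{\mathbb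 G}_a)$. Pullbacks $\phi^*$ and $\mathfrak f^*$ on characters are relative pullbacks along these Frobenii, so they are additive and $\phi$-semilinear: $\phi^*(c\Theta)=\phi(c)\phi^*\Theta$, $\mathfrak f^*(c\Psi)=\phi(c)\mathfrak f^*\Psi$ for $c\in R$. For an $R$-module $M$, $M_\phi$ is $M$ with $R$-structure precomposed with $\phi$. Definition of $\mathbf H(E)$. $\mathbf H(E):=\varinjlim_n \mathbf X(N^n)/i^*\phi^*(\mathbf X_{n-1}(E)_\phi)$ with transition maps $u^*$; $\mathfrak f^*$ descends to a $\phi$-semilinear endomorphism of $\mathbf H(E)$. It is known that $\mathbf H(E)$ is a free $R$-module of rank $\le r$. Put $\mathbf H_\delta(E):=\mathbf H(E)\otimes_Rl((z))$, to which $\mathfrak f^*$ extends. A $z$-isocrystal over $l$ is a finite-dimensional $l((z))$-vector space $D$ with an isomorphism $F_D:\sigma^*D=D\otimes_{\sigma,l((z))}l((z))\to D$ of $l((z))$-vector spaces, where $\sigma=\phi$ on $l((z))$; a $\phi$-semilinear operator is identified with its linearization.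
   Formalization: For imperfect l, bijectivity of f* means that of its linearization (on elements only for perfect l), and i*φ*(X_{n-1}(E)_φ) means its R-span; in condition (iii) A⊗R is replaced by its π-adic completion, as otherwise no E of positive dimension exists. *)

(* Defs.v *)
From HB Require Import structures.
From mathcomp Require Import all_boot all_order all_algebra.
From mathcomp Require Import separable boolp classical_sets.

Set Implicit Arguments.
Unset Strict Implicit.
Unset Printing Implicit Defensive.

Import GRing.Theory.
Local Open Scope ring_scope.

Definition pi_adically_complete (B : comNzRingType) (t : B) : Prop :=
  (forall x, (forall n, exists y, x = t ^+ n * y) -> x = 0) /\
  (forall u : nat -> B, (forall n, exists y, u n.+1 - u n = t ^+ n * y) ->
     exists x, forall n, exists y, x - u n = t ^+ n * y).

(* A pi-adically complete domain of characteristic p with a lift phi of the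
   qhat-power Frobenius fixing pi.  When pi is the image of an element of p not in
   p^2, congruences modulo pi are congruences modulo pR. *)
Record base := Base {
  base_ring :> idomainType;
  ppi : base_ring;
  qhat : nat;
  phi : {rmorphism base_ring -> base_ring};
  ppi_neq0 : ppi != 0;
  qhat_gt1 : (1 < qhat)%N;
  qhat_char : [pchar base_ring].-nat qhat;
  base_complete : pi_adically_complete ppi;
  phi_ppi : phi ppi = ppi;
  phi_lift : forall x, exists y, phi x = x ^+ qhat + ppi * y
}.

(* pi-adically complete (nonzero) algebras: the test objects on which the formal
   schemes over Spf R are evaluated. *)
Record calg (S : base) := CAlg {
  calg_ring :> comNzRingType;
  str : {rmorphism S -> calg_ring};
  calg_complete : pi_adically_complete (str (ppi S))
}.

Record chom (S : base) (B C : calg S) := CHom {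
  chom_fun :> {rmorphism B -> C};
  chom_str : forall r, chom_fun (str B r) = str C r
}.

Definition base_calg (S : base) : calg S :=
  @CAlg S S idfun (base_complete S).

Section BaseTheory.
Variable S : base.
Local Notation R := (base_ring S).
Local Notation q := (qhat S).
Local Notation pi := (ppi S).

(* w_n(x) = x_0^(q^n) + pi x_1^(q^(n-1)) + ... + pi^n x_n *)
Definition ghost (B : calg S) (x : nat -> B) (n : nat) : B :=
  \sum_(h < n.+1) str B pi ^+ h * x h ^+ (q ^ (n - h)).

Lemma calg_char (B : calg S) k : [pchar B].-nat (q ^ k)%N.
Proof.
rewrite pnatX; apply/orP; left; have := qhat_char S.
apply: sub_in_pnat => p _; rewrite !inE => /andP[-> /eqP p0] /=.
by rewrite -(rmorph_nat (str B)) p0 rmorph0.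
Qed.

Lemma qpowD (B : calg S) k (x y : B) :
  (x + y) ^+ (q ^ k) = x ^+ (q ^ k) + y ^+ (q ^ k).
Proof. exact/exprDn_pchar/calg_char. Qed.

Lemma qk_gt0 k : (0 < q ^ k)%N.
Proof. by rewrite expn_gt0 (ltnW (qhat_gt1 S)). Qed.

Lemma qpow0 (B : calg S) k : (0 : B) ^+ (q ^ k) = 0.
Proof. by rewrite expr0n eqn0Ngt qk_gt0. Qed.

Lemma qpow_sum (B : calg S) k (I : Type) (r : seq I) P (F : I -> B) :
  (\sum_(i <- r | P i) F i) ^+ (q ^ k) = \sum_(i <- r | P i) F i ^+ (q ^ k).
Proof. exact: (big_morph (fun x : B => x ^+ (q ^ k)) (@qpowD B k) (qpow0 B k)). Qed.

Lemma qpowN (B : calg S) k (x : B) : (- x) ^+ (q ^ k) = - x ^+ (q ^ k).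
Proof. by apply/eqP; rewrite -addr_eq0 -qpowD addNr qpow0. Qed.

Lemma qpow_comp (B : calg S) i h m (x : B) : (i <= h <= m)%N ->
  (x ^+ (q ^ (h - i))) ^+ (q ^ (m - h)) = x ^+ (q ^ (m - i)).
Proof.
by case/andP=> ih hm; rewrite -exprM -expnD addnC addnBA // subnK.
Qed.

Lemma ghostS (x : nat -> base_calg S) n : 
  ghost x n = \sum_(h < n) pi ^+ h * x h ^+ (q ^ (n - h)) + pi ^+ n * x n.
Proof. by rewrite /ghost big_ord_recr /= subnn expr1. Qed.

Lemma ghost_inj (x y : nat -> base_calg S) n :
  (forall m, (m <= n)%N -> ghost x m = ghost y m) ->
  forall m, (m <= n)%N -> x m = y m.
Proof.
move=> E; elim/ltn_ind=> m IH mn; have := E m mn; rewrite !ghostS.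
rewrite (eq_bigr (fun h : 'I_m => pi ^+ h * y h ^+ (q ^ (m - h)))).
  by move/addrI/mulfI; apply; rewrite expf_neq0 // ppi_neq0.
by move=> h _; rewrite IH // (leq_trans (ltnW (ltn_ord h)) mn).
Qed.

Lemma ghost_injP (x y : nat -> base_calg S) :
  (forall m, ghost x m = ghost y m) -> forall m, x m = y m.
Proof. by move=> E m; apply: (@ghost_inj x y m) => // k _; exact: E. Qed.

Lemma phi_qpow x k : exists y, phi S x ^+ (q ^ k) = x ^+ (q ^ k.+1) + pi ^+ k.+1 * y.
Proof.
have [y ->] := phi_lift x; rewrite (@qpowD (base_calg S)) -exprM -expnS.
rewrite exprMn; have le : (k.+1 <= q ^ k)%N by apply: ltn_expl (qhat_gt1 S).
by exists (pi ^+ (q ^ k - k.+1) * y ^+ (q ^ k)); rewrite mulrA -exprD subnKC.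
Qed.

Lemma dwork (x : nat -> base_calg S) (g : nat -> R) n :
  g n.+1 = phi S (g n) -> ghost x n = g n ->
  exists y, g n.+1 = \sum_(h < n.+1) pi ^+ h * x h ^+ (q ^ (n.+1 - h)) + pi ^+ n.+1 * y.
Proof.
move=> -> <-; rewrite rmorph_sum.
suff /choice [y yP] : forall h : 'I_n.+1, exists y, phi S (str (base_calg S) pi ^+ h * x h ^+ (q ^ (n - h))) =
  pi ^+ h * x h ^+ (q ^ (n.+1 - h)) + pi ^+ n.+1 * y.
  by exists (\sum_h y h); rewrite mulr_sumr -big_split; apply: eq_bigr => h _; rewrite yP.
move=> h; have hn : (h <= n)%N by rewrite -ltnS.
have [y yP] := phi_qpow (x h) (n - h); exists y.
rewrite rmorphM !rmorphXn /= phi_ppi yP subSn // mulrDr; congr (_ + _).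
by rewrite mulrA -exprD addnS subnKC.
Qed.

Lemma lam_exists (r : R) :
  exists x : nat -> base_calg S, forall n, ghost x n = iter n (phi S) r.
Proof.
pose g n := iter n (phi S) r.
suff fin n : exists x : nat -> R, forall m, (m <= n)%N -> @ghost (base_calg S) x m = g m.
  have /choice[X XP] := fin; exists (fun n => X n n) => n.
  rewrite -/(g n) -(XP n n) //; apply: eq_bigr => h _.
  have hn : (h <= n)%N by rewrite -ltnS.
  congr (_ * _ ^+ _); apply: (@ghost_inj (X h) (X n) h) => // m mh.
  by rewrite !XP // (leq_trans mh).
elim: n => [|n [x xP]].
  exists (fun=> r) => m; rewrite leqn0 => /eqP->.
  by rewrite ghostS big_ord0 add0r mul1r.
have [y yP] := @dwork x g n (erefl _) (xP n (leqnn n)).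
exists (fun m => if (m <= n)%N then x m else y) => m.
rewrite leq_eqVlt => /orP[/eqP->|]; last first.
  rewrite ltnS => mn; rewrite -xP //; apply: eq_bigr => h _.
  by rewrite (leq_trans _ mn) // -ltnS.
rewrite ghostS ltnn yP; congr (_ + _); apply: eq_bigr => h _.
by rewrite -ltnS ltn_ord.
Qed.

(* lam r is the image of r under the ring map R -> W(R) attached to phi, i.e.
   the unique Witt vector with ghost components w_n = phi^n(r). *)
Definition lam (r : R) : nat -> R := projT1 (cid (lam_exists r)).

Lemma ghost_lam r n : @ghost (base_calg S) (lam r) n = iter n (phi S) r.
Proof. by rewrite /lam; case: cid. Qed.

Lemma lam_uniq r (x : nat -> base_calg S) :
  (forall n, ghost x n = iter n (phi S) r) -> lam r =1 x.
Proof. by move=> E; apply: ghost_injP => m; rewrite ghost_lam E. Qed.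

Lemma iter_phi_pi n i : iter n (phi S) (pi ^+ i) = pi ^+ i.
Proof. by elim: n => //= n ->; rewrite rmorphXn /= phi_ppi. Qed.

Lemma lam_phi r n : lam (phi S r) n = phi S (lam r n).
Proof.
apply: (@lam_uniq _ (fun n => phi S (lam r n))) => m.
rewrite -iterSr iterS -ghost_lam rmorph_sum; apply: eq_bigr => h _.
by rewrite rmorphM !rmorphXn /= phi_ppi.
Qed.

Lemma lam_pi_fix i n : phi S (lam (pi ^+ i) n) = lam (pi ^+ i) n.
Proof. by rewrite -lam_phi rmorphXn /= phi_ppi. Qed.

(* gam m i j is the m-th component of the product V^i(1) V^j(1) = V^j(pi^i),
   i <= j, of Witt vectors. *)
Definition gam m i j : R :=
  if (maxn i j <= m)%N then lam (pi ^+ minn i j) (m - maxn i j) else 0.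

Lemma gam0 m i j : (m < maxn i j)%N -> gam m i j = 0.
Proof. by move=> h; rewrite /gam leqNgt h. Qed.

Lemma gamC m i j : gam m i j = gam m j i.
Proof. by rewrite /gam maxnC minnC. Qed.

Lemma gam_fix m i j : phi S (gam m i j) = gam m i j.
Proof. by rewrite /gam; case: ifP; rewrite ?lam_pi_fix ?rmorph0. Qed.

(* the k-fold Verschiebung *)
Definition wsh (B : calg S) (k : nat) (x : nat -> B) (n : nat) : B :=
  if (k <= n)%N then x (n - k)%N else 0.

Lemma ghost_wsh (B : calg S) k (x : nat -> B) n :
  ghost (wsh k x) n = if (k <= n)%N then str B pi ^+ k * ghost x (n - k) else 0.
Proof.
rewrite /ghost /wsh; case: leqP => kn; last first.
  apply: big1 => h _; have hn : (h <= n)%N by rewrite -ltnS.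
  by rewrite leqNgt (leq_ltn_trans hn kn) qpow0 mulr0.
rewrite mulr_sumr -(big_mkord xpredT (fun h => str B pi ^+ h *
  (if (k <= h)%N then x (h - k)%N else 0) ^+ (q ^ (n - h)))).
rewrite (@big_cat_nat _ _ _ k) //=; last exact: leqW.
rewrite big_nat big1 ?add0r => [|h /andP[_ hk]]; last first.
  by rewrite leqNgt hk qpow0 mulr0.
rewrite -{1}(add0n k) big_addn subSn // big_mkord; apply: eq_bigr => h _.
by rewrite leq_addl addnK mulrA -exprD addnC -subnDA.
Qed.

Lemma ghost_gam i j M :
  @ghost (base_calg S) (fun m => gam m i j) M =
  if (maxn i j <= M)%N then pi ^+ (i + j) else 0.
Proof.
have -> : @ghost (base_calg S) (fun m => gam m i j) M =
  @ghost (base_calg S) (wsh (maxn i j) (lam (pi ^+ minn i j) : nat -> base_calg S)) M by [].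
rewrite ghost_wsh; case: ifP => // _.
by rewrite ghost_lam iter_phi_pi -exprD addnC addn_min_max.
Qed.

(* In characteristic p the ghost components are additive, so Witt vectors are
   added componentwise; x = sum_i V^i[x_i] and bilinearity give the product
   below, whose ghost components multiply by ghost_wmul. *)
Definition wmul (B : calg S) (x y : nat -> B) (m : nat) : B :=
  \sum_(i < m.+1) \sum_(j < m.+1)
     str B (gam m i j) * (x i ^+ (q ^ (m - i)) * y j ^+ (q ^ (m - j))).

Lemma widen_sum (B : calg S) (F : nat -> B) m N : (m <= N)%N ->
  (forall i, (m < i)%N -> F i = 0) -> \sum_(i < m.+1) F i = \sum_(i < N.+1) F i.
Proof.
move=> mN F0; rewrite -!(big_mkord xpredT F).
rewrite (@big_cat_nat _ _ _ m.+1 0 N.+1) //= [X in _ + X]big1_seq ?addr0 //.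
by move=> i /=; rewrite mem_index_iota => /andP[im _]; apply: F0.
Qed.

Lemma wmul_widen (B : calg S) (x y : nat -> B) m N : (m <= N)%N ->
  wmul x y m = \sum_(i < N.+1) \sum_(j < N.+1)
     str B (gam m i j) * (x i ^+ (q ^ (m - i)) * y j ^+ (q ^ (m - j))).
Proof.
move=> mN; rewrite /wmul.
rewrite (@widen_sum B (fun i => \sum_(j < m.+1) str B (gam m i j) * (x i ^+ (q ^ (m - i)) * y j ^+ (q ^ (m - j)))) m N) //.
  apply: eq_bigr => i _.
  rewrite (@widen_sum B (fun j => str B (gam m i j) * (x i ^+ (q ^ (m - i)) * y j ^+ (q ^ (m - j)))) m N) //.
  by move=> j mj; rewrite gam0 ?rmorph0 ?mul0r // leq_max mj orbT.
move=> i mi; apply: big1 => j _.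
by rewrite gam0 ?rmorph0 ?mul0r // leq_max mi.
Qed.

Lemma ghost_wmul (B : calg S) (x y : nat -> B) n :
  ghost (wmul x y) n = ghost x n * ghost y n.
Proof.
rewrite {1}/ghost.
transitivity (\sum_(h < n.+1) \sum_(i < n.+1) \sum_(j < n.+1)
   str B (pi ^+ h * gam h i j ^+ (q ^ (n - h))) * (x i ^+ (q ^ (n - i)) * y j ^+ (q ^ (n - j)))).
  apply: eq_bigr => h _; have hn : (h <= n)%N by rewrite -ltnS.
  rewrite (wmul_widen x y hn) qpow_sum mulr_sumr; apply: eq_bigr => i _.
  rewrite qpow_sum mulr_sumr; apply: eq_bigr => j _.
  case: (ltnP h (maxn i j)) => [hij|].
    by rewrite (gam0 hij) (@qpow0 (base_calg S)) mulr0 !rmorph0 !mul0r qpow0 mulr0.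
  rewrite geq_max => /andP[ih jh].
  rewrite !exprMn !qpow_comp ?ih ?jh // rmorphM !rmorphXn /=.
  by rewrite !mulrA.
rewrite exchange_big /= /ghost mulr_suml; apply: eq_bigr => i _.
rewrite exchange_big /= mulr_sumr; apply: eq_bigr => j _.
rewrite -mulr_suml -rmorph_sum /=.
have -> : \sum_(h < n.+1) pi ^+ h * gam h i j ^+ (q ^ (n - h)) = pi ^+ (i + j).
  have := ghost_gam i j n; rewrite geq_max -(ltnS i) -(ltnS j) !ltn_ord /= => <-.
  by [].
by rewrite rmorphXn exprD /= mulrACA.
Qed.

Definition wone (B : calg S) (k : nat) (n : nat) : B := (n == k)%:R.

Lemma wone_wsh (B : calg S) k : wone B k =1 wsh k (wone B 0).
Proof.
move=> n; rewrite /wone /wsh; case: leqP => [kn|nk].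
  by rewrite subn_eq0 eqn_leq kn andbT.
by rewrite ltn_eqF.
Qed.

Lemma ghost_eq (B : calg S) (x y : nat -> B) n : x =1 y -> ghost x n = ghost y n.
Proof. by move=> E; apply: eq_bigr => h _; rewrite E. Qed.

Lemma ghost_wone (B : calg S) k n :
  ghost (wone B k) n = if (k <= n)%N then str B pi ^+ k else 0.
Proof.
rewrite (ghost_eq n (wone_wsh B k)) ghost_wsh; case: ifP => // _.
rewrite /ghost big_ord_recl /= expr0 mul1r /wone eqxx expr1n big1 ?addr0 ?mulr1 //.
by move=> h _; rewrite qpow0 mulr0.
Qed.

Lemma lam1 n : lam 1 n = (n == 0)%:R.
Proof.
apply: (@lam_uniq 1 (wone (base_calg S) 0)) => m.
by rewrite ghost_wone /= expr0 -(expr0 pi) iter_phi_pi.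
Qed.

Lemma wmul_eq (B : calg S) (x x' y y' : nat -> B) m :
  (forall i, (i <= m)%N -> x i = x' i) -> (forall i, (i <= m)%N -> y i = y' i) ->
  wmul x y m = wmul x' y' m.
Proof.
move=> Ex Ey; apply: eq_bigr => i _; apply: eq_bigr => j _.
by rewrite Ex ?Ey // -ltnS.
Qed.

Lemma wmulC (B : calg S) (x y : nat -> B) m : wmul x y m = wmul y x m.
Proof.
rewrite /wmul exchange_big; apply: eq_bigr => i _; apply: eq_bigr => j _.
by rewrite gamC (mulrC (x j ^+ _)).
Qed.

Lemma wmulDl (B : calg S) (x y z : nat -> B) m :
  wmul (fun i => x i + y i) z m = wmul x z m + wmul y z m.
Proof.
rewrite /wmul -big_split; apply: eq_bigr => i _; rewrite -big_split.
by apply: eq_bigr => j _; rewrite /= qpowD mulrDl mulrDr.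
Qed.

Lemma wmul1 (B : calg S) (y : nat -> B) m : wmul (wone B 0) y m = y m.
Proof.
rewrite /wmul big_ord_recl /= [X in _ + X]big1 ?addr0; last first.
  by move=> i _; apply: big1 => j _; rewrite qpow0 mul0r mulr0.
rewrite big_ord_recr /= big1 ?add0r; last first.
  move=> j _; rewrite /gam max0n min0n expr0 lam1.
  by rewrite subn_eq0 (leqNgt m) ltn_ord /=; case: ifP => _; rewrite rmorph0 mul0r.
by rewrite /gam max0n min0n leqnn expr0 lam1 subnn rmorph1 mul1r expr1n mul1r expr1.
Qed.

(* coefficients of the iterated products of the elements V^i(1) *)
Lemma gam_assoc m i j k :
  \sum_(h < m.+1) gam m h k * gam h i j ^+ (q ^ (m - h)) =
  \sum_(h < m.+1) gam m i h * gam h j k ^+ (q ^ (m - h)).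
Proof.
have L (x : nat -> base_calg S) l n :
    wmul x (wone _ l) n = \sum_(h < n.+1) gam n h l * x h ^+ (q ^ (n - h)).
  apply: eq_bigr => h _; have [ln|nl] := leqP l n; last first.
    rewrite (gam0 (_ : (n < maxn h l)%N)) ?leq_max ?nl ?orbT // mul0r.
    apply: big1 => j' _; rewrite /wone ltn_eqF ?qpow0 ?mulr0 //.
    by apply: leq_trans nl; rewrite ltn_ord.
  rewrite (bigD1 (Ordinal (ln : (l < n.+1)%N))) //= big1 ?addr0.
    by rewrite /wone eqxx expr1n mulr1.
  by move=> j' /negbTE; rewrite /wone -val_eqE /= => ->; rewrite (@qpow0 (base_calg S)) !mulr0.
have Rr (x : nat -> base_calg S) l n :
    wmul (wone _ l) x n = \sum_(h < n.+1) gam n l h * x h ^+ (q ^ (n - h)).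
  by rewrite wmulC L; apply: eq_bigr => h _; rewrite gamC.
rewrite -(L (fun m => gam m i j) k m) -(Rr (fun m => gam m j k) i m).
refine (@ghost_injP (@wmul (base_calg S) (fun m => gam m i j) (wone _ k)) (@wmul (base_calg S) (wone _ i) (fun m => gam m j k)) _ m) => M.
rewrite !ghost_wmul !ghost_wone !ghost_gam !geq_max /=.
case: (i <= M)%N; case: (j <= M)%N; case: (k <= M)%N; rewrite /= ?mulr0 ?mul0r //.
by rewrite -!exprD addnA.
Qed.

Lemma wmul_tri (B : calg S) (x y z : nat -> B) m :
  wmul (wmul x y) z m = \sum_(i < m.+1) \sum_(j < m.+1) \sum_(k < m.+1)
   str B (\sum_(h < m.+1) gam m h k * gam h i j ^+ (q ^ (m - h))) *
   (x i ^+ (q ^ (m - i)) * y j ^+ (q ^ (m - j)) * z k ^+ (q ^ (m - k))).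
Proof.
transitivity (\sum_(h < m.+1) \sum_(k < m.+1) \sum_(i < m.+1) \sum_(j < m.+1)
   str B (gam m h k * gam h i j ^+ (q ^ (m - h))) *
   (x i ^+ (q ^ (m - i)) * y j ^+ (q ^ (m - j)) * z k ^+ (q ^ (m - k)))).
  apply: eq_bigr => h _; apply: eq_bigr => k _.
  have hn : (h <= m)%N by rewrite -ltnS.
  rewrite (wmul_widen x y hn) qpow_sum mulr_suml mulr_sumr; apply: eq_bigr => i _.
  rewrite qpow_sum mulr_suml mulr_sumr; apply: eq_bigr => j _.
  case: (ltnP h (maxn i j)) => [hij|].
    by rewrite (gam0 hij) (@qpow0 (base_calg S)) mulr0 !rmorph0 !mul0r qpow0 mul0r mulr0.
  rewrite geq_max => /andP[ih jh].
  by rewrite !exprMn !qpow_comp ?ih ?jh // rmorphM !rmorphXn /= !mulrA.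
under eq_bigr do rewrite exchange_big /=.
rewrite exchange_big /=; apply: eq_bigr => i _.
under eq_bigr do rewrite exchange_big /=.
rewrite exchange_big /=; apply: eq_bigr => j _.
rewrite exchange_big /=; apply: eq_bigr => k _.
by rewrite rmorph_sum mulr_suml.
Qed.

Lemma wmulA (B : calg S) (x y z : nat -> B) m :
  wmul x (wmul y z) m = wmul (wmul x y) z m.
Proof.
rewrite wmulC (wmul_tri y z x) wmul_tri [RHS]exchange_big /=.
apply: eq_bigr => j _; rewrite [RHS]exchange_big /=.
apply: eq_bigr => k _; apply: eq_bigr => i _.
rewrite [in RHS]gam_assoc; congr (str B _ * _); last by rewrite mulrC mulrA.
by apply: eq_bigr => h _; rewrite gamC.
Qed.
End BaseTheory.

Section WittTheory.
Variable S : base.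
Local Notation R := (base_ring S).
Local Notation q := (qhat S).
Local Notation pi := (ppi S).

Definition str_hom (B : calg S) : chom (base_calg S) B :=
  @CHom S (base_calg S) B (str B) (fun r => erefl).

Lemma wmul_map (B C : calg S) (h : chom B C) (x y : nat -> B) m :
  h (wmul x y m) = wmul (fun i => h (x i)) (fun i => h (y i)) m.
Proof.
rewrite /wmul rmorph_sum; apply: eq_bigr => i _; rewrite rmorph_sum.
by apply: eq_bigr => j _; rewrite !rmorphM !rmorphXn /= chom_str.
Qed.

Definition wstr (B : calg S) (r : R) (i : nat) : B := str B (lam r i).

Lemma lamM (r s : R) : lam (r * s) =1 wmul (B := base_calg S) (lam r) (lam s).
Proof.
apply: lam_uniq => m; rewrite ghost_wmul !ghost_lam.
by elim: m => //= m <-; rewrite rmorphM.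
Qed.

Lemma lamD (r s : R) m : lam (r + s) m = lam r m + lam s m.
Proof.
apply: (@lam_uniq S _ (fun m => lam r m + lam s m)) => n.
transitivity (iter n (phi S) r + iter n (phi S) s); last first.
  by elim: n => //= n <-; rewrite rmorphD.
rewrite -!ghost_lam -big_split; apply: eq_bigr => h _ /=.
by rewrite (@qpowD S (base_calg S)) mulrDr.
Qed.

Lemma wstrM B (r s : R) m : wstr B (r * s) m = wmul (wstr B r) (wstr B s) m.
Proof. by rewrite /wstr lamM (wmul_map (str_hom B)). Qed.

Lemma wmul_woner (x : nat -> base_calg S) l n :
  wmul x (wone _ l) n = \sum_(h < n.+1) gam S n h l * x h ^+ (q ^ (n - h)).
Proof.
apply: eq_bigr => h _; have [ln|nl] := leqP l n; last first.
  rewrite (@gam0 S n h l) ?leq_max ?nl ?orbT // mul0r.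
  apply: big1 => j' _; rewrite /wone ltn_eqF ?qpow0 ?mulr0 //.
  by apply: leq_trans nl; rewrite ltn_ord.
rewrite (bigD1 (Ordinal (ln : (l < n.+1)%N))) //= big1 ?addr0.
  by rewrite /wone eqxx expr1n mulr1.
by move=> j' /negbTE; rewrite /wone -val_eqE /= => ->; rewrite (@qpow0 S (base_calg S)) !mulr0.
Qed.

Lemma gam_lam (r : R) m j :
  \sum_(i < m.+1) gam S m i j * lam r i ^+ (q ^ (m - i)) =
  wsh (B := base_calg S) j (lam (iter j (phi S) r)) m.
Proof.
rewrite -(wmul_woner (lam r)).
refine (@ghost_injP S (@wmul S (base_calg S) (lam r) (wone _ j))
  (@wsh S (base_calg S) j (lam (iter j (phi S) r))) _ m) => M.
rewrite ghost_wmul ghost_wone ghost_wsh; case: ifP => jM; last by rewrite mulr0.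
by rewrite !ghost_lam -iterD subnK // mulrC.
Qed.

Lemma wscaleE (B : calg S) r (x : nat -> B) m :
  wmul (wstr B r) x m =
  \sum_(j < m.+1) str B (lam (iter j (phi S) r) (m - j)) * x j ^+ (q ^ (m - j)).
Proof.
rewrite /wmul exchange_big; apply: eq_bigr => j _ /=.
under eq_bigr do rewrite mulrA -rmorphXn -rmorphM.
rewrite -mulr_suml -rmorph_sum /= gam_lam /wsh.
by rewrite -ltnS ltn_ord.
Qed.

Lemma lam_pi_dvd N k : exists y, lam (pi ^+ N) k = pi ^+ (N - k) * y.
Proof.
elim/ltn_ind: k => k IH; have [kN|Nk] := leqP k N; last first.
  by exists (lam (pi ^+ N) k); rewrite (eqP (ltnW Nk : (N - k == 0)%N)) mul1r.
have := ghost_lam (pi ^+ N) k; rewrite ghostS iter_phi_pi.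
suff [c ->] : exists c, \sum_(h < k) pi ^+ h * lam (pi ^+ N) h ^+ (q ^ (k - h)) = pi ^+ N * c.
  move=> E; exists (1 - c); apply: (mulfI (expf_neq0 k (ppi_neq0 S))).
  by rewrite mulrA -exprD subnKC // mulrBr mulr1 -[X in X - _]E addrC addKr.
suff /choice [y yP] : forall h : 'I_k, exists y, pi ^+ h * lam (pi ^+ N) h ^+ (q ^ (k - h)) = pi ^+ N * y.
  by exists (\sum_h y h); rewrite mulr_sumr; apply: eq_bigr.
move=> h; have [y ->] := IH h (ltn_ord h).
have hN : (h <= N)%N by apply: leq_trans kN; exact: ltnW.
set Q := (q ^ (k - h))%N; have Q0 : (0 < Q)%N by exact: qk_gt0.
exists (pi ^+ ((N - h) * Q.-1) * y ^+ Q).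
have eN : (h + (N - h) * Q = N + (N - h) * Q.-1)%N.
  by rewrite -{1}(prednK Q0) mulnS addnA subnKC.
by rewrite exprMn -exprM [LHS]mulrA -exprD eN exprD mulrA.
Qed.

Section Dvd.
Variable B : calg S.
Definition dvpi e (x : B) := exists y, x = str B pi ^+ e * y.

Lemma dvpi_sub e x y : dvpi e x -> dvpi e y -> dvpi e (x - y).
Proof. by move=> [a ->] [b ->]; exists (a - b); rewrite mulrBr. Qed.

Lemma dvpi_mul e x y : dvpi e x -> dvpi e (y * x).
Proof. by move=> [a ->]; exists (y * a); rewrite mulrCA. Qed.

Lemma dvpi0 e : dvpi e 0. Proof. by exists 0; rewrite mulr0. Qed.

Lemma dvpi_sum e (I : Type) (r : seq I) P (F : I -> B) :
  (forall i, dvpi e (F i)) -> dvpi e (\sum_(i <- r | P i) F i).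
Proof.
move=> H; apply: (big_ind (dvpi e)) => //; first exact: dvpi0.
by move=> x y [a ->] [b ->]; exists (a + b); rewrite mulrDr.
Qed.

Lemma dvpi_le e f x : (f <= e)%N -> dvpi e x -> dvpi f x.
Proof.
move=> fe [a ->]; exists (str B pi ^+ (e - f) * a).
by rewrite mulrA -exprD subnKC.
Qed.

Lemma dvpi_exp e k x : (0 < k)%N -> dvpi e x -> dvpi e (x ^+ k).
Proof. by case: k => // k _ dx; rewrite exprSr; apply: dvpi_mul. Qed.

Lemma dvpi_wmul e (a x : nat -> B) m :
  (forall j, (j <= m)%N -> dvpi e (x j)) -> dvpi e (wmul a x m).
Proof.
move=> H; apply: dvpi_sum => i; apply: dvpi_sum => j.
by do 2![apply: dvpi_mul]; apply: dvpi_exp (qk_gt0 _ _) (H _ _); rewrite -ltnS.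
Qed.

Lemma dvpi_wscale N (x : nat -> B) m : dvpi (N - m) (wmul (wstr B (pi ^+ N)) x m).
Proof.
rewrite wscaleE; apply: dvpi_sum => j; rewrite mulrC; apply: dvpi_mul.
rewrite iter_phi_pi; have [y ->] := lam_pi_dvd N (m - j).
apply: (@dvpi_le (N - (m - j))); first by rewrite leq_sub2l ?leq_subr.
by exists (str B y); rewrite rmorphM rmorphXn.
Qed.

Lemma dvpi_sep x : (forall e, dvpi e x) -> x = 0.
Proof. by case: (calg_complete B) => sep _; exact: sep. Qed.
End Dvd.

(* Witt vectors of length n.+1 *)
Definition witt (n : nat) (B : calg S) : Type := {ffun 'I_n.+1 -> B}.

HB.instance Definition _ n B := GRing.Zmodule.on (witt n B).

Definition wc n B (x : witt n B) (i : nat) : B := x (inord i).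
Definition mkw n (B : calg S) (x : nat -> B) : witt n B := [ffun i : 'I_n.+1 => x i].

Lemma wc_mkw n (B : calg S) (x : nat -> B) i : (i <= n)%N -> wc (mkw n x) i = x i.
Proof. by move=> ni; rewrite /wc ffunE inordK. Qed.

Lemma wext n B (x y : witt n B) : (forall i, (i <= n)%N -> wc x i = wc y i) -> x = y.
Proof.
move=> E; apply/ffunP => i; have := E i; rewrite /wc inord_val; apply.
by rewrite -ltnS.
Qed.

Lemma wcD n B (x y : witt n B) i : wc (x + y) i = wc x i + wc y i.
Proof. by rewrite /wc ffunE. Qed.
Lemma wcN n B (x : witt n B) i : wc (- x) i = - wc x i.
Proof. by rewrite /wc ffunE. Qed.
Lemma wc0 n B i : wc (0 : witt n B) i = 0.
Proof. by rewrite /wc ffunE. Qed.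

Section WittRing.
Variables (n : nat) (B : calg S).
Implicit Types x y z : witt n B.

Definition witt_one : witt n B := mkw n (wone B 0).
Definition witt_mul x y : witt n B := mkw n (wmul (wc x) (wc y)).

Lemma wc_mul x y i : (i <= n)%N -> wc (witt_mul x y) i = wmul (wc x) (wc y) i.
Proof. exact: wc_mkw. Qed.

Fact witt_mulA : associative witt_mul.
Proof.
move=> x y z; apply: wext => i ni; rewrite !wc_mul //.
rewrite (@wmul_eq S B _ (wc x) _ (wmul (wc y) (wc z))) // => [|k ki].
  rewrite wmulA; apply: wmul_eq => // k ki; rewrite wc_mul //.
  exact: leq_trans ki ni.
by rewrite wc_mul // (leq_trans ki).
Qed.
Fact witt_mulC : commutative witt_mul.
Proof. by move=> x y; apply: wext => i ni; rewrite !wc_mul // wmulC. Qed.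
Fact witt_mul1 : left_id witt_one witt_mul.
Proof.
move=> x; apply: wext => i ni; rewrite wc_mul // -[RHS]wmul1; apply: wmul_eq => // k ki.
by rewrite wc_mkw // (leq_trans ki).
Qed.
Fact witt_mulDl : left_distributive witt_mul +%R.
Proof.
move=> x y z; apply: wext => i ni; rewrite wcD !wc_mul // -wmulDl.
by apply: wmul_eq => // k ki; rewrite wcD.
Qed.
Fact witt_one_neq0 : witt_one != 0.
Proof.
apply/eqP => /(congr1 (fun x => wc x 0)); rewrite wc_mkw // wc0 /wone eqxx.
by apply/eqP; exact: oner_neq0.
Qed.

HB.instance Definition _ := GRing.Zmodule_isComNzRing.Build (witt n B)
  witt_mulA witt_mulC witt_mul1 witt_mulDl witt_one_neq0.

Lemma wcM x y i : (i <= n)%N -> wc (x * y) i = wmul (wc x) (wc y) i.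
Proof. exact: wc_mul. Qed.

Definition witt_str (r : R) : witt n B := mkw n (wstr B r).

Fact witt_str_zmod : zmod_morphism witt_str.
Proof.
move=> r s; apply: wext => i ni; rewrite wcD wcN !wc_mkw // /wstr -rmorphB.
by congr (str B _); rewrite -[X in _ = lam X _ - _](subrK s r) [in RHS]lamD addrK.
Qed.
Fact witt_str_mon : monoid_morphism witt_str.
Proof.
split=> [|r s]; apply: wext => i ni.
  by rewrite wc_mkw // /wstr lam1 rmorph_nat [RHS]wc_mkw.
rewrite wcM // wc_mkw // wstrM; apply: wmul_eq => k ki;
by rewrite wc_mkw // (leq_trans ki).
Qed.

HB.instance Definition _ := GRing.isZmodMorphism.Build R (witt n B) witt_str witt_str_zmod.
HB.instance Definition _ := GRing.isMonoidMorphism.Build R (witt n B) witt_str witt_str_mon.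

Lemma wc_str r i : (i <= n)%N -> wc (witt_str r) i = wstr B r i.
Proof. exact: wc_mkw. Qed.

Lemma wc_strM r x i : (i <= n)%N -> wc (witt_str r * x) i = wmul (wstr B r) (wc x) i.
Proof.
by move=> ni; rewrite wcM //; apply: wmul_eq => // k ki; rewrite wc_str // (leq_trans ki).
Qed.

Local Notation t := (witt_str pi).

Lemma dvpi_wc N x i : (i <= n)%N -> dvpi (N - i) (wc (t ^+ N * x) i).
Proof. by move=> ni; rewrite -rmorphXn wc_strM //; exact: dvpi_wscale. Qed.

Lemma witt_complete : pi_adically_complete t.
Proof.
split=> [x xP|u /choice[y yP]].
  apply: wext => i ni; rewrite wc0; apply: dvpi_sep => e.
  have [y ->] := xP (e + i)%N.
  by apply: (dvpi_le _ (dvpi_wc _ _ ni)); rewrite addnK.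
pose s N M := \sum_(k < M) t ^+ k * y (N + k)%N.
have sr N M : s N M.+1 = s N M + t ^+ M * y (N + M)%N by rewrite /s big_ord_recr.
have sl N M : s N M.+1 = y N + t * s N.+1 M.
  rewrite /s big_ord_recl /= expr0 mul1r addn0 mulr_sumr; congr (_ + _).
  by apply: eq_bigr => k _; rewrite /= exprS mulrA /bump leq0n add1n addnS.
have /choice[Y YP] N : exists Y : nat -> B, forall m e, (m <= n)%N ->
    dvpi e (Y m - wc (s N (e + m)%N) m).
  suff /choice[Y YP] : forall m, exists Y : B, forall e, (m <= n)%N ->
    dvpi e (Y - wc (s N (e + m)%N) m) by exists Y.
  move=> m; have [mn|] := boolP (m <= n)%N; last by exists 0.
  case: (calg_complete B) => _ /(_ (fun e => wc (s N (e + m)%N) m))[|Y YP].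
    move=> e; rewrite addSn sr wcD addrC addKr.
    by have := dvpi_wc (e + m)%N (y (N + (e + m))%N) mn; rewrite addnK.
  by exists Y => e _; exact: YP.
have YE N : mkw n (Y N) = y N + t * mkw n (Y N.+1).
  apply: wext => i ni; apply/eqP; rewrite -subr_eq0; apply/eqP; apply: dvpi_sep => e.
  have d1 : dvpi e (Y N i - wc (s N (e + i).+1) i).
    by apply: (@dvpi_le _ e.+1) => //; rewrite -addSn; apply: YP.
  rewrite wc_mkw //; set w := _ + t * _.
  have -> : Y N i - wc w i =
      (Y N i - wc (s N (e + i).+1) i) - wc (w - s N (e + i).+1) i.
    by rewrite (wcD w) wcN opprB addrA subrK.
  apply: dvpi_sub d1 _; rewrite sl /w opprD addrACA subrr add0r -mulrBr.
  rewrite wc_strM //; apply: dvpi_wmul => j ji; rewrite wcD wcN.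
  rewrite wc_mkw ?(leq_trans ji) //.
  have -> : (e + i = (e + (i - j)) + j)%N by rewrite -addnA subnK.
  apply: (@dvpi_le _ (e + (i - j))); first exact: leq_addr.
  by apply: YP; apply: leq_trans ni.
have uE N : u N = u 0%N + s 0%N N.
  elim: N => [|N IH]; first by rewrite /s big_ord0 addr0.
  by rewrite sr addrA -IH add0n -yP addrC subrK.
exists (u 0%N + mkw n (Y 0%N)) => N; exists (mkw n (Y N)).
rewrite (uE N) opprD addrACA subrr add0r.
suff -> : mkw n (Y 0%N) = s 0%N N + t ^+ N * mkw n (Y N) by rewrite addrC addKr.
elim: N => [|N IH]; first by rewrite /s big_ord0 add0r mul1r.
by rewrite sr IH YE mulrDr mulrA -exprSr addrA add0n.
Qed.

Definition witt_calg : calg S := @CAlg S (witt n B) witt_str witt_complete.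
End WittRing.
End WittTheory.

Section WittFunctor.
Variable S : base.
Local Notation R := (base_ring S).
Local Notation q := (qhat S).
Local Notation pi := (ppi S).
Implicit Types B C : calg S.

Lemma twist_complete B : pi_adically_complete ((str B \o phi S) pi).
Proof. by rewrite /= phi_ppi; exact: calg_complete. Qed.

(* B with its R-algebra structure precomposed with phi; evaluating a functor F
   at twist B computes the base change of F along phi at B. *)
Definition twist B : calg S := @CAlg S B (str B \o phi S) (twist_complete B).

Lemma twist_hom_str B C (h : chom B C) r : h (str (twist B) r) = str (twist C) r.
Proof. exact: chom_str. Qed.

Definition twist_hom B C (h : chom B C) : chom (twist B) (twist C) :=
  @CHom S (twist B) (twist C) h (twist_hom_str h).

Section Map.
Variables (n : nat) (B C : calg S) (h : chom B C).

Definition wmap (x : witt n B) : witt n C := mkw n (fun i => h (wc x i)).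

Lemma wc_map x i : (i <= n)%N -> wc (wmap x) i = h (wc x i).
Proof. exact: wc_mkw. Qed.

Fact wmap_zmod : zmod_morphism wmap.
Proof. by move=> x y; apply: wext => i ni; rewrite wcD wcN !wc_map // wcD wcN rmorphB. Qed.
Fact wmap_mon : monoid_morphism wmap.
Proof.
split=> [|x y]; apply: wext => i ni; rewrite wc_map //.
  by rewrite !wc_mkw // /wone rmorph_nat.
rewrite !wcM // wmul_map; apply: wmul_eq => k ki; by rewrite wc_map // (leq_trans ki).
Qed.
HB.instance Definition _ := GRing.isZmodMorphism.Build (witt n B) (witt n C) wmap wmap_zmod.
HB.instance Definition _ := GRing.isMonoidMorphism.Build (witt n B) (witt n C) wmap wmap_mon.

Fact wmap_str r : wmap (witt_str n B r) = witt_str n C r.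
Proof. by apply: wext => i ni; rewrite wc_map // !wc_str // /wstr chom_str. Qed.

Definition witt_map : chom (witt_calg n B) (witt_calg n C) :=
  @CHom S (witt_calg n B) (witt_calg n C) wmap wmap_str.
End Map.

Lemma lam0 r : lam r 0 = r :> R.
Proof. by have := ghost_lam r 0; rewrite ghostS big_ord0 add0r mul1r. Qed.

Lemma wmul0 B (x y : nat -> B) : wmul x y 0 = x 0%N * y 0%N.
Proof.
rewrite /wmul !big_ord_recl !big_ord0 !addr0 /gam /= !expr1.
by rewrite expr0 lam1 rmorph1 mul1r.
Qed.

Section Proj.
Variables (n : nat) (B : calg S).
Definition wproj (x : witt n B) : B := wc x 0.
Fact wproj_zmod : zmod_morphism wproj.
Proof. by move=> x y; rewrite /wproj wcD wcN. Qed.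
Fact wproj_mon : monoid_morphism wproj.
Proof. by split=> [|x y]; rewrite /wproj; [rewrite wc_mkw | rewrite wcM // wmul0]. Qed.
HB.instance Definition _ := GRing.isZmodMorphism.Build (witt n B) B wproj wproj_zmod.
HB.instance Definition _ := GRing.isMonoidMorphism.Build (witt n B) B wproj wproj_mon.
Fact wproj_str r : wproj (witt_str n B r) = str B r.
Proof. by rewrite /wproj wc_str // /wstr lam0. Qed.
Definition witt_proj : chom (witt_calg n B) B :=
  @CHom S (witt_calg n B) B wproj wproj_str.
End Proj.

Section Trunc.
Variables (m n : nat) (mn : (m <= n)%N) (B : calg S).
Definition wtrunc of (m <= n)%N := fun x : witt n B => mkw m (wc x) : witt m B.
Local Notation tr := (wtrunc mn).
Fact wtrunc_zmod : zmod_morphism tr.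
Proof. by move=> x y; apply: wext => i ni; rewrite wcD wcN !wc_mkw // wcD wcN. Qed.
Fact wtrunc_mon : monoid_morphism tr.
Proof.
split=> [|x y]; apply: wext => i ni; have ni' := leq_trans ni mn.
  by rewrite !wc_mkw.
rewrite wc_mkw // !wcM //; apply: wmul_eq => k ki; by rewrite wc_mkw // (leq_trans ki).
Qed.
HB.instance Definition _ := GRing.isZmodMorphism.Build (witt n B) (witt m B) tr wtrunc_zmod.
HB.instance Definition _ := GRing.isMonoidMorphism.Build (witt n B) (witt m B) tr wtrunc_mon.
Fact wtrunc_str r : tr (witt_str n B r) = witt_str m B r.
Proof. by apply: wext => i ni; rewrite wc_mkw // !wc_str // (leq_trans ni). Qed.
Definition witt_trunc : chom (witt_calg n B) (witt_calg m B) :=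
  @CHom S (witt_calg n B) (witt_calg m B) tr wtrunc_str.
End Trunc.

(* [fcoef m k] is the m-th component of F(V^k(1)) *)
Definition fcoef m k : R := if k is k'.+1 then wsh (B := base_calg S) k' (lam pi) m else (m == 0)%:R.

(* the Witt vector Frobenius, characterized by ghost_wfrob *)
Definition wfrob B (x : nat -> B) (m : nat) : B :=
  \sum_(k < m.+2) str B (fcoef m k) * x k ^+ (q ^ (m.+1 - k)).

Lemma ghost_fcoef k M :
  @ghost S (base_calg S) (fun m => fcoef m k) M = if (k <= M.+1)%N then pi ^+ k else 0.
Proof.
case: k => [|k].
  have -> : ghost (B := base_calg S) (fun m => fcoef m 0) M = ghost (wone (base_calg S) 0) M by [].
  by rewrite ghost_wone.
rewrite (ghost_wsh k (lam pi : nat -> base_calg S)) ltnS; case: ifP => // _.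
by rewrite ghost_lam -[pi in iter _ _ pi]expr1 iter_phi_pi expr1 /= -exprSr.
Qed.

Lemma fcoef0 m k : (m.+1 < k)%N -> fcoef m k = 0.
Proof. by case: k => // k mk; rewrite /= /wsh leqNgt -ltnS mk. Qed.

Lemma wfrob_widen B (x : nat -> B) m N : (m.+1 <= N)%N ->
  wfrob x m = \sum_(k < N.+1) str B (fcoef m k) * x k ^+ (q ^ (m.+1 - k)).
Proof.
move=> mN; apply: (@widen_sum S B (fun k => str B (fcoef m k) * x k ^+ (q ^ (m.+1 - k)))) => // k mk.
by rewrite fcoef0 // rmorph0 mul0r.
Qed.

Lemma ghost_wfrob B (x : nat -> B) n : ghost (wfrob x) n = ghost x n.+1.
Proof.
transitivity (\sum_(h < n.+1) \sum_(k < n.+2)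
   str B (pi ^+ h * fcoef h k ^+ (q ^ (n - h))) * x k ^+ (q ^ (n.+1 - k))).
  apply: eq_bigr => h _; have hn : (h <= n)%N by rewrite -ltnS.
  rewrite (wfrob_widen x (hn : (h.+1 <= n.+1)%N)) qpow_sum mulr_sumr; apply: eq_bigr => k _.
  case: (ltnP h.+1 k) => [hk|kh].
    by rewrite (fcoef0 hk) (@qpow0 S (base_calg S)) mulr0 !rmorph0 !mul0r qpow0 mulr0.
  rewrite exprMn -(subSS h n) qpow_comp ?kh // rmorphM !rmorphXn /=.
  by rewrite !mulrA.
rewrite exchange_big; apply: eq_bigr => k _; rewrite -mulr_suml -rmorph_sum /=.
have := ghost_fcoef k n; rewrite -(ltnS k) ltn_ord /ghost /= => ->.
by rewrite rmorphXn.
Qed.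

Lemma wfrobD B (x y : nat -> B) m : wfrob (fun i => x i + y i) m = wfrob x m + wfrob y m.
Proof.
by rewrite /wfrob -big_split; apply: eq_bigr => k _; rewrite /= qpowD mulrDr.
Qed.

Lemma wfrob_eq B (x y : nat -> B) m :
  (forall i, (i <= m.+1)%N -> x i = y i) -> wfrob x m = wfrob y m.
Proof. by move=> E; apply: eq_bigr => k _; rewrite E // -ltnS. Qed.

Lemma wfrob_map B C (h : chom B C) (x : nat -> B) m :
  h (wfrob x m) = wfrob (fun i => h (x i)) m.
Proof.
by rewrite rmorph_sum; apply: eq_bigr => k _; rewrite rmorphM rmorphXn /= chom_str.
Qed.

Lemma wfrobM B (x y : nat -> B) m :
  wfrob (wmul x y) m = wmul (wfrob x) (wfrob y) m.
Proof.
transitivity (\sum_(i < m.+2) \sum_(j < m.+2)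
    str B (wfrob (B := base_calg S) (fun k => gam S k i j) m) *
    (x i ^+ (q ^ (m.+1 - i)) * y j ^+ (q ^ (m.+1 - j)))).
  transitivity (\sum_(k < m.+2) \sum_(i < m.+2) \sum_(j < m.+2)
    str B (fcoef m k * gam S k i j ^+ (q ^ (m.+1 - k))) *
    (x i ^+ (q ^ (m.+1 - i)) * y j ^+ (q ^ (m.+1 - j)))).
    apply: eq_bigr => k _; have km : (k <= m.+1)%N by rewrite -ltnS.
    rewrite (wmul_widen x y km) qpow_sum mulr_sumr; apply: eq_bigr => i _.
    rewrite qpow_sum mulr_sumr; apply: eq_bigr => j _.
    case: (ltnP k (maxn i j)) => [kij|].
      by rewrite (gam0 S kij) (@qpow0 S (base_calg S)) mulr0 !rmorph0 !mul0r qpow0 mulr0.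
    rewrite geq_max => /andP[ik jk].
    by rewrite !exprMn !qpow_comp ?ik ?jk // rmorphM !rmorphXn /= !mulrA.
  rewrite exchange_big /=; apply: eq_bigr => i _.
  rewrite exchange_big /=; apply: eq_bigr => j _.
  by rewrite -mulr_suml -rmorph_sum.
transitivity (\sum_(a < m.+1) \sum_(b < m.+1) \sum_(i < m.+2) \sum_(j < m.+2)
    str B (gam S m a b * (fcoef a i ^+ (q ^ (m - a)) * fcoef b j ^+ (q ^ (m - b)))) *
    (x i ^+ (q ^ (m.+1 - i)) * y j ^+ (q ^ (m.+1 - j)))); last first.
  apply: eq_bigr => a _; apply: eq_bigr => b _.
  have am : (a <= m)%N by rewrite -ltnS.
  have bm : (b <= m)%N by rewrite -ltnS.
  rewrite (wfrob_widen x (am : (a.+1 <= m.+1)%N)) (wfrob_widen y (bm : (b.+1 <= m.+1)%N)).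
  rewrite !qpow_sum mulr_suml mulr_sumr; apply: eq_bigr => i _.
  rewrite mulr_sumr mulr_sumr; apply: eq_bigr => j _.
  case: (ltnP a.+1 i) => [ai|ia].
    by rewrite (fcoef0 ai) (@qpow0 S (base_calg S)) mul0r mulr0 !rmorph0 !mul0r qpow0 mul0r mulr0.
  case: (ltnP b.+1 j) => [bj|jb].
    by rewrite (fcoef0 bj) (@qpow0 S (base_calg S)) !mulr0 !rmorph0 !mul0r qpow0 !mulr0.
  rewrite !exprMn -(subSS a m) -(subSS b m) !qpow_comp ?ia ?jb //.
  by rewrite !rmorphM !rmorphXn /= -!mulrA; congr (_ * (_ * _)); rewrite mulrCA.
under [RHS]eq_bigr do rewrite exchange_big /=.
rewrite [RHS]exchange_big /=; apply: eq_bigr => i _.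
under [RHS]eq_bigr do rewrite exchange_big /=.
rewrite [RHS]exchange_big /=; apply: eq_bigr => j _.
under [RHS]eq_bigr do rewrite -mulr_suml -rmorph_sum.
rewrite -mulr_suml -rmorph_sum; congr (str B _ * _).
refine (@ghost_injP S (wfrob (B := base_calg S) (fun k => gam S k i j))
  (wmul (B := base_calg S) (fun k => fcoef k i) (fun k => fcoef k j)) _ m) => M.
rewrite ghost_wfrob ghost_wmul !ghost_fcoef ghost_gam geq_max.
by case: (_ <= _)%N; case: (_ <= _)%N; rewrite /= ?mul0r ?mulr0 // exprD.
Qed.

Lemma wfrob_lam r m : wfrob (B := base_calg S) (lam r) m = lam (phi S r) m.
Proof.
refine (@ghost_injP S (wfrob (B := base_calg S) (lam r)) (lam (phi S r)) _ m) => M.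
by rewrite ghost_wfrob !ghost_lam -iterSr.
Qed.

Lemma wmul_twist B (x y : nat -> B) m : wmul (B := twist B) x y m = wmul x y m.
Proof.
by apply: eq_bigr => i _; apply: eq_bigr => j _; rewrite /= gam_fix.
Qed.

Section Frob.
Variables (n : nat) (B : calg S).
Definition wF (x : witt n.+1 B) : witt n (twist B) := mkw (B := twist B) n (wfrob (wc x)).

Lemma wc_F x i : (i <= n)%N -> wc (wF x) i = wfrob (wc x) i.
Proof. exact: (@wc_mkw S n (twist B)). Qed.

Fact wF_zmod : zmod_morphism wF.
Proof.
move=> x y; apply: wext => i ni; rewrite wcD wcN !wc_F //.
apply/eqP; rewrite eq_sym; apply/eqP.
have -> : wfrob (wc x) i = wfrob (wc (x - y)) i + wfrob (wc y) i.
  by rewrite -wfrobD; apply: wfrob_eq => k _; rewrite wcD wcN subrK.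
exact: addrK.
Qed.
Fact wF_mon : monoid_morphism wF.
Proof.
split=> [|x y]; apply: wext => i ni; rewrite wc_F //.
  have -> : wc (1 : witt n (twist B)) i = (i == 0)%:R by rewrite wc_mkw.
  rewrite (@wfrob_eq _ _ (wstr B 1)) => [|k ki]; last first.
    by rewrite wc_mkw // ?(leq_trans ki) // /wstr lam1 rmorph_nat.
  by rewrite -(wfrob_map (str_hom B)) wfrob_lam rmorph1 lam1 /= rmorph_nat.
rewrite (wcM (wF x)) // wmul_twist (@wmul_eq S B _ (wfrob (wc x)) _ (wfrob (wc y))).
- rewrite -wfrobM; apply: (@wfrob_eq B) => k ki; rewrite wcM // (leq_trans ki) //.
- by move=> k ki; rewrite wc_F // (leq_trans ki).
- by move=> k ki; rewrite wc_F // (leq_trans ki).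
Qed.
HB.instance Definition _ := GRing.isZmodMorphism.Build (witt n.+1 B) (witt n (twist B)) wF wF_zmod.
HB.instance Definition _ := GRing.isMonoidMorphism.Build (witt n.+1 B) (witt n (twist B)) wF wF_mon.
Fact wF_str r : wF (witt_str n.+1 B r) = witt_str n (twist B) r.
Proof.
apply: wext => i ni; rewrite wc_F // wc_str // /wstr /= -lam_phi -wfrob_lam.
rewrite (wfrob_map (str_hom B)); apply: (@wfrob_eq B) => k ki.
by rewrite wc_str // (leq_trans ki).
Qed.
Definition witt_frob : chom (witt_calg n.+1 B) (witt_calg n (twist B)) :=
  @CHom S (witt_calg n.+1 B) (witt_calg n (twist B)) wF wF_str.
End Frob.

Definition witt_ver n B (x : witt n B) : witt n.+1 B := mkw n.+1 (wsh 1 (wc x)).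
Definition witt_unver n B (x : witt n.+1 B) : witt n B := mkw n (fun i => wc x i.+1).

Lemma witt_verK n B : cancel (@witt_ver n B) (@witt_unver n B).
Proof. by move=> x; apply: wext => i ni; rewrite !wc_mkw // /wsh subn1. Qed.

Lemma witt_unverK n B (x : witt n.+1 B) : wc x 0 = 0 -> witt_ver (witt_unver x) = x.
Proof.
by move=> x0; apply: wext => -[|i] ni; rewrite wc_mkw // /wsh // subn1 wc_mkw.
Qed.

(* V(y) |-> V(F(y)) *)
Definition witt_lat n B (x : witt n.+2 B) : witt n.+1 (twist B) :=
  witt_ver (witt_frob n B (witt_unver x)).

Lemma wc_lat n B (x : witt n.+2 B) i : (i <= n.+1)%N ->
  wc (witt_lat x) i = wsh 1 (wfrob (fun i => wc x i.+1)) i :> B.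
Proof.
move=> ni; rewrite [LHS]wc_mkw // /wsh; case: i ni => [|i] ni //=.
rewrite subn1 /= (wc_F _ (ni : (i <= n)%N)); apply: (@wfrob_eq B) => k ki.
by rewrite wc_mkw // (leq_trans ki).
Qed.

Lemma witt_lat_map n B C (h : chom B C) (x : witt n.+2 B) :
  witt_lat (witt_map n.+2 h x) = witt_map n.+1 (twist_hom h) (witt_lat x).
Proof.
apply: wext => i ni; rewrite [RHS]wc_map // !wc_lat // /wsh.
case: ifP => _; last by rewrite rmorph0.
have E : forall y : B, twist_hom h y = h y by [].
rewrite E (wfrob_map h); apply: (@wfrob_eq C) => k ki.
rewrite wc_map // !ltnS; apply: leq_trans ki _; by rewrite ltnS leq_subLR add1n.
Qed.
End WittFunctor.

Section DualNumbers.
Variable S : base.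
Local Notation R := (base_ring S).

(* R[eps]/(eps^2) *)
Definition dual : Type := (R * R)%type.
HB.instance Definition _ := GRing.Zmodule.on dual.

Definition dual_mul (x y : dual) : dual := (x.1 * y.1, x.1 * y.2 + x.2 * y.1).
Definition dual_one : dual := (1, 0).

Fact dual_mulA : associative dual_mul.
Proof.
move=> [a a'] [b b'] [c c']; rewrite /dual_mul /= mulrA; congr (_, _).
by rewrite !mulrDr !mulrDl !mulrA addrA.
Qed.
Fact dual_mulC : commutative dual_mul.
Proof.
move=> [a a'] [b b']; rewrite /dual_mul /= mulrC; congr (_, _).
by rewrite addrC (mulrC a') (mulrC a).
Qed.
Fact dual_mul1 : left_id dual_one dual_mul.
Proof. by move=> [a a']; rewrite /dual_mul /= !mul1r mul0r addr0. Qed.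
Fact dual_mulDl : left_distributive dual_mul +%R.
Proof.
move=> [a a'] [b b'] [c c']; rewrite /dual_mul /= [in LHS]/+%R /= !mulrDl.
by congr (_, _); rewrite addrACA.
Qed.
Fact dual_one_neq0 : dual_one != 0.
Proof. by apply/eqP => -[/eqP]; rewrite oner_eq0. Qed.
HB.instance Definition _ := GRing.Zmodule_isComNzRing.Build dual
  dual_mulA dual_mulC dual_mul1 dual_mulDl dual_one_neq0.

Definition dual_str (r : R) : dual := (r, 0).
Fact dual_str_zmod : zmod_morphism dual_str.
Proof.
move=> x y; have -> : dual_str x - dual_str y = (x - y, 0 - 0) by [].
by rewrite subr0.
Qed.
Fact dual_str_mon : monoid_morphism dual_str.
Proof.
by split=> // x y; rewrite [RHS]/(dual_mul _ _) /dual_mul /= mulr0 mul0r addr0.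
Qed.
HB.instance Definition _ := GRing.isZmodMorphism.Build R dual dual_str dual_str_zmod.
HB.instance Definition _ := GRing.isMonoidMorphism.Build R dual dual_str dual_str_mon.

Lemma dual_strM r (x : dual) : dual_str r * x = (r * x.1, r * x.2).
Proof. by rewrite [LHS]/(dual_mul _ _) /dual_mul /= mul0r addr0. Qed.

Lemma dual_complete : pi_adically_complete (dual_str (ppi S)).
Proof.
have [sep lim] := base_complete S.
split=> [[a b] H|u H].
  congr (_, _); apply: sep => n; have [[c d]] := H n;
  by rewrite -rmorphXn dual_strM /= => -[ea eb]; eexists;
  first [exact: ea | exact: eb].
have [|x xP] := lim (fun n => (u n).1).
  by move=> n; have [y /(congr1 fst)] := H n; rewrite -rmorphXn dual_strM /=; exists y.1.
have [|y yP] := lim (fun n => (u n).2).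
  by move=> n; have [y /(congr1 snd)] := H n; rewrite -rmorphXn dual_strM /=; exists y.2.
exists (x, y) => n; have [c cP] := xP n; have [d dP] := yP n; exists (c, d).
by rewrite -rmorphXn dual_strM /= -cP -dP.
Qed.

Definition dual_calg : calg S := @CAlg S dual dual_str dual_complete.

Definition dual_aug (x : dual) : R := x.1.
Fact dual_aug_zmod : zmod_morphism dual_aug. Proof. by []. Qed.
Fact dual_aug_mon : monoid_morphism dual_aug. Proof. by []. Qed.
HB.instance Definition _ := GRing.isZmodMorphism.Build dual R dual_aug dual_aug_zmod.
HB.instance Definition _ := GRing.isMonoidMorphism.Build dual R dual_aug dual_aug_mon.
Definition dual_aug_hom : chom dual_calg (base_calg S) :=
  @CHom S dual_calg (base_calg S) dual_aug (fun r => erefl).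

Definition dual_scale (c : R) (x : dual) : dual := (x.1, c * x.2).
Fact dual_scale_zmod c : zmod_morphism (dual_scale c).
Proof.
move=> x y; rewrite /dual_scale.
have -> : (x.1, c * x.2) - (y.1, c * y.2) = (x.1 - y.1, c * x.2 - c * y.2) :> dual by [].
by rewrite -mulrBr.
Qed.
Fact dual_scale_mon c : monoid_morphism (dual_scale c).
Proof.
split=> [|x y]; first by rewrite /dual_scale /= mulr0.
rewrite /dual_scale [RHS]/(dual_mul _ _) /dual_mul /=; congr (_, _).
by rewrite mulrDr mulrCA !mulrA.
Qed.
HB.instance Definition _ c := GRing.isZmodMorphism.Build dual dual (dual_scale c) (dual_scale_zmod c).
HB.instance Definition _ c := GRing.isMonoidMorphism.Build dual dual (dual_scale c) (dual_scale_mon c).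
Fact dual_scale_str c r : dual_scale c (dual_str r) = dual_str r.
Proof. by rewrite /dual_scale /= mulr0. Qed.
Definition dual_scale_hom (c : R) : chom dual_calg dual_calg :=
  @CHom S dual_calg dual_calg (dual_scale c) (dual_scale_str c).
End DualNumbers.

(* A-module valued functors on pi-adically complete R-algebras: formal A-module
   schemes are those which are representable, e.g. by coordinates below. *)
Record amod_functor (A : comNzRingType) (S : base) := AModFunctor {
  fobj :> calg S -> lmodType A;
  fmap : forall B C : calg S, chom B C -> {linear fobj B -> fobj C};
  fmap_id : forall (B : calg S) (h : chom B B), h =1 id -> fmap h =1 id;
  fmap_comp : forall (B C D : calg S) (f : chom B C) (g : chom C D) (h : chom B D),
    h =1 g \o f -> fmap h =1 fmap g \o fmap f
}.

(* morphisms over S of the underlying formal schemes *)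
Record ntrans (A : comNzRingType) (S : base) (F G : amod_functor A S) := NTrans {
  nt_app :> forall B : calg S, F B -> G B;
  nt_nat : forall (B C : calg S) (h : chom B C) (x : F B),
    nt_app (fmap F h x) = fmap G h (nt_app x)
}.

Definition A_linear (A : comNzRingType) (S : base) (F G : amod_functor A S)
    (f : ntrans F G) : Prop :=
  forall (B : calg S) (a : A) (x y : F B), f B (a *: x + y) = a *: f B x + f B y.

Section AdditiveGroup.
Variables (A : comNzRingType) (S : base) (theta : {rmorphism A -> S}).

(* B with A acting through theta *)
Definition ga_obj (th : {rmorphism A -> S}) (B : calg S) : Type := B.
HB.instance Definition _ th B := GRing.Zmodule.on (ga_obj th B).

Definition ga_scale th (B : calg S) (a : A) (b : ga_obj th B) : ga_obj th B :=
  str B (th a) * (b : B).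

Fact ga_scaleA th B (a b : A) (v : ga_obj th B) :
  ga_scale a (ga_scale b v) = ga_scale (a * b) v.
Proof. by rewrite /ga_scale !rmorphM mulrA. Qed.
Fact ga_scale1 th B : left_id 1 (@ga_scale th B).
Proof. by move=> x; rewrite /ga_scale !rmorph1 mul1r. Qed.
Fact ga_scaleDr th B : right_distributive (@ga_scale th B) +%R.
Proof. by move=> a x y; rewrite /ga_scale -mulrDr. Qed.
Fact ga_scaleDl th B (v : ga_obj th B) : {morph (@ga_scale th B)^~ v : a b / a + b}.
Proof. by move=> a b; rewrite /ga_scale !rmorphD mulrDl. Qed.
HB.instance Definition _ th B := GRing.Zmodule_isLmodule.Build A (ga_obj th B)
  (@ga_scaleA th B) (@ga_scale1 th B) (@ga_scaleDr th B) (@ga_scaleDl th B).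

Definition ga_map (B C : calg S) (h : chom B C) : ga_obj theta B -> ga_obj theta C := h.
Fact ga_map_linear B C (h : chom B C) : linear (ga_map h).
Proof.
move=> a x y; rewrite /ga_map; transitivity (h (str B (theta a) * (x : B)) + h (y : B)).
  exact: rmorphD.
by rewrite rmorphM chom_str.
Qed.
HB.instance Definition _ B C (h : chom B C) :=
  GRing.isLinear.Build A (ga_obj theta B) (ga_obj theta C) _ (ga_map h) (ga_map_linear h).

Definition Ga : amod_functor A S :=
  @AModFunctor A S (fun B => ga_obj theta B : lmodType A) (fun B C h => ga_map h : {linear _ -> _})
    (fun B h hid => hid) (fun B C D f g h hc => hc).
End AdditiveGroup.

Section JetSpaces.
Variables (A : comNzRingType) (S : base) (E : amod_functor A S).
Local Notation R := (base_ring S).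

Lemma wmap_id n (B : calg S) (h : chom B B) : h =1 id -> witt_map n h =1 id.
Proof. by move=> hid x; apply: wext => i ni; rewrite wc_map // hid. Qed.

Lemma wmap_comp n (B C D : calg S) (f : chom B C) (g : chom C D) (h : chom B D) :
  h =1 g \o f -> witt_map n h =1 witt_map n g \o witt_map n f.
Proof. by move=> hc x; apply: wext => i ni; rewrite /= !wc_map // hc. Qed.

Definition jet (n : nat) : amod_functor A S :=
  @AModFunctor A S (fun B => E (witt_calg n B)) (fun B C h => fmap E (witt_map n h))
    (fun B h hid => fmap_id (wmap_id hid))
    (fun B C D f g h hc => fmap_comp (wmap_comp hc)).

Lemma fmap_sq (B C C' D : calg S) (f : chom B C) (g : chom C D)
    (f' : chom B C') (g' : chom C' D) (x : E B) :
  g \o f =1 g' \o f' -> fmap E g (fmap E f x) = fmap E g' (fmap E f' x).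
Proof.
move=> H; pose gf := @CHom S B D (g \o f : {rmorphism B -> D})
  (fun r => etrans (congr1 g (chom_str f r)) (chom_str g r)).
rewrite -[LHS](@fmap_comp A S E _ _ _ f g gf (fun=> erefl)).
exact: (@fmap_comp A S E _ _ _ f' g' gf H).
Qed.

Definition jker n (B : calg S) : {pred E (witt_calg n B)} :=
  fun x => fmap E (witt_proj n B) x == 0.

Fact jker_submod n B : submod_closed (@jker n B).
Proof.
split=> [|a x y]; rewrite !unfold_in ?linear0 //.
by move=> /eqP x0 /eqP y0; rewrite linearP x0 y0 scaler0 addr0.
Qed.
HB.instance Definition _ n B := GRing.isSubmodClosed.Build A _ (@jker n B) (@jker_submod n B).

Definition nker_obj n (B : calg S) : Type := {x : E (witt_calg n B) | x \in @jker n B}.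
HB.instance Definition _ n B := SubChoice.on (nker_obj n B).
HB.instance Definition _ n B := [SubChoice_isSubLmodule of nker_obj n B by <:].

Definition mk_nker n B (y : E (witt_calg n B)) (yP : y \in @jker n B) : nker_obj n B :=
  exist (fun y => y \in @jker n B) y yP.
Definition nincl n B (x : nker_obj n B) : E (witt_calg n B) := val x.

Fact nker_map_subproof n (B C : calg S) (h : chom B C) (x : nker_obj n B) :
  fmap E (witt_map n h) (val x) \in @jker n C.
Proof.
rewrite unfold_in /jker (@fmap_sq _ _ B _ _ _ (witt_proj n B) h) => [|y].
  by have := valP x; rewrite unfold_in => /eqP->; rewrite linear0.
exact: wc_map.
Qed.
Definition nker_map n (B C : calg S) (h : chom B C) (x : nker_obj n B) : nker_obj n C :=
  mk_nker (nker_map_subproof h x).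
Fact nker_map_linear n B C h : linear (@nker_map n B C h).
Proof. by move=> a x y; apply: val_inj; rewrite /= !linearP. Qed.
HB.instance Definition _ n B C h :=
  GRing.isLinear.Build A (nker_obj n B) (nker_obj n C) _ (@nker_map n B C h) (nker_map_linear h).

Fact nker_map_id n (B : calg S) (h : chom B B) : h =1 id -> @nker_map n B B h =1 id.
Proof. by move=> hid x; apply: val_inj; exact: (fmap_id (wmap_id hid)). Qed.
Fact nker_map_comp n (B C D : calg S) (f : chom B C) (g : chom C D) (h : chom B D) :
  h =1 g \o f -> @nker_map n B D h =1 @nker_map n C D g \o @nker_map n B C f.
Proof. by move=> hc x; apply: val_inj; exact: (fmap_comp (wmap_comp hc)). Qed.

Definition nker (n : nat) : amod_functor A S :=
  @AModFunctor A S (fun B => nker_obj n B : lmodType A)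
    (fun B C h => @nker_map n B C h : {linear _ -> _}) (@nker_map_id n) (@nker_map_comp n).

Variable theta : {rmorphism A -> S}.
Local Notation Ga := (Ga theta).

Section Pullbacks.
Variable n : nat.

Definition incl_pull_fun (T : ntrans (jet n) Ga) (B : calg S) (x : nker n B) : Ga B :=
  T B (nincl x).
Fact incl_pull_nat T (B C : calg S) (h : chom B C) (x : nker n B) :
  incl_pull_fun T (fmap (nker n) h x) = fmap Ga h (incl_pull_fun T x).
Proof. exact: (nt_nat T h). Qed.
Definition incl_pull T : ntrans (nker n) Ga := NTrans (@incl_pull_nat T).

(* phi : J^(n+1)E -> J^nE lies over phi on S, i.e. it is given by the maps
   J^(n+1)E(B) -> J^nE(twist B); phi_pull is relative pullback along it. *)
Definition phi_pull_fun (T : ntrans (jet n) Ga) (B : calg S) (x : jet n.+1 B) : Ga B :=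
  T (twist B) (fmap E (witt_frob n B) x).
Fact phi_pull_nat T (B C : calg S) (h : chom B C) (x : jet n.+1 B) :
  phi_pull_fun T (fmap (jet n.+1) h x) = fmap Ga h (phi_pull_fun T x).
Proof.
rewrite /phi_pull_fun -[RHS](nt_nat T (twist_hom h)); refine (congr1 (T (twist C)) _).
apply: fmap_sq => y; apply: wext => i ni /=.
rewrite (wc_F _ ni) (wc_map (twist_hom h) _ ni) wc_F //.
rewrite [RHS](wfrob_map h); apply: (@wfrob_eq S C) => k ki.
by rewrite wc_map // (leq_trans ki).
Qed.
Definition phi_pull T : ntrans (jet n.+1) Ga := NTrans (@phi_pull_nat T).
End Pullbacks.

Section Transition.
Variables (m n : nat) (mn : (m <= n)%N).
Fact trunc_subproof (B : calg S) (x : nker n B) :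
  fmap E (witt_trunc mn B) (nincl x) \in @jker m B.
Proof.
rewrite unfold_in /jker (@fmap_sq _ _ B _ _ _ (witt_proj n B) (@CHom S B B idfun (fun=> erefl))) => [|y].
  by have := valP x; rewrite unfold_in => /eqP->; rewrite linear0.
by rewrite /= /wproj wc_mkw.
Qed.
Definition trunc_ker (B : calg S) (x : nker n B) : nker m B := mk_nker (trunc_subproof x).
Definition trunc_pull_fun (P : ntrans (nker m) Ga) (B : calg S) (x : nker n B) : Ga B :=
  P B (trunc_ker x).
Fact trunc_pull_nat P (B C : calg S) (h : chom B C) (x : nker n B) :
  trunc_pull_fun P (fmap (nker n) h x) = fmap Ga h (trunc_pull_fun P x).
Proof.
rewrite /trunc_pull_fun -[RHS](nt_nat P h); congr (nt_app P _); apply: val_inj => /=.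
apply: fmap_sq => y; apply: wext => i ni /=.
by rewrite wc_mkw // !wc_map ?(leq_trans ni) // wc_mkw.
Qed.
Definition trunc_pull P : ntrans (nker n) Ga := NTrans (@trunc_pull_nat P).
End Transition.

Variables (k : finFieldType) (kA : {rmorphism k -> A}) (d : nat).

(* an isomorphism of F_q-module schemes from E to Ga^d *)
Record coordinates := Coordinates {
  coord : forall B : calg S, E B -> 'rV[B]_d;
  coordI : forall B : calg S, 'rV[B]_d -> E B;
  coordK : forall B : calg S, cancel (@coord B) (@coordI B);
  coordIK : forall B : calg S, cancel (@coordI B) (@coord B);
  coord_nat : forall (B C : calg S) (h : chom B C) (x : E B),
    coord (fmap E h x) = map_mx h (coord x);
  coordD : forall (B : calg S) (x y : E B), coord (x + y) = coord x + coord y;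
  coord_Fq : forall (B : calg S) (c : k) (x : E B),
    coord (kA c *: x) = str B (theta (kA c)) *: coord x
}.

Section Lateral.
Variable g : coordinates.

Lemma coordI_nat (B C : calg S) (h : chom B C) (y : 'rV[B]_d) :
  fmap E h (coordI g y) = coordI g (map_mx h y).
Proof. by rewrite -[LHS](coordK g) coord_nat coordIK. Qed.

Lemma coordI0 (B : calg S) : coordI g (0 : 'rV[B]_d) = 0.
Proof.
rewrite -[RHS](coordK g); congr coordI.
by apply: (addrI (coord g (0 : E B))); rewrite -coordD !addr0.
Qed.

Definition lateral_fun n (B : calg S) (x : nker n.+2 B) : E (witt_calg n.+1 (twist B)) :=
  coordI g (map_mx (@witt_lat S n B : witt_calg n.+2 B -> witt_calg n.+1 (twist B))
              (coord g (nincl x))).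
Fact lateral_subproof n (B : calg S) (x : nker n.+2 B) :
  lateral_fun x \in @jker n.+1 (twist B).
Proof.
rewrite unfold_in /jker /lateral_fun coordI_nat; apply/eqP.
rewrite -[RHS]coordI0; congr coordI; apply/matrixP => i j; rewrite !mxE /=.
by rewrite /wproj (wc_lat _ (leq0n _)).
Qed.
Definition lateral n (B : calg S) (x : nker n.+2 B) : nker n.+1 (twist B) :=
  mk_nker (lateral_subproof x).

Section LateralPull.
Variable n : nat.
Definition lateral_pull_fun (P : ntrans (nker n.+1) Ga) (B : calg S) (x : nker n.+2 B) : Ga B :=
  P (twist B) (lateral x).
Fact lateral_pull_nat P (B C : calg S) (h : chom B C) (x : nker n.+2 B) :
  lateral_pull_fun P (fmap (nker n.+2) h x) = fmap Ga h (lateral_pull_fun P x).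
Proof.
rewrite /lateral_pull_fun -[RHS](nt_nat P (twist_hom h)); refine (congr1 (P (twist C)) _).
apply: val_inj; rewrite /= /lateral_fun coordI_nat; congr coordI.
rewrite /nincl /= coord_nat; apply/matrixP => i j; rewrite !mxE.
exact: witt_lat_map.
Qed.
Definition lateral_pull P : ntrans (nker n.+2) Ga := NTrans (@lateral_pull_nat P).
End LateralPull.
End Lateral.
End JetSpaces.

Definition Fq_linear (A : comNzRingType) (S : base) (theta : {rmorphism A -> S})
    (k : finFieldType) (kA : {rmorphism k -> A}) (E : amod_functor A S)
    (f : ntrans E (Ga theta)) : Prop :=
  forall (B : calg S) (c : k) (x y : E B),
    f B (kA c *: x + y) = kA c *: f B x + f B y.

Section AbelianAnderson.
Variables (A : comNzRingType) (S : base) (theta : {rmorphism A -> S}).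
Variables (k : finFieldType) (kA : {rmorphism k -> A}) (E : amod_functor A S).
Local Notation R := (base_ring S).

(* Lie E is the kernel of E(R[eps]) -> E(R), with c in R acting via eps |-> c eps *)
Definition lie_vector (v : E (dual_calg S)) : Prop := fmap E (dual_aug_hom S) v = 0.

Definition lie_defect (a : A) (v : E (dual_calg S)) : E (dual_calg S) :=
  a *: v - fmap E (dual_scale_hom (theta a)) v.

(* T is the pi-adic completion of the tensor product of A and R over F_q.  The
   completion is forced by the formal setting: Hom(E, Ga) is pi-adically
   complete, and no nonzero locally free module of finite rank over the
   uncompleted tensor product is (1 + pi (a (x) 1) would act invertibly). *)
Definition is_completed_tensor (T : calg S) (iT : {rmorphism A -> T}) : Prop :=
  (forall c, iT (kA c) = str T (theta (kA c))) /\
  forall (B : calg S) (g : {rmorphism A -> B}),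
    (forall c, g (kA c) = str B (theta (kA c))) ->
    exists h : chom T B, (forall a, h (iT a) = g a) /\
      forall h' : chom T B, (forall a, h' (iT a) = g a) -> h' =1 h.

(* mu identifies M(E), the F_q-linear morphisms E -> Ga, with the T-module M,
   where (a (x) b) m = b o m o phi_E(a). *)
Definition is_motive_module (T : calg S) (iT : {rmorphism A -> T}) (M : lmodType T)
    (mu : ntrans E (Ga theta) -> M) : Prop :=
  [/\ forall m1 m2 : ntrans E (Ga theta), Fq_linear kA m1 -> Fq_linear kA m2 -> mu m1 = mu m2 ->
        forall (B : calg S) (x : E B), m1 B x = m2 B x,
      forall y, exists m, Fq_linear kA m /\ mu m = y &
      forall (a : A) (b : R) (m m1 m2 : ntrans E (Ga theta)), Fq_linear kA m1 -> Fq_linear kA m2 ->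
        (forall (B : calg S) (x : E B), (m B x : B) = str B b * (m1 B (a *: x) : B) + (m2 B x : B)) ->
        mu m = (iT a * str T b) *: mu m1 + mu m2].

(* the images of the e i form a basis of the localization M_s over T_s *)
Definition free_after_inverting (T : comNzRingType) (M : lmodType T) (s : T) (r : nat) : Prop :=
  exists e : 'I_r -> M,
    (forall x, exists N (c : 'I_r -> T), s ^+ N *: x = \sum_i c i *: e i) /\
    (forall c : 'I_r -> T, \sum_i c i *: e i = 0 -> exists N, forall i, s ^+ N * c i = 0).

Definition locally_free (T : comNzRingType) (M : lmodType T) (r : nat) : Prop :=
  exists n (s t : 'I_n -> T), \sum_i t i * s i = 1 /\
    forall i, free_after_inverting M (s i) r.

Record abelian_anderson (d r : nat) : Prop := AbelianAnderson {
  aa_coordinates : inhabited (coordinates E theta kA d);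
  aa_lie : forall a v, lie_vector v -> iter d (lie_defect a) v = 0;
  aa_motive : exists (T : calg S) (iT : {rmorphism A -> T}), is_completed_tensor iT /\
    exists (M : lmodType T) (mu : ntrans E (Ga theta) -> M),
      is_motive_module iT mu /\ locally_free M r
}.
End AbelianAnderson.

(* For s the inclusion of R in its fraction field, is_scalar_extension says that
   W is the tensor product of V with K; for s = sigma it says that W is the
   Frobenius twist sigma^* V. *)
Definition semilinear_map (R K : nzRingType) (s : R -> K) (V : lmodType R) (W : lmodType K)
    (f : V -> W) : Prop :=
  forall a x y, f (a *: x + y) = s a *: f x + f y.

Definition is_scalar_extension (R K : nzRingType) (s : R -> K) (V : lmodType R)
    (W : lmodType K) (j : V -> W) : Prop :=
  semilinear_map s j /\
  forall (W' : lmodType K) (f : V -> W'), semilinear_map s f ->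
    exists g : {linear W -> W'}, (forall x, g (j x) = f x) /\
      forall g' : {linear W -> W'}, (forall x, g' (j x) = f x) -> g' =1 g.

(* The linearization F : sigma^* D -> D of f is bijective.  When sigma is an
   automorphism this is bijectivity of f itself. *)
Definition bijective_linearization (K : nzRingType) (s : K -> K) (D : lmodType K)
    (f : D -> D) : Prop :=
  exists (sD : lmodType K) (j : D -> sD), is_scalar_extension s j /\
    exists F : {linear sD -> D}, (forall x, F (j x) = f x) /\ bijective F.

Definition finite_dimensional (K : nzRingType) (D : lmodType K) : Prop :=
  exists n (e : 'I_n -> D), forall x, exists c : 'I_n -> K, x = \sum_i c i *: e i.

Definition is_isocrystal (K : nzRingType) (s : K -> K) (D : lmodType K) (f : D -> D) : Prop :=
  [/\ finite_dimensional D, semilinear_map s f & bijective_linearization s f].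

Section HModule.
Variables (A : comNzRingType) (S : base) (theta : {rmorphism A -> S}).
Variable E : amod_functor A S.
Local Notation R := (base_ring S).

(* The R-submodule i^* phi^* (X_m(E)) of X(N^(m+1)).  Since phi^* is only
   phi-semilinear, its image is a submodule a priori only if phi is onto, and the
   R-span has to be taken in general. *)
Definition in_phi_image (m : nat) (P : ntrans (nker E m.+1) (Ga theta)) : Prop :=
  exists n (c : 'I_n -> R) (T : 'I_n -> ntrans (jet E m) (Ga theta)),
    (forall i, A_linear (T i)) /\
    forall (B : calg S) (x : nker E m.+1 B), (P B x : B) = \sum_i str B (c i) * (incl_pull (phi_pull (T i)) B x : B).

(* H is the direct limit over m of X(N^(m+1)) / i^* phi^* (X_m(E)), cls m being
   the canonical map from X(N^(m+1)) to the limit; its values at morphisms which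
   are not A-linear are irrelevant. *)
Record is_HE (H : lmodType R) (cls : forall m, ntrans (nker E m.+1) (Ga theta) -> H)
    : Prop := IsHE {
  HE_linear : forall m (c : R) (P P1 P2 : ntrans (nker E m.+1) (Ga theta)), A_linear P1 -> A_linear P2 ->
    (forall (B : calg S) (x : nker E m.+1 B), (P B x : B) = str B c * (P1 B x : B) + (P2 B x : B)) ->
    cls m P = c *: cls m P1 + cls m P2;
  HE_trans : forall m n (mn : (m.+1 <= n.+1)%N) (P : ntrans (nker E m.+1) (Ga theta)),
    A_linear P -> cls n (trunc_pull mn P) = cls m P;
  HE_surj : forall h, exists m (P : ntrans (nker E m.+1) (Ga theta)), A_linear P /\ cls m P = h;
  HE_ker : forall m (P : ntrans (nker E m.+1) (Ga theta)), A_linear P ->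
    (cls m P = 0 <-> exists n (mn : (m.+1 <= n.+1)%N), in_phi_image (trunc_pull mn P))
}.

Definition is_lateral_operator (k : finFieldType) (kA : {rmorphism k -> A}) (d : nat)
    (g : coordinates E theta kA d) (H : lmodType R)
    (cls : forall m, ntrans (nker E m.+1) (Ga theta) -> H) (fs : H -> H) : Prop :=
  semilinear_map (phi S) fs /\
  forall m (P : ntrans (nker E m.+1) (Ga theta)), A_linear P ->
    A_linear (lateral_pull g P) /\ fs (cls m P) = cls m.+1 (lateral_pull g P).
End HModule.

Local Open Scope classical_set_scope.

Section Ideals.
Variable B : comNzRingType.
Implicit Types I J X : set B.

Definition is_ideal I : Prop := I 0 /\ forall a x y, I x -> I y -> I (a * x + y).

Definition maximal_ideal I : Prop :=
  [/\ is_ideal I, ~ I 1 & forall J, is_ideal J -> I `<=` J -> ~ J 1 -> J = I].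

Definition ideal_span X : set B :=
  [set x | exists n (a s : 'I_n -> B), (forall i, X (s i)) /\ x = \sum_i a i * s i].

Fixpoint ideal_pow I n : set B :=
  if n is n'.+1 then
    ideal_span [set x | exists y w, [/\ I y, ideal_pow I n' w & x = y * w]]
  else setT.

Definition adically_complete I : Prop :=
  (forall x, (forall n, ideal_pow I n x) -> x = 0) /\
  (forall u : nat -> B, (forall n, ideal_pow I n (u n.+1 - u n)) ->
     exists x, forall n, ideal_pow I n (x - u n)).

End Ideals.

Definition is_adic_completion (A Ahat : comNzRingType) (p : set A) (c : {rmorphism A -> Ahat})
    : Prop :=
  let J := ideal_span (c @` p) in
  [/\ adically_complete J,
      forall n x, exists a, ideal_pow J n (x - c a) &
      forall n a, ideal_pow J n (c a) -> ideal_pow p n a].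

(* flatness of C over B, through the equational criterion *)
Definition flat (B C : comNzRingType) (th : {rmorphism B -> C}) : Prop :=
  forall n (b : 'I_n -> B) (x : 'I_n -> C), \sum_i th (b i) * x i = 0 ->
    exists m (y : 'I_m -> C) (w : 'I_n -> 'I_m -> B),
      (forall i, x i = \sum_j th (w i j) * y j) /\ (forall j, \sum_i b i * w i j = 0).

Definition discrete_valuation_ring (R : idomainType) : Prop :=
  exists t : R, [/\ t != 0, t \isn't a GRing.unit &
    forall x, x != 0 -> exists n u, u \is a GRing.unit /\ x = u * t ^+ n].

(* x |-> sum_n cf x n z^n is a ring isomorphism from R to l[[z]] with t |-> z *)
Definition is_power_series_iso (R : idomainType) (t : R) (l : fieldType) (cf : R -> nat -> l)
    : Prop :=
  [/\ bijective cf,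
      forall x y n, cf (x + y) n = cf x n + cf y n,
      forall x y n, cf (x * y) n = \sum_(i < n.+1) cf x i * cf y (n - i)%N,
      forall n, cf 1 n = (n == 0%N)%:R &
      forall n, cf t n = (n == 1%N)%:R].

(* A smooth projective geometrically connected curve over the (perfect) finite
   field k is encoded by its function field L: k is algebraically closed in L, and
   the closed points are the nontrivial valuation rings of L over k. *)
Section Curve.
Variables (k : finFieldType) (L : fieldType) (kL : {rmorphism k -> L}).

Definition rational_in (t x : L) : Prop :=
  exists f g : {poly k}, (map_poly kL g).[t] != 0 /\
    x = (map_poly kL f).[t] / (map_poly kL g).[t].

Definition is_function_field : Prop :=
  exists t : L, (forall f : {poly k}, root (map_poly kL f) t -> f = 0) /\
    exists n (e : 'I_n -> L), forall x, exists c : 'I_n -> L,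
      (forall i, rational_in t (c i)) /\ x = \sum_i c i * e i.

Definition geometrically_connected : Prop :=
  forall (x : L) (f : {poly k}), f != 0 -> root (map_poly kL f) x -> exists c, x = kL c.

Definition is_place (O : set L) : Prop :=
  [/\ forall c, O (kL c), forall x y, O x -> O y -> O (x - y) /\ O (x * y),
      forall x, O x \/ O x^-1 & exists x, ~ O x].

Definition is_rational_place (O : set L) : Prop :=
  is_place O /\ forall x, O x -> exists c, x - kL c = 0 \/ ~ O (x - kL c)^-1.

Definition regular_outside (Oinf : set L) : set L :=
  [set x | forall O, is_place O -> O <> Oinf -> O x].

Definition is_coordinate_ring (Oinf : set L) (A : comNzRingType) (iA : {rmorphism A -> L})
    : Prop :=
  injective iA /\ forall x, regular_outside Oinf x <-> exists a, iA a = x.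

Definition separable_over (A : comNzRingType) (iA : {rmorphism A -> L}) (z : A) : Prop :=
  forall a, exists P : {poly L}, [/\ forall i, rational_in (iA z) P`_i,
    separable_poly P & root P (iA a)].
End Curve.

Definition ideal_degree (k : finFieldType) (A : comNzRingType) (kA : {rmorphism k -> A})
    (p : set A) (f : nat) : Prop :=
  exists e : 'I_f -> A, forall a,
    exists! c : {ffun 'I_f -> k}, p (a - \sum_i kA (c i) * e i).

(* Main.v *)
(* Write tau for the p-power Frobenius.  Identifying E with Ga^d, the action of a
   in A becomes a matrix Phi_a over R{{tau}} with null coefficients, and an
   additive character of J^n E or N^n becomes a family of null rows, equivalently
   its ghost components m_i, which are rows over K{{tau}}.  It is A-linear exactly
   when m_i phi^i(Phi_a) = theta(a) m_i for all a, and phi^* and f^* both send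
   (m_i) to the family with (i+1)-st component sigma(m_i).

   Let C be the space of rows s with s Phi_a = theta(a) s for all a.  Since Phi_z
   minus pi is nilpotent on Lie E, such an s is determined by its constant term,
   so dim C <= d, and s pi is null.  The i-th ghost components are spanned by
   sigma^i(C): this only uses that finitely many elements of K can be expanded
   over a family independent over sigma^i(K).  Hence H_K is spanned by the classes
   psi_i(s) of pi^k sigma^i(s), with f^* psi_i(s) = psi_(i+1)(s).

   The operator y |-> y Phi_z - pi y on null rows has finitely generated cokernel
   up to a power of pi.  It maps sigma^k(s) tau^(ek) to a null row for every k and
   is injective up to dimension d, so some nontrivial combination
   sum c_k sigma^k(s) tau^(ek) is null; dividing it by sigma tau^e if necessary,
   one may take c_0 <> 0.  The components c_k sigma^k(s) then define a character of
   a jet space, whose image under i^* phi^* is the relation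
   sum sigma(c_k) psi_(k+1)(s) = 0 in H_K.  Its leading coefficient bounds dim H_K,
   and c_0 <> 0 puts psi_1(s) in the span of f^* H_K.  So the linearization of f^*
   is a surjection between spaces of the same finite dimension. *)
Require Import Defs.
From HB Require Import structures.
From mathcomp Require Import all_boot all_order all_algebra.
From mathcomp Require Import fraction generic_quotient.
From mathcomp Require Import separable boolp classical_sets functions.
From mathcomp Require Import ring zify.
Set Implicit Arguments.
Unset Strict Implicit.
Unset Printing Implicit Defensive.
Import GRing.Theory.
Local Open Scope ring_scope.

(** * Twisted power series *)

(** Two facts shape the argument. In twisted series a constant c multiplies the coefficient of tau^n
    by c from the left but by c^(p^n) from the right. Since pi^(p^n) beats any denominator growing
    linearly in n, a solution s of s Phi_z = pi s, though not null in general, becomes null when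
    multiplied by pi on the right. Hence rows over K are arbitrary formal series and nullity is a
    separate predicate. It is also why s gives a character of N^n, where every Witt coordinate
    brings a factor pi, but not at once one of J^n E. Moreover, Phi_z may have a kernel modulo pi,
    so its reduction need not have finite cokernel. The gap is filled by tau^nu times that kernel, a
    part that can be divided further only after multiplication by pi^nu; this is the origin of the
    power of pi. The rows sigma^k(s) tau^(ek) occur because x^(qhat^k) and phi^k(x) agree modulo pi:
    moving tau^(ek) past Phi_z applies phi^k to it up to a multiple of pi, and that factor pi makes
    the remaining term null. *)

Section IterMorphism.
Variables (F : nzRingType) (al : {rmorphism F -> F}) (i : nat).
Definition itm (x : F) : F := iter i al x.
Fact itm_zmod : zmod_morphism itm.
Proof. by rewrite /itm => x y; elim: i => //= j ->; rewrite rmorphB. Qed.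
Fact itm_mon : monoid_morphism itm.
Proof.
rewrite /itm; split=> [|x y]; elim: i => //= j ->; by rewrite ?rmorph1 ?rmorphM.
Qed.
HB.instance Definition _ := GRing.isZmodMorphism.Build F F itm itm_zmod.
HB.instance Definition _ := GRing.isMonoidMorphism.Build F F itm itm_mon.
End IterMorphism.

Lemma itmD (F : nzRingType) (al : {rmorphism F -> F}) i j x :
  itm al (i + j) x = itm al i (itm al j x).
Proof. exact: iterD. Qed.

Lemma itmS (F : nzRingType) (al : {rmorphism F -> F}) i x :
  itm al i.+1 x = al (itm al i x).
Proof. by []. Qed.

(* A series f stands for the sum of the f n tau^n, where tau a = al(a) tau. *)
Definition tps (F : nzRingType) (al : {rmorphism F -> F}) : Type := nat -> F.

Section Skew.
Variables (F : nzRingType) (al : {rmorphism F -> F}).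
Local Notation sk := (tps al).
HB.instance Definition _ := GRing.Zmodule.copy sk (nat -> F).

Implicit Types f g h : sk.

Definition tps_mul f g : sk := fun n => \sum_(i < n.+1) f i * itm al i (g (n - i)%N).
Definition tps_one : sk := fun n => (n == 0%N)%:R.

Lemma tpsDE f g n : (f + g) n = f n + g n. Proof. by []. Qed.
Lemma tpsNE f n : (- f) n = - f n. Proof. by []. Qed.
Lemma tpsBE f g n : (f - g) n = f n - g n. Proof. by []. Qed.
Lemma tps0E n : (0 : sk) n = 0. Proof. by []. Qed.

Lemma tps_sumE (I : Type) (r : seq I) P (G : I -> sk) n :
  (\sum_(i <- r | P i) G i) n = \sum_(i <- r | P i) G i n.
Proof. by elim/big_rec2: _ => // i x y _ <-. Qed.

Fact tps_mulA : associative tps_mul.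
Proof.
move=> f g h; apply/funext => n; rewrite /tps_mul.
pose c3 j k := f j * (itm al j (g k) * itm al (j + k) (h (n - j - k)%N)).
transitivity (\sum_(j < n.+1) \sum_(k < n.+1 | (k <= n - j)%N) c3 j k).
  apply: eq_bigr => j _; rewrite rmorph_sum mulr_sumr (big_ord_narrow_leq (leq_subr _ _)).
  by apply: eq_bigr => k _; rewrite rmorphM /c3 itmD.
symmetry; transitivity (\sum_(m < n.+1) \sum_(j < n.+1 | (j <= m)%N) c3 j (m - j)%N).
  apply: eq_bigr => m _; have mn : (m.+1 <= n.+1)%N by [].
  rewrite (big_ord_narrow mn) mulr_suml; apply: eq_bigr => j _ /=.
  have jm : (j <= m)%N by rewrite -ltnS.
  by rewrite /c3 subnKC // -subnDA subnKC // mulrA.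
rewrite (exchange_big_dep predT) //=; apply: eq_bigr => j _.
have jn : (j <= n)%N by rewrite -ltnS.
rewrite -(big_mkord (fun m => j <= m)%N (fun m => c3 j (m - j)%N)).
rewrite -(big_mkord (fun k => k <= n - j)%N (c3 j)).
rewrite (@big_cat_nat _ _ _ j) //=; last exact: leqW.
rewrite big_nat_cond big1 ?add0r => [|m]; last first.
  by case/andP=> /andP[_ mj] jm; rewrite ltnNge jm in mj.
rewrite [RHS](@big_cat_nat _ _ _ (n - j).+1) //=; last by rewrite ltnS leq_subr.
rewrite [X in _ = _ + X]big_nat_cond [X in _ = _ + X]big1 ?addr0; last first.
  by move=> k /andP[/andP[nk _] kn]; rewrite ltnNge kn in nk.
rewrite -{1}(add0n j) big_addn subSn // big_nat_cond [RHS]big_nat_cond.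
apply: eq_big => [k|k _]; last by rewrite addnK.
by rewrite leq_addl /= ltnS andbT; case: (k <= n - j)%N.
Qed.

Fact tps_mul1l : left_id tps_one tps_mul.
Proof.
move=> f; apply/funext => n; rewrite /tps_mul big_ord_recl /= mul1r subn0.
by rewrite big1 ?addr0 // => i _; rewrite /tps_one mul0r.
Qed.
Fact tps_mul1r : right_id tps_one tps_mul.
Proof.
move=> f; apply/funext => n; rewrite /tps_mul big_ord_recr /= subnn rmorph1 mulr1.
rewrite big1 ?add0r // => i _; rewrite /tps_one subn_eq0 leqNgt ltn_ord.
by rewrite rmorph0 mulr0.
Qed.
Fact tps_mulDl : left_distributive tps_mul +%R.
Proof.
move=> f g h; apply/funext => n; rewrite tpsDE -big_split; apply: eq_bigr => i _.
exact: mulrDl.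
Qed.
Fact tps_mulDr : right_distributive tps_mul +%R.
Proof.
move=> f g h; apply/funext => n; rewrite tpsDE -big_split; apply: eq_bigr => i _ /=.
by rewrite tpsDE rmorphD mulrDr.
Qed.
Fact tps_one_neq0 : tps_one != 0.
Proof.
apply/eqP => /(congr1 (fun f : sk => f 0)) /eqP.
by rewrite /tps_one eqxx oner_eq0.
Qed.
HB.instance Definition _ := GRing.Zmodule_isNzRing.Build sk
  tps_mulA tps_mul1l tps_mul1r tps_mulDl tps_mulDr tps_one_neq0.

Lemma tpsME f g n : (f * g) n = \sum_(i < n.+1) f i * itm al i (g (n - i)%N).
Proof. by []. Qed.
Lemma tps1E n : (1 : sk) n = (n == 0%N)%:R. Proof. by []. Qed.

(* c tau^a *)
Definition mono (c : F) (a : nat) : sk := fun n => if n == a then c else 0.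

Lemma monoE c a n : mono c a n = if n == a then c else 0. Proof. by []. Qed.

Lemma mono_mulE c a f n : (mono c a * f) n = if (a <= n)%N then c * itm al a (f (n - a)%N) else 0.
Proof.
rewrite tpsME; case: leqP => [an|na].
  rewrite (bigD1 (Ordinal (an : (a < n.+1)%N))) //= monoE eqxx big1 ?addr0 // => i.
  by rewrite -val_eqE /= => /negbTE ia; rewrite monoE ia mul0r.
apply: big1 => i _; rewrite monoE; case: eqP => [ia|_]; last by rewrite mul0r.
by have := ltn_ord i; rewrite ia ltnS leqNgt na.
Qed.

Lemma mul_monoE f c a n : (f * mono c a) n = if (a <= n)%N then f (n - a)%N * itm al (n - a) c else 0.
Proof.
rewrite tpsME; case: leqP => [an|na].
  have na : (n - a < n.+1)%N by rewrite ltnS leq_subr.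
  rewrite (bigD1 (Ordinal na)) //= monoE subKn // eqxx big1 ?addr0 // => i.
  rewrite -val_eqE /= => /negbTE ia; rewrite monoE; case: eqP => [E|_]; last by rewrite rmorph0 mulr0.
  by move: ia; rewrite -E subKn ?eqxx // -ltnS.
apply: big1 => i _; rewrite monoE; case: eqP => [ia|_]; last by rewrite rmorph0 mulr0.
by move: na; rewrite -ia ltnNge leq_subr.
Qed.

Lemma mono_mul c a c' a' : mono c a * mono c' a' = mono (c * itm al a c') (a + a').
Proof.
apply/funext => n; rewrite mono_mulE !monoE; case: leqP => [an|na].
  by rewrite -(eqn_add2l a) subnKC //; case: eqP => _ //; rewrite rmorph0 mulr0.
by rewrite ltn_eqF // ltn_addr.
Qed.

Lemma mono1 : mono 1 0 = 1.
Proof. by apply/funext => n; rewrite monoE tps1E; case: eqP. Qed.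
Lemma monoD c c' a : mono (c + c') a = mono c a + mono c' a.
Proof. by apply/funext => n; rewrite tpsDE !monoE; case: eqP => // _; rewrite addr0. Qed.
Lemma mono0 a : mono 0 a = 0.
Proof. by apply/funext => n; rewrite monoE; case: eqP. Qed.
Lemma monoMl c c' a : mono (c * c') a = mono c 0 * mono c' a.
Proof. by rewrite mono_mul. Qed.
Lemma constM c f n : (mono c 0 * f) n = c * f n.
Proof. by rewrite mono_mulE subn0. Qed.
End Skew.

Section SkewDomain.
Variables (F : fieldType) (al : {rmorphism F -> F}).
(** If f_i and g_j are the lowest nonzero coefficients, the coefficient of tau^(i+j) in f g is f_i
    al^i(g_j), and al is injective on a field. *)
Lemma tps_mul_eq0 (f g : tps al) : f * g = 0 -> f = 0 \/ g = 0.
Proof.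
move=> fg0; have [|f0] := pselect (f = 0); [by left|right].
apply: contrapT => g0.
have ex (h : tps al) : h <> 0 -> exists n, h n != 0.
  move=> h0; apply: contrapT => nh; apply: h0; apply/funext => n; apply/eqP.
  by apply: contrapT => hn; apply: nh; exists n; apply/negP.
have [i fi imin] := ex_minnP (ex _ f0); have [j gj jmin] := ex_minnP (ex _ g0).
have := congr1 (fun h : tps al => h (i + j)%N) fg0; rewrite tpsME.
have ij : (i < (i + j).+1)%N by rewrite ltnS leq_addr.
rewrite (bigD1 (Ordinal ij)) //= big1 ?addr0 => [|k]; last first.
  rewrite -val_eqE /= neq_ltn => /orP[ki|ik].
    have [-> |/imin] := eqVneq (f k) 0; first by rewrite mul0r.
    by rewrite leqNgt ki.
  have [-> |/jmin] := eqVneq (g (i + j - k)%N) 0; first by rewrite rmorph0 mulr0.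
  by rewrite leqNgt ltn_subLR ?ltn_add2r ?ik // -ltnS.
rewrite addKn => /eqP; rewrite mulf_eq0 (negbTE fi) /= fmorph_eq0.
by rewrite (negbTE gj).
Qed.
End SkewDomain.

Section SkewMap.
Variables (F F' : nzRingType) (al : {rmorphism F -> F}) (al' : {rmorphism F' -> F'}).
Variables (rho : {rmorphism F -> F'}) (rho_al : forall x, rho (al x) = al' (rho x)).
Definition tpsmap of (forall x, rho (al x) = al' (rho x)) := fun (f : tps al) => (fun n => rho (f n)) : tps al'.
Local Notation tpm := (tpsmap rho_al).

Lemma rho_itm i x : rho (itm al i x) = itm al' i (rho x).
Proof. by elim: i => // i IH; rewrite !itmS rho_al IH. Qed.

Fact tpsmap_zmod : zmod_morphism tpm.
Proof. by move=> f g; apply/funext => n; rewrite /tpsmap !tpsBE rmorphB. Qed.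
Fact tpsmap_mon : monoid_morphism tpm.
Proof.
split=> [|f g]; apply/funext => n; first by rewrite /tpsmap !tps1E rmorph_nat.
rewrite /tpsmap !tpsME rmorph_sum; apply: eq_bigr => i _.
by rewrite rmorphM rho_itm.
Qed.
HB.instance Definition _ := GRing.isZmodMorphism.Build (tps al) (tps al') tpm tpsmap_zmod.
HB.instance Definition _ := GRing.isMonoidMorphism.Build (tps al) (tps al') tpm tpsmap_mon.
Lemma tpsmapE f n : tpm f n = rho (f n). Proof. by []. Qed.
Lemma tpsmap_mono c a : tpm (mono al c a) = mono al' (rho c) a.
Proof. by apply/funext => n; rewrite tpsmapE !monoE; case: eqP => // _; rewrite rmorph0. Qed.
End SkewMap.

(** * Convergent series and restricted power series *)

Section Convergence.
Variable S : base.
Local Notation R := (base_ring S).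
Local Notation pi := (ppi S).

Lemma dvpi_add (B : calg S) e (x y : B) : dvpi e x -> dvpi e y -> dvpi e (x + y).
Proof. by move=> [a ->] [b ->]; exists (a + b); rewrite mulrDr. Qed.

Lemma dvpi_opp (B : calg S) e (x : B) : dvpi e x -> dvpi e (- x).
Proof. by move=> [a ->]; exists (- a); rewrite mulrN. Qed.

Lemma dvpi_mulr (B : calg S) e (x y : B) : dvpi e x -> dvpi e (x * y).
Proof. by rewrite mulrC; apply: dvpi_mul. Qed.

Lemma dvpi_pi (B : calg S) e (x : B) : dvpi e (str B pi ^+ e * x).
Proof. by exists x. Qed.

Lemma dvpi_hom (B C : calg S) (h : chom B C) e x : dvpi e x -> dvpi e (h x).
Proof. by move=> [a ->]; exists (h a); rewrite rmorphM rmorphXn chom_str. Qed.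

Lemma dvpi_sum_nat (B : calg S) e a b (F : nat -> B) :
  (forall i, (a <= i < b)%N -> dvpi e (F i)) -> dvpi e (\sum_(a <= i < b) F i).
Proof.
move=> H; rewrite big_seq; apply: (big_ind (dvpi e)) => [||i].
- exact: dvpi0.
- exact: dvpi_add.
- by rewrite mem_index_iota => /H.
Qed.

Definition null (B : calg S) (u : nat -> B) :=
  forall N, exists J, forall j, (J <= j)%N -> dvpi N (u j).

Definition psum (B : calg S) (u : nat -> B) J := \sum_(j < J) u j.

Definition converges (B : calg S) (u : nat -> B) x :=
  forall N, exists J, forall j, (J <= j)%N -> dvpi N (x - u j).

Lemma converges_uniq (B : calg S) (u : nat -> B) x y : converges u x -> converges u y -> x = y.
Proof.
move=> cx cy; apply/eqP; rewrite -subr_eq0; apply/eqP; apply: dvpi_sep => N.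
have [J JP] := cx N; have [I IP] := cy N.
have -> : x - y = (x - u (maxn I J)) - (y - u (maxn I J)) by rewrite opprB addrA subrK.
by apply: dvpi_sub; [apply: JP; rewrite leq_maxr | apply: IP; rewrite leq_maxl].
Qed.

Lemma null_summable (B : calg S) (u : nat -> B) : null u -> exists x, converges (psum u) x.
Proof.
(* Completeness of [B] is stated for sequences whose N-th increment is divisible by pi^N. The
   partial sums are therefore sampled along a nondecreasing bound [M] of the ranks [J]. *)
move=> /choice[J JP]; pose M N := \sum_(i < N.+1) J i.
have JM N : (J N <= M N)%N by rewrite /M big_ord_recr leq_addl.
have MS N : (M N <= M N.+1)%N by rewrite {2}/M big_ord_recr leq_addr.
have tail N a b : (M N <= a)%N -> (a <= b)%N -> dvpi N (psum u b - psum u a).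
  move=> Na ab; rewrite /psum -!(big_mkord xpredT u) (big_cat_nat (leq0n a) ab) /=.
  rewrite [X in X - _]addrC addrK; apply: dvpi_sum_nat => i /andP[ai _]; apply: JP.
  by apply: leq_trans (JM N) _; apply: leq_trans ai.
have [_ /(_ (fun N => psum u (M N)))[N|x xP]] := calg_complete B.
  by have [y yP] := tail N _ _ (leqnn _) (MS N); exists y.
exists x => N; exists (M N) => j Mj.
have -> : x - psum u j = (x - psum u (M N)) - (psum u j - psum u (M N)).
  by rewrite opprB addrA subrK.
by apply: dvpi_sub; [exact: xP | exact: tail].
Qed.

Definition nsum (B : calg S) (u : nat -> B) : B := xget 0 [set x | converges (psum u) x]%classic.

Lemma nsumP (B : calg S) (u : nat -> B) : null u -> converges (psum u) (nsum u).
Proof.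
move=> /null_summable[x xP].
exact: (@xgetPex B 0 [set x | converges (psum u) x]%classic (ex_intro _ x xP)).
Qed.

Lemma nsum_eq (B : calg S) (u : nat -> B) x : converges (psum u) x -> nsum u = x.
Proof. by move=> cx; rewrite /nsum; apply: xget_unique => // y cy; exact: converges_uniq cy cx. Qed.

Lemma nsum_fin (B : calg S) (u : nat -> B) n :
  (forall j, (n <= j)%N -> u j = 0) -> nsum u = \sum_(j < n) u j.
Proof.
move=> u0; apply: nsum_eq => N; exists n => j nj; rewrite /psum -!(big_mkord xpredT u).
rewrite (big_cat_nat (leq0n n) nj) /= [X in _ - (_ + X)]big_nat_cond.
rewrite [X in _ - (_ + X)]big1 ?addr0 ?subrr ?dvpi0 //; first exact: dvpi0.
by move=> i /andP[/andP[ni _] _]; exact: u0.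
Qed.

Section Morph.
Variables (B C : calg S) (G : B -> C).
Hypotheses (GB : forall x y, G (x - y) = G x - G y)
  (Gdv : forall e x, dvpi e x -> dvpi e (G x)).

Lemma morph0 : G 0 = 0. Proof. by rewrite -(subrr 0) GB subrr. Qed.
Lemma morphD : {morph G : x y / x + y}.
Proof. by move=> x y; rewrite -{1}(opprK y) GB -{1}(sub0r y) GB morph0 sub0r opprK. Qed.

Lemma null_morph u : null u -> null (fun j => G (u j)).
Proof. by move=> nu N; have [J JP] := nu N; exists J => j /JP; exact: Gdv. Qed.

(** Only additivity and preservation of divisibility by powers of pi are asked of G, so that p^j-th
    powers and coefficient maps are covered as well as ring morphisms. *)
Lemma nsum_morph u : null u -> nsum (fun j => G (u j)) = G (nsum u).
Proof.
move=> nu; apply: nsum_eq => N; have [J JP] := nsumP nu N; exists J => j /JP.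
by rewrite /psum -(big_morph _ morphD morph0) -GB; exact: Gdv.
Qed.
End Morph.

Lemma nullD (B : calg S) (u v : nat -> B) : null u -> null v -> null (fun j => u j + v j).
Proof.
move=> nu nv N; have [J JP] := nu N; have [I IP] := nv N; exists (maxn I J) => j.
by rewrite geq_max => /andP[Ij Jj]; apply: dvpi_add; [exact: JP | exact: IP].
Qed.

Lemma nullN (B : calg S) (u : nat -> B) : null u -> null (fun j => - u j).
Proof. by move=> nu N; have [J JP] := nu N; exists J => j /JP; exact: dvpi_opp. Qed.

Lemma null_mull (B : calg S) (u v : nat -> B) : null u -> null (fun j => v j * u j).
Proof. by move=> nu N; have [J JP] := nu N; exists J => j /JP; exact: dvpi_mul. Qed.

Lemma null_fin (B : calg S) (u : nat -> B) n : (forall j, (n <= j)%N -> u j = 0) -> null u.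
Proof. by move=> u0 N; exists n => j /u0->; exact: dvpi0. Qed.

Lemma nsumD (B : calg S) (u v : nat -> B) : null u -> null v ->
  nsum (fun j => u j + v j) = nsum u + nsum v.
Proof.
move=> nu nv; apply: nsum_eq => N; have [J JP] := nsumP nu N; have [I IP] := nsumP nv N.
exists (maxn I J) => j; rewrite geq_max => /andP[Ij Jj].
rewrite /psum big_split /= opprD addrACA.
by apply: dvpi_add; [exact: JP | exact: IP].
Qed.

Lemma nsumMl (B : calg S) (u : nat -> B) a : null u -> nsum (fun j => a * u j) = a * nsum u.
Proof.
move=> nu; apply: (@nsum_morph B B (fun x => a * x)) => // [x y|e x]; first exact: mulrBr.
exact: dvpi_mul.
Qed.

Lemma nsum_recl (B : calg S) (u : nat -> B) : null u ->
  nsum u = u 0%N + nsum (fun j => u j.+1).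
Proof.
move=> nu; apply: nsum_eq => N.
have nu' : null (fun j => u j.+1).
  by move=> M; have [J JP] := nu M; exists J => j Jj; apply: JP; exact: leqW.
have [J JP] := nsumP nu' N; exists J.+1 => -[//|j] Jj.
by rewrite /psum big_ord_recl opprD addrACA subrr add0r; exact: JP.
Qed.

Lemma nsum_dvpi (B : calg S) (u : nat -> B) N : null u -> (forall j, dvpi N (u j)) -> dvpi N (nsum u).
Proof.
move=> nu uN; have [J /(_ J (leqnn J)) JP] := nsumP nu N.
by rewrite -(subrK (psum u J) (nsum u)); apply: dvpi_add => //; apply: dvpi_sum.
Qed.
End Convergence.

(* B<t>, the ring of power series over B with coefficients tending to 0 *)
Section Restricted.
Variables (S : base) (B : calg S).
Local Notation R := (base_ring S).
Local Notation pi := (ppi S).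

(** With the identity as twist, the product of [tps] is the Cauchy product, so ordinary power series
    inherit the ring structure built above. *)
Definition idm : {rmorphism B -> B} := idfun.
Definition pser : Type := tps idm.
HB.instance Definition _ := GRing.NzRing.copy pser (tps idm).

Lemma itm_id i (x : B) : itm idm i x = x.
Proof. by elim: i => // i IH; rewrite itmS IH. Qed.

Lemma pserME (f g : pser) n : (f * g) n = \sum_(i < n.+1) f i * g (n - i)%N.
Proof. by rewrite tpsME; apply: eq_bigr => i _; rewrite itm_id. Qed.

Fact pser_mulC : @commutative pser pser *%R.
Proof.
move=> f g; apply/funext => n; rewrite !pserME (reindex_inj rev_ord_inj) /=.
by apply: eq_bigr => i _; rewrite subSS subKn 1?mulrC // -ltnS.
Qed.
HB.instance Definition _ := GRing.PzRing_hasCommutativeMul.Build pser pser_mulC.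

Definition restricted : {pred pser} := fun f => `[< @null S B f >].

Lemma null_conv (f g : pser) : @null S B f -> @null S B g -> @null S B (f * g).
Proof.
move=> nf ng N; have [J JP] := nf N; have [I IP] := ng N; exists (I + J)%N => n IJ.
rewrite pserME; apply: dvpi_sum => i; case: (leqP J i) => [/JP|iJ].
  exact: dvpi_mulr.
apply: dvpi_mul; apply: IP; rewrite leq_subRL; last by rewrite -ltnS.
by apply: leq_trans IJ; rewrite addnC leq_add2l ltnW.
Qed.

Fact restricted_subring : subring_closed restricted.
Proof.
split=> [|f g|f g].
- apply/asboolP; apply: (@null_fin _ _ _ 1) => -[//|j] _; exact: tps1E.
- move=> /asboolP nf /asboolP ng; apply/asboolP; apply: (@nullD S B f (- g)) => //.
  exact: (@nullN S B g).
by move=> /asboolP nf /asboolP ng; apply/asboolP; exact: null_conv.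
Qed.
HB.instance Definition _ := GRing.isSubringClosed.Build pser restricted restricted_subring.

Definition rser : Type := {f : pser | f \in restricted}.
HB.instance Definition _ := SubChoice.on rser.
HB.instance Definition _ := [SubChoice_isSubComNzRing of rser by <:].

Definition rcoef (f : rser) : nat -> B := val f.
Lemma rcoef_null f : null (rcoef f).
Proof. by apply/asboolP; exact: (valP f). Qed.

Definition mk_rser (f : nat -> B) (nf : null f) : rser :=
  exist (fun f : pser => f \in restricted) f (asboolT nf).
Lemma rcoef_mk f (nf : null f) : rcoef (mk_rser nf) = f. Proof. by []. Qed.

Lemma rser_inj f g : rcoef f =1 rcoef g -> f = g.
Proof. by move=> E; apply: val_inj; apply/funext. Qed.

Lemma rcoefD f g n : rcoef (f + g) n = rcoef f n + rcoef g n. Proof. by []. Qed.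
Lemma rcoefB f g n : rcoef (f - g) n = rcoef f n - rcoef g n. Proof. by []. Qed.
Lemma rcoef0 n : rcoef 0 n = 0. Proof. by []. Qed.
Lemma rcoef1 n : rcoef 1 n = (n == 0%N)%:R. Proof. by []. Qed.
Lemma rcoefM f g n : rcoef (f * g) n = \sum_(i < n.+1) rcoef f i * rcoef g (n - i)%N.
Proof. exact: pserME. Qed.

Lemma mono_null (c : B) a : null (fun n => if n == a then c else 0).
Proof. by apply: (@null_fin _ _ _ a.+1) => j aj; rewrite gtn_eqF. Qed.
Definition rmono (c : B) a : rser := mk_rser (mono_null c a).
Lemma rmonoE c a n : rcoef (rmono c a) n = if n == a then c else 0. Proof. by []. Qed.

Lemma rcoef_rmonoM c a f n :
  rcoef (rmono c a * f) n = if (a <= n)%N then c * rcoef f (n - a)%N else 0.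
Proof.
have := mono_mulE (al := idm) c a (val f) n.
by rewrite itm_id.
Qed.

Definition rstr (r : R) : rser := rmono (str B r) 0.
Fact rstr_zmod : zmod_morphism rstr.
Proof.
move=> x y; apply: rser_inj => n; rewrite rcoefB !rmonoE.
by case: eqP => _; rewrite ?subrr // rmorphB.
Qed.
Fact rstr_mon : monoid_morphism rstr.
Proof.
split=> [|x y]; apply: rser_inj => n.
  by rewrite rcoef1 rmonoE rmorph1; case: eqP.
rewrite rcoef_rmonoM subn0 !rmonoE; case: eqP => _; last by rewrite mulr0.
exact: rmorphM.
Qed.
HB.instance Definition _ := GRing.isZmodMorphism.Build R rser rstr rstr_zmod.
HB.instance Definition _ := GRing.isMonoidMorphism.Build R rser rstr rstr_mon.

Lemma rcoef_strM r f n : rcoef (rstr r * f) n = str B r * rcoef f n.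
Proof. by rewrite rcoef_rmonoM subn0. Qed.

Lemma rcoef_piM k f n : rcoef (rstr pi ^+ k * f) n = str B pi ^+ k * rcoef f n.
Proof.
have -> : rstr pi ^+ k = rstr (pi ^+ k) by rewrite rmorphXn.
by rewrite rcoef_strM rmorphXn.
Qed.

Fact rser_complete : pi_adically_complete (rstr pi).
Proof.
split=> [f fP|u /choice[y yP]].
  apply: rser_inj => n; rewrite rcoef0; apply: dvpi_sep => e.
  by have [g ->] := fP e; rewrite rcoef_piM; exact: dvpi_pi.
(* The limit minus u_m will be pi^m times the series whose n-th coefficient is the sum of [w m n k]
   over k. That series is null in n: modulo pi^N only the terms k < N count, and each of them is
   null. *)
pose w m n k := str B pi ^+ k * rcoef (y (m + k)%N) n.
have nw m n : null (w m n) by move=> N; exists N => j Nj; apply: dvpi_le Nj (dvpi_pi _ _).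
pose Y m n := nsum (w m n).
have nY m : null (Y m).
  move=> N.
  have /choice[J JP] : forall k, exists J, forall j, (J <= j)%N -> dvpi N (w m j k).
    by move=> k; have [J JP] := rcoef_null (y (m + k)%N) N; exists J => j /JP; exact: dvpi_mul.
  exists (\sum_(k < N) J k) => j Jj; apply: nsum_dvpi => // k.
  case: (leqP N k) => [Nk|kN]; first exact: dvpi_le Nk (dvpi_pi _ _).
  apply: JP; apply: leq_trans Jj; rewrite (bigD1 (Ordinal kN)) //=; exact: leq_addr.
have YE m n : Y m n = rcoef (y m) n + str B pi * Y m.+1 n.
  rewrite {1}/Y (nsum_recl (nw m n)) {1}/w mul1r addn0 -nsumMl //; congr (_ + nsum _).
  by apply/funext => k; rewrite /w exprS mulrA addnS.
exists (u 0%N + mk_rser (nY 0%N)) => m; exists (mk_rser (nY m)).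
apply: rser_inj => n; rewrite rcoef_piM rcoefB rcoefD !rcoef_mk.
elim: m => [|m IH]; first by rewrite mul1r addrC addKr.
have : rcoef (u m.+1 - u m) n = str B pi ^+ m * rcoef (y m) n by rewrite yP rcoef_piM.
rewrite rcoefB => /eqP; rewrite subr_eq => /eqP ->.
rewrite opprD addrA addrAC IH YE mulrDr addrC addKr exprSr mulrA //.
Qed.

Definition rcalg : calg S := @CAlg S rser rstr rser_complete.

Lemma rcoef_dvpi N (f : rcalg) n : dvpi N f -> dvpi N (rcoef f n).
Proof. by move=> [g ->]; rewrite rcoef_piM; exact: dvpi_pi. Qed.

Lemma rcoef_nsum (u : nat -> rcalg) n : null u ->
  rcoef (nsum u) n = nsum (fun j => rcoef (u j) n).
Proof.
move=> nu; symmetry; apply: (@nsum_morph S rcalg B (fun f => rcoef f n)) => //.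
by move=> e x; exact: rcoef_dvpi.
Qed.
End Restricted.

(** Modulo pi^N both series agree with their truncations at J, and the product of the truncations is
    the value at 1 of a product of polynomials. *)
Lemma nsum_conv (S : base) (C : calg S) (u v : nat -> C) : null u -> null v ->
  nsum (fun n => \sum_(i < n.+1) u i * v (n - i)%N) = nsum u * nsum v.
Proof.
move=> nu nv; apply: nsum_eq => N.
have [J1 P1] := nu N; have [J2 P2] := nv N.
have [J3 P3] := nsumP nu N; have [J4 P4] := nsumP nv N.
pose J := maxn (maxn J1 J2) (maxn J3 J4).
have JJ1 : (J1 <= J)%N by rewrite /J leq_max leq_maxl.
have JJ2 : (J2 <= J)%N by rewrite /J leq_max leq_maxr.
have JJ3 : (J3 <= J)%N by rewrite /J leq_max leq_maxl orbT.
have JJ4 : (J4 <= J)%N by rewrite /J leq_max leq_maxr orbT.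
pose f := \poly_(i < J) u i; pose g := \poly_(i < J) v i.
have ev1 (h : {poly C}) n : (size h <= n)%N -> h.[1] = \sum_(i < n) h`_i.
  by move/horner_coef_wide=> ->; apply: eq_bigr => i _; rewrite expr1n mulr1.
have fE : f.[1] = psum u J.
  rewrite (ev1 _ J) ?size_poly //; apply: eq_bigr => i _.
  by rewrite coef_poly ltn_ord.
have gE : g.[1] = psum v J.
  rewrite (ev1 _ J) ?size_poly //; apply: eq_bigr => i _.
  by rewrite coef_poly ltn_ord.
exists (J + J)%N => j Jj.
have fgE : psum u J * psum v J = \sum_(n < j) (f * g)`_n.
  rewrite -fE -gE -hornerM; apply: ev1; apply: leq_trans Jj.
  apply: leq_trans (size_polyMleq _ _) _; rewrite -ltnS.
  apply: leq_ltn_trans (leq_pred _) _; rewrite ltnS.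
  by apply: leq_add; exact: size_poly.
have -> : nsum u * nsum v - psum (fun n => \sum_(i < n.+1) u i * v (n - i)%N) j =
  (nsum u - psum u J) * nsum v + psum u J * (nsum v - psum v J) -
  \sum_(n < j) (\sum_(i < n.+1) u i * v (n - i)%N - (f * g)`_n).
  by rewrite sumrB -fgE /psum; ring.
apply: dvpi_sub; first apply: dvpi_add.
- by apply: dvpi_mulr; exact: P3.
- by apply: dvpi_mul; exact: P4.
apply: dvpi_sum => n; rewrite coefM -sumrB; apply: dvpi_sum => i.
rewrite !coef_poly; case: ltnP => iJ; last first.
  by rewrite mul0r subr0; apply: dvpi_mulr; apply: P1; exact: leq_trans iJ.
case: ltnP => niJ; first by rewrite subrr; exact: dvpi0.
by rewrite mulr0 subr0; apply: dvpi_mul; apply: P2; exact: leq_trans niJ.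
Qed.

Section Evaluation.
Variables (S : base) (C : calg S) (c : C).
Local Notation R := (base_ring S).
Local Notation Rt := (rcalg (base_calg S)).

Lemma null_str (u : nat -> base_calg S) : null u -> null (fun n => str C (u n)).
Proof.
move=> nu N; have [J JP] := nu N; exists J => j /JP [y ->].
by exists (str C y); rewrite rmorphM rmorphXn.
Qed.

Lemma null_ev (u : nat -> base_calg S) (v : nat -> C) : null u -> null (fun n => str C (u n) * v n).
Proof.
move=> /null_str nu N; have [J JP] := nu N; exists J => j /JP; exact: dvpi_mulr.
Qed.

Definition reval (f : Rt) : C := nsum (fun n => str C (rcoef f n) * c ^+ n).

Fact reval_zmod : zmod_morphism reval.
Proof.
move=> f g; rewrite /reval; have nf := null_ev (fun n => c ^+ n) (rcoef_null f).
have ng := null_ev (fun n => c ^+ n) (rcoef_null g).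
rewrite -[X in _ = _ + X]mulN1r -nsumMl // -nsumD //; last exact: null_mull.
congr nsum; apply/funext => n.
by rewrite rcoefB rmorphB mulN1r mulrBl.
Qed.
Fact reval_mon : monoid_morphism reval.
Proof.
split=> [|f g].
  rewrite /reval (@nsum_fin _ _ _ 1) ?big_ord1 ?rcoef1 ?rmorph1 ?mul1r // => -[//|j] _.
  by rewrite rcoef1 rmorph0 mul0r.
have nf := null_ev (fun n => c ^+ n) (rcoef_null f).
have ng := null_ev (fun n => c ^+ n) (rcoef_null g).
rewrite /reval -nsum_conv //; congr nsum; apply/funext => n.
rewrite rcoefM rmorph_sum mulr_suml; apply: eq_bigr => i _.
by rewrite rmorphM mulrACA -exprD subnKC // -ltnS.
Qed.
HB.instance Definition _ := GRing.isZmodMorphism.Build Rt C reval reval_zmod.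
HB.instance Definition _ := GRing.isMonoidMorphism.Build Rt C reval reval_mon.
Fact reval_str r : reval (str Rt r) = str C r.
Proof.
rewrite /reval (@nsum_fin _ _ _ 1) ?big_ord1 /= ?rmonoE ?mulr1 // => -[//|j] _.
by rewrite rmonoE rmorph0 mul0r.
Qed.
(** Restricted series converge at every element, so every c is the image of the universal element
    [tvar]. A natural operation is thus determined by its value at [tvar]. *)
Definition eval_hom : chom Rt C := @CHom S Rt C reval reval_str.

Definition tvar : Rt := rmono (1 : base_calg S) 1.
Lemma eval_tvar : eval_hom tvar = c.
Proof.
rewrite /= /reval (@nsum_fin _ _ _ 2) ?big_ord_recl ?big_ord0 /= ?rmonoE.
  by rewrite rmorph0 mul0r rmorph1 mul1r addr0 add0r.
by move=> [//|[//|j]] _; rewrite rmonoE rmorph0 mul0r.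
Qed.
End Evaluation.

(** With q = p^a, the coefficient of X^q in (1 + X)^(q m) = (1 + X^q)^m is m, which is prime to
    p. *)
Lemma bin_pchar_neq0 (R : idomainType) p a m : p \in [pchar R] -> ~~ (p %| m)%N -> (1 < m)%N ->
  'C(p ^ a * m, p ^ a)%:R != 0 :> R.
Proof.
move=> chR pm m1; have p_pr := pcharf_prime chR; set q := (p ^ a)%N.
have q0 : (0 < q)%N by rewrite expn_gt0 prime_gt0.
have -> : 'C(q * m, q)%:R = ((1 + 'X) ^+ (q * m) : {poly R})`_q.
  have qm : (q < (q * m).+1)%N by rewrite ltnS leq_pmulr // ltnW.
  rewrite exprDn coef_sum (bigD1 (Ordinal qm)) //= big1 ?addr0.
    by rewrite expr1n mul1r coefMn coefXn eqxx.
  by move=> i /negbTE; rewrite -val_eqE /= expr1n mul1r coefMn coefXn eq_sym => ->; rewrite mul0rn.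
rewrite exprM exprDn_pchar; last by rewrite pnatX (eq_pnat _ (pchar_poly R)) pnatE ?chR.
rewrite expr1n exprDn coef_sum.
have m1' : (1 < m.+1)%N by exact: ltnW.
rewrite (bigD1 (Ordinal m1')) //= big1 ?addr0.
  by rewrite expr1n mul1r expr1 coefMn coefXn eqxx bin1 -(dvdn_pcharf chR).
move=> i /negbTE; rewrite -val_eqE /= expr1n mul1r -exprM coefMn coefXn => i1.
by rewrite -{1}(muln1 q) eqn_pmul2l // eq_sym i1 mul0rn.
Qed.

(** * Additive natural operations *)

Section Act.
Variables (S : base) (p : nat).
Local Notation R := (base_ring S).
Local Notation pi := (ppi S).
Local Notation bR := (base_calg S).
Hypothesis chR : p \in [pchar R].

Let p_pr : prime p. Proof. exact: pcharf_prime chR. Qed.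
Let p_gt1 : (1 < p)%N. Proof. exact: prime_gt1. Qed.

Lemma calg_pchar (B : calg S) : p \in [pchar B].
Proof. by rewrite inE p_pr /= -(rmorph_nat (str B)) (pcharf0 chR) rmorph0. Qed.

Lemma ppow_pchar (B : calg S) j : [pchar B].-nat (p ^ j)%N.
Proof. by rewrite pnatX (pnatE _ p_pr) calg_pchar. Qed.

Lemma ppowD (B : calg S) j (x y : B) : (x + y) ^+ (p ^ j) = x ^+ (p ^ j) + y ^+ (p ^ j).
Proof. exact/exprDn_pchar/ppow_pchar. Qed.

Lemma ppowN (B : calg S) j (x : B) : (- x) ^+ (p ^ j) = - x ^+ (p ^ j).
Proof.
apply/eqP; rewrite -addr_eq0 -ppowD addNr expr0n expn_eq0.
by rewrite eqn0Ngt prime_gt0.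
Qed.

Lemma ppow_gt0 j : (0 < p ^ j)%N. Proof. by rewrite expn_gt0 prime_gt0. Qed.

(** The action on B of the twisted series sum c_j tau^j, with tau acting as the p-th power. *)
Definition act (c : nat -> bR) (B : calg S) (b : B) : B :=
  nsum (fun j => str B (c j) * b ^+ (p ^ j)).

Lemma actD c (B : calg S) (x y : B) : null c -> act c (x + y) = act c x + act c y.
Proof.
move=> nc; rewrite /act -nsumD; [|exact: null_ev|exact: null_ev].
by congr nsum; apply/funext => j; rewrite ppowD mulrDr.
Qed.

Lemma act0 c (B : calg S) : null c -> act c (0 : B) = 0.
Proof. by move=> nc; apply: (addrI (act c (0 : B))); rewrite -actD // !addr0. Qed.

Lemma act_sum c (B : calg S) (I : Type) (r : seq I) P (F : I -> B) : null c ->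
  act c (\sum_(i <- r | P i) F i) = \sum_(i <- r | P i) act c (F i).
Proof.
move=> nc; apply: (big_morph (fun b : B => act c b)); last exact: act0.
by move=> x y; apply: actD.
Qed.

Lemma act_hom c (B C : calg S) (h : chom B C) (b : B) : null c -> act c (h b) = h (act c b).
Proof.
move=> nc; rewrite /act -(@nsum_morph S B C h); last exact: null_ev.
- by congr nsum; apply/funext => j; rewrite rmorphM rmorphXn chom_str.
- exact: rmorphB.
- exact: dvpi_hom.
Qed.

Definition nat_op (u : forall B : calg S, B -> B) : Prop :=
  (forall (B C : calg S) (h : chom B C) b, u C (h b) = h (u B b)) /\
  (forall (B : calg S) (x y : B), u B (x + y) = u B x + u B y).

Local Notation B1 := (rcalg bR).
Local Notation B2 := (rcalg B1).
Local Notation t1 := (rmono (1 : bR) 1 : B1).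
Local Notation t2 := (rmono t1 0 : B2).
Local Notation s2 := (rmono (1 : B1) 1 : B2).

Lemma rmonoX (B : calg S) (c : B) a n : (rmono c a : rcalg B) ^+ n = rmono (c ^+ n) (a * n)%N.
Proof.
elim: n => [|n IH].
  by rewrite muln0; apply: rser_inj => k; rewrite rcoef1 rmonoE; case: eqP.
apply: rser_inj => k; rewrite exprS IH rcoef_rmonoM !rmonoE mulnS exprS.
case: leqP => [ak|ka]; last by rewrite ltn_eqF // ltn_addr.
by rewrite -(eqn_add2l a) subnKC //; case: eqP => // _; rewrite mulr0.
Qed.

Lemma rcoef_mulrn (B : calg S) (f : rcalg B) n k : rcoef (f *+ n) k = rcoef f k *+ n.
Proof. by elim: n => [|n IH]; rewrite ?mulr0n ?rcoef0 // !mulrS rcoefD IH. Qed.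

Lemma rcoef_sum (B : calg S) (I : Type) (r : seq I) P (F : I -> rcalg B) k :
  rcoef (\sum_(i <- r | P i) F i) k = \sum_(i <- r | P i) rcoef (F i) k.
Proof. by elim/big_rec2: _ => // i x y _ <-. Qed.

(** [B2] is R<t><s> with variables [t2] and [s2]; here i is the exponent of s and m that of t. *)
Lemma coef_t2s2 n i m : rcoef (rcoef ((t2 + s2) ^+ n) i) m =
  (if n == (m + i)%N then 'C(n, i)%:R else 0).
Proof.
rewrite exprDn rcoef_sum rcoef_sum.
have E (j : 'I_n.+1) : rcoef (rcoef (t2 ^+ (n - j) * s2 ^+ j *+ 'C(n, j)) i) m =
    if (i == j) && (m == n - j)%N then 'C(n, j)%:R else 0.
  rewrite !rcoef_mulrn !rmonoX mul0n !mul1n rcoef_rmonoM subn0 rmonoE !expr1n.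
  case: eqP => _ /=; last by rewrite mulr0 rcoef0 mul0rn.
  by rewrite mulr1 rmonoE; case: eqP => _; rewrite // mul0rn.
rewrite (eq_bigr _ (fun j _ => E j)) -big_mkcond /=; case: eqP => [nmi|nmi].
  have ii : (i < n.+1)%N by rewrite ltnS nmi leq_addl.
  rewrite (big_pred1 (Ordinal ii)) // => j /=; rewrite -val_eqE /= [RHS]eq_sym.
  by case: eqP => //= <-; rewrite nmi addnK eqxx.
apply: big_pred0 => j; apply/negP => /andP[/eqP ij /eqP mj]; apply: nmi.
by rewrite mj ij subnK // -ltnS.
Qed.

Lemma rcoef_ev2 (f : B1) (x : B2) i m :
  rcoef (rcoef (reval x f) i) m = nsum (fun n => rcoef f n * rcoef (rcoef (x ^+ n) i) m).
Proof.
rewrite /reval rcoef_nsum; last exact/null_ev/rcoef_null.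
rewrite rcoef_nsum; last first.
  apply: (@null_morph S B2 B1 (fun f => rcoef f i)) => [e y|]; first exact: rcoef_dvpi.
  exact/null_ev/rcoef_null.
by congr nsum; apply/funext => n; rewrite /= rcoef_strM /= rcoef_strM.
Qed.

Lemma nsum_sparse (B : calg S) (u : nat -> B) : null u ->
  (forall n, (forall j, n != p ^ j)%N -> u n = 0) -> nsum u = nsum (fun j => u (p ^ j)%N).
Proof.
move=> nu u0; symmetry; apply: nsum_eq => N; have [J JP] := nsumP nu N.
exists J => j Jj; have jp : (j <= p ^ j)%N by apply: ltnW; exact: ltn_expl.
suff -> : psum (fun j => u (p ^ j)%N) j = psum u (p ^ j) by exact: JP (leq_trans Jj jp).
elim: j {Jj jp} => [|j IH].
  rewrite /psum big_ord0 expn0 big_ord1 u0 // => j.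
  by apply/eqP => j0; have := ppow_gt0 j; rewrite -j0.
have jS : (p ^ j < p ^ j.+1)%N by rewrite ltn_exp2l.
rewrite /psum big_ord_recr -/(psum (fun j => u (p ^ j)%N) j) IH /psum -!(big_mkord xpredT u).
rewrite (big_cat_nat (leq0n _) (ltnW jS)) /= (big_ltn jS); congr (_ + _).
rewrite big_nat_cond big1 ?addr0 // => n; rewrite andbT => /andP[jn nj]; apply: u0 => i.
apply/eqP => ni; move: jn nj; rewrite ni !ltn_exp2l // ltnS => ji.
by rewrite leqNgt ji.
Qed.

(* An operation is determined by its value at t in R<t>, a restricted series in
   t; additivity kills the coefficients of all t^n with n not a power of p. *)
Lemma op_series (u : forall B : calg S, B -> B) : nat_op u ->
  exists c : nat -> bR, null c /\ forall (B : calg S) (b : B), u B b = act c b.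
Proof.
move=> [u_nat uD]; pose P := u B1 t1.
have uE (B : calg S) (b : B) : u B b = reval b P.
  by rewrite -[in LHS](eval_tvar b) u_nat.
have nP := rcoef_null P.
have additive_coef i m : (0 < i)%N -> (0 < m)%N -> rcoef P (m + i) *+ 'C(m + i, i) = 0.
  move=> i0 m0; have D2 (x y : B2) : rcoef (rcoef (x + y) i) m = rcoef (rcoef x i) m + rcoef (rcoef y i) m.
    by rewrite (congr1 (fun f : B1 => rcoef f m) (rcoefD x y i)) (rcoefD (rcoef x i) (rcoef y i)).
  have : reval (t2 + s2) P = reval t2 P + reval s2 P by rewrite -!uE; exact: uD.
  move=> /(congr1 (fun x : B2 => rcoef (rcoef x i) m)) /= uts.
  have := etrans (esym (rcoef_ev2 P (t2 + s2) i m)) (etrans uts (etrans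
    (D2 (reval t2 P) (reval s2 P)) (congr2 +%R (rcoef_ev2 P t2 i m) (rcoef_ev2 P s2 i m)))).
  rewrite (@nsum_fin _ _ _ (m + i).+1) => [|j mj]; last first.
    by rewrite coef_t2s2 gtn_eqF // mulr0.
  rewrite big_ord_recr big1 /= => [|j _]; last by rewrite coef_t2s2 ltn_eqF // mulr0.
  rewrite add0r coef_t2s2 eqxx mulr_natr => ->.
  rewrite (@nsum_fin _ _ _ 0) ?big_ord0 => [|j _]; last first.
    by rewrite rmonoX mul0n rmonoE gtn_eqF // rcoef0 mulr0.
  rewrite (@nsum_fin _ _ _ 0) ?big_ord0 ?addr0 // => j _.
  by rewrite rmonoX mul1n rmonoE expr1n; case: eqP => _; rewrite ?rcoef0 ?rcoef1 ?gtn_eqF ?mulr0.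
have P0 : rcoef P 0 = 0.
  have u0 : u bR 0 = 0 by apply: (addrI (u bR 0)); rewrite -uD !addr0.
  have := uE bR 0; rewrite u0 /reval (@nsum_fin _ _ _ 1) => [|[//|j] _].
    by rewrite big_ord1 expr0 mulr1 /= => /esym.
  by rewrite expr0n mulr0.
have Psupp n : (forall j, n != p ^ j)%N -> rcoef P n = 0.
  have [-> //|n0] := posnP n; move=> np.
  (* As n is not a power of p, its prime-to-p part m exceeds 1. In the additivity identity the
     coefficient of s^(p^a) t^(n - p^a) is P_n times a binomial coefficient that is nonzero in R. *)
  have nE : n = (p ^ logn p n * n`_p^')%N by rewrite -p_part partnC.
  set m := (n`_p^')%N in nE; set a := logn p n in nE.
  have pm : ~~ (p %| m)%N.
    by rewrite -prime_coprime // (pnat_coprime (pi := p)) ?pnat_id // part_pnat.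
  have m1 : (1 < m)%N.
    rewrite ltn_neqAle part_gt0 andbT eq_sym; apply/eqP => m1.
    by have := np a; rewrite {1}nE m1 muln1 eqxx.
  have q0 := ppow_gt0 a.
  have an : (p ^ a < n)%N by rewrite nE -{1}(muln1 (p ^ a)%N) ltn_pmul2l.
  have := @additive_coef (p ^ a)%N (n - p ^ a)%N q0; rewrite subn_gt0 an subnK 1?ltnW // => /(_ isT).
  move/eqP; rewrite -mulr_natr mulf_eq0 => /orP[/eqP //|].
  by rewrite {1}nE (negbTE (bin_pchar_neq0 a chR pm m1)).
have nc : null (fun j => rcoef P (p ^ j)).
  move=> N; have [J JP] := nP N; exists J => j Jj; apply: JP.
  by apply: leq_trans Jj _; apply: ltnW; exact: ltn_expl.
exists (fun j => rcoef P (p ^ j)); split=> // B b.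
rewrite uE /reval nsum_sparse //; first exact: null_ev.
by move=> n /Psupp->; rewrite rmorph0 mul0r.
Qed.

Lemma rcoef_act_t1 c n : null c -> rcoef (act c t1) n =
  if n == (p ^ logn p n)%N then c (logn p n) else 0.
Proof.
move=> nc; rewrite /act rcoef_nsum; last exact: null_ev.
have E j : rcoef (str B1 (c j) * t1 ^+ (p ^ j)) n = if n == (p ^ j)%N then c j else 0.
  rewrite rcoef_strM rmonoX expr1n mul1n rmonoE.
  by case: eqP => _; rewrite ?mulr1 ?mulr0.
have -> : (fun j => rcoef (str B1 (c j) * t1 ^+ (p ^ j)) n) =
  (fun j => if n == (p ^ j)%N then c j else 0) by apply/funext => j; exact: E.
case: eqP => [nE|nE].
  rewrite (@nsum_fin _ _ _ (logn p n).+1) => [|j nj].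
    rewrite big_ord_recr /= -nE eqxx big1 ?add0r // => j _.
    by case: eqP => // E'; have := ltn_ord j; rewrite {2}E' pfactorK // ltnn.
  by case: eqP => // E'; move: nj; rewrite {1}E' pfactorK // ltnn.
rewrite (@nsum_fin _ _ _ 0) ?big_ord0 // => j _.
by case: eqP => // E'; case: nE; rewrite {2}E' pfactorK.
Qed.

(** Applied to the variable t of R<t>, the operation gives c_j back as the coefficient of t^(p^j).
    Identities between series are obtained in this way from identities between operations. *)
Lemma act_inj c c' : null c -> null c' ->
  (forall (B : calg S) (b : B), act c b = act c' b) -> c = c'.
Proof.
move=> nc nc' E; apply/funext => j.
have H d : null d -> rcoef (act d t1) (p ^ j) = d j.
  by move=> nd; have := rcoef_act_t1 (p ^ j) nd; rewrite pfactorK // eqxx.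
exact: etrans (esym (H c nc)) (etrans (congr1 (fun x : B1 => rcoef x (p ^ j)) (E B1 t1)) (H c' nc')).
Qed.

Lemma act_add c c' (B : calg S) (b : B) : null c -> null c' ->
  act (fun j => c j + c' j) b = act c b + act c' b.
Proof.
move=> nc nc'; rewrite /act -nsumD; [|exact: null_ev|exact: null_ev].
by congr nsum; apply/funext => j; rewrite rmorphD mulrDl.
Qed.

Lemma act_mono (r : R) a (B : calg S) (b : B) :
  act (fun n => if n == a then r else 0) b = str B r * b ^+ (p ^ a).
Proof.
rewrite /act (@nsum_fin _ _ _ a.+1) => [|j aj]; last by rewrite gtn_eqF // rmorph0 mul0r.
rewrite big_ord_recr /= eqxx big1 ?add0r // => j _.
by rewrite ltn_eqF // rmorph0 mul0r.
Qed.
End Act.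

Definition frob (F : comNzRingType) (p : nat) (chF : p \in [pchar F]) : {rmorphism F -> F} :=
  pFrobenius_aut chF.

Lemma itm_frob (F : comNzRingType) (p : nat) (chF : p \in [pchar F]) i x :
  itm (frob chF) i x = x ^+ (p ^ i).
Proof.
elim: i => [|i IH]; first by rewrite expr1.
by rewrite itmS IH /frob /= pFrobenius_autE -exprM expnSr.
Qed.

Section ActRing.
Variables (S : base) (p : nat).
Local Notation R := (base_ring S).
Local Notation pi := (ppi S).
Local Notation bR := (base_calg S).
Hypothesis chR : p \in [pchar R].
Local Notation Fr := (frob chR).
Local Notation RT := (tps Fr).
Local Notation B1 := (rcalg bR).
Local Notation t1 := (rmono (1 : bR) 1 : B1).

Let p_pr : prime p. Proof. exact: pcharf_prime chR. Qed.
Let p_gt1 : (1 < p)%N. Proof. exact: prime_gt1. Qed.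

Lemma nullM (f g : RT) : @null S bR f -> @null S bR g -> @null S bR (f * g).
Proof.
move=> nf ng N; have [J JP] := nf N; have [I IP] := ng N; exists (I + J)%N => n IJ.
rewrite tpsME; apply: (@dvpi_sum S bR) => i; case: (leqP J i) => [/JP|iJ].
  exact: dvpi_mulr.
apply: (@dvpi_mul S bR); rewrite itm_frob.
apply: (@dvpi_exp S bR); first exact: ppow_gt0 chR _.
apply: IP; rewrite leq_subRL; last by rewrite -ltnS.
by apply: leq_trans IJ; rewrite addnC leq_add2l ltnW.
Qed.

Lemma act_ppow c (B : calg S) (b : B) j : @null S bR c ->
  act p c b ^+ (p ^ j) = nsum (fun i => (str B (c i) * b ^+ (p ^ i)) ^+ (p ^ j)).
Proof.
move=> nc; symmetry; apply: (@nsum_morph S B B (fun x => x ^+ (p ^ j))).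
- by move=> x y; rewrite (ppowD chR) (ppowN chR).
- by move=> e x; apply: dvpi_exp; exact: ppow_gt0 chR _.
- exact: null_ev.
Qed.

(** The composite is an additive natural operation, hence given by a series by [op_series]. Only its
    coefficients at t^(p^n) in R<t> have to be computed, and no double series is rearranged in a
    general B. *)
Lemma act_mul (c c' : RT) (B : calg S) (b : B) : @null S bR c -> @null S bR c' ->
  act p c (act p c' b) = act p (c * c') b.
Proof.
move=> nc nc'; have [|d [nd dE]] := @op_series S p chR (fun B b => act p c (act p c' b)).
- split=> [A C h x|A x y]; first by rewrite !act_hom.
  by rewrite !(actD chR).
rewrite dE; congr (act p _ b); apply/funext => n.
have cf1 d' : @null S bR d' -> rcoef (act p d' t1) (p ^ n) = d' n.
  by move=> nd'; have := rcoef_act_t1 chR (p ^ n) nd'; rewrite pfactorK // eqxx.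
rewrite -(cf1 d nd); etransitivity.
  exact: (congr1 (fun x : B1 => rcoef x (p ^ n)) (esym (dE B1 t1))).
rewrite /= {1}/act rcoef_nsum; last exact: null_ev.
have E j : rcoef (str B1 (c j) * act p c' t1 ^+ (p ^ j)) (p ^ n) =
    if (j <= n)%N then c j * itm Fr j (c' (n - j)%N) else 0.
  rewrite rcoef_strM act_ppow // rcoef_nsum; last first.
    apply: (@null_morph S B1 B1 (fun x => x ^+ (p ^ j))) => [e x|]; last exact: null_ev.
    by apply: dvpi_exp; exact: ppow_gt0 chR _.
  have E' i : rcoef ((str B1 (c' i) * t1 ^+ (p ^ i)) ^+ (p ^ j)) (p ^ n) =
      if n == (i + j)%N then c' i ^+ (p ^ j) else 0.
    rewrite exprMn -rmorphXn rcoef_strM !rmonoX !expr1n mul1n -expnD rmonoE.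
    rewrite eqn_exp2l //; case: eqP => _; rewrite ?mulr1 ?mulr0 //.
  rewrite (_ : (fun i => _) = (fun i => if n == (i + j)%N then c' i ^+ (p ^ j) else 0)); last first.
    by apply/funext => i; exact: E'.
  rewrite itm_frob; case: leqP => jn; last first.
    rewrite (@nsum_fin _ _ _ 0) ?big_ord0 ?mulr0 // => i _.
    by rewrite ltn_eqF // ltn_addl.
  rewrite (@nsum_fin _ _ _ (n - j).+1) => [|i ni].
    rewrite big_ord_recr /= subnK // eqxx big1 ?add0r // => i _.
    by rewrite gtn_eqF // -[X in (_ < X)%N](subnK jn) ltn_add2r.
  by rewrite ltn_eqF // -(subnK jn) ltn_add2r.
rewrite (_ : (fun j => _) = (fun j => if (j <= n)%N then c j * itm Fr j (c' (n - j)%N) else 0)); last first.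
  by apply/funext => j; exact: E.
rewrite (@nsum_fin _ _ _ n.+1) => [|j nj]; last by rewrite leqNgt nj.
by rewrite tpsME; apply: eq_bigr => i _; rewrite -ltnS ltn_ord.
Qed.

Lemma null_add (f g : RT) : @null S bR f -> @null S bR g -> @null S bR (f + g).
Proof. exact: nullD. Qed.
Lemma null_zero : @null S bR (0 : RT).
Proof. by apply: (@null_fin S bR _ 0) => j _. Qed.
Lemma null_sum (I : Type) (r : seq I) (P : pred I) (F : I -> RT) :
  (forall i, P i -> @null S bR (F i)) -> @null S bR (\sum_(i <- r | P i) F i).
Proof. by move=> H; apply: (big_ind (@null S bR)) => //; [exact: null_zero | exact: null_add]. Qed.
Lemma null_mono (r : R) a : @null S bR (mono Fr r a).
Proof. by apply: (@null_fin S bR _ a.+1) => j aj; rewrite monoE gtn_eqF. Qed.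

Lemma act_plus (f g : RT) (B : calg S) (b : B) : @null S bR f -> @null S bR g ->
  act p (f + g) b = act p f b + act p g b.
Proof. exact: act_add. Qed.
Lemma act_zero (B : calg S) (b : B) : act p (0 : RT) b = 0.
Proof. by rewrite /act (@nsum_fin _ _ _ 0) ?big_ord0 // => j _; rewrite rmorph0 mul0r. Qed.
Lemma act_bigsum (I : Type) (r : seq I) (P : pred I) (F : I -> RT) (B : calg S) (b : B) :
  (forall i, P i -> @null S bR (F i)) ->
  act p (\sum_(i <- r | P i) F i) b = \sum_(i <- r | P i) act p (F i) b.
Proof.
move=> H; suff [] : @null S bR (\sum_(i <- r | P i) F i) /\
  act p (\sum_(i <- r | P i) F i) b = \sum_(i <- r | P i) act p (F i) b by [].
apply: (big_rec2 (fun f x => @null S bR f /\ act p f b = x)).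
  by split; [exact: null_zero | exact: act_zero].
move=> i x f Pi [nf fE]; split; first by apply: null_add => //; exact: H.
by rewrite act_plus ?fE //; exact: H.
Qed.
Lemma act_monoE (r : R) a (B : calg S) (b : B) : act p (mono Fr r a) b = str B r * b ^+ (p ^ a).
Proof. exact: act_mono. Qed.

Lemma itm_phi_pi i : itm (phi S) i pi = pi.
Proof. by elim: i => // i IH; rewrite itmS IH phi_ppi. Qed.

Lemma twi_complete i (B : calg S) : pi_adically_complete ((str B \o itm (phi S) i) pi).
Proof. by rewrite /= itm_phi_pi; exact: calg_complete. Qed.
(** The natural target of the i-th ghost component: w_i sends the image of r in W_n(B) to the image
    of phi^i(r), so it is a morphism of R-algebras only for this structure. *)
Definition twi i (B : calg S) : calg S := @CAlg S B (str B \o itm (phi S) i) (twi_complete i B).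

Lemma dvpi_twi i (B : calg S) N (x : B) : @dvpi S (twi i B) N x <-> dvpi N x.
Proof. by rewrite /dvpi /= itm_phi_pi. Qed.

Lemma nsum_twi i (B : calg S) (u : nat -> B) : null u -> @nsum S (twi i B) u = nsum u.
Proof.
move=> nu; apply: nsum_eq => N; have [J JP] := nsumP nu N; exists J => j /JP.
by move/dvpi_twi; exact.
Qed.

Lemma null_phi i (c : nat -> bR) : null c -> @null S bR (fun n => itm (phi S) i (c n)).
Proof.
move=> nc N; have [J JP] := nc N; exists J => j /JP [y ->].
by exists (itm (phi S) i y); rewrite rmorphM rmorphXn /= itm_phi_pi.
Qed.

Lemma act_twi i (B : calg S) c (b : B) : null c ->
  @act S p c (twi i B) b = act p (fun n => itm (phi S) i (c n)) b.
Proof.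
move=> nc; rewrite /act nsum_twi //=.
by apply: null_ev; exact: null_phi.
Qed.

Lemma act_twist (B : calg S) c (b : B) : null c ->
  @act S p c (twist B) b = act p (fun n => phi S (c n)) b.
Proof.
move=> nc; have nu := null_ev (fun j => b ^+ (p ^ j)) (null_phi 1 nc).
rewrite /act; apply: nsum_eq => N; have [J JP] := nsumP nu N; exists J => j /JP.
by rewrite /dvpi /= phi_ppi; exact.
Qed.
End ActRing.

(** * Additive characters of jet spaces *)

Section GhostHom.
Variables (S : base) (n i : nat) (ni : (i <= n)%N) (B : calg S).

Definition gmap of (i <= n)%N := fun x : witt n B => (ghost (wc x) i : twi i B).
Local Notation gm := (gmap ni).

Fact gmap_zmod : zmod_morphism gm.
Proof.
move=> x y; rewrite /gmap /ghost -sumrB; apply: eq_bigr => h _.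
by rewrite wcD wcN qpowD qpowN -mulrBr.
Qed.
Fact gmap_mon : monoid_morphism gm.
Proof.
split=> [|x y]; rewrite /gmap.
  rewrite -[RHS](@ghost_wone S B 0 i) /ghost; apply: eq_bigr => h _.
  by rewrite wc_mkw // (leq_trans _ ni) // -ltnS.
transitivity (ghost (wmul (wc x) (wc y)) i); last exact: (@ghost_wmul S B (wc x) (wc y) i).
apply: eq_bigr => h _.
by rewrite wcM // (leq_trans _ ni) // -ltnS.
Qed.
HB.instance Definition _ := GRing.isZmodMorphism.Build (witt n B) (twi i B) gm gmap_zmod.
HB.instance Definition _ := GRing.isMonoidMorphism.Build (witt n B) (twi i B) gm gmap_mon.
Fact gmap_str r : gm (str (witt_calg n B) r) = str (twi i B) r.
Proof.
rewrite /gmap /= -[itm (phi S) i r]/(iter i (phi S) r) -ghost_lam.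
rewrite /ghost rmorph_sum; apply: eq_bigr => h _.
rewrite wc_str; last by rewrite (leq_trans _ ni) // -ltnS.
by rewrite /wstr rmorphM !rmorphXn.
Qed.
Definition ghost_hom : chom (witt_calg n B) (twi i B) :=
  @CHom S (witt_calg n B) (twi i B) gm gmap_str.
End GhostHom.

(** X is additively a finite product of copies of the additive group, with coordinates [xi] and
    inclusions [io]; restriction of V to each factor reduces to [op_series]. It is applied to E, to
    J^n E and to N^n. *)
Lemma gen_op_series (A : comNzRingType) (S : base) (p : nat) (chR : p \in [pchar (base_ring S)])
    (X : amod_functor A S) (J : finType)
    (xi : forall B : calg S, X B -> J -> B) (io : forall B : calg S, J -> B -> X B)
    (io_nat : forall (B C : calg S) (h : chom B C) j b, io C j (h b) = fmap X h (io B j b))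
    (ioD : forall (B : calg S) j (b b' : B), io B j (b + b') = io B j b + io B j b')
    (decomp : forall (B : calg S) (x : X B), x = \sum_j io B j (xi B x j))
    (V : forall B : calg S, X B -> B)
    (V_nat : forall (B C : calg S) (h : chom B C) x, V C (fmap X h x) = h (V B x))
    (VD : forall (B : calg S) (x y : X B), V B (x + y) = V B x + V B y) :
  exists c : J -> tps (frob chR), (forall j, @null S (base_calg S) (c j)) /\
    forall (B : calg S) x, V B x = \sum_j act p (c j) (xi B x j).
Proof.
have /choice[c cP] j : exists c : nat -> base_calg S, null c /\
    forall (B : calg S) (b : B), V B (io B j b) = act p c b.
  apply: (op_series chR (u := fun B b => V B (io B j b))); split=> [B C h b|B x y].
    by rewrite io_nat V_nat.
  by rewrite ioD VD.
exists c; split=> [j|B x]; first by have [] := cP j.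
have V0 : V B 0 = 0 by apply: (addrI (V B 0)); rewrite -VD !addr0.
rewrite [in LHS](decomp B x) (big_morph (V B) (VD B) V0); apply: eq_bigr => j _.
by have [_ ->] := cP j.
Qed.

Section Coordinates.
Variables (A : comNzRingType) (S : base) (theta : {rmorphism A -> S}).
Variables (k : finFieldType) (kA : {rmorphism k -> A}) (E : amod_functor A S) (d : nat).
Variable g : coordinates E theta kA d.
Local Notation R := (base_ring S).
Local Notation pi := (ppi S).

Lemma coord0 (B : calg S) : Defs.coord g (0 : E B) = 0.
Proof. by apply: (addrI (Defs.coord g (0 : E B))); rewrite -coordD !addr0. Qed.

Lemma coordID (B : calg S) (x y : 'rV[B]_d) : coordI g (x + y) = coordI g x + coordI g y.
Proof. by rewrite -[RHS](coordK g) coordD !coordIK. Qed.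

Lemma coord_inj (B : calg S) : injective (@Defs.coord _ _ _ _ _ _ _ g B).
Proof. exact: can_inj (@coordK _ _ _ _ _ _ _ g B). Qed.

Definition drow (B : nmodType) (j : 'I_d) (b : B) : 'rV[B]_d := \row_i (if i == j then b else 0).

Lemma drowD (B : nmodType) j (b b' : B) : drow j (b + b') = drow j b + drow j b'.
Proof. by apply/rowP => i; rewrite !mxE; case: eqP => _; rewrite ?addr0. Qed.

Lemma drow_sum (B : nmodType) (v : 'rV[B]_d) : v = \sum_j drow j (v 0 j).
Proof.
apply/rowP => i; rewrite summxE (bigD1 i) //= mxE eqxx big1 ?addr0 // => j ji.
by rewrite mxE eq_sym (negbTE ji).
Qed.

Lemma coordI_sum (B : calg S) (I : Type) (r : seq I) P (F : I -> 'rV[B]_d) :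
  coordI g (\sum_(i <- r | P i) F i) = \sum_(i <- r | P i) coordI g (F i).
Proof. exact: (big_morph _ (@coordID B) (coordI0 g B)). Qed.

Lemma E_op_series p (chR : p \in [pchar R]) (V : forall B : calg S, E B -> B)
    (V_nat : forall (B C : calg S) (h : chom B C) x, V C (fmap E h x) = h (V B x))
    (VD : forall (B : calg S) (x y : E B), V B (x + y) = V B x + V B y) :
  exists c : 'I_d -> tps (frob chR), (forall j, @null S (base_calg S) (c j)) /\
    forall (B : calg S) x, V B x = \sum_j act p (c j) (Defs.coord g x 0 j).
Proof.
apply: (@gen_op_series A S p chR E _ (fun B x j => Defs.coord g x 0 j)
  (fun B j b => coordI g (drow j b))) => // [B C h j b|B j b b'|B x].
- rewrite coordI_nat; congr coordI; apply/rowP => i; rewrite !mxE.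
  by case: eqP => _ //; rewrite rmorph0.
- by rewrite -coordID drowD.
by rewrite -coordI_sum -drow_sum coordK.
Qed.

Section Jets.
Variable n : nat.

Definition xc (B : calg S) (x : E (witt_calg n B)) (h : nat) (j : 'I_d) : B :=
  wc (Defs.coord g x 0 j : witt n B) h.

Lemma xcD (B : calg S) (x y : E (witt_calg n B)) h j : xc (x + y) h j = xc x h j + xc y h j.
Proof. by rewrite /xc coordD mxE wcD. Qed.
Lemma xc0 (B : calg S) h j : xc (0 : E (witt_calg n B)) h j = 0.
Proof. by rewrite /xc coord0 mxE wc0. Qed.
Lemma xc_sum (B : calg S) (I : Type) (r : seq I) P (F : I -> E (witt_calg n B)) h j :
  xc (\sum_(i <- r | P i) F i) h j = \sum_(i <- r | P i) xc (F i) h j.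
Proof. exact: (big_morph (fun x => xc x h j) (fun x y => xcD x y h j) (xc0 B h j)). Qed.

Lemma xc_nat (B C : calg S) (f : chom B C) (x : E (witt_calg n B)) h j : (h <= n)%N ->
  xc (fmap E (witt_map n f) x) h j = f (xc x h j).
Proof. by move=> hn; rewrite /xc coord_nat mxE; exact: wc_map. Qed.

Lemma xc_inj (B : calg S) (x y : E (witt_calg n B)) :
  (forall h j, (h <= n)%N -> xc x h j = xc y h j) -> x = y.
Proof.
move=> xy; apply: coord_inj; apply/rowP => j; apply: (@wext S n B) => h hn.
exact: xy.
Qed.

Definition iota_jet (B : calg S) (h : nat) (j : 'I_d) (b : B) : E (witt_calg n B) :=
  coordI g (drow j (mkw n (fun i => if i == h then b else 0) : witt_calg n B)).

Lemma xc_iota (B : calg S) h j (b : B) h' j' : (h' <= n)%N ->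
  xc (iota_jet h j b) h' j' = if (h' == h) && (j' == j) then b else 0.
Proof.
move=> hn; rewrite /xc /iota_jet coordIK mxE; case: (j' == j); last by rewrite andbF wc0.
by rewrite wc_mkw // andbT.
Qed.

Lemma xc_sum_iota (B : calg S) (F : nat -> 'I_d -> B) h j : (h <= n)%N ->
  xc (\sum_(h' < n.+1) \sum_j' iota_jet h' j' (F h' j')) h j = F h j.
Proof.
move=> hn; rewrite xc_sum (bigD1 (Ordinal (hn : (h < n.+1)%N))) //= xc_sum.
rewrite (bigD1 j) //= xc_iota // !eqxx big1 => [|j' jj']; last first.
  by rewrite xc_iota // [j == j']eq_sym (negbTE jj') andbF.
rewrite big1 ?addr0 // => h'; rewrite -val_eqE /= => hh'.
rewrite xc_sum big1 // => j' _.
by rewrite xc_iota // eq_sym (negbTE hh').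
Qed.

Lemma jet_op_series p (chR : p \in [pchar R]) (V : forall B : calg S, E (witt_calg n B) -> B)
    (V_nat : forall (B C : calg S) (h : chom B C) x, V C (fmap E (witt_map n h) x) = h (V B x))
    (VD : forall (B : calg S) (x y : E (witt_calg n B)), V B (x + y) = V B x + V B y) :
  exists c : nat -> 'rV[tps (frob chR)]_d, (forall h j, @null S (base_calg S) (c h 0 j)) /\
    forall (B : calg S) x, V B x = \sum_(h < n.+1) \sum_j act p (c h 0 j) (xc x h j).
Proof.
have [|||c [nc cE]] := @gen_op_series A S p chR (jet E n) ('I_n.+1 * 'I_d)%type
  (fun B x hj => xc (x : E (witt_calg n B)) hj.1 hj.2)
  (fun B hj b => iota_jet hj.1 hj.2 b) _ _ _ V V_nat VD.
- move=> B C f [h j] b; apply: xc_inj => h' j' hn.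
  by rewrite xc_nat // !xc_iota //; case: ifP => // _; rewrite rmorph0.
- move=> B [h j] b b'; apply: xc_inj => h' j' hn.
  by rewrite xcD !xc_iota //; case: ifP => // _; rewrite addr0.
- move=> B x; apply: xc_inj => h j hn.
  rewrite -(pair_bigA _ (fun (h : 'I_n.+1) j => iota_jet h j (xc (x : E (witt_calg n B)) h j))).
  by rewrite (xc_sum_iota (fun h j => xc (x : E (witt_calg n B)) h j)).
exists (fun h => \row_j if insub h is Some h' then c (h', j) else 0); split=> [h j|B x].
  by rewrite mxE; case: insubP => [h' _ _|_]; [exact: nc | exact: null_zero].
rewrite cE pair_bigA; apply: eq_bigr => -[h j] _ /=.
rewrite mxE insubT ?ltn_ord // => hn.
by rewrite (_ : Sub (h : nat) hn = h) //; apply: val_inj.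
Qed.

Lemma xc_ker (B : calg S) (x : nker E n B) j : xc (nincl x) 0 j = 0.
Proof.
have := valP x; rewrite unfold_in => /eqP x0.
have := coord_nat g (witt_proj n B) (nincl x); rewrite x0 coord0 => /rowP/(_ j).
by rewrite !mxE => /esym.
Qed.

Lemma nincl_inj (B : calg S) : injective (@nincl A S E n B).
Proof. exact: val_inj. Qed.

Lemma in_jker (B : calg S) (x : E (witt_calg n B)) : (forall j, xc x 0 j = 0) -> x \in @jker A S E n B.
Proof.
move=> x0; rewrite unfold_in /jker; apply/eqP; apply: coord_inj.
by rewrite coord_nat coord0; apply/rowP => j; rewrite !mxE; exact: x0.
Qed.

Lemma iota_ker (B : calg S) (h : nat) (j : 'I_d) (b : B) : iota_jet h.+1 j b \in @jker A S E n B.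
Proof. by apply: in_jker => i; rewrite xc_iota. Qed.
End Jets.

Lemma nker_op_series n p (chR : p \in [pchar R]) (V : forall B : calg S, nker E n B -> B)
    (V_nat : forall (B C : calg S) (h : chom B C) x, V C (fmap (nker E n) h x) = h (V B x))
    (VD : forall (B : calg S) (x y : nker E n B), V B (x + y) = V B x + V B y) :
  exists c : nat -> 'rV[tps (frob chR)]_d, (forall h j, @null S (base_calg S) (c h 0 j)) /\
    forall (B : calg S) x, V B x = \sum_(h < n) \sum_j act p (c h.+1 0 j) (xc (nincl x) h.+1 j).
Proof.
have nD (B : calg S) (x y : nker E n B) : nincl (x + y) = nincl x + nincl y by [].
have n0 (B : calg S) : nincl (0 : nker E n B) = 0 by [].
have [|||c [nc cE]] := @gen_op_series A S p chR (nker E n) ('I_n * 'I_d)%type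
  (fun B x hj => xc (nincl x) hj.1.+1 hj.2)
  (fun B hj b => mk_nker (iota_ker n hj.1 hj.2 b)) _ _ _ V V_nat VD.
- move=> B C f [h j] b; apply: nincl_inj; apply: xc_inj => h' j' hn.
  rewrite /nincl /= xc_nat // !xc_iota //; case: ifP => // _; by rewrite rmorph0.
- move=> B [h j] b b'; apply: nincl_inj; apply: xc_inj => h' j' hn.
  rewrite nD xcD /nincl /= !xc_iota //; case: ifP => // _; by rewrite addr0.
- move=> B x; apply: nincl_inj; apply: xc_inj => h j hn.
  rewrite (big_morph (@nincl A S E n B) (nD B) (n0 B)).
  rewrite -(pair_bigA _ (fun (h : 'I_n) j => iota_jet n h.+1 j (xc (nincl x) h.+1 j))).
  transitivity (xc (\sum_(h' < n.+1) \sum_j' iota_jet n h' j' (xc (nincl x) h' j')) h j).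
    by rewrite (xc_sum_iota (fun h j => xc (nincl x) h j)).
  rewrite big_ord_recl xcD [X in X + _]xc_sum big1 ?add0r // => j' _.
  by rewrite xc_ker xc_iota //; case: ifP.
(* Row h belongs to the Witt component h, and on N^n these start at 1, whence the shift by one. Row
   0 is never read. *)
exists (fun h => \row_j if insub h.-1 is Some h' then c (h', j) else 0); split=> [h j|B x].
  by rewrite mxE; case: insubP => [h' _ _|_]; [exact: nc | exact: null_zero].
rewrite cE pair_bigA; apply: eq_bigr => -[h j] _ /=.
rewrite mxE insubT ?ltn_ord // => hn.
by rewrite (_ : Sub (h : nat) hn = h) //; apply: val_inj.
Qed.
End Coordinates.

Lemma mulmx_scalarE (F : pzRingType) (m n : nat) (M : 'M[F]_(m, n)) (c : F) i j :
  (M *m c%:M) i j = M i j * c.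
Proof.
rewrite mxE (bigD1 j) //= mxE eqxx mulr1n big1 ?addr0 // => l lj.
by rewrite mxE (negbTE lj) mulr0n mulr0.
Qed.

Lemma scalar_mulmxE (F : pzRingType) (n m : nat) (M : 'M[F]_(n, m)) (c : F) i j :
  (c%:M *m M) i j = c * M i j.
Proof.
rewrite mxE (bigD1 i) //= mxE eqxx mulr1n big1 ?addr0 // => l li.
by rewrite mxE eq_sym (negbTE li) mulr0n mul0r.
Qed.

(** * Ghost components and the Witt Frobenius as matrices of twisted series *)

Section GhostSeries.
Variables (S : base) (p e : nat).
Local Notation R := (base_ring S).
Local Notation pi := (ppi S).
Local Notation q := (qhat S).
Local Notation bR := (base_calg S).
Hypothesis chR : p \in [pchar R].
Hypothesis qE : q = (p ^ e)%N.
Local Notation Fr := (frob chR).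
Local Notation RT := (tps Fr).

Lemma phi_frob i x : itm (phi S) i (Fr x) = Fr (itm (phi S) i x).
Proof. by rewrite /frob /= !pFrobenius_autE rmorphXn. Qed.
Definition phiT i : RT -> RT := tpsmap (@phi_frob i).
HB.instance Definition _ i := GRing.RMorphism.on (phiT i).

Lemma phiT_null i f : @null S bR f -> @null S bR (phiT i f).
Proof. exact: null_phi. Qed.

(* V^h [x] has i-th ghost component pi^h x^(qhat^(i-h)), and qhat = p^e. *)
Definition gser (i h : nat) : RT := if (h <= i)%N then mono Fr (pi ^+ h) (e * (i - h)) else 0.
(** The contribution of the component h' of a Witt vector x to the component h of F(x). *)
Definition fser (h h' : nat) : RT := mono Fr (fcoef S h h') (e * (h.+1 - h')).

Lemma gser_null i h : @null S bR (gser i h).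
Proof. by rewrite /gser; case: ifP => _; [exact: null_mono | exact: null_zero]. Qed.
Lemma gserE i h : (h <= i)%N -> gser i h = mono Fr (pi ^+ h) (e * (i - h)).
Proof. by rewrite /gser => ->. Qed.

Lemma gser_small i h : (i < h)%N -> gser i h = 0.
Proof. by rewrite ltnNge => /negbTE ih; rewrite /gser ih. Qed.
Lemma fser_null h h' : @null S bR (fser h h').
Proof. exact: null_mono. Qed.

Lemma act_gser i h (B : calg S) (b : B) :
  act p (gser i h) b = if (h <= i)%N then str B pi ^+ h * b ^+ (q ^ (i - h)) else 0.
Proof.
rewrite /gser; case: ifP => _; last exact: act_zero.
by rewrite act_monoE rmorphXn expnM -qE.
Qed.

Lemma act_fser h h' (B : calg S) (b : B) :
  act p (fser h h') b = str B (fcoef S h h') * b ^+ (q ^ (h.+1 - h')).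
Proof. by rewrite /fser act_monoE expnM -qE. Qed.

Lemma ghost_act (B : calg S) (y : nat -> B) n i : (i <= n)%N ->
  ghost y i = \sum_(h < n.+1) act p (gser i h) (y h).
Proof.
move=> ni; rewrite -(@widen_sum S B (fun h => act p (gser i h) (y h)) i n) // => [|h ih].
  by apply: eq_bigr => h _; rewrite act_gser -ltnS ltn_ord.
by rewrite act_gser leqNgt ih.
Qed.

Lemma wfrob_act (B : calg S) (y : nat -> B) n h : (h <= n)%N ->
  wfrob y h = \sum_(h' < n.+2) act p (fser h h') (y h').
Proof.
move=> hn; rewrite (wfrob_widen y (hn : (h.+1 <= n.+1)%N)).
by apply: eq_bigr => h' _; rewrite act_fser.
Qed.

Lemma act_delta (F : nat -> RT) n h (B : calg S) (b : B) : (forall h, @null S bR (F h)) -> (h <= n)%N ->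
  \sum_(h' < n.+1) act p (F h') (if (h' : nat) == h then b else 0) = act p (F h) b.
Proof.
move=> nF hn; rewrite (bigD1 (Ordinal (hn : (h < n.+1)%N))) //= eqxx big1 ?addr0 // => h'.
by rewrite -val_eqE /= => /negbTE->; rewrite act0.
Qed.

(** This is w_i F = w_(i+1), read off by [act_inj] from Witt vectors whose only nonzero component
    has index h'. *)
Lemma gser_fser n i h' : (i <= n)%N -> (h' <= n.+1)%N ->
  \sum_(h < n.+1) gser i h * fser h h' = gser i.+1 h'.
Proof.
move=> ni hn; apply: (act_inj chR) => [||B b].
- by apply: null_sum => h _; apply: nullM; [exact: gser_null | exact: fser_null].
- exact: gser_null.
rewrite act_bigsum => [|h _]; last by apply: nullM; [exact: gser_null | exact: fser_null].
pose y h := if h == h' then b else 0.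
transitivity (ghost y i.+1).
  rewrite -ghost_wfrob (ghost_act _ ni); apply: eq_bigr => h _.
  have hn' : (h <= n)%N by rewrite -ltnS.
  rewrite -act_mul; [|exact: gser_null|exact: fser_null].
  by rewrite (wfrob_act _ hn') act_delta // => j; exact: fser_null.
rewrite (@ghost_act _ _ n.+1) // act_delta // => j; exact: gser_null.
Qed.

(** The identity w_(i+1) V = pi w_i. *)
Lemma gserSS i h : gser i.+1 h.+1 = mono Fr pi 0 * gser i h.
Proof.
rewrite /gser ltnS subSS; case: ifP => _; last by rewrite mulr0.
by rewrite mono_mul exprS.
Qed.

(** The identity w_(i+1) V F = pi w_(i+1) = w_(i+2) V, which describes the lateral Frobenius in
    ghost components. *)
Lemma gser_fserS n i h' : (i <= n)%N -> (h' <= n.+1)%N ->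
  \sum_(h < n.+1) gser i.+1 h.+1 * fser h h' = gser i.+2 h'.+1.
Proof.
move=> ni hn; rewrite gserSS -(gser_fser ni hn) mulr_sumr.
by apply: eq_bigr => h _; rewrite gserSS mulrA.
Qed.

Lemma gser00 : gser 0 0 = 1.
Proof. by rewrite /gser /= muln0 expr0 mono1. Qed.
End GhostSeries.

(** * The action of A on E and on its jet spaces *)

Section ScalarAction.
Variables (A : comNzRingType) (S : base) (theta : {rmorphism A -> S}).
Variables (k : finFieldType) (kA : {rmorphism k -> A}) (E : amod_functor A S) (d : nat).
Variable g : coordinates E theta kA d.
Variables (p e : nat).
Local Notation R := (base_ring S).
Local Notation bR := (base_calg S).
Hypothesis chR : p \in [pchar R].
Hypothesis qE : qhat S = (p ^ e)%N.
Local Notation RT := (tps (frob chR)).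

Definition is_action_matrix (a : A) (Phi : 'M[RT]_d) : Prop :=
  (forall i j, @null S bR (Phi i j)) /\
  forall (B : calg S) (x : E B) i,
    Defs.coord g (a *: x) 0 i = \sum_j act p (Phi i j) (Defs.coord g x 0 j).

Lemma action_matrix_exists a : exists Phi, is_action_matrix a Phi.
Proof.
have /choice[c cP] i : exists c : 'I_d -> RT, (forall j, @null S bR (c j)) /\
   forall (B : calg S) (x : E B), Defs.coord g (a *: x) 0 i = \sum_j act p (c j) (Defs.coord g x 0 j).
  apply: (E_op_series g chR (V := fun B x => Defs.coord g (a *: x) 0 i)) => [B C h x|B x y].
    by rewrite -linearZ coord_nat mxE.
  by rewrite scalerDr coordD mxE.
exists (\matrix_(i, j) c i j); split=> [i j|B x i]; first by rewrite mxE; have [] := cP i.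
have [_ ->] := cP i; by apply: eq_bigr => j _; rewrite mxE.
Qed.

Variables (a : A) (Phi : 'M[RT]_d).
Hypothesis PhiP : is_action_matrix a Phi.

Local Notation G i h := ((gser e chR i h)%:M : 'M[RT]_d).

(** The matrices of a in Witt coordinates are controlled through ghost components: w_i is a morphism
    of algebras from W_n(B) to [twi i B], so E(w_i) is A-linear, and on its target a acts through
    phi^i(Phi). *)
Lemma jet_action n : exists Y : nat -> nat -> 'M[RT]_d,
  [/\ forall h' h i j, @null S bR (Y h' h i j),
      forall h' i (B : calg S) (x : E (witt_calg n B)), (h' <= n)%N ->
        xc g (a *: x) h' i = \sum_(h < n.+1) \sum_j act p (Y h' h i j) (xc g x h j) &
      forall i h, (i <= n)%N -> (h <= n)%N ->
        \sum_(h' < n.+1) G i h' *m Y h' h = map_mx (phiT i) Phi *m G i h].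
Proof.
have /choice[c cP] (hi : nat * 'I_d) : exists c : nat -> 'rV[RT]_d,
    (forall h j, @null S bR (c h 0 j)) /\ ((hi.1 <= n)%N -> forall (B : calg S) (x : E (witt_calg n B)),
      xc g (a *: x) hi.1 hi.2 = \sum_(h < n.+1) \sum_j act p (c h 0 j) (xc g x h j)).
  case: (leqP hi.1 n) => hn; last first.
    by exists (fun=> 0); split=> // h j; rewrite mxE; exact: null_zero.
  have [||c [nc cE]] := @jet_op_series _ _ _ _ _ _ _ g n p chR (fun B x => xc g (a *: x) hi.1 hi.2).
  - by move=> B C h x; rewrite -linearZ xc_nat.
  - by move=> B x y; rewrite scalerDr xcD.
  by exists c.
exists (fun h' h => \matrix_(i, j) c (h', i) h 0 j).
have nY h' h i j : @null S bR (c (h', i) h 0 j) by have [] := cP (h', i).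
have YE h' i (B : calg S) (x : E (witt_calg n B)) : (h' <= n)%N ->
    xc g (a *: x) h' i = \sum_(h < n.+1) \sum_j act p (c (h', i) h 0 j) (xc g x h j).
  by move=> hn; have [_ /(_ hn)] := cP (h', i).
split=> [h' h i j|h' i B x hn|i h ni hn]; first by rewrite mxE.
  by rewrite YE //; apply: eq_bigr => h _; apply: eq_bigr => j _; rewrite mxE.
have [nPhi PhiE] := PhiP.
apply/matrixP => r s; rewrite summxE mulmx_scalarE mxE.
under eq_bigr do rewrite scalar_mulmxE mxE.
have nG j h0 := gser_null e chR j h0.
apply: (act_inj chR) => [||B b].
- by apply: null_sum => h' _; apply: nullM; [exact: nG | exact: nY].
- by apply: nullM; [exact/phiT_null/nPhi | exact: nG].
rewrite act_bigsum => [|h' _]; last by apply: nullM; [exact: nG | exact: nY].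
rewrite -act_mul; [|exact/phiT_null/nPhi|exact: nG].
pose x := iota_jet g n h s b.
transitivity (\sum_(h' < n.+1) act p (gser e chR i h') (xc g (a *: x) h' r)).
  apply: eq_bigr => h' _; have hn' : (h' <= n)%N by rewrite -ltnS.
  rewrite -act_mul; [|exact: nG|exact: nY]; congr act; rewrite YE //.
  rewrite (bigD1 (Ordinal (hn : (h < n.+1)%N))) //= (bigD1 s) //=.
  rewrite xc_iota // !eqxx /= big1 ?addr0 => [|j js]; last first.
    by rewrite xc_iota // (negbTE js) andbF act0.
  rewrite big1 ?addr0 // => h0; rewrite -val_eqE /= => h0h.
  have h0n : (h0 <= n)%N by rewrite -ltnS.
  by rewrite big1 // => j _; rewrite xc_iota // (negbTE h0h) act0.
rewrite -(ghost_act chR qE (fun h' => xc g (a *: x) h' r) ni).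
have gE (y : E (witt_calg n B)) j : ghost (fun h' => xc g y h' j) i =
    Defs.coord g (fmap E (ghost_hom ni B) y) 0 j.
  by rewrite coord_nat mxE.
rewrite gE linearZ PhiE (bigD1 s) //= big1 ?addr0 => [|j js]; last first.
  rewrite -gE (ghost_act chR qE _ ni) big1 ?act0 // => h0 _.
  have h0n : (h0 <= n)%N by rewrite -ltnS.
  by rewrite xc_iota // (negbTE js) andbF act0.
rewrite (act_twi _ i _ (nPhi r s)) -gE; congr (act p _ _).
rewrite (ghost_act chR qE _ ni) -(@act_delta _ _ chR (gser e chR i) n h B b) //.
apply: eq_bigr => h0 _; have h0n : (h0 <= n)%N by rewrite -ltnS.
by rewrite xc_iota // eqxx andbT.
Qed.
End ScalarAction.

(** * Series over the fraction field and inversion of the ghost matrix *)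

Lemma fraction_pchar (R : idomainType) p : p \in [pchar R] -> p \in [pchar {fraction R}].
Proof.
move=> chR; rewrite inE (pcharf_prime chR) /= -(rmorph_nat (@tofrac R)).
by rewrite (pcharf0 chR) rmorph0.
Qed.

Section FractionSeries.
Variables (S : base) (p e : nat).
Local Notation R := (base_ring S).
Local Notation pi := (ppi S).
Local Notation bR := (base_calg S).
Local Notation K := {fraction R}.
Hypothesis chR : p \in [pchar R].
Hypothesis qE : qhat S = (p ^ e)%N.
Variable sigma : {rmorphism K -> K}.
Hypothesis sigmaE : forall x : R, sigma (tofrac x) = tofrac (phi S x).
Local Notation RT := (tps (frob chR)).
Local Notation FrK := (frob (fraction_pchar chR)).
Local Notation KT := (tps FrK).

Lemma tofrac_frob (x : R) : tofrac (frob chR x) = FrK (tofrac x).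
Proof. by rewrite /frob /= !pFrobenius_autE rmorphXn. Qed.
Definition fracT : RT -> KT := tpsmap tofrac_frob.
HB.instance Definition _ := GRing.RMorphism.on fracT.

Lemma sigma_frob i (x : K) : itm sigma i (FrK x) = FrK (itm sigma i x).
Proof. by rewrite /frob /= !pFrobenius_autE rmorphXn. Qed.
Definition sigmaT i : KT -> KT := tpsmap (sigma_frob i).
HB.instance Definition _ i := GRing.RMorphism.on (sigmaT i).

Lemma sigmaTE i (f : KT) n : sigmaT i f n = itm sigma i (f n). Proof. by []. Qed.

Lemma fracT_inj : injective fracT.
Proof.
move=> f f' E; apply/funext => n; apply/eqP; rewrite -tofrac_eq; apply/eqP.
exact: (congr1 (fun f : KT => f n) E).
Qed.

Lemma itm_sigmaE i (x : R) : itm sigma i (tofrac x) = tofrac (itm (phi S) i x).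
Proof. by elim: i => // i IH; rewrite !itmS IH sigmaE. Qed.

Lemma sigmaT_fracT i f : sigmaT i (fracT f) = fracT (phiT i f).
Proof. by apply/funext => n; exact: itm_sigmaE. Qed.

Lemma sigmaTD i j f : sigmaT (i + j) f = sigmaT i (sigmaT j f).
Proof. by apply/funext => n; exact: itmD. Qed.
Lemma sigmaT0 f : sigmaT 0 f = f. Proof. by []. Qed.

Lemma phiT_gser j i h : phiT j (gser e chR i h) = gser e chR i h.
Proof.
rewrite /gser; case: ifP => _; last exact: rmorph0.
rewrite [LHS]tpsmap_mono; congr mono.
by rewrite [LHS](rmorphXn (itm (phi S) j)) /= itm_phi_pi.
Qed.

Definition kst (c : K) : KT := mono FrK c 0.

Lemma kst_fracT (r : R) : fracT (mono (frob chR) r 0) = kst (tofrac r).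
Proof. exact: tpsmap_mono. Qed.

Lemma kstM c c' : kst (c * c') = kst c * kst c'.
Proof. by rewrite /kst mono_mul. Qed.
Lemma kst1 : kst 1 = 1. Proof. exact: mono1. Qed.
Lemma kst0 : kst 0 = 0. Proof. exact: mono0. Qed.
Lemma kstE c f n : (kst c * f) n = c * f n. Proof. exact: constM. Qed.
Lemma sigmaT_kst i c : sigmaT i (kst c) = kst (itm sigma i c).
Proof. exact: tpsmap_mono. Qed.

Lemma piK_neq0 : (tofrac pi : K) != 0.
Proof. by rewrite tofrac_eq0 ppi_neq0. Qed.

Variable d : nat.
Implicit Types m X : nat -> 'rV[KT]_d.

Definition GK i h : 'M[KT]_d := (fracT (gser e chR i h))%:M.

Lemma GKE i h : GK i h = (fracT (gser e chR i h))%:M. Proof. by []. Qed.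

Lemma GK_small i h : (i < h)%N -> GK i h = 0.
Proof.
move=> ih; rewrite /GK /gser leqNgt ih /= [fracT 0]rmorph0.
by apply/matrixP => r s; rewrite !mxE mul0rn.
Qed.

Definition GKinv h : 'M[KT]_d := (kst (tofrac pi ^- h))%:M.
Lemma GKinvK h : GKinv h *m GK h h = 1%:M.
Proof.
rewrite /GK /GKinv /gser leqnn subnn muln0 kst_fracT -scalar_mxM -kstM rmorphXn.
by rewrite mulVf ?kst1 // expf_neq0 // piK_neq0.
Qed.
Lemma GKKinv h : GK h h *m GKinv h = 1%:M.
Proof.
rewrite /GK /GKinv /gser leqnn subnn muln0 kst_fracT -scalar_mxM -kstM rmorphXn.
by rewrite divff ?kst1 // expf_neq0 // piK_neq0.
Qed.

(** The ghost matrix is triangular with diagonal entries pi^h, invertible over K, so descending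
    induction on i applies. Nothing is learned about X_0, because [GK 0 h] vanishes for h > 0. *)
Lemma tri_zero n X :
  (forall h, (0 < h <= n)%N -> \sum_(i < n.+1) X i *m GK i h = 0) ->
  forall i, (0 < i <= n)%N -> X i = 0.
Proof.
move=> H i; have [s] : exists s, (n - i < s)%N by exists (n - i).+1.
elim: s i => // s IH i sn hi; have /andP[i0 ni] := hi.
have := H i hi; rewrite (bigD1 (Ordinal (ni : (i < n.+1)%N))) //= big1.
  rewrite addr0 => /(congr1 (fun M => M *m GKinv i)).
  by rewrite mul0mx -mulmxA GKKinv mulmx1.
move=> j; have jn : (j <= n)%N by rewrite -ltnS.
rewrite -val_eqE /= neq_ltn => /orP[ji|ij]; first by rewrite GK_small ?mulmx0.
rewrite IH ?mul0mx //; last by rewrite jn (leq_trans i0 (ltnW ij)).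
by rewrite -ltnS; apply: leq_trans sn; rewrite ltnS ltn_sub2l // (leq_trans ij).
Qed.

Lemma tri_exists n (t : nat -> 'rV[KT]_d) :
  exists m, forall h, (0 < h <= n)%N -> t h = \sum_(i < n.+1) m i *m GK i h.
Proof.
(* Back substitution: once the last s columns are solved, changing m_(n-s) leaves them intact,
   because [GK i h] vanishes for i < h. *)
suff H s : (s <= n)%N -> exists m, forall h, (0 < h <= n)%N -> (n - s < h)%N ->
    t h = \sum_(i < n.+1) m i *m GK i h.
  by have [m mP] := H n (leqnn n); exists m => h hn; apply: mP => //; rewrite subnn; case/andP: hn.
elim: s => [|s IH] sn; first by exists (fun=> 0) => h /andP[_ hn]; rewrite subn0 ltnNge hn.
have [m mP] := IH (ltnW sn); pose h0 := (n - s)%N.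
have h0n : (h0 < n.+1)%N by rewrite ltnS leq_subr.
pose c := (t h0 - \sum_(i < n.+1 | i != Ordinal h0n) m i *m GK i h0) *m GKinv h0.
exists (fun i => if i == h0 then c else m i) => h hn; rewrite subnS.
have p0 : (0 < n - s)%N by rewrite subn_gt0.
rewrite prednK // -/h0 leq_eqVlt => /orP[/eqP <-|hh].
  rewrite (bigD1 (Ordinal h0n)) //= eqxx /c -mulmxA.
  rewrite GKinvK mulmx1 -addrA [X in _ + X](_ : _ = 0) ?addr0 //.
  rewrite addrC -sumrB big1 // => i; rewrite -val_eqE /= => /negbTE->.
  by rewrite subrr.
rewrite (mP h hn hh); apply: eq_bigr => i _; have [ih|//] := eqVneq (i : nat) h0.
by rewrite !GK_small ?mulmx0 // ih.
Qed.
End FractionSeries.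

(** * Characters in Witt and ghost coordinates *)

Section Representation.
Variables (A : comNzRingType) (S : base) (theta : {rmorphism A -> S}).
Variables (k : finFieldType) (kA : {rmorphism k -> A}) (E : amod_functor A S) (d : nat).
Variable g : coordinates E theta kA d.
Variables (p e : nat).
Local Notation R := (base_ring S).
Local Notation pi := (ppi S).
Local Notation bR := (base_calg S).
Local Notation K := {fraction R}.
Hypothesis chR : p \in [pchar R].
Hypothesis qE : qhat S = (p ^ e)%N.
Variable sigma : {rmorphism K -> K}.
Hypothesis sigmaE : forall x : R, sigma (tofrac x) = tofrac (phi S x).
Hypothesis theta_phi : forall a, phi S (theta a) = theta a.
Local Notation RT := (tps (frob chR)).
Local Notation KT := (tps (frob (fraction_pchar chR))).
Local Notation GK := (@GK S p e chR d).
Local Notation fracT := (@fracT S p chR).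
Local Notation sigmaT := (@sigmaT S p chR sigma).
Local Notation kst := (@kst S p chR).
Local Notation gser := (gser e chR).
Local Notation fser := (fser e chR).

Variable Phi : A -> 'M[RT]_d.
Hypothesis PhiP : forall a, is_action_matrix g a (Phi a).

Definition null_rows (t : nat -> 'rV[RT]_d) := forall h j, @null S bR (t h 0 j).

Definition eigen i (m : 'rV[KT]_d) := forall a,
  m *m map_mx (fun f => sigmaT i (fracT f)) (Phi a) = kst (tofrac (theta a)) *: m.

(** The character with rows t in Witt coordinates is the sum of the m_i composed with w_i. Here h0
    is 0 on J^n E and 1 on N^n, where the Witt components of index 0 vanish. *)
Definition ghostly h0 n (t : nat -> 'rV[RT]_d) (m : nat -> 'rV[KT]_d) :=
  forall h, (h0 <= h <= n)%N -> map_mx fracT (t h) = \sum_(i < n.+1) m i *m GK i h.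

Definition repx h0 n (t : nat -> 'rV[RT]_d) (B : calg S) (x : E (witt_calg n B)) : B :=
  \sum_(h < n.+1 | (h0 <= h)%N) \sum_j act p (t h 0 j) (xc g x h j).

Lemma repxE h0 n (t : nat -> 'rV[RT]_d) (B : calg S) (x : E (witt_calg n B)) :
  repx h0 t x = \sum_(h < n.+1 | (h0 <= h)%N) \sum_j act p (t h 0 j) (xc g x h j).
Proof. by []. Qed.

Section Rep.
Variables (h0 n : nat) (t : nat -> 'rV[RT]_d).
Hypothesis nt : null_rows t.

Lemma repxD (B : calg S) (x y : E (witt_calg n B)) :
  repx h0 t (x + y) = repx h0 t x + repx h0 t y.
Proof.
rewrite /repx -big_split; apply: eq_bigr => h _; rewrite -big_split.
by apply: eq_bigr => j _; rewrite xcD (actD chR) //; exact: nt.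
Qed.

Lemma repx_nat (B C : calg S) (f : chom B C) (x : E (witt_calg n B)) :
  repx h0 t (fmap E (witt_map n f) x) = f (repx h0 t x).
Proof.
rewrite /repx rmorph_sum; apply: eq_bigr => h _; rewrite rmorph_sum.
apply: eq_bigr => j _; rewrite xc_nat; last by rewrite -ltnS.
by rewrite act_hom //; exact: nt.
Qed.

Lemma repx_iota (B : calg S) h j (b : B) : (h0 <= h <= n)%N ->
  repx h0 t (iota_jet g n h j b) = act p (t h 0 j) b.
Proof.
move=> /andP[h0h hn]; rewrite /repx (bigD1 (Ordinal (hn : (h < n.+1)%N))) //= (bigD1 j) //=.
rewrite xc_iota // !eqxx /= big1 ?addr0 => [|i ij]; last first.
  by rewrite xc_iota // (negbTE ij) andbF (act0 chR) //; exact: nt.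
rewrite big1 ?addr0 // => i /andP[_]; rewrite -val_eqE /= => /negbTE ih.
have ni : (i <= n)%N by rewrite -ltnS.
by rewrite big1 // => l _; rewrite xc_iota // ih (act0 chR) //; exact: nt.
Qed.

Lemma repx_act (Y : nat -> nat -> 'M[RT]_d) (nY : forall h' h i j, @null S bR (Y h' h i j))
    a (B : calg S) (x : E (witt_calg n B))
    (YE : forall h' i, (h' <= n)%N ->
      xc g (a *: x) h' i = \sum_(h < n.+1) \sum_j act p (Y h' h i j) (xc g x h j)) :
  repx h0 t (a *: x) =
  \sum_(h < n.+1) \sum_j act p ((\sum_(h' < n.+1 | (h0 <= h')%N) t h' *m Y h' h) 0 j) (xc g x h j).
Proof.
have ntY h' h i j : @null S bR (t h' 0 i * Y h' h i j) by apply: nullM; [exact: nt | exact: nY].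
have ntY' h' h j : @null S bR ((t h' *m Y h' h) 0 j) by rewrite mxE; apply: null_sum => i _.
transitivity (\sum_(h' < n.+1 | (h0 <= h')%N) \sum_(h < n.+1) \sum_j
    act p ((t h' *m Y h' h) 0 j) (xc g x h j)).
  apply: eq_bigr => h' _; have hn' : (h' <= n)%N by rewrite -ltnS.
  transitivity (\sum_i \sum_(h < n.+1) \sum_j act p (t h' 0 i * Y h' h i j) (xc g x h j)).
    apply: eq_bigr => i _; rewrite YE // (act_sum chR); last exact: nt.
    apply: eq_bigr => h _; rewrite (act_sum chR); last exact: nt.
    by apply: eq_bigr => j _; rewrite act_mul //; exact: nt.
  rewrite exchange_big; apply: eq_bigr => h _; rewrite exchange_big.
  by apply: eq_bigr => j _; rewrite mxE act_bigsum.
rewrite exchange_big; apply: eq_bigr => h _; rewrite exchange_big.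
by apply: eq_bigr => j _; rewrite summxE act_bigsum.
Qed.
End Rep.

Section Scale.
Variables (h0 n : nat) (h01 : (h0 <= 1)%N) (t : nat -> 'rV[RT]_d) (a : A).
Hypothesis nt : null_rows t.

Lemma action_jet_ghost (Y : nat -> nat -> 'M[RT]_d) (m : nat -> 'rV[KT]_d)
    (GY : forall i h, (i <= n)%N -> (h <= n)%N ->
       \sum_(h' < n.+1) ((gser i h')%:M : 'M[RT]_d) *m Y h' h =
       map_mx (phiT i) (Phi a) *m (gser i h)%:M) :
  ghostly h0 n t m ->
  forall h, (h0 <= h <= n)%N ->
  map_mx fracT (\sum_(h' < n.+1 | (h0 <= h')%N) t h' *m Y h' h) =
  \sum_(i < n.+1) (m i *m map_mx (fun f => sigmaT i (fracT f)) (Phi a)) *m GK i h.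
Proof.
move=> tm h /andP[h0h hn].
(* The component 0 of a x depends only on the component 0 of x, as w_0 shows. This allows the sum
   over h' to start at h0. *)
have Y0 (h' : nat) : (h' < h0)%N -> Y h' h = 0.
  move=> h'0; have h'E : h' = 0%N by case: h' h'0 => // h'; rewrite ltnNge (leq_trans h01).
  have hp : (0 < h)%N by apply: leq_trans h0h; exact: leq_ltn_trans h'0.
  have := GY 0%N h (leq0n _) hn; rewrite big_ord_recl /= big1 => [|i _].
    rewrite addr0 (gser00 e chR) mul_scalar_mx scale1r h'E => ->.
    by apply/matrixP => r s; rewrite mulmx_scalarE gser_small // mulr0 mxE.
  by apply/matrixP => r s; rewrite scalar_mulmxE gser_small // mul0r mxE.
transitivity (\sum_(h' < n.+1) (\sum_(i < n.+1) m i *m GK i h') *m map_mx fracT (Y h' h)).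
  rewrite raddf_sum big_mkcond; apply: eq_bigr => h' _; have hn' : (h' <= n)%N by rewrite -ltnS.
  case: leqP => hh'; last by rewrite Y0 // map_mx0 mulmx0.
  by rewrite /= map_mxM tm // hh'.
transitivity (\sum_(h' < n.+1) \sum_(i < n.+1) m i *m (GK i h' *m map_mx fracT (Y h' h))).
  apply: eq_bigr => h' _; rewrite mulmx_suml; apply: eq_bigr => i _.
  by rewrite [RHS]mulmxA.
rewrite exchange_big; apply: eq_bigr => i _ /=.
rewrite -mulmx_sumr -mulmxA; congr (_ *m _).
have ni : (i <= n)%N by rewrite -ltnS.
have := congr1 (map_mx fracT) (GY i h ni hn); rewrite map_mxM map_scalar_mx -/(GK i h).
rewrite -map_mx_comp raddf_sum /= => E1.
transitivity (map_mx (fracT \o phiT i) (Phi a) *m GK i h).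
  refine (etrans _ E1); apply: eq_bigr => h' _.
  have -> : GK i h' = map_mx fracT (gser i h')%:M by rewrite map_scalar_mx.
  by rewrite -map_mxM.
by congr (_ *m _); apply/matrixP => r s; rewrite !mxE (sigmaT_fracT sigmaE).
Qed.

Lemma repx_scale (m : nat -> 'rV[KT]_d) (B : calg S) (x : E (witt_calg n B)) :
  ghostly h0 n t m -> (forall i, (h0 <= i <= n)%N -> eigen i (m i)) ->
  (forall h j, (h < h0)%N -> xc g x h j = 0) ->
  repx h0 t (a *: x) = str B (theta a) * repx h0 t x.
Proof.
move=> tm em x0; have [Y [nY YE GY]] := jet_action qE (PhiP a) n.
rewrite (repx_act _ nt nY (fun h' i hn => YE h' i B x hn)) /repx big_distrr big_mkcond /=.
rewrite [RHS]big_mkcond; apply: eq_bigr => h _ /=; have hn : (h <= n)%N by rewrite -ltnS.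
case: leqP => hh; last first.
  rewrite big1 // => j _; rewrite x0 // (act0 chR) // summxE; apply: null_sum => h' _.
  by rewrite mxE; apply: null_sum => i _; apply: nullM; [exact: nt | exact: nY].
rewrite mulr_sumr; apply: eq_bigr => j _.
have hhn : (h0 <= h <= n)%N by rewrite hh.
have := action_jet_ghost GY tm hhn.
rewrite (eq_bigr (fun i : 'I_n.+1 => kst (tofrac (theta a)) *: (m i *m GK i h))) => [|i _]; last first.
  case: (leqP h0 i) => h0i; first by rewrite em ?scalemxAl // h0i -ltnS /=.
  by rewrite GK_small ?(leq_trans h0i) // !mulmx0 scaler0.
rewrite -scaler_sumr -tm // -kst_fracT => E1.
have -> : (\sum_(h' < n.+1 | (h0 <= h')%N) t h' *m Y h' h) 0 j = mono (frob chR) (theta a) 0 * t h 0 j.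
  by apply: (@fracT_inj S p chR); rewrite rmorphM; have := congr1 (fun M : 'rV[KT]_d => M 0 j) E1; rewrite !mxE.
rewrite -act_mul; [|exact: null_mono|exact: nt].
by rewrite act_monoE expr1.
Qed.

(** Evaluation at elements with a single nonzero Witt coordinate turns homogeneity into an equality
    of null rows, by [act_inj]; [tri_zero] carries it over to ghost components. *)
Lemma scale_eigen (m : nat -> 'rV[KT]_d) : ghostly h0 n t m ->
  (forall (B : calg S) (x : E (witt_calg n B)), (forall h j, (h < h0)%N -> xc g x h j = 0) ->
    repx h0 t (a *: x) = str B (theta a) * repx h0 t x) ->
  forall i, (0 < i <= n)%N -> m i *m map_mx (fun f => sigmaT i (fracT f)) (Phi a) =
    kst (tofrac (theta a)) *: m i.
Proof.
move=> tm tlin i hi; apply/eqP; rewrite -subr_eq0; apply/eqP.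
apply: (@tri_zero S p e chR d n (fun i => m i *m map_mx (fun f => sigmaT i (fracT f)) (Phi a) -
  kst (tofrac (theta a)) *: m i)) hi => h /andP[hp hn].
have [Y [nY YE GY]] := jet_action qE (PhiP a) n.
have hhn : (h0 <= h <= n)%N by rewrite hn andbT (leq_trans h01).
have E1 := action_jet_ghost GY tm hhn.
transitivity (\sum_(i < n.+1) (m i *m map_mx (fun f => sigmaT i (fracT f)) (Phi a)) *m GK i h -
  kst (tofrac (theta a)) *: \sum_(i < n.+1) m i *m GK i h).
  by rewrite scaler_sumr -sumrB; apply: eq_bigr => l _; rewrite mulmxBl -scalemxAl.
refine (etrans (congr2 (fun X Y : 'rV[KT]_d => X - kst (tofrac (theta a)) *: Y)
  (esym E1) (esym (tm h hhn))) _).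
rewrite -kst_fracT.
rewrite [X in map_mx fracT X](_ : _ = mono (frob chR) (theta a) 0 *: t h).
  by apply/eqP; rewrite subr_eq0; apply/eqP/rowP => j; rewrite !mxE rmorphM.
apply/rowP => j; have nS : @null S bR ((\sum_(h' < n.+1 | (h0 <= h')%N) t h' *m Y h' h) 0 j).
  rewrite summxE; apply: null_sum => h' _; rewrite mxE; apply: null_sum => l _.
  by apply: nullM; [exact: nt | exact: nY].
apply: (act_inj chR) => // [|B b].
  by rewrite mxE; apply: nullM; [exact: null_mono | exact: nt].
rewrite [X in _ = act p X b]mxE -act_mul; [|exact: null_mono|exact: nt].
rewrite act_monoE expr1; have := tlin B (iota_jet g n h j b); rewrite repx_iota // => <-; last first.
  move=> h' j' hh'; rewrite xc_iota ?(leq_trans (ltnW hh')) ?(leq_trans (ltnW hp)) //; last first.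
    by rewrite (leq_trans h01) // (leq_trans hp).
  by rewrite ltn_eqF // (leq_trans hh') // (leq_trans h01).
rewrite (repx_act _ nt nY (fun h' i hn => YE h' i B _ hn)).
have nS' h' j' : @null S bR ((\sum_(h'' < n.+1 | (h0 <= h'')%N) t h'' *m Y h'' h') 0 j').
  rewrite summxE; apply: null_sum => h'' _; rewrite mxE; apply: null_sum => l _.
  by apply: nullM; [exact: nt | exact: nY].
symmetry; pose X h' j' := (\sum_(i0 < n.+1 | (h0 <= i0)%N) t i0 *m Y i0 h') 0 j'.
change (\sum_(h' < n.+1) \sum_j' act p (X h' j') (xc g (iota_jet g n h j b) h' j') = act p (X h j) b).
rewrite (bigD1 (Ordinal (hn : (h < n.+1)%N))) //= (bigD1 j) //= xc_iota // !eqxx /=.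
rewrite big1 ?addr0 => [|l lj]; last by rewrite xc_iota // (negbTE lj) andbF (act0 chR) //; exact: nS'.
rewrite big1 ?addr0 // => l; rewrite -val_eqE /= => /negbTE lh.
have ln : (l <= n)%N by rewrite -ltnS.
by rewrite big1 // => l' _; rewrite xc_iota // lh (act0 chR) //; exact: nS'.
Qed.
End Scale.
End Representation.

Section Characters.
Variables (A : comNzRingType) (S : base) (theta : {rmorphism A -> S}).
Variables (k : finFieldType) (kA : {rmorphism k -> A}) (E : amod_functor A S) (d : nat).
Variable g : coordinates E theta kA d.
Variables (p e : nat).
Local Notation R := (base_ring S).
Local Notation pi := (ppi S).
Local Notation bR := (base_calg S).
Local Notation K := {fraction R}.
Hypothesis chR : p \in [pchar R].
Hypothesis qE : qhat S = (p ^ e)%N.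
Variable sigma : {rmorphism K -> K}.
Hypothesis sigmaE : forall x : R, sigma (tofrac x) = tofrac (phi S x).
Hypothesis theta_phi : forall a, phi S (theta a) = theta a.
Local Notation RT := (tps (frob chR)).
Local Notation KT := (tps (frob (fraction_pchar chR))).
Local Notation GK := (@GK S p e chR d).
Local Notation fracT := (@fracT S p chR).
Local Notation sigmaT := (@sigmaT S p chR sigma).
Local Notation kst := (@kst S p chR).
Local Notation gser := (gser e chR).
Local Notation fser := (fser e chR).
Local Notation repx h0 n t B x := (@repx A S theta k kA E d g p chR h0 n t B x).
Local Notation ghostly := (@ghostly S d p e chR).

Variable Phi : A -> 'M[RT]_d.
Hypothesis PhiP : forall a, is_action_matrix g a (Phi a).
Local Notation eigen := (@eigen A S theta d p chR sigma Phi).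

Definition jrep n (T : ntrans (jet E n) (Ga theta)) t :=
  null_rows t /\ forall (B : calg S) (x : jet E n B), T B x = repx 0 n t B x.
Definition nrep n (P : ntrans (nker E n) (Ga theta)) t :=
  null_rows t /\ forall (B : calg S) (x : nker E n B), P B x = repx 1 n t B (nincl x).

Definition rep n (P : ntrans (nker E n) (Ga theta)) m :=
  exists t, nrep P t /\ ghostly 1 n t m.

Lemma jrep_exists n t : null_rows t -> exists T : ntrans (jet E n) (Ga theta), jrep T t.
Proof.
move=> nt; have T_nat (B C : calg S) (f : chom B C) (x : jet E n B) :
    repx 0 n t C (fmap (jet E n) f x) = fmap (Ga theta) f (repx 0 n t B x).
  exact: repx_nat.
by exists (@NTrans _ _ (jet E n) (Ga theta) (fun B x => repx 0 n t B x) T_nat).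
Qed.

Lemma nrep_exists n t : null_rows t -> exists P : ntrans (nker E n) (Ga theta), nrep P t.
Proof.
move=> nt; have T_nat (B C : calg S) (f : chom B C) (x : nker E n B) :
    repx 1 n t C (nincl (fmap (nker E n) f x)) = fmap (Ga theta) f (repx 1 n t B (nincl x)).
  exact: repx_nat.
by exists (@NTrans _ _ (nker E n) (Ga theta) (fun B x => repx 1 n t B (nincl x)) T_nat).
Qed.

Lemma J_A_linear n (T : ntrans (jet E n) (Ga theta)) t m : jrep T t -> ghostly 0 n t m ->
  (forall i, (i <= n)%N -> eigen i (m i)) -> A_linear T.
Proof.
move=> [nt TE] tm em B a x y; rewrite !TE repxD //; congr (_ + _).
by apply: (repx_scale qE sigmaE PhiP _ a nt tm).
Qed.

Lemma N_A_linear n (P : ntrans (nker E n) (Ga theta)) m : rep P m ->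
  (forall i, (0 < i <= n)%N -> eigen i (m i)) -> A_linear P.
Proof.
move=> [t [[nt PE] tm]] em B a x y; rewrite !PE.
have -> : nincl (a *: x + y) = a *: nincl x + nincl y by [].
rewrite repxD //; congr (_ + _).
apply: (repx_scale qE sigmaE PhiP _ a nt tm) => // h j; rewrite ltnS leqn0 => /eqP->.
exact: xc_ker.
Qed.

Lemma sum_pos n (V : nmodType) (F : nat -> V) :
  \sum_(h < n.+1 | (0 < h)%N) F h = \sum_(h < n) F h.+1.
Proof.
by rewrite big_mkcond big_ord_recl /= add0r.
Qed.

(** The ghost rows come from back substitution over K: they may have denominators and need not be
    null, although the Witt rows are. *)
Lemma A_linear_rep n (P : ntrans (nker E n) (Ga theta)) : A_linear P ->
  exists m, rep P m /\ forall i, (0 < i <= n)%N -> eigen i (m i).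
Proof.
move=> PA; have [B C h x|B x y|t [nt tE]] := @nker_op_series _ _ _ _ _ _ _ g n p chR
    (fun B x => (P B x : B)).
- exact: (nt_nat P h x).
- by have := PA B 1 x y; rewrite !scale1r.
have PE (B : calg S) (x : nker E n B) : P B x = repx 1 n t B (nincl x).
  by rewrite tE !repxE (sum_pos n (fun h => \sum_j act p (t h 0 j) (xc g (nincl x) h j))).
have [m mP] := @tri_exists S p e chR d n (fun h => map_mx fracT (t h)).
exists m; split; first by exists t; split=> // h /mP.
move=> i hi a; apply: (scale_eigen qE sigmaE PhiP _ nt mP _ hi) => // B x x0.
have xk : x \in @jker A S E n B by apply: (in_jker (g := g)) => j; exact: x0.
have := PA B a (mk_nker xk) 0; rewrite !PE.
have -> : nincl (a *: mk_nker xk + 0) = a *: x.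
  by have -> : nincl (a *: mk_nker xk + 0) = a *: nincl (mk_nker xk) + 0 by []; rewrite addr0.
move=> ->; have -> : nincl (mk_nker xk) = x by [].
have -> : repx 1 n t B (nincl (0 : nker E n B)) = 0.
  by apply: (addrI (repx 1 n t B 0)); rewrite -repxD // !addr0.
by rewrite addr0.
Qed.

(** Identities between characters of N^n are proved below by comparing their ghost rows of positive
    index. *)
Lemma rep_ext n (P P' : ntrans (nker E n) (Ga theta)) m m' : rep P m -> rep P' m' ->
  (forall i, (0 < i <= n)%N -> m i = m' i) ->
  forall (B : calg S) (x : nker E n B), P B x = P' B x.
Proof.
move=> [t [[nt PE] tm]] [t' [[nt' PE'] tm']] mm' B x; rewrite PE PE' !repxE.
apply: eq_bigr => h h1; apply: eq_bigr => j _; rewrite (_ : t h 0 j = t' h 0 j) //.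
have hn : (0 < h <= n)%N by rewrite h1 -ltnS /=.
have : map_mx fracT (t h) = map_mx fracT (t' h).
  refine (etrans (tm h hn) (etrans _ (esym (tm' h hn)))).
  apply: eq_bigr => -[[|i] /= il] _; last by rewrite mm'.
  by rewrite GK_small ?mulmx0.
move=> /(congr1 (fun M : 'rV[KT]_d => M 0 j)); rewrite !mxE; exact: fracT_inj.
Qed.

Lemma rep_lin n (P P1 P2 : ntrans (nker E n) (Ga theta)) (c : R) m1 m2 :
  rep P1 m1 -> rep P2 m2 ->
  (forall (B : calg S) (x : nker E n B), (P B x : B) = str B c * (P1 B x : B) + (P2 B x : B)) ->
  rep P (fun i => kst (tofrac c) *: m1 i + m2 i).
Proof.
move=> [t1 [[nt1 PE1] tm1]] [t2 [[nt2 PE2] tm2]] PE.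
exists (fun h => mono (frob chR) c 0 *: t1 h + t2 h); split; first split.
- move=> h j; rewrite !mxE; apply: null_add; last exact: nt2.
  by apply: nullM; [exact: null_mono | exact: nt1].
- move=> B x; rewrite PE PE1 PE2 !repxE mulr_sumr -big_split; apply: eq_bigr => h _.
  rewrite mulr_sumr -big_split; apply: eq_bigr => j _ /=; rewrite !mxE.
  rewrite act_plus; [|by apply: nullM; [exact: null_mono | exact: nt1]|exact: nt2].
  by rewrite -act_mul ?act_monoE ?expr1 //; first [exact: null_mono | exact: nt1].
move=> h hn; transitivity (kst (tofrac c) *: map_mx fracT (t1 h) + map_mx fracT (t2 h)).
  by apply/rowP => j; rewrite !mxE rmorphD rmorphM -kst_fracT.
rewrite (tm1 h hn) (tm2 h hn) scaler_sumr -big_split.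
by apply: eq_bigr => i _ /=; rewrite mulmxDl scalemxAl.
Qed.

Definition shift (m : nat -> 'rV[KT]_d) i := if i is i'.+1 then map_mx (sigmaT 1) (m i') else 0.
(** On N^n ghost indices start at 1, so a lateral pullback has no component of index 1. Entry 0 is a
    filler. *)
Definition shiftN (m : nat -> 'rV[KT]_d) i := if i is i'.+2 then map_mx (sigmaT 1) (m i'.+1) else 0.

Lemma eigen_shift i m : eigen i m -> eigen i.+1 (map_mx (sigmaT 1) m).
Proof.
move=> em a; have E1 : map_mx (sigmaT 1) (kst (tofrac (theta a)) *: m) =
    kst (tofrac (theta a)) *: map_mx (sigmaT 1) m.
  apply/rowP => j; rewrite !mxE.
  transitivity (sigmaT 1 (kst (tofrac (theta a))) * sigmaT 1 (m 0 j)); first exact: rmorphM.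
  by rewrite sigmaT_kst (itm_sigmaE sigmaE) itmS theta_phi.
rewrite -E1 -(em a) map_mxM; congr (_ *m _).
by apply/matrixP => r s; rewrite !mxE.
Qed.

Lemma sigmaT_GK i h : map_mx (sigmaT 1) (GK i h) = GK i h.
Proof. by rewrite !GKE map_scalar_mx /= (sigmaT_fracT sigmaE) phiT_gser. Qed.

Local Notation fK h h' := ((fracT (fser h h'))%:M : 'M[KT]_d).

Lemma GK_fK n i h' : (i <= n)%N -> (h' <= n.+1)%N ->
  \sum_(h < n.+1) GK i h *m fK h h' = GK i.+1 h'.
Proof.
move=> ni hn; rewrite !GKE -(gser_fser chR qE ni hn) rmorph_sum.
apply/matrixP => r s; rewrite summxE mxE -sumrMnl; apply: eq_bigr => h _.
by rewrite -scalar_mxM mxE rmorphM.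
Qed.

Lemma GK_fKS n i h' : (i <= n)%N -> (h' <= n.+1)%N ->
  \sum_(h < n.+1) GK i.+1 h.+1 *m fK h h' = GK i.+2 h'.+1.
Proof.
move=> ni hn; rewrite !GKE -(gser_fserS chR qE ni hn) rmorph_sum.
apply/matrixP => r s; rewrite summxE mxE -sumrMnl; apply: eq_bigr => h _.
by rewrite -scalar_mxM mxE rmorphM.
Qed.

(** Rows of the relative pullback along F: evaluation on [twist B] applies phi to the coefficients,
    and F contributes its matrix [fser]. *)
Definition frob_rows n (t : nat -> 'rV[RT]_d) h' : 'rV[RT]_d :=
  \sum_(h < n.+1) map_mx (phiT 1) (t h) *m (fser h h')%:M.

Lemma frob_rowsE n t h' j : frob_rows n t h' 0 j = \sum_(h < n.+1) phiT 1 (t h 0 j) * fser h h'.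
Proof. by rewrite summxE; apply: eq_bigr => h _; rewrite mulmx_scalarE mxE. Qed.

Lemma frob_rows_null n t : null_rows t -> null_rows (frob_rows n t).
Proof.
move=> nt h j; rewrite frob_rowsE; apply: null_sum => h' _.
by apply: nullM; [exact/phiT_null/nt | exact: fser_null].
Qed.

Lemma frob_rows_act n (t : nat -> 'rV[RT]_d) (nt : null_rows t) (B : calg S) (y : nat -> 'I_d -> B) :
  \sum_(h < n.+1) \sum_j @act S p (t h 0 j) (twist B) (wfrob (fun i => y i j) h) =
  \sum_(h' < n.+2) \sum_j act p (frob_rows n t h' 0 j) (y h' j).
Proof.
transitivity (\sum_(h < n.+1) \sum_j \sum_(h' < n.+2) act p (phiT 1 (t h 0 j) * fser h h') (y h' j)).
  apply: eq_bigr => h _; apply: eq_bigr => j _; have hn : (h <= n)%N by rewrite -ltnS.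
  rewrite (act_twist _ _ (nt h j)) (wfrob_act chR qE _ hn) (act_sum chR); last exact: (null_phi 1 (nt h j)).
  apply: eq_bigr => h' _; rewrite -act_mul //; first exact/phiT_null/nt.
  exact: fser_null.
under eq_bigr do rewrite exchange_big /=.
rewrite exchange_big; apply: eq_bigr => h' _; rewrite exchange_big; apply: eq_bigr => j _ /=.
rewrite frob_rowsE act_bigsum // => h _.
by apply: nullM; [exact/phiT_null/nt | exact: fser_null].
Qed.

Lemma fracT_frob_rows n t h' : map_mx fracT (frob_rows n t h') =
  \sum_(h < n.+1) map_mx (sigmaT 1) (map_mx fracT (t h)) *m fK h h'.
Proof.
rewrite /frob_rows raddf_sum; apply: eq_bigr => h _ /=.
rewrite map_mxM map_scalar_mx; congr (_ *m _).
by apply/matrixP => r s; rewrite !mxE (sigmaT_fracT sigmaE).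
Qed.

Lemma xc_frob n (B : calg S) (x : E (witt_calg n.+1 B)) h j : (h <= n)%N ->
  xc g (fmap E (witt_frob n B) x) h j = wfrob (fun i => xc g x i j) h.
Proof. by move=> hn; rewrite /xc coord_nat mxE /=; exact: wc_F. Qed.

Lemma xc_lateral n (B : calg S) (x : nker E n.+2 B) h j : (h <= n)%N ->
  xc g (nincl (lateral g x)) h.+1 j = wfrob (fun i => xc g (nincl x) i.+1 j) h.
Proof.
move=> hn; rewrite /xc /nincl /= /lateral_fun coordIK mxE.
have := @wc_lat S n B (Defs.coord g (val x) 0 j) h.+1 hn.
by rewrite /wsh subn1.
Qed.

Lemma lateral_rep n (P : ntrans (nker E n.+1) (Ga theta)) m : rep P m ->
  rep (lateral_pull g P) (shiftN m).
Proof.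
move=> [t [[nt PE] tm]]; have nt' : null_rows (fun h => t h.+1) by move=> h j; exact: nt.
exists (fun h => frob_rows n (fun h => t h.+1) h.-1); split; first split.
- by move=> h j; exact: frob_rows_null.
- move=> B x; have -> : lateral_pull g P B x = P (twist B) (lateral g x) by [].
  rewrite PE !repxE.
  rewrite (sum_pos n.+1 (fun h => \sum_j act p (t h 0 j) (xc g (nincl (lateral g x)) h j))).
  transitivity (\sum_(h < n.+1) \sum_j @act S p (t h.+1 0 j) (twist B)
      (wfrob (fun i => xc g (nincl x) i.+1 j) h)).
    by apply: eq_bigr => h _; apply: eq_bigr => j _; rewrite xc_lateral // -ltnS.
  rewrite (frob_rows_act n nt' (fun i j => xc g (nincl x) i.+1 j)).
  rewrite (sum_pos n.+2 (fun h => \sum_j act p (frob_rows n (fun h => t h.+1) h.-1 0 j) (xc g (nincl x) h j))).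
  by [].
move=> [//|h'] hn; rewrite fracT_frob_rows.
transitivity (\sum_(h < n.+1) \sum_(i < n.+2) map_mx (sigmaT 1) (m i) *m (GK i h.+1 *m fK h h')).
  apply: eq_bigr => h _; rewrite tm; last by rewrite /= ltn_ord.
  rewrite raddf_sum mulmx_suml; apply: eq_bigr => i _ /=.
  by rewrite map_mxM sigmaT_GK mulmxA.
transitivity (\sum_(i < n.+2) map_mx (sigmaT 1) (m i) *m \sum_(h < n.+1) (GK i h.+1 *m fK h h')).
  by rewrite exchange_big; apply: eq_bigr => i _ /=; rewrite mulmx_sumr.
(* The term i = 0 drops out because [GK 0 h.+1] is 0. On the right the two leading zeros of [shiftN]
   drop out, and the sums match. *)
rewrite big_ord_recl [X in _ *m X + _]big1 => [|h _]; last by rewrite GK_small // mul0mx.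
rewrite mulmx0 add0r [RHS]big_ord_recl [X in X + _]mul0mx add0r.
rewrite [RHS]big_ord_recl [X in X + _]mul0mx add0r.
by apply: eq_bigr => i _; rewrite (GK_fKS (n := n)) // -ltnS.
Qed.

(** Truncation forgets the Witt components above n, and w_i involves only those up to i, so both
    kinds of rows are extended by zero. *)
Lemma trunc_rep n n' (nn : (n <= n')%N) (P : ntrans (nker E n) (Ga theta)) m : rep P m ->
  rep (trunc_pull nn P) (fun i => if (i <= n)%N then m i else 0).
Proof.
move=> [t [[nt PE] tm]].
exists (fun h => if (h <= n)%N then t h else 0); split; first split.
- by move=> h j; case: ifP => _; [exact: nt | rewrite mxE; exact: null_zero].
- move=> B x; have -> : trunc_pull nn P B x = P B (trunc_ker nn x) by [].
  rewrite PE !repxE.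
  have xE h j : (h <= n)%N -> xc g (nincl (trunc_ker nn x)) h j = xc g (nincl x) h j.
    by move=> hn; rewrite /xc /nincl /= coord_nat mxE /=; exact: wc_mkw.
  rewrite (sum_pos n (fun h => \sum_j act p (t h 0 j) (xc g (nincl (trunc_ker nn x)) h j))).
  rewrite (sum_pos n' (fun h => \sum_j act p ((if (h <= n)%N then t h else 0) 0 j) (xc g (nincl x) h j))).
  rewrite (big_ord_widen n' (fun h => \sum_j act p (t h.+1 0 j) (xc g (nincl (trunc_ker nn x)) h.+1 j)) nn).
  rewrite big_mkcond; apply: eq_bigr => h _; case: ifP => hn.
    by apply: eq_bigr => j _; rewrite xE.
  by rewrite big1 // => j _; rewrite mxE act_zero.
move=> h /andP[h0 hn]; case: leqP => hh.
  have hn' : (1 <= h <= n)%N by rewrite h0.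
  have nn' : (n.+1 <= n'.+1)%N by [].
  refine (etrans (tm h hn') (etrans (big_ord_widen n'.+1 (fun i => m i *m GK i h) nn') _)).
  have mk (Q : pred 'I_n'.+1) (F : 'I_n'.+1 -> 'rV[KT]_d) :
    \sum_(i | Q i) F i = \sum_i (if Q i then F i else 0) by exact: big_mkcond.
  refine (etrans (mk _ _) _); apply: eq_bigr => i _.
  by rewrite ltnS; case: ifP => _ //; rewrite mul0mx.
rewrite map_mx0 big1 // => i _; case: leqP => ii; last by rewrite mul0mx.
by rewrite GK_small ?mulmx0 // (leq_ltn_trans ii).
Qed.
End Characters.

Lemma fractionP (R : idomainType) (x : {fraction R}) :
  exists n d : R, d != 0 /\ tofrac d * x = tofrac n.
Proof.
elim/quotW: x => r; exists (frac r).1, (frac r).2; split; first exact: denom_ratioP.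
rewrite [_ * _]piE /FracField.mulf !numden_Ratio ?oner_neq0 // mul1r; unlock tofrac.
apply/eqmodP; rewrite /= FracField.equivfE !numden_Ratio ?oner_neq0 ?mulf_neq0 ?oner_neq0 ?denom_ratioP //.
by rewrite ?mul1r ?mulr1 mulrC.
Qed.

Definition mcoef (F : nzRingType) (al : {rmorphism F -> F}) r s n (M : 'M[tps al]_(r, s)) : 'M[F]_(r, s) :=
  map_mx (fun f : tps al => f n) M.

Lemma mcoefM (F : nzRingType) (al : {rmorphism F -> F}) r s t n (M : 'M[tps al]_(r, s)) (N : 'M[tps al]_(s, t)) :
  mcoef n (M *m N) = \sum_(i < n.+1) mcoef i M *m map_mx (itm al i) (mcoef (n - i) N).
Proof.
apply/matrixP => i j; rewrite summxE !mxE tps_sumE.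
under eq_bigr do rewrite tpsME.
rewrite exchange_big; apply: eq_bigr => l _; rewrite mxE; apply: eq_bigr => l' _.
by rewrite !mxE.
Qed.

(** * Eigenvectors of the action of z *)

Section NullK.
Variables (S : base) (p : nat).
Local Notation R := (base_ring S).
Local Notation pi := (ppi S).
Local Notation bR := (base_calg S).
Local Notation K := {fraction R}.
Hypothesis chR : p \in [pchar R].
Hypothesis valR : forall x : R, x != 0 -> exists N y, x * y = pi ^+ N.
Local Notation RT := (tps (frob chR)).
Local Notation KT := (tps (frob (fraction_pchar chR))).
Local Notation fracT := (@fracT S p chR).
Local Notation kst := (@kst S p chR).
Local Notation piK := (tofrac pi : K).

Lemma common_denominator1 (c : K) : exists N (r : R), piK ^+ N * c = tofrac r.
Proof.
have [n [d [d0 E]]] := fractionP c; have [N [y yE]] := valR d0.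
by exists N, (y * n); rewrite -rmorphXn -yE rmorphM mulrAC E rmorphM mulrC.
Qed.

Lemma common_denominator (I : finType) (c : I -> K) : exists N, forall i, exists r : R, piK ^+ N * c i = tofrac r.
Proof.
have /choice[N /choice[r rP]] i := common_denominator1 (c i); exists (\sum_i N i) => i.
exists (pi ^+ (\sum_(j | j != i) N j) * r i); rewrite (bigD1 i) //= exprD -mulrA mulrCA rP.
by rewrite rmorphM rmorphXn.
Qed.

Definition dvK N (x : K) := exists y : R, x = tofrac (pi ^+ N * y).
Definition nullK (m : nat -> K) := forall N, exists J, forall j, (J <= j)%N -> dvK N (m j).

Lemma dvK0 N : dvK N 0. Proof. by exists 0; rewrite mulr0 rmorph0. Qed.
Lemma dvKD N x y : dvK N x -> dvK N y -> dvK N (x + y).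
Proof. by move=> [a ->] [b ->]; exists (a + b); rewrite mulrDr rmorphD. Qed.
Lemma nullK_add m m' : nullK m -> nullK m' -> nullK (fun j => m j + m' j).
Proof.
move=> nm nm' N; have [J JP] := nm N; have [I IP] := nm' N; exists (maxn I J) => j.
by rewrite geq_max => /andP[Ij Jj]; apply: dvKD; [exact: JP | exact: IP].
Qed.
Lemma nullK_scale c m : nullK m -> nullK (fun j => c * m j).
Proof.
move=> nm N; have [M [r rE]] := common_denominator1 c; have [J JP] := nm (N + M)%N; exists J => j /JP [y ->].
exists (r * y); rewrite exprD (mulrC (pi ^+ N)) -mulrA rmorphM mulrA rmorphXn (mulrC c) rE.
by rewrite -rmorphM mulrCA.
Qed.

Lemma nullK_frac (c : RT) : @null S bR c -> nullK (fracT c).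
Proof. by move=> nc N; have [J JP] := nc N; exists J => j /JP [y yE]; exists y; rewrite -[LHS]/(tofrac (c j)) yE. Qed.

(** Divisibility by pi^0 already means integrality, so only finitely many coefficients have
    denominators. *)
Lemma nullK_integral (m : nat -> K) : nullK m ->
  exists C (c : RT), @null S bR c /\ forall j, piK ^+ C * m j = tofrac (c j).
Proof.
move=> nm; have [J JP] := nm 0%N; have [C /choice[r rP]] := common_denominator (fun j : 'I_J => m j).
have /choice[c cP] j : exists y : R, piK ^+ C * m j = tofrac y.
  case: (leqP J j) => [/JP [y ->]|jJ]; last by exists (r (Ordinal jJ)); rewrite -rP.
  by exists (pi ^+ C * y); rewrite mul1r rmorphM rmorphXn.
exists C, c; split=> // N; have [I IP] := nullK_scale (piK ^+ C) nm N.
exists I => j /IP; rewrite cP => -[y /eqP]; rewrite tofrac_eq => /eqP yE.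
by exists y.
Qed.

Lemma nullK_fin (m : nat -> K) n : (forall j, (n <= j)%N -> m j = 0) -> nullK m.
Proof. by move=> m0 N; exists n => j /m0 ->; exact: dvK0. Qed.

Lemma nullK_sum (I : Type) (r : seq I) (Q : pred I) (F : I -> KT) :
  (forall i, Q i -> nullK (F i)) -> nullK (\sum_(i <- r | Q i) F i).
Proof.
move=> H; apply: (big_ind (fun f : KT => nullK f)) => //.
  by apply: (@nullK_fin _ 0) => j _.
by move=> x y nx ny; exact: nullK_add.
Qed.

Lemma nullK_kst c (m : KT) : nullK m -> nullK (kst c * m).
Proof.
move=> nm; rewrite (_ : kst c * m = (fun j => c * m j)); first exact: nullK_scale.
by apply/funext => j; exact: kstE.
Qed.

Lemma nullK_kst_inv c (m : KT) : c != 0 -> nullK (kst c * m) -> nullK m.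
Proof.
move=> c0 /(nullK_kst c^-1); rewrite mulrA -kstM mulVf // kst1.
by rewrite mul1r.
Qed.

Lemma nullK_mul (m : KT) (w : RT) : nullK m -> @null S bR w -> nullK (m * fracT w).
Proof.
move=> nm nw; have [C [c [nc cE]]] := nullK_integral nm.
apply: (@nullK_kst_inv (piK ^+ C)); first by rewrite expf_neq0 // piK_neq0.
have -> : kst (piK ^+ C) * (m * fracT w) = fracT (c * w).
  rewrite mulrA [RHS]rmorphM; congr (_ * _); apply/funext => j.
  by rewrite kstE cE.
by apply: nullK_frac; exact: nullM.
Qed.

Definition nullKrow d (m : 'rV[KT]_d) := forall j, nullK (m 0 j).
Definition nullRrow d (m : 'rV[RT]_d) := forall j, @null S bR (m 0 j).
Definition nullRmx d (M : 'M[RT]_d) := forall i j, @null S bR (M i j).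

Lemma nullRrow_mul d (m : 'rV[RT]_d) (W : 'M[RT]_d) : nullRrow m -> nullRmx W ->
  nullRrow (m *m W).
Proof.
by move=> nm nW j; rewrite mxE; apply: null_sum => i _; apply: nullM; [exact: nm | exact: nW].
Qed.

Lemma nullKrow_integral d (m : 'rV[KT]_d) : nullKrow m ->
  exists C (c : 'rV[RT]_d), nullRrow c /\ kst (piK ^+ C) *: m = map_mx fracT c.
Proof.
move=> nm; have /choice[C CP] j := nullK_integral (nm j).
have /choice[c cP] j : exists c : RT, @null S bR c /\ kst (piK ^+ (\sum_j C j)) * m 0 j = fracT c.
  have [c [nc cE]] := CP j; exists (mono _ (pi ^+ (\sum_(i | i != j) C i)) 0 * c); split.
    by apply: nullM => //; exact: null_mono.
  rewrite [RHS]rmorphM [X in _ = X * _]kst_fracT (bigD1 j) //= addnC exprD kstM rmorphXn -mulrA.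
  by congr (_ * _); apply/funext => i; rewrite kstE cE.
exists (\sum_j C j)%N, (\row_j c j); split=> [j|]; first by rewrite mxE; have [] := cP j.
by apply/rowP => j; rewrite !mxE; have [_ ->] := cP j.
Qed.
End NullK.

Lemma exp2_dominates a b : exists J, forall n, (J <= n)%N -> (a * n + b <= 2 ^ n)%N.
Proof.
have sq n : (n * n <= 4 * 2 ^ n)%N.
  have half k : (k < 2 ^ k)%N by exact: ltn_expl.
  have nE := odd_double_half n; set h := n./2 in nE.
  have := half h; have -> : (2 ^ n = 2 ^ odd n * (2 ^ h * 2 ^ h))%N.
    by rewrite -!expnD addnn nE.
  by case: (odd n) nE => /= nE; rewrite ?expn1 ?expn0; nia.
(* From this bound on, 4 (a n + b) <= n^2 <= 4 * 2^n. *)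
exists (4 * a + 4 * b + 1)%N => n Jn; have := sq n; nia.
Qed.

Section Eigenseries.
Variables (S : base) (p : nat).
Local Notation R := (base_ring S).
Local Notation pi := (ppi S).
Local Notation bR := (base_calg S).
Local Notation K := {fraction R}.
Hypothesis chR : p \in [pchar R].
Hypothesis valR : forall x : R, x != 0 -> exists N y, x * y = pi ^+ N.
Hypothesis unitR : forall y : R, exists u, (1 + pi * y) * u = 1.
Variable sigma : {rmorphism K -> K}.
Hypothesis sigmaE : forall x : R, sigma (tofrac x) = tofrac (phi S x).
Local Notation Fr := (frob chR).
Local Notation RT := (tps (frob chR)).
Local Notation KT := (tps (frob (fraction_pchar chR))).
Local Notation fracT := (@fracT S p chR).
Local Notation sigmaT := (@sigmaT S p chR sigma).
Local Notation kst := (@kst S p chR).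
Local Notation piK := (tofrac pi : K).

Variables (d : nat) (Phi : 'M[RT]_d).
Hypothesis Phi_nilp : (mcoef 0 Phi - pi%:M) ^+ d = 0.

(* Comparing coefficients of tau^n in m Phi = pi m leaves the matrix
   Phi_0^(p^n) - pi acting on m_n, which is pi^(p^n) - pi up to a nilpotent. *)
Lemma pole_inverse n : (0 < n)%N -> exists Q : 'M[R]_d,
  (map_mx (itm Fr n) (mcoef 0 Phi) - pi%:M) *m Q = (pi ^+ d)%:M.
Proof.
move=> n0; pose N := mcoef 0 Phi - pi%:M.
pose x := pi ^+ (p ^ n) - pi; pose N' := map_mx (itm Fr n) N.
have XE : map_mx (itm Fr n) (mcoef 0 Phi) - pi%:M = x%:M - (- N').
  have -> : mcoef 0 Phi = N + pi%:M by rewrite subrK.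
  rewrite map_mxD map_scalar_mx /= itm_frob -addrA opprK addrC; congr (_ + _).
  by rewrite /x [RHS]rmorphB.
have N'd : (- N') ^+ d = 0.
  rewrite exprNn; suff -> : N' ^+ d = 0 by rewrite mulr0.
  have H k : map_mx (itm Fr n) (N ^+ k) = N' ^+ k.
    elim: k => [|k IH]; first by rewrite !expr0 map_mx1.
    by rewrite !exprS -IH -!mulmxE map_mxM.
  by rewrite -H Phi_nilp map_mx0.
have cm : GRing.comm (x%:M : 'M[R]_d) (- N').
  by rewrite /GRing.comm -!mulmxE scalar_mxC.
have := subrXX_comm d cm; rewrite N'd subr0 -XE => E.
have xd k : (x%:M : 'M[R]_d) ^+ k = (x ^+ k)%:M.
  by elim: k => [|k IH]; rewrite ?expr0 // !exprS IH -mulmxE -scalar_mxM.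
(* pi^(p^n) - pi is -pi times the unit 1 - pi^(p^n - 1), whose inverse is u. The d-th power of the
   scalar matrix x is then split off by factoring x^d - y^d with y nilpotent. *)
have [u uE] := unitR (- pi ^+ (p ^ n - 2)).
have p2 : (2 <= p ^ n)%N.
  have p_gt1 := prime_gt1 (pcharf_prime chR).
  by apply: (leq_trans p_gt1); rewrite -[X in (X <= _)%N]expn1 leq_exp2l.
have xu : x * - u = pi.
  have -> : x = - (pi * (1 + pi * - pi ^+ (p ^ n - 2))).
    rewrite mulrN -exprS mulrBr mulr1 -exprS opprB /x; congr (_ ^+ _ - _); lia.
  by rewrite mulrNN -mulrA uE mulr1.
exists ((\sum_(i < d) (x%:M : 'M[R]_d) ^+ (d.-1 - i) * (- N') ^+ i) *m ((- u) ^+ d)%:M).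
by rewrite mulmxA mulmxE -E -mulmxE xd -scalar_mxM -exprMn xu.
Qed.

Definition frac_i i : R -> K := itm sigma i \o @tofrac R.
HB.instance Definition _ i := GRing.RMorphism.copy (frac_i i) (itm sigma i \o @tofrac R).

Lemma frac_iE i r : frac_i i r = tofrac (itm (phi S) i r).
Proof. exact: itm_sigmaE. Qed.

Lemma frac_i_pi i j : frac_i i (pi ^+ j) = piK ^+ j.
Proof.
by rewrite frac_iE -rmorphXn; congr tofrac; rewrite rmorphXn /= itm_phi_pi.
Qed.

Definition eigenseries i (m : 'rV[KT]_d) :=
  m *m map_mx (fun f => sigmaT i (fracT f)) Phi = kst piK *: m.

(** Solving for m_n costs a factor pi^d, which bounds the denominators. All matrices involved have
    entries in the image of sigma^i, so expansions with coefficients in sigma^i(K) propagate from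
    m_0 to every m_n. *)
Lemma eigen_rec i (m : 'rV[KT]_d) n : eigenseries i m -> (0 < n)%N ->
  exists Q : 'M[R]_d, piK ^+ d *: mcoef n m =
    - (\sum_(j < n) mcoef j m *m map_mx (frac_i i) (map_mx (itm Fr j) (mcoef (n - j) Phi)))
      *m map_mx (frac_i i) Q.
Proof.
move=> em n0; have [Q QE] := pole_inverse n0; exists Q.
have := congr1 (mcoef n) em; rewrite mcoefM big_ord_recr /= subnn.
have -> : mcoef n (kst piK *: m) = piK *: mcoef n m.
  by apply/rowP => j; rewrite !mxE kstE.
have cE (j : nat) l : map_mx (itm (frob (fraction_pchar chR)) j)
    (mcoef l (map_mx (fun f => sigmaT i (fracT f)) Phi)) =
    map_mx (frac_i i) (map_mx (itm Fr j) (mcoef l Phi)).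
  apply/matrixP => r s; rewrite !mxE !itm_frob /frac_i [RHS](rmorphXn (frac_i i)) //.
rewrite cE; under eq_bigr do rewrite cE.
move=> E; have := congr1 (fun M => map_mx (frac_i i) M) QE.
rewrite map_mxM map_mxB !map_scalar_mx /= => QE'.
have piE : frac_i i pi = piK by have := frac_i_pi i 1; rewrite !expr1.
have piE' : frac_i i (pi ^+ d) = piK ^+ d by exact: frac_i_pi.
rewrite -piE' -mul_mx_scalar -QE' mulmxA; congr (_ *m _).
by rewrite mulmxBr mul_mx_scalar piE -E [X in _ - X]addrC opprD addrA subrr sub0r.
Qed.

Lemma eigen_eq0 i (m : 'rV[KT]_d) : eigenseries i m -> mcoef 0 m = 0 -> m = 0.
Proof.
move=> em m0; suff H n : mcoef n m = 0.
  apply/rowP => j; apply/funext => n; have := H n => /rowP/(_ j).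
  by rewrite !mxE.
elim/ltn_ind: n => -[//|n] IH; have [Q QE] := eigen_rec em (ltn0Sn n).
move: QE; rewrite big1 => [|j _]; last by rewrite IH ?mul0mx.
rewrite oppr0 mul0mx => /eqP; rewrite scalemx_eq0 expf_eq0 (negbTE (piK_neq0 S)) andbF.
by move/eqP.
Qed.

(* The denominators of m_n grow linearly in n, while right multiplication by pi
   multiplies m_n by pi^(p^n); hence eigen_tame. *)
Lemma eigen_growth (m : 'rV[KT]_d) : eigenseries 0 m ->
  exists C, forall n k, exists r : R, piK ^+ (C + d * n) * m 0 k n = tofrac r.
Proof.
move=> em; have [C CP] := common_denominator valR (fun k => m 0 k 0%N); exists C.
elim/ltn_ind => -[_ k|n IH k]; first by have [r rE] := CP k; exists r; rewrite muln0 addn0.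
have [Q QE] := eigen_rec em (ltn0Sn n).
have /choice[c cP] (jk : 'I_n.+1 * 'I_d) : exists r : R, piK ^+ (C + d * n) * m 0 jk.2 jk.1 = tofrac r.
  have [r rE] := IH jk.1 (ltn_ord _) jk.2; exists (pi ^+ (d * (n - jk.1)) * r).
  rewrite tofracM tofracXn -rE mulrA -exprD addnCA -mulnDr subnK //.
  by rewrite -ltnS.
have -> : piK ^+ (C + d * n.+1) * m 0 k n.+1 = piK ^+ (C + d * n) * (piK ^+ d *: mcoef n.+1 m) 0 k.
  by rewrite !mxE mulrA -exprD mulnS [(d + _)%N]addnC addnA.
pose cr (j : 'I_n.+1) := \row_k' c (j, k').
pose M (j : nat) := map_mx (itm Fr j) (mcoef (n.+1 - j) Phi).
exists ((- (\sum_(j < n.+1) cr j *m M j) *m Q) 0 k).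
have E2 : piK ^+ (C + d * n) *: (- (\sum_(j < n.+1) mcoef j m *m map_mx (frac_i 0) (M j)) *m map_mx (frac_i 0) Q)
    = map_mx (frac_i 0) (- (\sum_(j < n.+1) cr j *m M j) *m Q).
  rewrite map_mxM map_mxN scalemxAl scalerN; congr (- _ *m _); rewrite scaler_sumr raddf_sum.
  apply: eq_bigr => j _ /=; rewrite map_mxM scalemxAl; congr (_ *m _).
  by apply/rowP => k'; rewrite !mxE; have := cP (j, k').
rewrite QE; have := congr1 (fun M : 'rV[K]_d => M 0 k) E2.
by rewrite mxE => ->; rewrite mxE.
Qed.

Lemma expn_gt_lin C N : exists J, forall n, (J <= n)%N -> (N + (C + d * n) <= p ^ n)%N.
Proof.
have [J JP] := exp2_dominates d (N + C); exists J => n /JP H.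
apply: leq_trans (_ : 2 ^ n <= _)%N; first by rewrite addnA addnC.
by have [->|n0] := posnP n; rewrite // leq_exp2r // (prime_gt1 (pcharf_prime chR)).
Qed.

Lemma eigen_tame (m : 'rV[KT]_d) : eigenseries 0 m ->
  forall k, nullK (m 0 k * mono (frob (fraction_pchar chR)) piK 0 : KT).
Proof.
move=> /eigen_growth[C CP] k N; have [J JP] := expn_gt_lin C N; exists J => j /JP H.
have [r rE] := CP j k; exists (pi ^+ (p ^ j - (N + (C + d * j))) * r).
rewrite mul_monoE subn0 /= itm_frob mulrA -exprD tofracM tofracXn -rE mulrA -exprD.
by rewrite mulrC addnC -addnA; congr (_ ^+ _ * _); lia.
Qed.
End Eigenseries.

(** * The action of z modulo pi *)

Section PolynomialRows.
Variables (l : fieldType) (p : nat) (chl : p \in [pchar l]).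
Local Notation LT := (tps (frob chl)).
Variable d : nat.
Local Notation rowL := ('rV[LT]_d).
Local Notation cst c := (mono (frob chl) c 0).
Local Notation tau a := (mono (frob chl) 1 a).
Implicit Types x y w : rowL.

Definition deg_lt s x := forall k n, (s <= n)%N -> x 0 k n = 0.
Definition polyrow x := exists s, deg_lt s x.

Lemma deg_lt_le s t x : (s <= t)%N -> deg_lt s x -> deg_lt t x.
Proof. by move=> st xs k n tn; apply: xs; exact: leq_trans tn. Qed.

Lemma deg_lt_add s x y : deg_lt s x -> deg_lt s y -> deg_lt s (x + y).
Proof. by move=> xs ys k n sn; rewrite mxE tpsDE xs // ys // addr0. Qed.

Lemma deg_lt_sum s (I : Type) (r : seq I) (Q : pred I) (F : I -> rowL) :
  (forall i, Q i -> deg_lt s (F i)) -> deg_lt s (\sum_(i <- r | Q i) F i).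
Proof.
move=> H; apply: (big_ind (deg_lt s)) => //; last exact: deg_lt_add.
by move=> k n _; rewrite mxE.
Qed.

Lemma deg_lt_mono s x c a : deg_lt s x -> deg_lt (s + a) (mono (frob chl) c a *: x).
Proof.
move=> xs k n sn; rewrite mxE mono_mulE; case: ifP => // an.
by rewrite xs ?rmorph0 ?mulr0 // leq_subRL // addnC.
Qed.

Lemma deg_lt_cst s x c : deg_lt s x -> deg_lt s (cst c *: x).
Proof. by move=> xs; have := deg_lt_mono c (a := 0) xs; rewrite addn0. Qed.

Definition deg_le_mx h (Z : 'M[LT]_d) := forall i j n, (h < n)%N -> Z i j n = 0.

Lemma deg_lt_mul s h x Z : deg_lt s x -> deg_le_mx h Z -> deg_lt (s + h) (x *m Z).
Proof.
move=> xs Zh k n sn; rewrite mxE tps_sumE big1 // => i _; rewrite tpsME big1 // => j _.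
case: (leqP s j) => [sj|js]; first by rewrite xs ?mul0r.
rewrite Zh ?rmorph0 ?mulr0 //; have := ltn_ord j; lia.
Qed.

Lemma deg_le_mxX h Z k : deg_le_mx h Z -> exists h', deg_le_mx h' (Z ^+ k).
Proof.
move=> Zh; elim: k => [|k [h' H]].
  exists 0%N => i j n n0; rewrite expr0 mxE; case: (i == j); rewrite ?mulr0n // mulr1n.
  by rewrite tps1E gtn_eqF.
exists (h + h')%N => i j n hn; rewrite exprS -mulmxE mxE tps_sumE big1 // => i' _.
rewrite tpsME big1 // => u _; case: (leqP u h) => [uh|hu]; last by rewrite Zh ?mul0r.
by rewrite H ?rmorph0 ?mulr0 //; lia.
Qed.

Definition vec s x : 'rV[l]_(s * d) := mxvec (\matrix_(j < s, k < d) x 0 k j).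

Lemma vec_inj s x : deg_lt s x -> vec s x = 0 -> x = 0.
Proof.
move=> xs /(congr1 vec_mx); rewrite mxvecK linear0 => /matrixP x0.
apply/rowP => k; apply/funext => n; rewrite mxE.
case: (leqP s n) => [/xs -> //|ns].
by have := x0 (Ordinal ns) k; rewrite !mxE.
Qed.

Lemma vecD s x y : vec s (x + y) = vec s x + vec s y.
Proof.
rewrite /vec -linearD; congr mxvec; by apply/matrixP => j k; rewrite !mxE.
Qed.
Lemma vec0 s : vec s 0 = 0.
Proof. by rewrite -[RHS](linear0 (@mxvec l s d)); congr mxvec; apply/matrixP => j k; rewrite !mxE. Qed.
Lemma vec_cst s c x : vec s (cst c *: x) = c *: vec s x.
Proof.
by rewrite /vec -linearZ; congr mxvec; apply/matrixP => j k; rewrite !mxE constM.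
Qed.

Definition devec s (v : 'rV[l]_(s * d)) : rowL :=
  \row_k ((fun n => if insub n is Some j then vec_mx v j k else 0) : LT).

Lemma devec_deg s v : deg_lt s (@devec s v).
Proof. by move=> k n sn; rewrite mxE insubF // ltnNge sn. Qed.
Lemma devecK s v : vec s (@devec s v) = v.
Proof.
rewrite -[RHS]vec_mxK; congr mxvec; apply/matrixP => j k; rewrite !mxE.
by rewrite /= valK !mxE.
Qed.
Lemma vecK s x : deg_lt s x -> devec (vec s x) = x.
Proof.
move=> xs; apply/eqP; rewrite -subr_eq0; apply/eqP; apply: (@vec_inj s).
  move=> k n sn; rewrite mxE tpsDE devec_deg // add0r mxE tpsNE xs ?oppr0 //.
have -> : vec s (devec (vec s x) - x) = vec s (devec (vec s x)) - vec s x.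
  apply/eqP; rewrite eq_sym subr_eq -vecD subrK //.
by rewrite devecK subrr.
Qed.

Lemma vec_sum s (I : Type) (r : seq I) (F : I -> rowL) :
  vec s (\sum_(i <- r) F i) = \sum_(i <- r) vec s (F i).
Proof. exact: (big_morph (vec s) (@vecD s) (vec0 s)). Qed.

Lemma deg_lt_opp s x : deg_lt s x -> deg_lt s (- x).
Proof. by move=> xs k n sn; rewrite mxE tpsNE xs ?oppr0. Qed.

Lemma vec_eq s x y : deg_lt s x -> deg_lt s y -> vec s x = vec s y -> x = y.
Proof. by move=> xs ys E; rewrite -(vecK xs) -(vecK ys) E. Qed.

Lemma devec_sum s (I : Type) (r : seq I) (c : I -> l) (v : I -> 'rV[l]_(s * d)) :
  devec (\sum_(i <- r) c i *: v i) = \sum_(i <- r) cst (c i) *: devec (v i).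
Proof.
apply: (@vec_eq s); first exact: devec_deg.
  by apply: deg_lt_sum => i _; apply: deg_lt_cst; exact: devec_deg.
rewrite devecK vec_sum; apply: eq_bigr => i _.
by rewrite vec_cst devecK.
Qed.

Lemma ker_vector m n (M : 'M[l]_(m, n)) : (n < m)%N -> exists v : 'rV_m, v != 0 /\ v *m M = 0.
Proof.
move=> nm; have k0 : kermx M != 0.
  rewrite -mxrank_eq0 mxrank_ker subn_eq0 -ltnNge.
  exact: leq_ltn_trans (rank_leq_col M) nm.
by have /rowV0Pn[v /sub_kermxP vM v0] := k0; exists v.
Qed.

Lemma dependent (I : finType) (v : I -> rowL) t : (forall i, deg_lt t (v i)) ->
  (t * d < #|I|)%N -> exists c : I -> l, (exists i, c i != 0) /\ \sum_i cst (c i) *: v i = 0.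
Proof.
move=> vt tI; pose M := \matrix_(i < #|I|) vec t (v (enum_val i)).
have [u [u0 uM]] := ker_vector M tI; exists (fun i => u 0 (enum_rank i)); split.
  have [i ui] : exists i, u 0 i != 0.
    apply: contrapT => H; move/eqP: u0; apply; apply/rowP => i; rewrite mxE.
    by apply: contrapT => /eqP ui; apply: H; exists i.
  by exists (enum_val i); rewrite enum_valK.
apply: (@vec_inj t); first by apply: deg_lt_sum => i _; exact: deg_lt_cst.
rewrite vec_sum -[RHS]uM mulmx_sum_row (reindex (@enum_val I I)) /=; last first.
  by apply: onW_bij; exact: enum_val_bij.
by apply: eq_bigr => i _; rewrite vec_cst enum_valK rowK.
Qed.

Lemma mono_cst_tau c a : mono (frob chl) c a = cst c * tau a.
Proof. by rewrite mono_mul mulr1. Qed.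

(* independence over l{tau} of x, x Z, ..., x Z^d when x Z^d <> 0 = x Z^(d+1) *)
Lemma ker_stable h Z x : deg_le_mx h Z -> polyrow x ->
  x *m Z ^+ d.+1 = 0 -> x *m Z ^+ d = 0.
Proof.
move=> Zh [D xD] xZ0; apply: contrapT => xZ.
have /choice[H HP] i : exists h', deg_le_mx h' (Z ^+ i) by exact: deg_le_mxX Zh.
pose D' := (\sum_(i < d.+1) (D + H i))%N.
have xZD (i : 'I_d.+1) : deg_lt D' (x *m Z ^+ i).
  by apply: deg_lt_le (deg_lt_mul xD (HP i)); rewrite /D' (bigD1 i) //= leq_addr.
(* The (d + 1) s rows tau^a x Z^i with a < s lie in a space of dimension (D' + s) d; s > D' d makes
   them dependent. *)
pose s := (D' * d).+1.
have [||c [[[i0 a0] ca] cE]] := @dependent ('I_d.+1 * 'I_s)%type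
    (fun ia => tau ia.2 *: (x *m Z ^+ ia.1)) (D' + s).
- move=> [i a] /=; apply: deg_lt_le (deg_lt_mono 1 (xZD i)); by rewrite leq_add2l ltnW.
- rewrite card_prod !card_ord /s; nia.
pose f (i : nat) : LT := \sum_(a < s) mono (frob chl) (if insub i is Some i' then c (i', a) else 0) a.
have fE (i : 'I_d.+1) : f i = \sum_(a < s) mono (frob chl) (c (i, a)) a.
  by apply: eq_bigr => a _; rewrite valK.
have sum0 : \sum_(i < d.+1) f i *: (x *m Z ^+ i) = 0.
  rewrite -[RHS]cE (eq_bigr (fun i : 'I_d.+1 => \sum_(a < s) cst (c (i, a)) *: (tau a *: (x *m Z ^+ i)))).
    by rewrite pair_bigA; apply: eq_bigr => -[i a].
  by move=> i _; rewrite fE scaler_suml; apply: eq_bigr => a _; rewrite scalerA -mono_cst_tau.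
have Zbig j : (d < j)%N -> x *m Z ^+ j = 0.
  by move=> dj; rewrite -(subnKC dj) exprD -mulmxE mulmxA xZ0 mul0mx.
(* Multiplying the relation by Z^(d - j) kills the terms of index above j, those below j vanish by
   induction, and f_j x Z^d = 0 forces f_j = 0 in the absence of zero divisors. *)
have f0 j : (j <= d)%N -> f j = 0.
  elim/ltn_ind: j => j IH jd.
  have := congr1 (fun M => M *m Z ^+ (d - j)) sum0; rewrite mul0mx mulmx_suml.
  rewrite (bigD1 (Ordinal (jd : (j < d.+1)%N))) //= big1 => [|i]; last first.
    rewrite -val_eqE /= neq_ltn => /orP[ij|ji].
      by rewrite IH ?scale0r ?mul0mx // ltnW // (leq_trans ij).
    rewrite -scalemxAl -mulmxA mulmxE -exprD Zbig ?scaler0 //; lia.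
  rewrite addr0 -scalemxAl -mulmxA mulmxE -exprD subnKC // => E.
  have [k yk] : exists k, (x *m Z ^+ d) 0 k <> 0.
    apply: contrapT => N; apply: xZ; apply/rowP => k; rewrite [RHS]mxE.
    by apply: contrapT => yk; apply: N; exists k.
  have := congr1 (fun M : rowL => M 0 k) E; rewrite !mxE => /tps_mul_eq0[//|].
  by move=> yk0; case: yk; rewrite mxE.
have := congr1 (fun f : LT => f a0) (f0 i0 (leq_ord i0)); rewrite fE tps_sumE.
rewrite (bigD1 a0) //= monoE eqxx big1 ?addr0 => [c0|a]; first by rewrite c0 eqxx in ca.
by rewrite -val_eqE /= eq_sym => /negbTE aa; rewrite monoE aa.
Qed.

Section Cokernel.
Variables (h a : nat) (Z : 'M[LT]_d).
Hypotheses (Zh : deg_le_mx h Z) (ah : (a <= h)%N).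
Hypothesis Zst : forall x, polyrow x -> x *m Z *m Z = 0 -> x *m Z = 0.

(** The image of Z alone can have infinite codimension when Z is not injective; tau^a times the
    kernel makes up for it. The scalars stand to the left of tau^a, since tau^a x with x in the
    kernel only yields p^a-th powers of scalars. *)
Definition big_image u := exists w n (c : 'I_n -> l) (x : 'I_n -> rowL),
  [/\ polyrow w, forall i, polyrow (x i) /\ x i *m Z = 0 &
      u = w *m Z + \sum_i mono (frob chl) (c i) a *: x i].

Definition mulZ_mx s : 'M[l]_(s * d, (s + h) * d) :=
  \matrix_i vec (s + h) (devec (delta_mx 0 i : 'rV[l]_(s * d)) *m Z).

Lemma mulZ_mxE s (u : 'rV[l]_(s * d)) : u *m mulZ_mx s = vec (s + h) (devec u *m Z).
Proof.
rewrite mulmx_sum_row {2}(row_sum_delta u) devec_sum mulmx_suml vec_sum.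
by apply: eq_bigr => i _; rewrite rowK -scalemxAl vec_cst.
Qed.

Lemma mulZ_eq0 s (u : 'rV[l]_(s * d)) : u *m mulZ_mx s = 0 <-> devec u *m Z = 0.
Proof.
rewrite mulZ_mxE; split=> [|->]; last exact: vec0.
by apply: vec_inj; apply: deg_lt_mul Zh; exact: devec_deg.
Qed.

(** Up to a shift, tau^a raises the coefficients of a row to the power p^a, and a field morphism
    preserves rank. *)
Lemma tau_free s m (B : 'M[l]_(m, s * d)) (b : 'I_m -> l) : row_free B ->
  \sum_i mono (frob chl) (b i) a *: devec (row i B) = 0 -> forall i, b i = 0.
Proof.
move=> fB E; pose al := itm (frob chl) a.
have fB' : row_free (map_mx al B) by rewrite row_free_map.
have : (\row_i b i) *m map_mx al B = 0.
  apply/rowP => j; rewrite [RHS]mxE mxE; case/mxvec_indexP: j => n k.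
  have := congr1 (fun x : rowL => x 0 k (n + a)%N) E; rewrite summxE tps_sumE => E1.
  transitivity ((0 : rowL) 0 k (n + a)%N); last by rewrite mxE.
  by rewrite -E1; apply: eq_bigr => i _; rewrite !mxE mono_mulE leq_addl addnK valK !mxE.
move=> E' i; have /rowP/(_ i) : \row_i b i = 0 by apply: (row_free_inj fB'); rewrite E' mul0mx.
by rewrite !mxE.
Qed.

(* Count dimensions among rows of degree < s: x Z for all x, together with
   tau^a ker Z, fill all but h d dimensions of the rows of degree < s + h. *)
Lemma cokernel_dependent N (v : 'I_N -> rowL) : (h * d < N)%N -> (forall i, polyrow (v i)) ->
  exists c : 'I_N -> l, (exists i, c i != 0) /\ big_image (\sum_i cst (c i) *: v i).
Proof.
move=> hN /choice[t tP]; pose s := (\sum_i t i)%N.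
have vs i : deg_lt (s + h) (v i).
  by apply: deg_lt_le (tP i); rewrite /s (bigD1 i) //= -addnA leq_addr.
(* The family V consists of the N given rows, the image of a complement of the kernel, and tau^a
   times the kernel: N + s d members in a space of dimension (s + h) d. *)
pose M := mulZ_mx s; pose Kb := row_base (kermx M); pose Cb := row_base (kermx M)^C%MS.
pose V (i : 'I_N + ('I_(\rank (kermx M)^C) + 'I_(\rank (kermx M)))) := match i with
  | inl i => v i
  | inr (inl i) => devec (row i Cb) *m Z
  | inr (inr i) => tau a *: devec (row i Kb)
  end.
have KbZ i : devec (row i Kb) *m Z = 0.
  apply/mulZ_eq0; apply/sub_kermxP; apply: submx_trans (row_sub i Kb) _.
  by rewrite eq_row_base.
have [||c [c0 cE]] := @dependent _ V (s + h).
- move=> [i|[i|i]] //=; first by apply: deg_lt_mul Zh; exact: devec_deg.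
  by apply: deg_lt_le (deg_lt_mono 1 (devec_deg _)); rewrite leq_add2l.
- rewrite !card_sum !card_ord mxrank_compl subnK ?rank_leq_col //.
  by rewrite mulnDl addnC ltn_add2r.
move: cE; rewrite !big_sumType /=.
set yv := \sum_(i < N) _; set yc := \sum_(i < \rank _^C) _; set yk := \sum_(i < _) _ => cE.
exists (fun i => c (inl i)); split; last first.
  exists (- \sum_i cst (c (inr (inl i))) *: devec (row i Cb)), (\rank (kermx M)),
    (fun i => - c (inr (inr i))), (fun i => devec (row i Kb)); split.
  - exists s; apply: deg_lt_opp; apply: deg_lt_sum => i _; apply: deg_lt_cst; exact: devec_deg.
  - by move=> i; split; [exists s; exact: devec_deg | exact: KbZ].
  rewrite mulNmx mulmx_suml.
  have -> : \sum_i cst (c (inr (inl i))) *: devec (row i Cb) *m Z = yc.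
    by apply: eq_bigr => i _; rewrite scalemxAl.
  have -> : \sum_i mono (frob chl) (- c (inr (inr i))) a *: devec (row i Kb) = - yk.
    rewrite -sumrN; apply: eq_bigr => i _; rewrite -scaleNr scalerA mulNr -mono_cst_tau.
    congr (_ *: _); apply: (addrI (mono (frob chl) (c (inr (inr i))) a)).
    by rewrite -monoD !subrr mono0.
  by apply/eqP; rewrite -opprD -addr_eq0 cE.
apply: contrapT => cl0; have cl i : c (inl i) = 0.
  by apply: contrapT => /eqP ci; apply: cl0; exists i.
have yv0 : yv = 0 by apply: big1 => i _; rewrite cl mono0 scale0r.
rewrite yv0 add0r in cE.
pose al := \row_i c (inr (inl i)).
have ycE : yc = devec (al *m Cb) *m Z.
  rewrite [al *m Cb]mulmx_sum_row devec_sum mulmx_suml; apply: eq_bigr => i _.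
  by rewrite mxE scalemxAl.
have ykZ : yk *m Z = 0.
  by rewrite mulmx_suml big1 // => i _; rewrite -!scalemxAl KbZ !scaler0.
(* Z kills yk, so the relation gives yc Z = 0; but yc is itself of the form w Z, and [Zst] says that
   such a row vanishes. *)
have yc0 : yc = 0.
  rewrite ycE; apply: Zst; first by exists s; exact: devec_deg.
  by have := congr1 (fun x => x *m Z) cE; rewrite mulmxDl ykZ addr0 mul0mx ycE.
have al0 : al = 0.
  have fC : row_free Cb by exact: row_base_free.
  apply: (row_free_inj fC); rewrite mul0mx.
  have ak : (al *m Cb <= kermx M)%MS by apply/sub_kermxP/mulZ_eq0; rewrite -ycE.
  have ac : (al *m Cb <= (kermx M)^C)%MS.
    by apply: submx_trans (submxMl _ _) _; rewrite eq_row_base.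
  by apply/eqP; rewrite -submx0 -(capmx_compl (kermx M)) sub_capmx ak ac.
have yk0 : yk = 0 by move: cE; rewrite yc0 add0r.
have ck := @tau_free s _ Kb (fun i => c (inr (inr i))) (row_base_free _).
case: c0 => -[i|[i|i]]; rewrite ?cl ?eqxx //.
  by have := congr1 (fun x : 'rV__ => x 0 i) al0; rewrite !mxE => ->; rewrite eqxx.
rewrite ck ?eqxx //; rewrite -[RHS]yk0; apply: eq_bigr => j _.
by rewrite scalerA -mono_cst_tau.
Qed.

Lemma big_image_scale c u : big_image u -> big_image (cst c *: u).
Proof.
move=> [w [n [b [x [[s ws] xP ->]]]]]; exists (cst c *: w), n, (fun i => c * b i), x; split=> //.
  by exists s; exact: deg_lt_cst.
rewrite scalerDr scalemxAl scaler_sumr; congr (_ + _); apply: eq_bigr => i _.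
by rewrite scalerA mono_mul.
Qed.

(** A family independent modulo [big_image] has at most h d members, and one of maximal length
    generates the quotient. *)
Lemma cokernel_generators : exists n (G : 'I_n -> rowL), (forall i, polyrow (G i)) /\
  forall w, polyrow w -> exists c : 'I_n -> l, exists u,
    big_image u /\ w = \sum_i cst (c i) *: G i + u.
Proof.
pose free n := exists G : 'I_n -> rowL, (forall i, polyrow (G i)) /\
  forall c : 'I_n -> l, big_image (\sum_i cst (c i) *: G i) -> forall i, c i = 0.
have free0 : `[< free 0%N >].
  by apply/asboolP; exists (fun=> 0); split=> [[]|c _ []].
have bnd n : `[< free n >] -> (n <= h * d)%N.
  move=> /asboolP[G [Gp Gf]]; rewrite leqNgt; apply/negP => nN.
  have [c [[i ci] cU]] := cokernel_dependent nN Gp.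
  by rewrite (Gf c cU) eqxx in ci.
have [n /asboolP[G [Gp Gf]] nmax] := ex_maxnP (ex_intro _ 0%N free0) bnd.
exists n, G; split=> // w wp; apply: contrapT => H.
suff /asboolP/nmax : free n.+1 by rewrite ltnn.
pose G' (i : 'I_n.+1) := if unlift ord0 i is Some j then G j else w.
exists G'; split=> [i|c]; first by rewrite /G'; case: unlift.
rewrite big_ord_recl {1}/G' unlift_none.
rewrite (eq_bigr (fun i => cst (c (lift ord0 i)) *: G i)) => [|i _]; last by rewrite /G' liftK.
move=> cU; have [c0|c0] := eqVneq (c ord0) 0.
  rewrite c0 mono0 scale0r add0r in cU => i.
  by case: (unliftP ord0 i) => [j ->|->] //; exact: (Gf _ cU j).
case: H; exists (fun i => - (c ord0)^-1 * c (lift ord0 i)).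
exists (cst (c ord0)^-1 *: (cst (c ord0) *: w + \sum_i cst (c (lift ord0 i)) *: G i)).
split; first exact: big_image_scale.
rewrite scalerDr scalerA -monoMl mulVf // mono1 scale1r scaler_sumr addrCA -big_split /= big1 ?addr0 //.
move=> i _; rewrite scalerA -monoMl -scalerDl mulNr -monoD addNr mono0.
by rewrite scale0r.
Qed.
End Cokernel.
End PolynomialRows.

Lemma sub3K (V : zmodType) (w a b c : V) : w = a + b + c + (w - a - b - c).
Proof.
have -> : w - a - b - c = w - (a + b + c) by rewrite !opprD !addrA.
by rewrite addrC subrK.
Qed.

Lemma addr_shuffle6 (V : zmodType) (a b c d e f : V) :
  a + (b + c) + (d - e) + f = c - e + a + (b + d + f).
Proof. by rewrite !addrA [LHS](ACl (3*5*1*2*4*6)). Qed.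

Lemma sub3_eq0 (V : zmodType) (a b c : V) : a + (b + c) - a - b - c = 0.
Proof. by rewrite -!addrA -!opprD !addrA subrr. Qed.

(** * The cokernel of y |-> y Phi - pi y on null rows *)

Section Fredholm.
Variables (S : base) (p : nat).
Local Notation R := (base_ring S).
Local Notation pi := (ppi S).
Local Notation bR := (base_calg S).
Local Notation K := {fraction R}.
Hypothesis chR : p \in [pchar R].
Hypothesis valR : forall x : R, x != 0 -> exists N y, x * y = pi ^+ N.
Variables (l : fieldType) (res : {rmorphism R -> l}).
Hypothesis res_ker : forall x, res x = 0 -> exists y, x = pi * y.
Hypothesis res_pi : res pi = 0.
Hypothesis res_surj : forall a, exists x, res x = a.
Variable chl : p \in [pchar l].
Local Notation Fr := (frob chR).
Local Notation RT := (tps (frob chR)).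
Local Notation LT := (tps (frob chl)).
Local Notation KT := (tps (frob (fraction_pchar chR))).
Local Notation fracT := (@fracT S p chR).
Local Notation kst := (@kst S p chR).
Local Notation piK := (tofrac pi : K).
Local Notation rst c := (mono Fr c 0).

Lemma res_frob x : res (Fr x) = frob chl (res x).
Proof. by rewrite /frob /= !pFrobenius_autE rmorphXn. Qed.
Definition resT : RT -> LT := tpsmap res_frob.
HB.instance Definition _ := GRing.RMorphism.on resT.

Lemma resT_mono c a : resT (mono Fr c a) = mono (frob chl) (res c) a.
Proof. exact: tpsmap_mono. Qed.

Lemma res_dvpi x : @dvpi S bR 1 x -> res x = 0.
Proof. by move=> [y ->]; rewrite rmorphM expr1 /= res_pi mul0r. Qed.

Variable d : nat.
Implicit Types x y w : 'rV[RT]_d.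

Lemma res_poly x : nullRrow x -> polyrow (map_mx resT x).
Proof.
move=> nx; have /choice[J JP] k := nx k 1%N; exists (\sum_k J k)%N => k n Jn.
rewrite mxE; apply: res_dvpi; apply: JP; apply: leq_trans Jn.
by rewrite (bigD1 k) //= leq_addr.
Qed.

Lemma res_mx_deg (M : 'M[RT]_d) : nullRmx M -> exists h, deg_le_mx h (map_mx resT M).
Proof.
move=> nM; have /choice[J JP] (ij : 'I_d * 'I_d) := nM ij.1 ij.2 1%N.
exists (\sum_ij J ij)%N => i j n Jn; rewrite mxE; apply: res_dvpi; apply: (JP (i, j)).
by apply: leq_trans (ltnW Jn); rewrite (bigD1 (i, j)) //= leq_addr.
Qed.

Lemma lift_poly (y : 'rV[LT]_d) : polyrow y -> exists x, nullRrow x /\ map_mx resT x = y.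
Proof.
move=> [s ys]; have /choice[r rP] := res_surj.
exists (\row_k ((fun n => if (n < s)%N then r (y 0 k n) else 0) : RT)); split=> [k|].
  by rewrite mxE; apply: (@null_fin S bR _ s) => j sj; rewrite ltnNge sj.
apply/rowP => k; rewrite !mxE; apply/funext => n; rewrite /resT tpsmapE.
by case: ltnP => [_|sn]; [exact: rP | rewrite rmorph0 ys].
Qed.

Lemma res_eq0 x : nullRrow x -> map_mx resT x = 0 -> exists y, nullRrow y /\ x = rst pi *: y.
Proof.
move=> nx x0; have /choice[y yP] (kn : 'I_d * nat) : exists v : R, x 0 kn.1 kn.2 = pi * v.
  apply: res_ker; have := congr1 (fun M : 'rV[LT]_d => M 0 kn.1 kn.2) x0.
  by rewrite !mxE.
exists (\row_k ((fun n => y (k, n)) : RT)); split=> [k|]; last first.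
  by apply/rowP => k; rewrite !mxE; apply/funext => n; rewrite constM (yP (k, n)).
rewrite mxE => N; have [J JP] := nx k N.+1; exists J => j /JP [z zE].
exists z; apply: (mulfI (ppi_neq0 S)); rewrite -(yP (k, j)) zE /=.
by rewrite exprS mulrA.
Qed.

Lemma nullRrow_add x y : nullRrow x -> nullRrow y -> nullRrow (x + y).
Proof. by move=> nx ny k; rewrite mxE; apply: null_add. Qed.
Lemma nullRrow_scale (c : RT) x : @null S bR c -> nullRrow x -> nullRrow (c *: x).
Proof. by move=> nc nx k; rewrite mxE; apply: nullM. Qed.
Lemma nullRrow_opp x : nullRrow x -> nullRrow (- x).
Proof. by move=> nx k; rewrite mxE; exact: nullN. Qed.
Lemma nullRrow0 : nullRrow (0 : 'rV[RT]_d).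
Proof. by move=> k; rewrite mxE; exact: null_zero. Qed.
Lemma nullRrow_sum (I : Type) (r : seq I) (Q : pred I) (F : I -> 'rV[RT]_d) :
  (forall i, Q i -> nullRrow (F i)) -> nullRrow (\sum_(i <- r | Q i) F i).
Proof. by move=> H; apply: big_ind => //; [exact: nullRrow0 | exact: nullRrow_add]. Qed.
Lemma rst_null c : @null S bR (rst c : RT). Proof. exact: null_mono. Qed.
Lemma rstM c c' : rst (c * c') = rst c * rst c' :> RT. Proof. exact: monoMl. Qed.
Lemma rst_comm c c' : rst c * rst c' = rst c' * rst c :> RT.
Proof. by rewrite -!rstM mulrC. Qed.

Variable Phi : 'M[RT]_d.
Hypothesis nPhi : nullRmx Phi.

Definition pole y := y *m Phi - rst pi *: y.

Lemma poleD x y : pole (x + y) = pole x + pole y.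
Proof. by rewrite /pole mulmxDl scalerDr opprD addrACA. Qed.
Lemma poleZ c y : pole (rst c *: y) = rst c *: pole y.
Proof. by rewrite /pole -scalemxAl scalerBr !scalerA rst_comm. Qed.
Lemma poleM y : pole (y *m Phi) = pole y *m Phi.
Proof. by rewrite /pole mulmxBl -scalemxAl. Qed.
Lemma pole0 : pole 0 = 0. Proof. by rewrite /pole mul0mx scaler0 subr0. Qed.
Lemma poleN y : pole (- y) = - pole y.
Proof. by rewrite /pole mulNmx scalerN -opprD. Qed.
Lemma pole_sum (I : Type) (r : seq I) (F : I -> 'rV[RT]_d) :
  pole (\sum_(i <- r) F i) = \sum_(i <- r) pole (F i).
Proof. exact: (big_morph pole poleD pole0). Qed.

Lemma pole_pow k y : nullRrow y ->
  exists y', nullRrow y' /\ y *m Phi ^+ k - rst (pi ^+ k) *: y = pole y'.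
Proof.
move=> ny; elim: k => [|k [y' [ny' E]]].
  by exists 0; split; [exact: nullRrow0 | rewrite !expr0 mulmx1 mono1 scale1r subrr pole0].
exists (y' *m Phi + rst (pi ^+ k) *: y); split.
  apply: nullRrow_add; first exact: nullRrow_mul.
  by apply: nullRrow_scale => //; exact: rst_null.
rewrite poleD poleM poleZ -E mulmxBl -scalemxAl -mulmxA mulmxE -exprSr /pole scalerBr.
by rewrite addrA subrK scalerA -rstM -exprSr.
Qed.

Local Notation nu := d.+1.
Local Notation Phib := (map_mx resT Phi).

Lemma map_mxX (F F' : pzRingType) (rho : {rmorphism F -> F'}) n (M : 'M[F]_n) j :
  map_mx rho (M ^+ j) = map_mx rho M ^+ j.
Proof.
elim: j => [|j IH]; first by rewrite !expr0 map_mx1.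
by rewrite !exprS -IH -!mulmxE map_mxM.
Qed.

Lemma nullRmxX j : nullRmx (Phi ^+ j).
Proof.
elim: j => [|j IH] i i'.
  by rewrite expr0 mxE; case: (i == i'); rewrite ?mulr1n ?mulr0n -?mono1; [exact: null_mono | exact: null_zero].
rewrite exprS -mulmxE mxE; apply: null_sum => i0 _.
by apply: nullM; [exact: nPhi | exact: IH].
Qed.

Lemma resT_mulX x j : map_mx resT (x *m Phi ^+ j) = map_mx resT x *m Phib ^+ j.
Proof. by rewrite map_mxM map_mxX. Qed.

(* Modulo the image of pole, Phi acts as pi. Hence, writing w modulo pi as
   y Phi^nu + sum b tau^nu x + finitely many generators, with x Phi^nu = 0 mod pi,
   the first two terms multiplied by pi^nu become divisible by pi^(nu+1): the
   second one because tau^nu pi = pi^(p^nu) tau^nu. *)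
Lemma fredholm_step : exists n (G : 'I_n -> 'rV[RT]_d), (forall i, nullRrow (G i)) /\
  forall w, nullRrow w -> exists y (r : 'I_n -> R) w', [/\ nullRrow y, nullRrow w' &
    rst (pi ^+ nu) *: w = pole y + \sum_i rst (r i) *: G i + rst (pi ^+ nu.+1) *: w'].
Proof.
have [h Zh] := res_mx_deg nPhi; have [h' Zh'] := deg_le_mxX nu Zh.
(* The degree bound is raised to at least nu, because the dimension count must also accommodate
   multiplication by tau^nu. *)
pose H := (h' + nu)%N.
have ZH : deg_le_mx H (Phib ^+ nu) by move=> i j n Hn; apply: Zh'; apply: leq_ltn_trans Hn; rewrite leq_addr.
(* The kernels of the powers of the reduction are constant from the exponent d on. As nu > d, the
   nu-th power has the same kernel as its square, as the cokernel count requires. *)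
have stab j (x : 'rV[LT]_d) : polyrow x -> x *m Phib ^+ (d + j) = 0 -> x *m Phib ^+ d = 0.
  elim: j x => [|j IH] x xp; first by rewrite addn0.
  rewrite addnS => E; apply: IH => //.
  have xjp : polyrow (x *m Phib ^+ j).
    have [hj Zj] := deg_le_mxX j Zh; have [s xs] := xp.
    by exists (s + hj)%N; exact: deg_lt_mul.
  rewrite addnC exprD -mulmxE mulmxA; apply: (ker_stable Zh xjp).
  by rewrite -mulmxA mulmxE -exprD addnS addnC.
have st (x : 'rV[LT]_d) : polyrow x -> x *m Phib ^+ nu *m Phib ^+ nu = 0 -> x *m Phib ^+ nu = 0.
  move=> xp; rewrite -mulmxA mulmxE -exprD => E.
  rewrite exprSr -mulmxE mulmxA (stab (nu + 1)%N x xp) ?mul0mx //.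
  by rewrite -E; congr (_ *m _ ^+ _); lia.
have nuH : (nu <= H)%N by rewrite leq_addl.
have [n [Gb [Gbp Gbgen]]] := cokernel_generators ZH nuH st.
have /choice[G GP] i := lift_poly (Gbp i).
exists n, (fun i => rst (pi ^+ nu) *: G i); split=> [i|w nw].
  by apply: nullRrow_scale; [exact: rst_null | case: (GP i)].
have [cb [ub [[yb [m [bb [xb [ybp xbP ->]]]]] wE]]] := Gbgen _ (res_poly nw).
have /choice[c cP] i := res_surj (cb i); have /choice[b bP] i := res_surj (bb i).
have [y [ny yE]] := lift_poly ybp.
have /choice[x xP] i : exists v, nullRrow v /\ map_mx resT v = xb i.
  by apply: lift_poly; case: (xbP i).
pose w0 := w - \sum_i rst (c i) *: G i - y *m Phi ^+ nu - \sum_i mono Fr (b i) nu *: x i.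
have nw0 : nullRrow w0.
  rewrite /w0; do ![apply: nullRrow_add => //; last apply: nullRrow_opp].
  - by apply: nullRrow_sum => i _; apply: nullRrow_scale; [exact: rst_null | case: (GP i)].
  - by apply: nullRrow_mul => //; exact: nullRmxX.
  - by apply: nullRrow_sum => i _; apply: nullRrow_scale; [exact: null_mono | case: (xP i)].
have resZ (cc : RT) x' : map_mx resT (cc *: x') = resT cc *: map_mx resT x'.
  by apply/rowP => k; rewrite !mxE; exact: rmorphM.
have resS (m' : nat) (F : 'I_m' -> 'rV[RT]_d) : map_mx resT (\sum_i F i) = \sum_i map_mx resT (F i).
  exact: raddf_sum.
have [w1 [nw1 w1E]] : exists w1, nullRrow w1 /\ w0 = rst pi *: w1.
  apply: res_eq0 => //; rewrite /w0 !map_mxB resT_mulX yE !resS wE.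
  have -> : \sum_i map_mx resT (rst (c i) *: G i) = \sum_i mono (frob chl) (cb i) 0 *: Gb i.
    by apply: eq_bigr => i _; rewrite resZ resT_mono cP; case: (GP i) => _ ->.
  have -> : \sum_i map_mx resT (mono Fr (b i) nu *: x i) = \sum_i mono (frob chl) (bb i) nu *: xb i.
    by apply: eq_bigr => i _; rewrite resZ resT_mono bP; case: (xP i) => _ ->.
  exact: sub3_eq0.
have wE' : w = \sum_i rst (c i) *: G i + y *m Phi ^+ nu + \sum_i mono Fr (b i) nu *: x i + rst pi *: w1.
  by rewrite -w1E; exact: sub3K.
have [y1 [ny1 y1E]] : exists y1, nullRrow y1 /\
    (rst (pi ^+ nu) *: y) *m Phi ^+ nu = rst (pi ^+ nu.+1) *: (rst (pi ^+ d) *: y) + pole y1.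
  have [|y1 [ny1 y1E]] := @pole_pow nu (rst (pi ^+ nu) *: y).
    by apply: nullRrow_scale => //; exact: rst_null.
  exists y1; split=> //.
  have -> : rst (pi ^+ nu.+1) *: (rst (pi ^+ d) *: y) = rst (pi ^+ nu) *: (rst (pi ^+ nu) *: y).
    by rewrite !scalerA -!rstM -!exprD addSnnS.
  by rewrite -y1E addrC subrK.
have /choice[X1 X1P] i : exists zX : 'rV[RT]_d * 'rV[RT]_d, [/\ nullRrow zX.1, nullRrow zX.2 &
    rst (pi ^+ nu) *: (mono Fr (b i) nu *: x i) = rst (pi ^+ nu.+1) *: zX.1 - pole zX.2].
  have [nx xE] := xP i.
  have [z [nz zE]] : exists z, nullRrow z /\ x i *m Phi ^+ nu = rst pi *: z.
    apply: res_eq0; first by apply: nullRrow_mul => //; exact: nullRmxX.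
    by rewrite resT_mulX xE; case: (xbP i).
  have [|X [nX XE]] := @pole_pow nu (mono Fr (b i) nu *: x i).
    by apply: nullRrow_scale => //; exact: null_mono.
  exists (mono Fr (b i * pi ^+ (p ^ nu - nu.+1)) nu *: z, X); split=> //=.
    by apply: nullRrow_scale => //; exact: null_mono.
  rewrite -XE opprB addrC -[LHS]addr0; apply/eqP; rewrite -subr_eq0.
  have -> : rst (pi ^+ nu.+1) *: (mono Fr (b i * pi ^+ (p ^ nu - nu.+1)) nu *: z) =
      (mono Fr (b i) nu *: x i) *m Phi ^+ nu.
    rewrite -scalemxAl zE !scalerA !mono_mul !itm_frob addn0 add0n expn0 expr1 mulrCA -exprD subnKC //.
    exact/ltn_expl/prime_gt1/(pcharf_prime chR).
  by rewrite addr0 -addrA addNr addr0 subrr.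
exists (y1 - \sum_i (X1 i).2), c, (rst (pi ^+ d) *: y + \sum_i (X1 i).1 + w1); split.
- apply: nullRrow_add => //; apply: nullRrow_opp; apply: nullRrow_sum => i _.
  by have [] := X1P i.
- apply: nullRrow_add => //; apply: nullRrow_add.
    by apply: nullRrow_scale => //; exact: rst_null.
  by apply: nullRrow_sum => i _; have [] := X1P i.
rewrite {1}wE' !scalerDr.
have -> : rst (pi ^+ nu) *: (\sum_i rst (c i) *: G i) = \sum_i rst (c i) *: (rst (pi ^+ nu) *: G i).
  by rewrite scaler_sumr; apply: eq_bigr => i _; rewrite !scalerA rst_comm.
have -> : rst (pi ^+ nu) *: (y *m Phi ^+ nu) = rst (pi ^+ nu.+1) *: (rst (pi ^+ d) *: y) + pole y1.
  by rewrite scalemxAl.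
have -> : rst (pi ^+ nu) *: (\sum_i mono Fr (b i) nu *: x i) =
    rst (pi ^+ nu.+1) *: (\sum_i (X1 i).1) - pole (\sum_i (X1 i).2).
  rewrite !scaler_sumr pole_sum -sumrB; apply: eq_bigr => i _.
  by have [_ _ ->] := X1P i.
have -> : rst (pi ^+ nu) *: (rst pi *: w1) = rst (pi ^+ nu.+1) *: w1.
  by rewrite scalerA -rstM -exprSr.
rewrite poleD poleN.
exact: addr_shuffle6.
Qed.
End Fredholm.

Lemma addr_shuffle5 (V : zmodType) (a b c d e : V) :
  a + b + (c + d + e) = a + c + (b + d) + e.
Proof. by rewrite !addrA [LHS](ACl (1*3*2*4*5)). Qed.

Lemma addr_shuffle7 (V : zmodType) (a a' b b' w : V) :
  a + b + w - (a + a' + (b + b')) = w - a' - b'.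
Proof. by rewrite !opprD !addrA [LHS](ACl (1*4*2*6*3*5*7)) /= subrr add0r subrr add0r. Qed.

Lemma scalerD3 (F : pzRingType) (V : lmodType F) (c : F) (x y z : V) :
  c *: (x + y + z) = c *: x + c *: y + c *: z.
Proof. by rewrite !scalerDr. Qed.

Lemma scalerB3 (F : pzRingType) (V : lmodType F) (c : F) (x y z : V) :
  c *: (x - y - z) = c *: x - c *: y - c *: z.
Proof. by rewrite !scalerBr. Qed.

Lemma adic_series (S : base) (B : calg S) (v : nat -> B) : exists x, forall N, exists z,
  x = \sum_(k < N) str B (ppi S) ^+ k * v k + str B (ppi S) ^+ N * z.
Proof.
have [_ cB] := calg_complete B.
have [|x xP] := cB (fun N => \sum_(k < N) str B (ppi S) ^+ k * v k).
  by move=> n; exists (v n); rewrite big_ord_recr /= addrAC subrr add0r.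
by exists x => N; have [z zE] := xP N; exists z; rewrite -zE addrC subrK.
Qed.

Section FredholmR.
Variables (S : base) (p : nat).
Local Notation R := (base_ring S).
Local Notation pi := (ppi S).
Local Notation bR := (base_calg S).
Local Notation K := {fraction R}.
Hypothesis chR : p \in [pchar R].
Hypothesis valR : forall x : R, x != 0 -> exists N y, x * y = pi ^+ N.
Variables (l : fieldType) (res : {rmorphism R -> l}).
Hypothesis res_ker : forall x, res x = 0 -> exists y, x = pi * y.
Hypothesis res_pi : res pi = 0.
Hypothesis res_surj : forall a, exists x, res x = a.
Variable chl : p \in [pchar l].
Local Notation Fr := (frob chR).
Local Notation RT := (tps (frob chR)).
Local Notation KT := (tps (frob (fraction_pchar chR))).
Local Notation fracT := (@fracT S p chR).
Local Notation kst := (@kst S p chR).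
Local Notation piK := (tofrac pi : K).
Local Notation rst c := (mono Fr c 0).
Variable d : nat.

(** Completeness of R<t>, transported to twisted series: the underlying coefficient sequences are
    the same, and left multiplication by a constant is the same in both rings. *)
Lemma null_series (u : nat -> RT) : (forall k, @null S bR (u k)) -> exists Y : RT,
  @null S bR Y /\ forall N, exists z : RT, @null S bR z /\
    Y = \sum_(k < N) rst (pi ^+ k) * u k + rst (pi ^+ N) * z.
Proof.
move=> nu; have [x xP] := @adic_series S (rcalg bR) (fun k => mk_rser (nu k)).
exists (rcoef x); split=> [|N]; first exact: rcoef_null.
have [z zE] := xP N; exists (rcoef z); split; first exact: rcoef_null.
apply/funext => n; rewrite zE rcoefD; rewrite rcoef_piM tpsDE constM; congr (_ + _).
rewrite tps_sumE; apply: (big_ind2 (fun (a : rcalg bR) (b : R) => rcoef a n = b)) => //.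
  by move=> a b a' b' <- <-; rewrite rcoefD.
by move=> k _; rewrite rcoef_piM constM.
Qed.

Lemma nullRrow_series (u : nat -> 'rV[RT]_d) : (forall k, nullRrow (u k)) -> exists Y,
  nullRrow Y /\ forall N, exists z, nullRrow z /\
    Y = \sum_(k < N) rst (pi ^+ k) *: u k + rst (pi ^+ N) *: z.
Proof.
move=> nu; have /choice[Y YP] j := null_series (fun k => nu k j).
exists (\row_j Y j); split=> [j|N]; first by rewrite mxE; have [] := YP j.
have /choice[z zP] j := (YP j).2 N; exists (\row_j z j); split=> [j|].
  by rewrite mxE; have [] := zP j.
apply/rowP => j; rewrite mxE; have [_ ->] := zP j; rewrite !mxE summxE; congr (_ + _).
by apply: eq_bigr => k _; rewrite mxE.
Qed.

Lemma rst_separated (x : 'rV[RT]_d) : (forall N, exists z, x = rst (pi ^+ N) *: z) -> x = 0.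
Proof.
move=> H; apply/rowP => j; rewrite mxE; apply/funext => n; rewrite tps0E.
have [s _] := base_complete S; apply: s => N; have [z ->] := H N.
by exists (z 0 j n); rewrite mxE constM.
Qed.

Variable Phi : 'M[RT]_d.
Hypothesis nPhi : nullRmx Phi.
Local Notation pole := (pole Phi).

(** Successive approximation: one step leaves the remainder pi^(nu+1) w', and pi^nu w' is treated in
    turn. The solution is the sum of pi^k times the data of the k-th step. *)
Lemma fredholm : exists nu n (G : 'I_n -> 'rV[RT]_d), (forall i, nullRrow (G i)) /\
  forall w, nullRrow w -> exists y (r : 'I_n -> R), nullRrow y /\
    rst (pi ^+ nu) *: w = pole y + \sum_i rst (r i) *: G i.
Proof.
have [n [G [nG step]]] := fredholm_step res_ker res_pi res_surj chl nPhi.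
exists d.+1, n, G; split=> // w nw.
have /choice[nx nxP] (w0 : {w : 'rV[RT]_d | nullRrow w}) :
    exists u : 'rV[RT]_d * ('I_n -> R) * {w : 'rV[RT]_d | nullRrow w}, nullRrow u.1.1 /\
      rst (pi ^+ d.+1) *: sval w0 = pole u.1.1 + \sum_i rst (u.1.2 i) *: G i + rst (pi ^+ d.+2) *: sval u.2.
  case: w0 => w1 nw1; have [y [r [w'' [ny nw'' E]]]] := step w1 nw1.
  by exists (y, r, exist _ w'' nw'').
pose W := fix W k := if k is k'.+1 then (nx (W k')).2 else exist _ w nw.
pose y k := (nx (W k)).1.1; pose r k := (nx (W k)).1.2.
have WE k : rst (pi ^+ d.+1) *: sval (W k) =
    pole (y k) + \sum_i rst (r k i) *: G i + rst (pi ^+ d.+2) *: sval (W k.+1).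
  by have [] := nxP (W k).
have ny k : nullRrow (y k) by have [] := nxP (W k).
have [Y [nY YP]] := nullRrow_series ny.
have /choice[c cP] i := @adic_series S bR (fun k => r k i).
exists Y, c; split=> //; apply/eqP; rewrite -subr_eq0; apply/eqP/rst_separated => N.
have partial : rst (pi ^+ d.+1) *: w = pole (\sum_(k < N) rst (pi ^+ k) *: y k) +
    \sum_i rst (\sum_(k < N) pi ^+ k * r k i) *: G i + rst (pi ^+ N) *: (rst (pi ^+ d.+1) *: sval (W N)).
  elim: N => [|N IH].
    rewrite big_ord0 pole0 expr0 mono1 scale1r add0r big1 ?add0r // => i _.
    by rewrite big_ord0 mono0 scale0r.
  rewrite IH WE scalerD3.
  have -> : \sum_i rst (\sum_(k < N.+1) pi ^+ k * r k i) *: G i =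
     \sum_i rst (\sum_(k < N) pi ^+ k * r k i) *: G i + rst (pi ^+ N) *: (\sum_i rst (r N i) *: G i).
    rewrite scaler_sumr -big_split; apply: eq_bigr => i _ /=.
    by rewrite big_ord_recr monoD scalerDl scalerA -rstM.
  rewrite [in RHS]big_ord_recr poleD poleZ /= !scalerA -!rstM -!exprD addSnnS addnS.
  exact: addr_shuffle5.
have [z [nz ->]] := YP N; have /choice[s sP] i := cP i N.
exists (rst (pi ^+ d.+1) *: sval (W N) - pole z - \sum_i rst (s i) *: G i).
rewrite partial poleD poleZ.
have -> : \sum_i rst (c i) *: G i = \sum_i rst (\sum_(k < N) pi ^+ k * r k i) *: G i
     + rst (pi ^+ N) *: (\sum_i rst (s i) *: G i).
  rewrite scaler_sumr -big_split; apply: eq_bigr => i _ /=.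
  by rewrite (sP i) monoD scalerDl scalerA -rstM.
rewrite scalerB3.
exact: addr_shuffle7.
Qed.

Definition poleK (y : 'rV[KT]_d) := y *m map_mx fracT Phi - kst piK *: y.

Lemma poleKE (y : 'rV[KT]_d) : poleK y = y *m map_mx fracT Phi - kst piK *: y.
Proof. by []. Qed.

Lemma fracT_scale c (x : 'rV[RT]_d) : map_mx fracT (rst c *: x) = kst (tofrac c) *: map_mx fracT x.
Proof. by apply/rowP => k; rewrite !mxE rmorphM -kst_fracT. Qed.

Lemma fracT_pole y : map_mx fracT (pole y) = poleK (map_mx fracT y).
Proof.
have E1 : map_mx fracT (rst pi *: y) = kst piK *: map_mx fracT y by exact: fracT_scale.
have E2 : map_mx fracT (y *m Phi) = map_mx fracT y *m map_mx fracT Phi by rewrite map_mxM.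
rewrite /poleK -E2 -E1; apply/rowP => k; rewrite !mxE.
exact: rmorphB.
Qed.

Lemma kst_sum (I : Type) (r : seq I) (F : I -> K) : kst (\sum_(i <- r) F i) = \sum_(i <- r) kst (F i).
Proof.
apply: (big_morph kst _ (kst0 chR)) => x y.
exact: monoD.
Qed.

Lemma kst_comm c c' : kst c * kst c' = kst c' * kst c.
Proof. by rewrite -!kstM mulrC. Qed.

Lemma poleK_scale c y : poleK (kst c *: y) = kst c *: poleK y.
Proof.
have E : kst piK *: (kst c *: y) = kst c *: (kst piK *: y).
  by rewrite (scalerA (kst piK)) (scalerA (kst c)) kst_comm.
rewrite /poleK E.
rewrite -scalemxAl.
by rewrite scalerBr.
Qed.

Lemma poleK_sum n (y : 'I_n -> 'rV[KT]_d) : poleK (\sum_i y i) = \sum_i poleK (y i).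
Proof. by rewrite /poleK mulmx_suml scaler_sumr -sumrB. Qed.

(** Over K, null rows modulo the image of null rows under [poleK] are spanned by the n generators of
    [fredholm], so n + 1 of them are dependent. *)
Lemma fredholm_dependence : exists n, forall w : 'I_n.+1 -> 'rV[KT]_d, (forall i, nullKrow (w i)) ->
  exists (c : 'I_n.+1 -> K) y, [/\ exists i, c i != 0, nullKrow y &
    \sum_i kst (c i) *: w i = poleK y].
Proof.
have [nu [n [G [nG GP]]]] := fredholm; exists n => w nw.
have /choice[C CP] i := nullKrow_integral valR (nw i).
have /choice[v vP] := CP.
have /choice[yr yrP] i : exists yr : 'rV[RT]_d * ('I_n -> R), nullRrow yr.1 /\
    rst (pi ^+ nu) *: v i = pole yr.1 + \sum_j rst (yr.2 j) *: G j.
  by have [y [r [ny E]]] := GP _ (vP i).1; exists (y, r).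
pose M : 'M[K]_(n.+1, n) := \matrix_(i, j) tofrac ((yr i).2 j).
have [b [b0 bM]] := ker_vector M (ltnSn n).
have bE j : \sum_i b 0 i * tofrac ((yr i).2 j) = 0.
  have : (b *m M) 0 j = 0 by rewrite bM mxE.
  by rewrite mxE => bMj; rewrite -[RHS]bMj; apply: eq_bigr => i _; rewrite mxE.
(* The factor pi^(C i) makes w_i integral, pi^nu is the one required by [fredholm], and b kills the
   coefficients on the generators. *)
exists (fun i => b 0 i * piK ^+ nu * piK ^+ C i), (\sum_i kst (b 0 i) *: map_mx fracT (yr i).1); split.
- have [i bi] : exists i, b 0 i != 0.
    apply: contrapT => H; case/negP: b0; apply/eqP/rowP => i; rewrite mxE.
    by apply/eqP/negPn/negP => bi; apply: H; exists i.
  by exists i; rewrite !mulf_neq0 // expf_neq0 // piK_neq0.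
- move=> k; rewrite summxE; apply: nullK_sum => i _; rewrite !mxE; apply: (nullK_kst valR).
  exact/nullK_frac/(yrP i).1.
transitivity (\sum_i kst (b 0 i) *: map_mx fracT (pole (yr i).1)); last first.
  rewrite poleK_sum; apply: eq_bigr => i _.
  by rewrite poleK_scale fracT_pole.
transitivity (\sum_i kst (b 0 i) *: map_mx fracT (rst (pi ^+ nu) *: v i)).
  apply: eq_bigr => i _; have [_ E] := vP i.
  by rewrite !kstM -!scalerA E fracT_scale rmorphXn.
apply/eqP; rewrite -subr_eq0 -sumrB; apply/eqP.
transitivity (\sum_i \sum_j kst (b 0 i * tofrac ((yr i).2 j)) *: map_mx fracT (G j)).
  apply: eq_bigr => i _; rewrite -scalerBr; have [_ ->] := yrP i.
  rewrite map_mxD addrAC subrr add0r raddf_sum scaler_sumr; apply: eq_bigr => j _ /=.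
  by rewrite fracT_scale scalerA -kstM.
rewrite exchange_big big1 // => j _; rewrite -scaler_suml.
have -> : \sum_i kst (b 0 i * tofrac ((yr i).2 j)) = kst (\sum_i b 0 i * tofrac ((yr i).2 j)).
  by rewrite kst_sum.
by rewrite bE kst0 scale0r.
Qed.
End FredholmR.

(** * Families independent over the image of a Frobenius lift *)

Section Independence.
Variable S : base.
Local Notation R := (base_ring S).
Local Notation pi := (ppi S).
Local Notation K := {fraction R}.
Local Notation piK := (tofrac pi : K).
Hypothesis localR : forall x : R, (exists y, x = pi * y) \/ (exists y, x * y = 1).
Hypothesis valR : forall x : R, x != 0 -> exists N y, x * y = pi ^+ N.
Variable psi : {rmorphism R -> R}.
Hypothesis psi_pi : psi pi = pi.

(** Independence over psi(R) in a quantitative form: divisibility of the sum by pi^N passes to each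
    coefficient. [descend] needs this to carry nullity over to coefficients. *)
Definition indep m (e : nat -> R) := forall N (y : nat -> R),
  (exists z, \sum_(u < m) e u * psi (y u) = pi ^+ N * z) ->
  forall u, (u < m)%N -> exists z, y u = pi ^+ N * z.

(** Once every y_u is divisible by pi, one factor pi can be cancelled from the whole relation,
    because psi fixes pi. *)
Lemma indep1 m (e : nat -> R) :
  (forall y : nat -> R, (exists z, \sum_(u < m) e u * psi (y u) = pi * z) ->
    forall u, (u < m)%N -> exists z, y u = pi * z) -> indep m e.
Proof.
move=> H; elim=> [|N IH] y [z zE] u um; first by exists (y u); rewrite expr0 mul1r.
have /choice[y' y'P] u' : exists y', (u' < m)%N -> y u' = pi * y'.
  case: (ltnP u' m) => [um'|_]; last by exists 0.
  have [|y' yE'] := H y _ u' um'; last by exists y'.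
  by exists (pi ^+ N * z); rewrite zE exprS mulrA.
have [|z' z'E] := IH y' _ u um.
  exists z; apply: (mulfI (ppi_neq0 S)); rewrite mulrA -exprS -zE mulr_sumr.
  by apply: eq_bigr => u' _; rewrite y'P // rmorphM psi_pi mulrCA.
by exists z'; rewrite y'P // z'E exprS mulrA.
Qed.

Lemma pi_pow_psi N : psi (pi ^+ N) = pi ^+ N.
Proof. by rewrite rmorphXn /= psi_pi. Qed.

Definition frob_span m (e : nat -> R) x := exists s : nat -> R, x = \sum_(u < m) e u * psi (s u).

(** Two approximations modulo pi^n have coefficients that agree modulo pi^n, by independence; the
    coefficients therefore converge. *)
Lemma span_closed m e x : indep m e ->
  (forall N, exists (s : nat -> R) z, x = \sum_(u < m) e u * psi (s u) + pi ^+ N * z) -> frob_span m e x.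
Proof.
move=> ie /choice[s /choice[z xE]].
have [sep cpl] := base_complete S.
have /choice[s' s'P] u : exists s', (u < m)%N -> forall n, exists y, s' - s n u = pi ^+ n * y.
  case: (ltnP u m) => [um|_]; last by exists 0.
  have [|s' s'P] := cpl (fun n => s n u); last by exists s'.
  move=> n; apply: (ie n (fun u => s n.+1 u - s n u)) => //.
  exists (z n - pi * z n.+1).
  transitivity (\sum_(u < m) e u * psi (s n.+1 u) - \sum_(u < m) e u * psi (s n u)).
    by rewrite -sumrB; apply: eq_bigr => i _; rewrite rmorphB mulrBr.
  have -> : \sum_(u < m) e u * psi (s n.+1 u) = x - pi ^+ n.+1 * z n.+1 by rewrite [in RHS](xE n.+1) addrK.
  have -> : \sum_(u < m) e u * psi (s n u) = x - pi ^+ n * z n by rewrite [in RHS](xE n) addrK.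
  by rewrite opprB addrC addrA subrK mulrBr mulrA -exprSr.
exists s'; apply/eqP; rewrite -subr_eq0; apply/eqP/sep => N.
have /choice[y yP] (u : 'I_m) := s'P u (ltn_ord u) N.
exists (z N - \sum_(u < m) e u * psi (y u)); rewrite [in LHS](xE N) addrAC -sumrB mulrBr addrC.
congr (_ + _); rewrite mulr_sumr -sumrN; apply: eq_bigr => u _.
by rewrite -mulrBr -opprB -rmorphB yP rmorphM pi_pow_psi mulrN mulrCA.
Qed.

(* If x is not in the span, write x = sum e_u psi(s_u) + pi^N e_0 with N maximal
   and adjoin e_0. *)
Lemma span_extend m e x : indep m e -> exists m' e', [/\ indep m' e', frob_span m' e' x,
  (m <= m')%N & forall u, (u < m)%N -> e' u = e u].
Proof.
move=> ie; pose P N := exists (s : nat -> R) z, x = \sum_(u < m) e u * psi (s u) + pi ^+ N * z.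
have [H|/existsNP[N0 nP]] := pselect (forall N, P N).
  by exists m, e; split=> //; exact: span_closed.
have [N [[s [e0 xE]] nPS]] : exists N, P N /\ ~ P N.+1.
  apply: contrapT => H; apply: nP; elim: N0 => [|N IH].
    exists (fun=> 0), x; rewrite big1 ?add0r ?expr0 ?mul1r // => u _.
    by rewrite rmorph0 mulr0.
  by apply: contrapT => nPS; apply: H; exists N.
exists m.+1, (fun u => if (u < m)%N then e u else e0); split=> //; last by move=> u ->.
  apply: indep1 => y [z]; rewrite big_ord_recr /= ltnn.
  under eq_bigr do rewrite ltn_ord.
  move=> zE; have [[y' yE]|[v vE]] := localR (y m).
    move=> u; rewrite ltnS leq_eqVlt => /orP[/eqP->|um]; first by exists y'.
    have [|w wE] := ie 1%N y _ u um; last by exists w; rewrite wE expr1.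
    exists (z - e0 * psi y'); rewrite expr1 mulrBr -zE yE rmorphM psi_pi.
    by rewrite [pi * (_ * _)]mulrCA addrK.
  (* If y_m were a unit, solving the relation for e_0 would approximate x by the old span modulo
     pi^(N+1), against the choice of N. *)
  case: nPS; exists (fun u => s u - pi ^+ N * (y u * v)), (z * psi v).
  have e0E : e0 = pi * (z * psi v) - \sum_(u < m) e u * psi (y u * v).
    have -> : e0 = e0 * psi (y m) * psi v by rewrite -mulrA -rmorphM vE rmorph1 mulr1.
    have -> : e0 * psi (y m) = pi * z - \sum_(u < m) e u * psi (y u).
      by rewrite -zE addrAC subrr add0r.
    rewrite mulrBl mulrA; congr (_ - _); rewrite mulr_suml; apply: eq_bigr => u _.
    by rewrite rmorphM mulrA.
  rewrite [LHS]xE e0E [pi ^+ N * _]mulrBr [pi ^+ N * (pi * _)]mulrA -exprSr addrCA addrC.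
  congr (_ + _); rewrite mulr_sumr -sumrB; apply: eq_bigr => u _.
  by rewrite rmorphB [psi (pi ^+ N * _)]rmorphM pi_pow_psi mulrBr [in RHS]mulrCA.
exists (fun u => if (u < m)%N then s u else pi ^+ N).
rewrite big_ord_recr /= ltnn pi_pow_psi [in LHS]xE (mulrC e0); congr (_ + _).
by apply: eq_bigr => u _; rewrite ltn_ord.
Qed.

Lemma frob_span_le m m' e e' x : (m <= m')%N -> (forall u, (u < m)%N -> e' u = e u) ->
  frob_span m e x -> frob_span m' e' x.
Proof.
move=> mm' ee' [s ->]; exists (fun u => if (u < m)%N then s u else 0).
rewrite (big_ord_widen m' (fun u => e u * psi (s u)) mm') big_mkcond.
apply: eq_bigr => u _; case: ifP => um; first by rewrite ee'.
by rewrite rmorph0 mulr0.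
Qed.

Lemma independent_family n (x : nat -> R) : exists m e, indep m e /\
  forall i, (i < n)%N -> frob_span m e (x i).
Proof.
elim: n => [|n [m [e [ie xe]]]].
  by exists 0%N, (fun=> 0); split=> // N y _ u.
have [m' [e' [ie' xn mm' ee']]] := span_extend (x n) ie; exists m', e'; split=> // i.
rewrite ltnS leq_eqVlt => /orP[/eqP->//|iN]; apply: frob_span_le mm' ee' _; exact: xe.
Qed.

Variable sg : {rmorphism K -> K}.
Hypothesis sgE : forall x : R, sg (tofrac x) = tofrac (psi x).

Definition indepK m (e : nat -> R) := forall N (y : nat -> K),
  dvK N (\sum_(u < m) tofrac (e u) * sg (y u)) ->
  forall u, (u < m)%N -> dvK N (y u).

Lemma indep_K m e : indep m e -> indepK m e.
Proof.
move=> ie N y [z zE] u um.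
have [M /choice[r rP]] := common_denominator valR (fun u : 'I_m => y u).
pose r' u := if insub u is Some u' then r u' else 0.
have r'P (v : 'I_m) : r' v = r v by rewrite /r' valK.
have [|w wE] := ie (N + M)%N r' _ u um.
  exists z; apply/eqP; rewrite -tofrac_eq exprD (mulrC (pi ^+ N)) -mulrA tofracM -zE tofracXn mulr_sumr.
  apply/eqP; rewrite rmorph_sum; apply: eq_bigr => v _ /=.
  rewrite tofracM -sgE r'P -rP rmorphM; have -> : sg (piK ^+ M) = piK ^+ M by rewrite -rmorphXn sgE pi_pow_psi.
  by rewrite mulrCA.
exists w; apply: (mulfI (_ : piK ^+ M != 0)); first by rewrite expf_neq0 // tofrac_eq0 ppi_neq0.
have := rP (Ordinal um) => /= ->; rewrite -(r'P (Ordinal um)) /= wE exprD (mulrC (pi ^+ N)) -mulrA tofracM tofracXn. by [].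
Qed.

Lemma independent_familyK n (x : nat -> K) : exists m e (s : nat -> nat -> K), indepK m e /\
  forall i, (i < n)%N -> x i = \sum_(u < m) tofrac (e u) * sg (s i u).
Proof.
have [M /choice[r rP]] := common_denominator valR (fun i : 'I_n => x i).
pose r' i := if insub i is Some i' then r i' else 0.
have [m [e [ie re]]] := independent_family n r'.
have /choice[s sP] i : exists s : nat -> R, (i < n)%N -> r' i = \sum_(u < m) e u * psi (s u).
  by case: (ltnP i n) => [/re[s sE]|_]; [exists s | exists (fun=> 0)].
have pM : piK ^+ M != 0 by rewrite expf_neq0 // tofrac_eq0 ppi_neq0.
have sgp : sg (piK ^+ M) = piK ^+ M by rewrite -rmorphXn sgE pi_pow_psi.
exists m, e, (fun i u => tofrac (s i u) / piK ^+ M); split=> [|i ii]; first exact: indep_K.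
apply: (mulfI pM); have := rP (Ordinal ii) => /= ->.
have -> : r (Ordinal ii) = r' i by rewrite /r' (insubT (fun i => i < n)%N ii).
rewrite sP // mulr_sumr rmorph_sum; apply: eq_bigr => u _ /=.
by rewrite fmorph_div /= sgp sgE tofracM [RHS]mulrCA [piK ^+ M * _]mulrC divfK.
Qed.
End Independence.

Lemma subrACA (V : zmodType) (a b c d : V) : a - b - (c - d) = a - c - (b - d).
Proof. by rewrite !opprB !addrA [LHS](ACl (1*4*3*2)). Qed.

Lemma sum_blocks (V : nmodType) a b (F : nat -> V) :
  \sum_(k < a * b) F k = \sum_(j < a) \sum_(i < b) F (j * b + i)%N.
Proof.
elim: a => [|a IH]; first by rewrite mul0n !big_ord0.
by rewrite big_ord_recr -IH mulSn addnC big_split_ord.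
Qed.

(** * Relations between the Frobenius iterates of an eigenvector *)

Section Tame.
Variables (S : base) (p e : nat).
Local Notation R := (base_ring S).
Local Notation pi := (ppi S).
Local Notation bR := (base_calg S).
Local Notation K := {fraction R}.
Hypothesis chR : p \in [pchar R].
Hypothesis qE : qhat S = (p ^ e)%N.
Hypothesis valR : forall x : R, x != 0 -> exists N y, x * y = pi ^+ N.
Hypothesis unitR : forall y : R, exists u, (1 + pi * y) * u = 1.
Hypothesis localR : forall x : R, (exists y, x = pi * y) \/ (exists y, x * y = 1).
Variable sigma : {rmorphism K -> K}.
Hypothesis sigmaE : forall x : R, sigma (tofrac x) = tofrac (phi S x).
Local Notation Fr := (frob chR).
Local Notation FrK := (frob (fraction_pchar chR)).
Local Notation RT := (tps Fr).
Local Notation KT := (tps FrK).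
Local Notation fracT := (@fracT S p chR).
Local Notation sigmaT := (@sigmaT S p chR sigma).
Local Notation kst := (@kst S p chR).
Local Notation piK := (tofrac pi : K).
Local Notation rst c := (mono Fr c 0).

Lemma phi_iter_mod k (x : R) : exists y, x ^+ (p ^ (e * k)) - itm (phi S) k x = pi * y.
Proof.
elim: k => [|k [y yE]]; first by exists 0; rewrite muln0 expr1 subrr mulr0.
have [z zE] := phi_lift (itm (phi S) k x); rewrite itmS zE.
have -> : itm (phi S) k x = x ^+ (p ^ (e * k)) - pi * y by rewrite -yE opprB addrCA subrr addr0.
have := @qpowD S bR 1 (x ^+ (p ^ (e * k))) (- (pi * y)); rewrite expn1 => ->.
have := @qpowN S bR 1 (pi * y); rewrite expn1 => ->.
have -> : (x ^+ (p ^ (e * k))) ^+ qhat S = x ^+ (p ^ (e * k.+1)).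
  by rewrite qE -exprM -expnD mulnS addnC.
exists (pi ^+ (qhat S).-1 * y ^+ qhat S - z).
have q0 := ltnW (qhat_gt1 S); rewrite exprMn -{1}(prednK q0) exprS.
by rewrite mulrBr !opprD opprK !addrA subrr add0r mulrA.
Qed.

(** On coefficients this is the congruence of x^(qhat^k) and phi^k(x) modulo pi; dividing a null
    sequence by pi leaves it null. *)
Lemma twist_defect k (f : RT) : @null S bR f -> exists D : RT, @null S bR D /\
  mono Fr 1 (e * k) * f - phiT k f * mono Fr 1 (e * k) = rst pi * D.
Proof.
move=> nf; set D := _ - _.
have nD : @null S bR D.
  apply: null_add; first by apply: nullM => //; exact: null_mono.
  apply: nullN; apply: nullM; [exact: phiT_null | exact: null_mono].
have /choice[D' D'E] n : exists y, D n = pi * y.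
  rewrite /D tpsBE mono_mulE mul_monoE mul1r rmorph1 mulr1.
  case: ifP => _; last by exists 0; rewrite subrr mulr0.
  by rewrite itm_frob; exact: phi_iter_mod.
exists (D' : RT); split; last by apply/funext => n; rewrite constM D'E.
move=> N; have [J JP] := nD N.+1; exists J => j /JP [z zE].
by exists z; apply: (mulfI (ppi_neq0 S)); rewrite -D'E zE exprS mulrA.
Qed.

Lemma dvK_sigma i N x : dvK N x -> dvK N (itm sigma i x).
Proof.
move=> [y ->]; exists (itm (phi S) i y).
by rewrite (itm_sigmaE sigmaE) rmorphM rmorphXn /= itm_phi_pi.
Qed.

Lemma nullK_sigmaT i (f : KT) : nullK f -> nullK (sigmaT i f).
Proof. by move=> nf N; have [J JP] := nf N; exists J => j /JP; exact: dvK_sigma. Qed.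

Variables (d : nat) (Phi : 'M[RT]_d).
Hypothesis nPhi : nullRmx Phi.
Hypothesis Phi_nilp : (mcoef 0 Phi - pi%:M) ^+ d = 0.
Hypothesis dependence : exists n, forall w : 'I_n.+1 -> 'rV[KT]_d, (forall i, nullKrow (w i)) ->
  exists (c : 'I_n.+1 -> K) y, [/\ exists i, c i != 0, nullKrow y &
    \sum_i kst (c i) *: w i = poleK Phi y].
Local Notation eigenseries := (eigenseries sigma Phi).
Local Notation poleK := (poleK Phi).

Lemma poleK_eigen s : eigenseries 0 s <-> poleK s = 0.
Proof.
by split=> [em|/eqP]; [apply/eqP; rewrite subr_eq0; apply/eqP | rewrite subr_eq0 => /eqP].
Qed.

Definition sigma_tau (s : 'rV[KT]_d) k : 'rV[KT]_d := \row_j (sigmaT k (s 0 j) * mono FrK 1 (e * k)).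

(** Moving tau^(ek) past Phi replaces Phi by phi^k(Phi) up to pi D. The main terms cancel by sigma^k
    of the equation for s, and sigma^k(s) pi D is null by [eigen_tame]. *)
Lemma sigma_tau_pole s k : eigenseries 0 s -> nullKrow (poleK (sigma_tau s k)).
Proof.
move=> es j.
have Es : \sum_i s 0 i * fracT (Phi i j) = kst piK * s 0 j.
  have : (s *m map_mx (fun f => sigmaT 0 (fracT f)) Phi) 0 j = (kst piK *: s) 0 j by rewrite es.
  by rewrite !mxE => <-; apply: eq_bigr => i _; rewrite mxE.
have spi : sigmaT k (kst piK) = kst piK.
  by rewrite sigmaT_kst (itm_sigmaE sigmaE) itm_phi_pi.
have Esk : \sum_i sigmaT k (s 0 i) * fracT (phiT k (Phi i j)) = kst piK * sigmaT k (s 0 j).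
  have := congr1 (sigmaT k) Es; rewrite rmorph_sum rmorphM /= spi => <-.
  by apply: eq_bigr => i _; rewrite rmorphM /= (sigmaT_fracT sigmaE).
have /choice[D DP] i := twist_defect k (nPhi i j).
suff -> : poleK (sigma_tau s k) 0 j = \sum_i (sigmaT k (s 0 i) * kst piK) * fracT (D i).
  apply: nullK_sum => i _; apply: (nullK_mul valR); last by have [] := DP i.
  rewrite -spi -(rmorphM (sigmaT k)); apply: nullK_sigmaT.
  exact: (eigen_tame valR unitR sigmaE Phi_nilp es).
rewrite !poleKE !mxE mulrA -Esk mulr_suml -sumrB; apply: eq_bigr => i _.
rewrite !mxE -!mulrA -mulrBr; congr (_ * _).
have [_ E] := DP i.
have := congr1 (fun f => fracT f) E; rewrite rmorphB !rmorphM /= kst_fracT => <-.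
have -> : fracT (mono Fr 1 (e * k)) = mono FrK 1 (e * k).
  by rewrite [LHS]tpsmap_mono rmorph1.
by [].
Qed.

Lemma nullKrow_scale c (x : 'rV[KT]_d) : nullKrow x -> nullKrow (kst c *: x).
Proof. by move=> nx j; rewrite mxE; exact: nullK_kst. Qed.
Lemma nullKrow_sum (I : Type) (r : seq I) (Q : pred I) (F : I -> 'rV[KT]_d) :
  (forall i, Q i -> nullKrow (F i)) -> nullKrow (\sum_(i <- r | Q i) F i).
Proof. by move=> H j; rewrite summxE; apply: nullK_sum => i /H; exact. Qed.

Lemma poleKB x y : poleK (x - y) = poleK x - poleK y.
Proof. by rewrite !poleKE mulmxBl scalerBr subrACA. Qed.

Definition ncomb N (c : nat -> K) (v : nat -> 'rV[KT]_d) := \sum_(k < N) kst (c k) *: v k.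

Lemma ncombE N c v j n : ncomb N c v 0 j n = \sum_(k < N) c k * v k 0 j n.
Proof. by rewrite summxE tps_sumE; apply: eq_bigr => k _; rewrite mxE kstE. Qed.

(** The v_k are cut into d + 1 blocks of length n + 1. A combination within each block, corrected by
    a null row y_j, lies in the kernel of [poleK]. Constant terms embed this kernel in K^d, so the d
    + 1 results are dependent. *)
Lemma dependent_mod_null (v : nat -> 'rV[KT]_d) : (forall k, nullKrow (poleK (v k))) ->
  exists N c, (exists2 k, (k < N)%N & c k != 0) /\ nullKrow (ncomb N c v).
Proof.
move=> nv; have [n nP] := dependence.
have /choice[cc /choice[y yP]] (j : 'I_d.+1) := nP (fun i => poleK (v (j * n.+1 + i)%N)) (fun i => nv _).
pose x j := \sum_(i < n.+1) kst (cc j i) *: v (j * n.+1 + i)%N - y j.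
have x0 j : poleK (x j) = 0.
  rewrite poleKB poleK_sum; have [_ _ <-] := yP j.
  by rewrite -sumrB big1 // => i _; rewrite poleK_scale subrr.
have [b [b0 bM]] := ker_vector (\matrix_(j, i) mcoef 0 (x j) 0 i : 'M[K]_(d.+1, d)) (ltnSn d).
have bx : \sum_j kst (b 0 j) *: x j = 0.
  apply: (eigen_eq0 unitR sigmaE Phi_nilp (i := 0)).
    by apply/poleK_eigen; rewrite poleK_sum big1 // => j _; rewrite poleK_scale x0 scaler0.
  apply/rowP => i; rewrite !mxE summxE tps_sumE.
  have := congr1 (fun M : 'rV[K]_d => M 0 i) bM; rewrite !mxE => E; rewrite -[RHS]E.
  by apply: eq_bigr => j _; rewrite !mxE kstE.
pose c k := b 0 (inord (k %/ n.+1)) * cc (inord (k %/ n.+1)) (inord (k %% n.+1)).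
have cE (j : 'I_d.+1) (i : 'I_n.+1) : c (j * n.+1 + i)%N = b 0 j * cc j i.
  by rewrite /c divnMDl // modnMDl divn_small // modn_small // addn0 !inord_val.
exists (d.+1 * n.+1)%N, c; split.
  have [j bj] : exists j, b 0 j != 0.
    apply: contrapT => H; case/negP: b0; apply/eqP/rowP => i; rewrite mxE.
    by apply/eqP/negPn/negP => bi; apply: H; exists i.
  have [[i ci] _ _] := yP j; exists (j * n.+1 + i)%N; last by rewrite cE mulf_neq0.
  apply: (@leq_trans (j.+1 * n.+1)%N); first by rewrite mulSn [leqRHS]addnC ltn_add2l.
  by rewrite leq_mul2r ltn_ord orbT.
suff -> : ncomb (d.+1 * n.+1) c v = \sum_j kst (b 0 j) *: y j.
  by apply: nullKrow_sum => j _; apply: nullKrow_scale; have [] := yP j.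
apply/eqP; rewrite -subr_eq0; apply/eqP/(etrans _ bx).
rewrite /ncomb (sum_blocks d.+1 n.+1 (fun k => kst (c k) *: v k)) -sumrB.
apply: eq_bigr => j _; rewrite /x scalerBr; congr (_ - _).
rewrite scaler_sumr; apply: eq_bigr => i _.
by rewrite cE kstM scalerA.
Qed.

(* Expanding the coefficients over a sigma-independent family divides the whole
   relation by sigma and tau^e. *)
Lemma descend s N c i0 : nullKrow (ncomb N c (sigma_tau s)) -> (i0.+1 < N)%N ->
  (forall k, (k <= i0)%N -> c k = 0) -> c i0.+1 != 0 ->
  exists c', [/\ nullKrow (ncomb N.-1 c' (sigma_tau s)), forall k, (k < i0)%N -> c' k = 0 & c' i0 != 0].
Proof.
case: N => // N nT iN c0 ci; rewrite [N.+1.-1]/=.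
have [m [f [t [fi ct]]]] := independent_familyK localR valR (phi_ppi S) sigmaE N.+1 c.
have [u um tu] : exists2 u, (u < m)%N & t i0.+1 u != 0.
  apply: contrapT => H; case/negP: ci; rewrite ct // big1 // => u _.
  have [->|tu] := eqVneq (t i0.+1 u) 0; first by rewrite rmorph0 mulr0.
  by case: H; exists u.
(* Coefficients are reset to 0 wherever c vanishes, so that the vanishing of c below i0.+1 is
   inherited whatever expansion was chosen. *)
pose t' i u := if c i == 0 then 0 else t i u.
have ct' i : (i < N.+1)%N -> c i = \sum_(u < m) tofrac (f u) * sigma (t' i u).
  move=> iN'; rewrite /t'; case: eqP => [->|_]; last exact: ct.
  by rewrite big1 // => v _; rewrite rmorph0 mulr0.
exists (fun k => t' k.+1 u); split.
- move=> j N0; have [J JP] := nT j N0; exists J => n Jn.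
  (* As c 0 = 0, every surviving term contains tau^e, so the coefficient of tau^(n + e) is sigma of
     a coefficient of tau^n. *)
  have := JP (n + e)%N (leq_trans Jn (leq_addr _ _)).
  have -> : ncomb N.+1 c (sigma_tau s) 0 j (n + e)%N =
      \sum_(v < m) tofrac (f v) * sigma (ncomb N (fun k => t' k.+1 v) (sigma_tau s) 0 j n).
    rewrite ncombE big_ord_recl [c _]c0 // mul0r add0r.
    transitivity (\sum_(k < N) \sum_(v < m) tofrac (f v) * sigma (t' k.+1 v) * sigma (sigma_tau s k 0 j n)).
      apply: eq_bigr => k _; rewrite (ct' _ (ltn_ord (lift ord0 k))) mulr_suml; apply: eq_bigr => v _.
      congr (_ * _); rewrite !mxE !mul_monoE !rmorph1 !mulr1 !lift0 mulnS (addnC n) leq_add2l.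
      rewrite subnDl; case: ifP => _; last by rewrite rmorph0.
      by rewrite !sigmaTE.
    rewrite exchange_big; apply: eq_bigr => v _ /=.
    rewrite ncombE rmorph_sum mulr_sumr; apply: eq_bigr => k _ /=.
    by rewrite rmorphM mulrA.
  move=> D; exact: (fi N0 (fun v => ncomb N (fun k => t' k.+1 v) (sigma_tau s) 0 j n) D u um).
- by move=> k ki; rewrite /t' c0 // eqxx.
- by rewrite /t' (negbTE ci).
Qed.

Lemma null_relation s : eigenseries 0 s ->
  exists N c, [/\ (0 < N)%N, c 0%N != 0 & nullKrow (ncomb N c (sigma_tau s))].
Proof.
move=> es; have [N [c [ex nT]]] := dependent_mod_null (fun k => sigma_tau_pole k es).
have [i0 [iN ci c0]] : exists i0, [/\ (i0 < N)%N, c i0 != 0 & forall k, (k < i0)%N -> c k = 0].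
  have ex' : exists k, (k < N)%N && (c k != 0) by case: ex => k kN ck; exists k; rewrite kN.
  exists (ex_minn ex'); case: ex_minnP => i /andP[iN ci] mini; split=> // k ki.
  apply/eqP; apply: contraTT ki => ck; rewrite -leqNgt; case: (ltnP k N) => [kN|Nk].
    by apply: mini; rewrite kN.
  exact: ltnW (leq_trans iN Nk).
elim: i0 N c nT iN ci c0 {ex} => [|i0 IH] N c nT iN ci c0.
  by exists N, c.
have [c' [nT' c0' ci']] := descend nT iN c0 ci.
by apply: (IH N.-1 c') => //; rewrite -ltnS prednK // (leq_trans _ iN).
Qed.
End Tame.

(** * Eigenvectors for the twisted actions *)

Section EigenSpan.
Variables (A : comNzRingType) (S : base) (theta : {rmorphism A -> S}) (p : nat).
Local Notation R := (base_ring S).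
Local Notation pi := (ppi S).
Local Notation K := {fraction R}.
Hypothesis chR : p \in [pchar R].
Hypothesis valR : forall x : R, x != 0 -> exists N y, x * y = pi ^+ N.
Hypothesis unitR : forall y : R, exists u, (1 + pi * y) * u = 1.
Hypothesis localR : forall x : R, (exists y, x = pi * y) \/ (exists y, x * y = 1).
Variable sigma : {rmorphism K -> K}.
Hypothesis sigmaE : forall x : R, sigma (tofrac x) = tofrac (phi S x).
Hypothesis theta_phi : forall a, phi S (theta a) = theta a.
Local Notation Fr := (frob chR).
Local Notation FrK := (frob (fraction_pchar chR)).
Local Notation RT := (tps Fr).
Local Notation KT := (tps FrK).
Local Notation fracT := (@fracT S p chR).
Local Notation sigmaT := (@sigmaT S p chR sigma).
Local Notation kst := (@kst S p chR).
Local Notation piK := (tofrac pi : K).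
Variables (d : nat) (Phi : A -> 'M[RT]_d) (z : A).
Hypothesis theta_z : theta z = pi.
Hypothesis Phi_nilp : (mcoef 0 (Phi z) - pi%:M) ^+ d = 0.
Local Notation eigen := (@eigen A S theta d p chR sigma Phi).
Local Notation frac_i := (frac_i sigma).

Lemma eigen_series i m : eigen i m -> eigenseries sigma (Phi z) i m.
Proof. by move/(_ z); rewrite theta_z. Qed.

Lemma dvK_eq0 (x : K) : (forall N, dvK N x) -> x = 0.
Proof.
move=> H; have [w wE] := H 0%N; rewrite expr0 mul1r in wE.
have [sep _] := base_complete S; rewrite wE (sep w) ?rmorph0 // => N.
by have [y /eqP] := H N; rewrite wE tofrac_eq => /eqP; exists y.
Qed.

Lemma indepK_eq0 (sg : {rmorphism K -> K}) m e (y : nat -> K) : indepK sg m e ->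
  \sum_(u < m) tofrac (e u) * sg (y u) = 0 -> forall u, (u < m)%N -> y u = 0.
Proof.
by move=> ie y0 u um; apply: dvK_eq0 => N; apply: (ie N y) => //; rewrite y0; exact: dvK0.
Qed.

Lemma theta_fix i a : itm sigma i (tofrac (theta a)) = tofrac (theta a).
Proof. by rewrite (itm_sigmaE sigmaE); congr tofrac; elim: i => // i IH; rewrite itmS IH theta_phi. Qed.

Definition sigma_comb i n (f : nat -> R) (v : 'rV[K]_d) := exists t : nat -> 'rV[K]_d,
  v = \sum_(u < n) tofrac (f u) *: map_mx (itm sigma i) (t u).

Lemma sigma_comb_scale i n f c v : itm sigma i c = c ->
  sigma_comb i n f v -> sigma_comb i n f (c *: v).
Proof.
move=> ci [t ->]; exists (fun u => c *: t u); rewrite scaler_sumr; apply: eq_bigr => u _.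
apply/rowP => k; rewrite !mxE rmorphM mulrCA; congr (_ * (_ * _)).
exact: esym.
Qed.

Lemma sigma_comb_sum i n f N (v : 'I_N -> 'rV[K]_d) : (forall j, sigma_comb i n f (v j)) ->
  sigma_comb i n f (\sum_j v j).
Proof.
move=> /choice[t tE]; exists (fun u => \sum_j t j u).
transitivity (\sum_j \sum_(u < n) tofrac (f u) *: map_mx (itm sigma i) (t j u)).
  by apply: eq_bigr => j _; exact: tE.
rewrite exchange_big; apply: eq_bigr => u _ /=.
rewrite -scaler_sumr; congr (_ *: _); apply/rowP => k.
by rewrite !mxE !summxE rmorph_sum; apply: eq_bigr => j _; rewrite mxE.
Qed.

Lemma sigma_comb_mul i n f v (M : 'M[R]_d) : sigma_comb i n f v ->
  sigma_comb i n f (v *m map_mx (frac_i i) M).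
Proof.
move=> [t ->]; exists (fun u => t u *m map_mx (@tofrac R) M); rewrite mulmx_suml.
apply: eq_bigr => u _; rewrite -scalemxAl; congr (_ *: _).
by rewrite map_mxM; congr (_ *m _); apply/matrixP => a b; rewrite !mxE.
Qed.

Lemma sigmaT_scale i c (x : 'rV[KT]_d) :
  map_mx (sigmaT i) (kst c *: x) = kst (itm sigma i c) *: map_mx (sigmaT i) x.
Proof.
apply/rowP => j; rewrite !mxE.
transitivity (sigmaT i (kst c) * sigmaT i (x 0 j)); first exact: rmorphM.
by rewrite sigmaT_kst.
Qed.

Lemma sigmaT_defect i a (x : 'rV[KT]_d) :
  map_mx (sigmaT i) (x *m map_mx (fun f => sigmaT 0 (fracT f)) (Phi a) - kst (tofrac (theta a)) *: x) =
  map_mx (sigmaT i) x *m map_mx (fun f => sigmaT i (fracT f)) (Phi a)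
      - kst (tofrac (theta a)) *: map_mx (sigmaT i) x.
Proof.
have E1 : map_mx (sigmaT i) (x *m map_mx (fun f => sigmaT 0 (fracT f)) (Phi a)) =
    map_mx (sigmaT i) x *m map_mx (fun f => sigmaT i (fracT f)) (Phi a).
  by rewrite map_mxM; congr (_ *m _); apply/matrixP => r s; rewrite !mxE.
have := sigmaT_scale i (tofrac (theta a)) x; rewrite theta_fix => <-.
rewrite -E1; apply/rowP => k; rewrite !mxE.
exact: rmorphB.
Qed.

Lemma defect_scale c b (x : 'rV[KT]_d) (P : 'M[KT]_d) :
  (kst c *: x) *m P - kst b *: (kst c *: x) = kst c *: (x *m P - kst b *: x).
Proof.
have E : kst b *: (kst c *: x) = kst c *: (kst b *: x).
  by rewrite (scalerA (kst b)) (scalerA (kst c)) -!kstM mulrC.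
rewrite E -scalemxAl.
by rewrite scalerBr.
Qed.

Lemma sigma_sum_coef i n (f : nat -> R) (x : nat -> 'rV[KT]_d) k N :
  (\sum_(u < n) kst (tofrac (f u)) *: map_mx (sigmaT i) (x u)) 0 k N =
  \sum_(u < n) tofrac (f u) * itm sigma i (x u 0 k N).
Proof.
rewrite summxE tps_sumE; apply: eq_bigr => u _; rewrite mxE kstE mxE.
by rewrite sigmaTE.
Qed.

(** The constant term of m is expanded over a family f independent over sigma^i(K), and [eigen_rec]
    extends the expansion to all coefficients. The defects of the parts t_u satisfy a relation over
    f with coefficients in sigma^i(K); by independence each of them vanishes. *)
Lemma eigen_span i m : eigen i m -> exists n (f : nat -> R) (t : nat -> 'rV[KT]_d),
  (forall u, (u < n)%N -> eigen 0 (t u)) /\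
  m = \sum_(u < n) kst (tofrac (f u)) *: map_mx (sigmaT i) (t u).
Proof.
move=> em; have es := eigen_series em.
pose x0 k := if insub k is Some k' then m 0 k' 0%N else 0.
have [n [f [s [fi xs]]]] := independent_familyK localR valR
  (itm_phi_pi S i) (itm_sigmaE sigmaE i) d x0.
have pd : piK ^+ d != 0 by rewrite expf_neq0 // piK_neq0.
have spd : itm sigma i (piK ^+ d)^-1 = (piK ^+ d)^-1.
  by rewrite fmorphV rmorphXn /= (itm_sigmaE sigmaE) itm_phi_pi.
have /choice[t tE] N : sigma_comb i n f (mcoef N m).
  elim/ltn_ind: N => -[_|N IH].
    exists (fun u => \row_k s k u); apply/rowP => k; rewrite !mxE summxE.
    have := xs k (ltn_ord k); rewrite /x0 valK => ->.
    by apply: eq_bigr => u _; rewrite !mxE.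
  have [Q QE] := eigen_rec unitR sigmaE Phi_nilp es (ltn0Sn N).
  have -> : mcoef N.+1 m = (piK ^+ d)^-1 *: (piK ^+ d *: mcoef N.+1 m).
    by rewrite scalerA mulVf // scale1r.
  rewrite QE mulNmx -mulmxN -map_mxN.
  apply: sigma_comb_scale => //; apply: sigma_comb_mul.
  by apply: sigma_comb_sum => j; apply: sigma_comb_mul; exact: IH.
pose T u : 'rV[KT]_d := \row_k ((fun N => t N u 0 k) : KT).
have mE : m = \sum_(u < n) kst (tofrac (f u)) *: map_mx (sigmaT i) (T u).
  apply/rowP => k; apply/funext => N; have := congr1 (fun M : 'rV[K]_d => M 0 k) (tE N).
  rewrite mxE => ->; rewrite sigma_sum_coef summxE; apply: eq_bigr => u _.
  by rewrite !mxE.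
exists n, f, T; split=> // u un a.
apply/rowP => k; apply/funext => N; apply/eqP; rewrite -subr_eq0; apply/eqP.
pose D u : 'rV[KT]_d := T u *m map_mx (fun f => sigmaT 0 (fracT f)) (Phi a) - kst (tofrac (theta a)) *: T u.
have ED : \sum_(u < n) kst (tofrac (f u)) *: map_mx (sigmaT i) (D u) = 0.
  have := em a; rewrite mE => /eqP; rewrite -subr_eq0 => /eqP em0; rewrite -[RHS]em0.
  rewrite mulmx_suml scaler_sumr -sumrB; apply: eq_bigr => v _.
  rewrite /D sigmaT_defect.
  exact: esym (defect_scale _ _ _ _).
have ED' : \sum_(v < n) tofrac (f v) * itm sigma i (D v 0 k N) = 0.
  by rewrite -sigma_sum_coef ED mxE.
have := indepK_eq0 (y := fun v => D v 0 k N) fi ED' un.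
by rewrite /D mxE [X in _ + X]mxE.
Qed.

Lemma eigen0_coef_eq m m' : eigen 0 m -> eigen 0 m' -> mcoef 0 m = mcoef 0 m' -> m = m'.
Proof.
move=> em em' E; apply/eqP; rewrite -subr_eq0; apply/eqP.
have es : eigenseries sigma (Phi z) 0 (m - m').
  have := eigen_series em; have := eigen_series em'; rewrite /eigenseries mulmxBl => -> ->.
  by rewrite scalerBr.
apply: (eigen_eq0 unitR sigmaE Phi_nilp es).
have -> : mcoef 0 (m - m') = mcoef 0 m - mcoef 0 m' by apply/rowP => j; rewrite !mxE.
by rewrite E subrr.
Qed.

Lemma eigen_comb i n (c : 'I_n -> K) (s : 'I_n -> 'rV[KT]_d) : (forall b, eigen i (s b)) ->
  eigen i (\sum_b kst (c b) *: s b).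
Proof.
move=> es a; apply/eqP; rewrite -subr_eq0; apply/eqP.
rewrite mulmx_suml scaler_sumr -sumrB big1 // => b _.
by rewrite defect_scale es subrr scaler0.
Qed.

(** An eigenrow is determined by its constant term in K^d, so a family with independent constant
    terms and of maximal length spans. *)
Lemma eigen_basis : exists n (s : 'I_n -> 'rV[KT]_d), (forall b, eigen 0 (s b)) /\
  forall m, eigen 0 m -> exists c : 'I_n -> K, m = \sum_b kst (c b) *: s b.
Proof.
pose M n (s : 'I_n -> 'rV[KT]_d) : 'M[K]_(n, d) := \matrix_(b, k) s b 0 k 0%N.
pose P n := `[< exists s : 'I_n -> 'rV[KT]_d, (forall b, eigen 0 (s b)) /\ \rank (M n s) = n >].
have P0 : P 0%N by apply/asboolP; exists (fun=> 0); split=> [[]//|]; apply/eqP; rewrite -leqn0 rank_leq_row.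
have Pd n : P n -> (n <= d)%N by move=> /asboolP[s [_ <-]]; exact: rank_leq_col.
case: (ex_maxnP (ex_intro P 0%N P0) Pd) => n /asboolP[s [es rs]] nmax.
exists n, s; split=> // m em.
have [/submxP[c cE]|nsub] := boolP (mcoef 0 m <= M n s)%MS.
  exists (c 0); apply: eigen0_coef_eq => //; first exact: eigen_comb.
  rewrite cE; apply/rowP => k; rewrite !mxE summxE tps_sumE.
  by apply: eq_bigr => b _; rewrite !mxE kstE.
have Pn : P (n + 1)%N.
  apply/asboolP; exists (fun b => match fintype.split b with inl b => s b | inr _ => m end).
  split=> [b|]; first by case: fintype.split.
  have -> : M (n + 1)%N (fun b => match fintype.split b with inl b => s b | inr _ => m end) =
      col_mx (M n s) (mcoef 0 m).
    apply/matrixP => b k; rewrite !mxE; case: fintype.split => b'; rewrite !mxE //.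
    by rewrite ord1.
  apply/eqP; rewrite eqn_leq rank_leq_row /= -addsmxE addn1 -{1}rs.
  by apply: rank_ltmx; rewrite ltmxE addsmxSl addsmx_sub submx_refl.
by have := nmax _ Pn; rewrite addn1 ltnn.
Qed.
End EigenSpan.

(** * The module H *)

Section Lattice.
Variables (A : comNzRingType) (S : base) (theta : {rmorphism A -> S}).
Variables (k : finFieldType) (kA : {rmorphism k -> A}) (E : amod_functor A S) (d : nat).
Variable g : coordinates E theta kA d.
Variables (p e : nat).
Local Notation R := (base_ring S).
Local Notation pi := (ppi S).
Local Notation bR := (base_calg S).
Local Notation K := {fraction R}.
Hypothesis chR : p \in [pchar R].
Hypothesis qE : qhat S = (p ^ e)%N.
Variable sigma : {rmorphism K -> K}.
Hypothesis sigmaE : forall x : R, sigma (tofrac x) = tofrac (phi S x).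
Hypothesis theta_phi : forall a, phi S (theta a) = theta a.
Local Notation RT := (tps (frob chR)).
Local Notation KT := (tps (frob (fraction_pchar chR))).
Local Notation GK := (@GK S p e chR d).
Local Notation fracT := (@fracT S p chR).
Local Notation sigmaT := (@sigmaT S p chR sigma).
Local Notation kst := (@kst S p chR).
Local Notation gser := (gser e chR).
Local Notation fser := (fser e chR).
Local Notation repx h0 n t B x := (@repx A S theta k kA E d g p chR h0 n t B x).
Local Notation ghostly := (@ghostly S d p e chR).
Variable Phi : A -> 'M[RT]_d.
Hypothesis PhiP : forall a, is_action_matrix g a (Phi a).
Local Notation eigen := (@eigen A S theta d p chR sigma Phi).
Local Notation jrep := (@jrep A S theta k kA E d g p chR).
Local Notation rep := (@rep A S theta k kA E d g p e chR).
Local Notation shift := (@shift S d p chR sigma).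
Local Notation shiftN := (@shiftN S d p chR sigma).
Local Notation fK h h' := ((fracT (fser h h'))%:M : 'M[KT]_d).

Lemma tri_exists0 n (t : nat -> 'rV[KT]_d) :
  exists m : nat -> 'rV[KT]_d, forall h, (0 <= h <= n)%N -> t h = \sum_(i < n.+1) m i *m GK i h.
Proof.
have [m mP] := @tri_exists S p e chR d n t.
have G0 : GK 0 0 = 1%:M by rewrite -(GKinvK e chR d 0) /GKinv expr0 invr1 kst1 mul1mx.
exists (fun i => if i is 0 then t 0%N - \sum_(i < n) m i.+1 *m GK i.+1 0 else m i) => [[|h]] hn.
  by rewrite big_ord_recl /= G0 mulmx1 subrK.
have hn' : (0 < h.+1 <= n)%N by case/andP: hn.
rewrite (mP h.+1 hn').
apply: eq_bigr => i _.
have [->|] := eqVneq (i : nat) 0%N.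
  have G0h : GK 0 h.+1 = 0 by exact: GK_small.
  by rewrite G0h mulmx0 mulmx0.
case: (i : nat) => [/eqP i0|i' _]; first by case: i0.
reflexivity.
Qed.

Lemma A_linear_jrep n (T : ntrans (jet E n) (Ga theta)) : A_linear T ->
  exists t m, jrep T t /\ ghostly 0 n t m.
Proof.
move=> TA; have [B C h x|B x y|t [nt tE]] := @jet_op_series _ _ _ _ _ _ _ g n p chR
    (fun B x => (T B x : B)).
- exact: (nt_nat T h x).
- by have := TA B 1 x y; rewrite !scale1r.
have [m mP] := tri_exists0 n (fun h => map_mx fracT (t h)).
exists t, m; split=> //; split=> // B x; exact: tE.
Qed.

Lemma incl_rep n (T : ntrans (jet E n) (Ga theta)) t m : jrep T t -> ghostly 0 n t m ->
  rep (incl_pull T) m.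
Proof.
move=> [nt TE] tm; exists t; split; last by move=> h /andP[h0 hn]; apply: tm.
split=> // B x; have -> : incl_pull T B x = T B (nincl x) by [].
rewrite TE !repxE (sum_pos n (fun h => \sum_j act p (t h 0 j) (xc g (nincl x) h j))).
rewrite big_ord_recl big1 ?add0r // => j _.
by rewrite xc_ker (act0 chR).
Qed.

Lemma phi_pull_jrep n (T : ntrans (jet E n) (Ga theta)) t m : jrep T t -> ghostly 0 n t m ->
  jrep (phi_pull T) (frob_rows e n t) /\ ghostly 0 n.+1 (frob_rows e n t) (shift m).
Proof.
move=> [nt TE] tm; split; first split.
- exact: frob_rows_null.
- move=> B x; have -> : phi_pull T B x = T (twist B) (fmap E (witt_frob n B) x) by [].
  rewrite TE !repxE.
  transitivity (\sum_(h < n.+1) \sum_j @act S p (t h 0 j) (twist B)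
      (wfrob (fun i => xc g x i j) h)).
    apply: eq_bigr => h _; apply: eq_bigr => j _; rewrite xc_frob //; by rewrite -ltnS.
  exact: (frob_rows_act qE n nt (fun i j => xc g x i j)).
move=> h' /andP[h'0 hn]; rewrite (fracT_frob_rows e sigmaE).
transitivity (\sum_(h < n.+1) \sum_(i < n.+1) map_mx (sigmaT 1) (m i) *m (GK i h *m fK h h')).
  apply: eq_bigr => h _; rewrite tm; last by rewrite /= -ltnS ltn_ord.
  rewrite raddf_sum mulmx_suml; apply: eq_bigr => i _ /=.
  by rewrite map_mxM (sigmaT_GK d e chR sigmaE) mulmxA.
rewrite exchange_big [RHS]big_ord_recl mul0mx add0r; apply: eq_bigr => i _ /=.
by rewrite -mulmx_sumr (GK_fK d chR qE (n := n)) // -ltnS.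
Qed.

Lemma phi_pull_A_linear n (T : ntrans (jet E n) (Ga theta)) : A_linear T -> A_linear (phi_pull T).
Proof.
move=> TA B a x y.
have -> : phi_pull T B (a *: x + y) = T (twist B) (fmap E (witt_frob n B) (a *: x + y)) by [].
rewrite linearP TA; congr (_ + _).
have -> : forall c : Ga theta (twist B), a *: c = str B (phi S (theta a)) * (c : B) by [].
by rewrite theta_phi.
Qed.

(** The relation phi i f = phi phi i for the lateral Frobenius f, pulled back to characters. In
    ghost components both sides apply sigma twice and shift by two. *)
Lemma lateral_phi_pull n (T : ntrans (jet E n) (Ga theta)) : A_linear T ->
  forall (B : calg S) (x : nker E n.+2 B),
    lateral_pull g (incl_pull (phi_pull T)) B x = incl_pull (phi_pull (phi_pull T)) B x.
Proof.
move=> TA; have [t [m [Tt tm]]] := A_linear_jrep TA.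
have [Tt1 tm1] := phi_pull_jrep Tt tm; have [Tt2 tm2] := phi_pull_jrep Tt1 tm1.
have r1 := lateral_rep qE sigmaE (incl_rep Tt1 tm1); have r2 := incl_rep Tt2 tm2.
apply: (rep_ext r1 r2) => -[//|[|i]] _ //.
by rewrite /= map_mx0.
Qed.

Lemma lateral_A_linear n (P : ntrans (nker E n.+1) (Ga theta)) : A_linear P ->
  A_linear (lateral_pull g P).
Proof.
move=> PA; have [m [Pm em]] := A_linear_rep qE sigmaE PhiP PA.
apply: (N_A_linear qE sigmaE PhiP (lateral_rep qE sigmaE Pm)) => -[//|[_|i ii]] /=.
  by move=> a; rewrite mul0mx scaler0.
by apply: eigen_shift => //; apply: em.
Qed.

Lemma lateral_trunc n n' (nn : (n.+1 <= n'.+1)%N) (nn' : (n.+2 <= n'.+2)%N)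
    (P : ntrans (nker E n.+1) (Ga theta)) : A_linear P ->
  forall (B : calg S) (x : nker E n'.+2 B),
    lateral_pull g (trunc_pull nn P) B x = trunc_pull nn' (lateral_pull g P) B x.
Proof.
move=> PA; have [m [Pm em]] := A_linear_rep qE sigmaE PhiP PA.
have r1 := lateral_rep qE sigmaE (trunc_rep nn Pm); have r2 := trunc_rep nn' (lateral_rep qE sigmaE Pm).
apply: (rep_ext r1 r2) => -[//|[|i]] _ /=; first by [].
by rewrite !ltnS; case: ifP => // _; rewrite map_mx0.
Qed.
End Lattice.

(** * The lateral operator on H and classes given by ghost components *)

Section Classes.
Variables (A : comNzRingType) (S : base) (theta : {rmorphism A -> S}).
Variables (k : finFieldType) (kA : {rmorphism k -> A}) (E : amod_functor A S) (d : nat).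
Variable g : coordinates E theta kA d.
Variables (p e : nat).
Local Notation R := (base_ring S).
Local Notation pi := (ppi S).
Local Notation bR := (base_calg S).
Local Notation K := {fraction R}.
Hypothesis chR : p \in [pchar R].
Hypothesis qE : qhat S = (p ^ e)%N.
Variable sigma : {rmorphism K -> K}.
Hypothesis sigmaE : forall x : R, sigma (tofrac x) = tofrac (phi S x).
Hypothesis theta_phi : forall a, phi S (theta a) = theta a.
Local Notation RT := (tps (frob chR)).
Local Notation KT := (tps (frob (fraction_pchar chR))).
Local Notation GK := (@GK S p e chR d).
Local Notation fracT := (@fracT S p chR).
Local Notation sigmaT := (@sigmaT S p chR sigma).
Local Notation kst := (@kst S p chR).
Local Notation gser := (gser e chR).
Local Notation fser := (fser e chR).
Local Notation repx h0 n t B x := (@repx A S theta k kA E d g p chR h0 n t B x).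
Local Notation ghostly := (@ghostly S d p e chR).
Variable Phi : A -> 'M[RT]_d.
Hypothesis PhiP : forall a, is_action_matrix g a (Phi a).
Local Notation eigen := (@eigen A S theta d p chR sigma Phi).
Local Notation jrep := (@jrep A S theta k kA E d g p chR).
Local Notation rep := (@rep A S theta k kA E d g p e chR).
Local Notation shift := (@shift S d p chR sigma).
Local Notation shiftN := (@shiftN S d p chR sigma).
Local Notation fK h h' := ((fracT (fser h h'))%:M : 'M[KT]_d).


Variables (H : lmodType R) (cls : forall m, ntrans (nker E m.+1) (Ga theta) -> H).
Hypothesis H_limit : is_HE cls.

Section Combination.
Variables (F : amod_functor A S) (c : R) (P1 P2 : ntrans F (Ga theta)).
Fact ntrans_comb_nat (B C : calg S) (h : chom B C) (x : F B) :
  (str C c * (P1 C (fmap F h x) : C) + (P2 C (fmap F h x) : C) : Ga theta C) =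
  fmap (Ga theta) h (str B c * (P1 B x : B) + (P2 B x : B)).
Proof.
rewrite !nt_nat; have hE (b : B) : fmap (Ga theta) h b = h b :> C by [].
by rewrite !hE rmorphD rmorphM chom_str.
Qed.
Definition ntrans_comb : ntrans F (Ga theta) :=
  @NTrans A S F (Ga theta) (fun B x => str B c * (P1 B x : B) + (P2 B x : B)) ntrans_comb_nat.

Lemma ntrans_comb_A_linear : A_linear P1 -> A_linear P2 -> A_linear ntrans_comb.
Proof.
move=> A1 A2 B a x y; rewrite /ntrans_comb /= A1 A2.
have sE (b : Ga theta B) : a *: b = str B (theta a) * (b : B) by [].
rewrite !sE /=.
have DE (b b' : Ga theta B) : b + b' = (b : B) + (b' : B) by [].
rewrite !DE; ring.
Qed.
End Combination.

Lemma trunc_A_linear n n' (nn : (n.+1 <= n'.+1)%N) (P : ntrans (nker E n.+1) (Ga theta)) :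
  A_linear P -> A_linear (trunc_pull nn P).
Proof.
move=> PA; have [m [Pm em]] := A_linear_rep qE sigmaE PhiP PA.
apply: (N_A_linear qE sigmaE PhiP (trunc_rep nn Pm)) => i /andP[i0 _].
case: ifP => ii; first by apply: em; rewrite i0.
by move=> a; rewrite mul0mx scaler0.
Qed.

Lemma cls_ext n (P P' : ntrans (nker E n.+1) (Ga theta)) : A_linear P' ->
  (forall (B : calg S) x, P B x = P' B x) -> cls P = cls P'.
Proof.
move=> PA' PP; rewrite (HE_linear H_limit (c := 0) PA' PA').
  by rewrite scale0r add0r.
by move=> B x; rewrite rmorph0 mul0r add0r PP.
Qed.

Lemma cls_comb n c (P1 P2 : ntrans (nker E n.+1) (Ga theta)) : A_linear P1 -> A_linear P2 ->
  cls (ntrans_comb c P1 P2) = c *: cls P1 + cls P2.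
Proof. by move=> A1 A2; apply: (HE_linear H_limit). Qed.

Lemma lateral_comb n c (P1 P2 : ntrans (nker E n.+1) (Ga theta)) : A_linear P1 -> A_linear P2 ->
  cls (lateral_pull g (ntrans_comb c P1 P2)) =
    phi S c *: cls (lateral_pull g P1) + cls (lateral_pull g P2).
Proof.
move=> A1 A2; apply: (HE_linear H_limit) => //; exact: (lateral_A_linear qE sigmaE theta_phi PhiP).
Qed.

(** By [lateral_phi_pull], a relation formed from T with coefficient c goes to the one formed from
    phi^* T with coefficient phi(c), one level higher. *)
Lemma cls_lateral_eq0 n (P : ntrans (nker E n.+1) (Ga theta)) : A_linear P -> cls P = 0 ->
  cls (lateral_pull g P) = 0.
Proof.
move=> PA /(HE_ker H_limit PA)[n' [nn [N [c [T [TA TE]]]]]].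
have lA := lateral_A_linear qE sigmaE theta_phi PhiP PA.
apply/(HE_ker H_limit lA); exists n'.+1, nn; exists N, (fun i => phi S (c i)), (fun i => phi_pull (T i)).
split=> [i|B x]; first exact: phi_pull_A_linear.
rewrite -(lateral_trunc qE sigmaE PhiP nn nn PA).
have -> : lateral_pull g (trunc_pull nn P) B x = trunc_pull nn P (twist B) (lateral g x) by [].
rewrite TE; apply: eq_bigr => i _; congr (_ * _).
rewrite -(lateral_phi_pull g chR qE sigmaE (TA i)).
by [].
Qed.

(** Both characters are moved to a common level, where their difference is a character of class
    0. *)
Lemma cls_lateral_eq n n' (P : ntrans (nker E n.+1) (Ga theta)) (P' : ntrans (nker E n'.+1) (Ga theta)) :
  A_linear P -> A_linear P' -> cls P = cls P' ->
  cls (lateral_pull g P) = cls (lateral_pull g P').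
Proof.
move=> PA PA' E0; pose N := maxn n n'.
have nN : (n.+1 <= N.+1)%N by rewrite ltnS leq_maxl.
have nN' : (n'.+1 <= N.+1)%N by rewrite ltnS leq_maxr.
have lateral_truncE m (mN : (m.+1 <= N.+1)%N) (Q : ntrans (nker E m.+1) (Ga theta)) : A_linear Q ->
    cls (lateral_pull g (trunc_pull mN Q)) = cls (lateral_pull g Q).
  move=> QA; have lA := lateral_A_linear qE sigmaE theta_phi PhiP QA.
  have mN2 : (m.+2 <= N.+2)%N by exact: mN.
  rewrite -(HE_trans H_limit mN2 lA); apply: cls_ext; first exact: trunc_A_linear.
  exact: (lateral_trunc qE sigmaE PhiP).
rewrite -(lateral_truncE _ nN) // -(lateral_truncE _ nN') //.
have TA := trunc_A_linear nN PA; have TA' := trunc_A_linear nN' PA'.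
have := cls_lateral_eq0 (ntrans_comb_A_linear (-1) TA' TA); rewrite cls_comb // lateral_comb //.
rewrite !(HE_trans H_limit) // E0 scaleN1r addNr => /(_ erefl).
by rewrite rmorphN rmorph1 scaleN1r addrC => /eqP; rewrite subr_eq0 => /eqP.
Qed.

Lemma common_level x y : exists n (P Q : ntrans (nker E n.+1) (Ga theta)),
  [/\ A_linear P, A_linear Q, cls P = x & cls Q = y].
Proof.
have [n [P [PA <-]]] := HE_surj H_limit x; have [n' [Q [QA <-]]] := HE_surj H_limit y.
have nN : (n.+1 <= (maxn n n').+1)%N by rewrite ltnS leq_maxl.
have nN' : (n'.+1 <= (maxn n n').+1)%N by rewrite ltnS leq_maxr.
exists (maxn n n'), (trunc_pull nN P), (trunc_pull nN' Q).
by split; [exact: trunc_A_linear | exact: trunc_A_linear | exact: (HE_trans H_limit) | exact: (HE_trans H_limit)].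
Qed.

Lemma lateral_operator_exists : exists fs, is_lateral_operator g cls fs.
Proof.
have /choice[fs fsP] x : exists y, forall n (P : ntrans (nker E n.+1) (Ga theta)),
    A_linear P -> cls P = x -> y = cls (lateral_pull g P).
  have [n [P [PA PE]]] := HE_surj H_limit x; exists (cls (lateral_pull g P)) => n' P' PA' PE'.
  by apply: cls_lateral_eq => //; rewrite PE.
exists fs; split=> [a x y|m P PA].
  have [n [P [Q [PA QA PE QE]]]] := common_level x y.
  rewrite (fsP _ n (ntrans_comb a P Q)); last by rewrite cls_comb // PE QE.
    by rewrite lateral_comb // (fsP x n P) // (fsP y n Q).
  exact: ntrans_comb_A_linear.
by split; [exact: (lateral_A_linear qE sigmaE theta_phi PhiP) | exact: fsP].
Qed.

(** Computations in H are carried out on ghost rows through this relation: by [hrep_ext] the rows of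
    index 1 to n + 1 determine h. *)
Definition hrep n (m : nat -> 'rV[KT]_d) (h : H) := exists P : ntrans (nker E n.+1) (Ga theta),
  [/\ rep P m, forall i, (0 < i <= n.+1)%N -> eigen i (m i) & cls P = h].

Lemma hrep_exists h : exists n m, hrep n m h.
Proof.
have [n [P [PA PE]]] := HE_surj H_limit h.
by have [m [Pm em]] := A_linear_rep qE sigmaE PhiP PA; exists n, m, P.
Qed.

Lemma hrep_A n m (P : ntrans (nker E n.+1) (Ga theta)) : rep P m ->
  (forall i, (0 < i <= n.+1)%N -> eigen i (m i)) -> A_linear P.
Proof. exact: (N_A_linear qE sigmaE PhiP). Qed.

Lemma hrep_ext n m m' h h' : hrep n m h -> hrep n m' h' ->
  (forall i, (0 < i <= n.+1)%N -> m i = m' i) -> h = h'.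
Proof.
move=> [P [Pm em <-]] [P' [Pm' em' <-]] mm; apply: cls_ext; first exact: hrep_A Pm' em'.
exact: (rep_ext Pm Pm' mm).
Qed.

Lemma eigen_lin i c m m' : eigen i m -> eigen i m' -> eigen i (kst c *: m + m').
Proof.
move=> em em' a.
have E1 : kst c *: (kst (tofrac (theta a)) *: m) = kst (tofrac (theta a)) *: (kst c *: m).
  by rewrite (scalerA (kst c)) (scalerA (kst (tofrac (theta a)))) -!kstM mulrC.
rewrite mulmxDl -scalemxAl em em' E1.
by rewrite scalerDr.
Qed.

Lemma hrep_comb n c m m' h h' : hrep n m h -> hrep n m' h' ->
  hrep n (fun i => kst (tofrac c) *: m i + m' i) (c *: h + h').
Proof.
move=> [P [Pm em <-]] [P' [Pm' em' <-]]; exists (ntrans_comb c P P'); split.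
- exact: (rep_lin Pm Pm').
- by move=> i hi; apply: eigen_lin; [exact: em | exact: em'].
- by rewrite cls_comb //; [exact: hrep_A Pm em | exact: hrep_A Pm' em'].
Qed.

Lemma hrep_trunc n n' m h : (n <= n')%N -> hrep n m h ->
  hrep n' (fun i => if (i <= n.+1)%N then m i else 0) h.
Proof.
move=> nn [P [Pm em <-]]; have nn' : (n.+1 <= n'.+1)%N by [].
exists (trunc_pull nn' P); split; first exact: trunc_rep.
  move=> i /andP[i0 _]; case: ifP => ii; first by apply: em; rewrite i0.
  by move=> a; rewrite mul0mx scaler0.
by apply: (HE_trans H_limit); exact: hrep_A Pm em.
Qed.

Lemma hrep_zero n m : (forall i, (0 < i <= n.+1)%N -> m i = 0) -> hrep n m 0.
Proof.
move=> m0; have n0 : null_rows (fun=> 0 : 'rV[RT]_d) by move=> h j; rewrite mxE; exact: null_zero.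
have [P [_ PE]] := @nrep_exists _ _ _ _ _ _ _ g p chR n.+1 _ n0.
have P0 (B : calg S) x : P B x = 0.
  rewrite PE !repxE big1 // => h _; rewrite big1 // => j _.
  by rewrite mxE act_zero.
have em i : (0 < i <= n.+1)%N -> eigen i (m i).
  by move=> /m0 -> a; rewrite mul0mx scaler0.
have Pm : rep P m.
  exists (fun=> 0); split=> // h /andP[h0 hn]; rewrite map_mx0 big1 // => -[[|i] /= il] _.
    have G0 : GK 0 h = 0 by exact: GK_small.
    by rewrite G0 mulmx0.
  by rewrite m0 ?mul0mx.
have PA := hrep_A Pm em; exists P; split=> //.
rewrite (HE_linear H_limit (c := -1) PA PA); first by rewrite scaleN1r addNr.
by move=> B x; rewrite !P0 mulr0 addr0.
Qed.

Lemma hrep_phi_image n (T : ntrans (jet E n) (Ga theta)) t m : jrep T t -> ghostly 0 n t m ->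
  (forall i, (i <= n)%N -> eigen i (m i)) -> hrep n (shift m) 0.
Proof.
move=> Tt tm em; have [Tt' tm'] := phi_pull_jrep qE sigmaE Tt tm; have r := incl_rep Tt' tm'.
have es i : (0 < i <= n.+1)%N -> eigen i (shift m i).
  by case: i => // i ii; apply: eigen_shift => //; exact: em.
have PA := hrep_A r es; exists (incl_pull (phi_pull T)); split=> //.
apply/(HE_ker H_limit PA); exists n, (leqnn _), 1%N, (fun=> 1), (fun=> T); split=> [_|B x].
  exact: (J_A_linear qE sigmaE PhiP Tt tm em).
rewrite big_ord1 rmorph1 mul1r; apply: (rep_ext (trunc_rep (leqnn _) r) r) => i /andP[_ ->].
by [].
Qed.

Lemma hrep_lateral fs n m h : is_lateral_operator g cls fs -> hrep n m h -> hrep n.+1 (shiftN m) (fs h).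
Proof.
move=> [_ fsP] [P [Pm em <-]]; have PA := hrep_A Pm em; have [lA ->] := fsP _ _ PA.
exists (lateral_pull g P); split=> //; first exact: lateral_rep.
move=> [//|[_|i ii]] /=; first by move=> a; rewrite mul0mx scaler0.
by apply: eigen_shift => //; exact: em.
Qed.
End Classes.

(** * Generators and relations of H over K *)

Section Generators.
Variables (A : comNzRingType) (S : base) (theta : {rmorphism A -> S}).
Variables (k : finFieldType) (kA : {rmorphism k -> A}) (E : amod_functor A S) (d : nat).
Variable g : coordinates E theta kA d.
Variables (p e : nat).
Local Notation R := (base_ring S).
Local Notation pi := (ppi S).
Local Notation bR := (base_calg S).
Local Notation K := {fraction R}.
Hypothesis chR : p \in [pchar R].
Hypothesis qE : qhat S = (p ^ e)%N.
Variable sigma : {rmorphism K -> K}.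
Hypothesis sigmaE : forall x : R, sigma (tofrac x) = tofrac (phi S x).
Hypothesis theta_phi : forall a, phi S (theta a) = theta a.
Local Notation RT := (tps (frob chR)).
Local Notation KT := (tps (frob (fraction_pchar chR))).
Local Notation GK := (@GK S p e chR d).
Local Notation fracT := (@fracT S p chR).
Local Notation sigmaT := (@sigmaT S p chR sigma).
Local Notation kst := (@kst S p chR).
Local Notation gser := (gser e chR).
Local Notation fser := (fser e chR).
Local Notation repx h0 n t B x := (@repx A S theta k kA E d g p chR h0 n t B x).
Local Notation ghostly := (@ghostly S d p e chR).
Variable Phi : A -> 'M[RT]_d.
Hypothesis PhiP : forall a, is_action_matrix g a (Phi a).
Local Notation eigen := (@eigen A S theta d p chR sigma Phi).
Local Notation jrep := (@jrep A S theta k kA E d g p chR).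
Local Notation rep := (@rep A S theta k kA E d g p e chR).
Local Notation shift := (@shift S d p chR sigma).
Local Notation shiftN := (@shiftN S d p chR sigma).
Local Notation fK h h' := ((fracT (fser h h'))%:M : 'M[KT]_d).


Hypothesis valR : forall x : R, x != 0 -> exists N y, x * y = pi ^+ N.
Hypothesis unitR : forall y : R, exists u, (1 + pi * y) * u = 1.
Hypothesis localR : forall x : R, (exists y, x = pi * y) \/ (exists y, x * y = 1).
Variable z : A.
Hypothesis theta_z : theta z = pi.
Hypothesis Phi_nilp : (mcoef 0 (Phi z) - pi%:M) ^+ d = 0.
Hypothesis dependence : exists n, forall w : 'I_n.+1 -> 'rV[KT]_d, (forall i, nullKrow (w i)) ->
  exists (c : 'I_n.+1 -> K) y, [/\ exists i, c i != 0, nullKrow y &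
    \sum_i kst (c i) *: w i = poleK (Phi z) y].
Variables (H : lmodType R) (cls : forall m, ntrans (nker E m.+1) (Ga theta) -> H).
Hypothesis H_limit : is_HE cls.
Local Notation piK := (tofrac pi : K).
Local Notation Fr := (frob chR).
Local Notation FrK := (frob (fraction_pchar chR)).
Local Notation hrep := (@hrep A S theta k kA E d g p e chR sigma Phi H cls).

(* psi i b below is the class of the character with the single ghost component
   sigma^(i+1)(s_b), up to a power of pi. *)
Definition single (j : nat) (v : 'rV[KT]_d) (i : nat) := if i == j then v else 0.
Local Notation sT i := (map_mx (sigmaT i)).

Lemma eigen_scale i c m : eigen i m -> eigen i (kst c *: m).
Proof.
move=> em a; apply/eqP; rewrite -subr_eq0; apply/eqP.
by rewrite defect_scale em subrr scaler0.
Qed.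

Lemma sT_S i (x : 'rV[KT]_d) : sT 1 (sT i x) = sT i.+1 x.
Proof. by apply/rowP => j; rewrite !mxE; exact: esym (sigmaTD _ _ _ _). Qed.

Lemma eigen_sT i s : eigen 0 s -> eigen i (sT i s).
Proof.
move=> es; elim: i => [|i IH].
  rewrite (_ : sT 0 s = s) //; apply/rowP => j; rewrite mxE; exact: sigmaT0.
by rewrite -sT_S; exact: eigen_shift.
Qed.

Lemma fracT_gser i h : (h <= i)%N -> fracT (gser i h) = mono FrK (piK ^+ h) (e * (i - h)).
Proof. by move=> hi; rewrite gserE // [LHS]tpsmap_mono rmorphXn. Qed.

Lemma itm_piK i C : itm sigma i (piK ^+ C) = piK ^+ C.
Proof. by rewrite -rmorphXn (itm_sigmaE sigmaE) (rmorphXn (itm (phi S) i)) /= itm_phi_pi. Qed.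

Lemma tame_row s : eigen 0 s -> exists C (c : 'rV[RT]_d), nullRrow c /\
  forall j, kst (piK ^+ C) * (s 0 j * kst piK) = fracT (c 0 j).
Proof.
move=> es; have nst : nullKrow (\row_j (s 0 j * kst piK)).
  move=> j; rewrite mxE; exact: (eigen_tame valR unitR sigmaE Phi_nilp (eigen_series theta_z es)).
have [C [c [nc cE]]] := nullKrow_integral valR nst; exists C, c; split=> // j.
have := congr1 (fun M : 'rV[KT]_d => M 0 j) cE; rewrite mxE mxE => ->.
by rewrite mxE.
Qed.

(** Witt rows of the character with the single ghost component pi^C sigma^i(s). For h >= 1 one
    factor of pi^h is absorbed in c = pi^C s pi, which is null, and pi^(h-1) remains. Row 0 would
    lack this factor, so the construction takes place on N^n. *)
Definition tame_rows (c : 'rV[RT]_d) i h : 'rV[RT]_d :=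
  \row_j (phiT i (c 0 j) * mono Fr (pi ^+ h.-1) (e * (i - h))).

Lemma tame_rows_null c i h j : nullRrow c -> @null S bR (tame_rows c i h 0 j).
Proof.
by move=> nc; rewrite mxE; apply: nullM; [exact/phiT_null/nc | exact: null_mono].
Qed.

Lemma tame_rowsE (s : 'rV[KT]_d) C (c : 'rV[RT]_d) i h : (forall j, kst (piK ^+ C) * (s 0 j * kst piK) = fracT (c 0 j)) ->
  (0 < h <= i)%N -> map_mx fracT (tame_rows c i h) = (kst (piK ^+ C) *: sT i s) *m GK i h.
Proof.
move=> cE /andP[h0 hi]; apply/rowP => j; rewrite !GKE mulmx_scalarE !mxE fracT_gser //.
have -> : fracT (phiT i (c 0 j) * mono Fr (pi ^+ h.-1) (e * (i - h))) =
    sigmaT i (fracT (c 0 j)) * mono FrK (piK ^+ h.-1) (e * (i - h)).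
  rewrite rmorphM; congr (_ * _); first by rewrite (sigmaT_fracT sigmaE).
  by rewrite [LHS]tpsmap_mono rmorphXn.
have spi C' : sigmaT i (kst (piK ^+ C')) = kst (piK ^+ C').
  by rewrite sigmaT_kst itm_piK.
rewrite -cE.
have -> : sigmaT i (kst (piK ^+ C) * (s 0 j * kst piK)) =
    kst (piK ^+ C) * (sigmaT i (s 0 j) * kst piK).
  transitivity (sigmaT i (kst (piK ^+ C)) * (sigmaT i (s 0 j) * sigmaT i (kst (piK ^+ 1)))).
    by rewrite -(rmorphM (sigmaT i)) -rmorphM.
  by rewrite !spi.
rewrite -!mulrA; congr (_ * (_ * _)).
by rewrite -monoMl -exprS prednK.
Qed.

(** The exponent C is the same for all i; as sigma fixes pi^C, the lateral operator then maps each
    class exactly to the next. *)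
Lemma psi_exists s : eigen 0 s -> exists C, forall i, exists h,
  hrep i (single i.+1 (kst (piK ^+ C) *: sT i.+1 s)) h.
Proof.
move=> es; have [C [c [nc cE]]] := tame_row es; exists C => i.
have nt : null_rows (fun h => tame_rows c i.+1 h) by move=> h j; exact: tame_rows_null.
have [P Pt] := @nrep_exists _ _ _ _ _ _ _ g p chR i.+1 _ nt.
exists (cls P), P; split=> //.
- exists (tame_rows c i.+1); split=> // h hi; rewrite (tame_rowsE cE hi).
  rewrite big_ord_recr /= big1 => [|i' _]; first by rewrite add0r /single eqxx.
  by rewrite /single ltn_eqF //= mul0mx.
- move=> i' _; rewrite /single; have [->|_] := eqVneq i' i.+1.
    exact/eigen_scale/eigen_sT.
  by move=> a; rewrite mul0mx scaler0.
Qed.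

Lemma hrep_sum n (I : Type) (r : seq I) (c : I -> R) (m : I -> nat -> 'rV[KT]_d) (h : I -> H) :
  (forall x, hrep n (m x) (h x)) ->
  hrep n (fun i => \sum_(x <- r) kst (tofrac (c x)) *: m x i) (\sum_(x <- r) c x *: h x).
Proof.
move=> mh; elim: r => [|x r IH].
  by rewrite big_nil; apply: (hrep_zero qE sigmaE PhiP H_limit) => i _; rewrite big_nil.
have -> : (fun i => \sum_(x <- x :: r) kst (tofrac (c x)) *: m x i) =
    (fun i => kst (tofrac (c x)) *: m x i + \sum_(x <- r) kst (tofrac (c x)) *: m x i).
  by apply/funext => i; rewrite big_cons.
by rewrite big_cons; exact: (hrep_comb qE sigmaE PhiP H_limit).
Qed.

Lemma hrep_scale n c m h : hrep n m h -> hrep n (fun i => kst (tofrac c) *: m i) (c *: h).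
Proof.
move=> mh; have := hrep_sum [:: tt] (fun=> c) (fun=> mh); rewrite big_seq1.
have -> : (fun i => \sum_(x <- [:: tt]) kst (tofrac c) *: m i) = (fun i => kst (tofrac c) *: m i).
  by apply/funext => i; rewrite big_seq1.
by [].
Qed.

Lemma sT_comb i N (c : 'I_N -> K) (s : 'I_N -> 'rV[KT]_d) :
  sT i (\sum_b kst (c b) *: s b) = \sum_b kst (itm sigma i (c b)) *: sT i (s b).
Proof.
transitivity (\sum_b sT i (kst (c b) *: s b)).
  by apply/rowP => j; rewrite mxE !summxE rmorph_sum; apply: eq_bigr => b _; rewrite [RHS]mxE.
by apply: eq_bigr => b _; exact: sigmaT_scale.
Qed.

Variables (N : nat) (s : 'I_N -> 'rV[KT]_d).
Hypothesis es : forall b, eigen 0 (s b).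
Hypothesis gs : forall m, eigen 0 m -> exists c : 'I_N -> K, m = \sum_b kst (c b) *: s b.

Lemma eigen_decomposition i m : eigen i m -> exists c : 'I_N -> K, m = \sum_b kst (c b) *: sT i (s b).
Proof.
move=> em; have [n [f [t [et ->]]]] := eigen_span valR unitR localR sigmaE theta_phi theta_z Phi_nilp em.
have /choice[c cE] (u : 'I_n) := gs (et u (ltn_ord u)).
exists (fun b => \sum_(u < n) tofrac (f u) * itm sigma i (c u b)).
transitivity (\sum_(u < n) \sum_b kst (tofrac (f u) * itm sigma i (c u b)) *: sT i (s b)).
  apply: eq_bigr => u _; rewrite cE sT_comb scaler_sumr; apply: eq_bigr => b _.
  by rewrite scalerA kstM.
rewrite exchange_big; apply: eq_bigr => b _ /=.
by rewrite kst_sum scaler_suml.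
Qed.

Variables (kap : 'I_N -> nat) (psi : nat -> 'I_N -> H).
Hypothesis psiP : forall i b, hrep i (single i.+1 (kst (piK ^+ kap b) *: sT i.+1 (s b))) (psi i b).

Lemma lateral_psi fs i b : is_lateral_operator g cls fs -> fs (psi i b) = psi i.+1 b.
Proof.
move=> fsP; have := hrep_lateral qE sigmaE theta_phi PhiP fsP (psiP i b) => r.
apply: (hrep_ext qE sigmaE PhiP H_limit r (psiP i.+1 b)) => -[//|[_|i' _]]; first by [].
rewrite /single /= !eqSS; case: eqP => [_|_]; last by rewrite map_mx0.
rewrite sigmaT_scale sT_S; congr (kst _ *: _).
exact: itm_piK.
Qed.

Lemma psi_comb n (c : nat -> 'I_N -> R) : exists m,
  hrep n m (\sum_(i < n.+1) \sum_b c i b *: psi i b) /\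
  forall i, (i < n.+1)%N -> m i.+1 = \sum_b kst (tofrac (c i b) * piK ^+ kap b) *: sT i.+1 (s b).
Proof.
have r (x : 'I_n.+1 * 'I_N) := hrep_trunc qE sigmaE PhiP H_limit (leq_ord x.1) (psiP x.1 x.2).
have := hrep_sum (index_enum _) (fun x : 'I_n.+1 * 'I_N => c x.1 x.2) r.
set m := (fun i => _); set h := \sum_(x <- _) _ => mh; exists m; split.
  suff <- : h = \sum_(i < n.+1) \sum_b c i b *: psi i b by [].
  by rewrite /h -(pair_bigA _ (fun (i : 'I_n.+1) b => c i b *: psi i b)).
move=> i ii; rewrite /m.
transitivity (\sum_(i' < n.+1) \sum_b kst (tofrac (c i' b)) *:
    (if (i.+1 <= i'.+1)%N then single i'.+1 (kst (piK ^+ kap b) *: sT i'.+1 (s b)) i.+1 else 0)).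
  exact: esym (pair_bigA _ (fun (i' : 'I_n.+1) b => kst (tofrac (c i' b)) *:
    (if (i.+1 <= i'.+1)%N then single i'.+1 (kst (piK ^+ kap b) *: sT i'.+1 (s b)) i.+1 else 0))).
rewrite (bigD1 (Ordinal ii)) //= [X in _ + X]big1 => [|i' i'i]; last first.
  apply: big1 => b _; rewrite /single eqSS; case: ifP => _; last by rewrite scaler0.
  by rewrite eq_sym -val_eqE /= in i'i; rewrite (negbTE i'i) scaler0.
rewrite addr0; apply: eq_bigr => b _.
by rewrite leqnn /single eqxx scalerA -kstM.
Qed.

Lemma psi_span h : exists r n (c : nat -> 'I_N -> R), r != 0 /\
  r *: h = \sum_(i < n) \sum_b c i b *: psi i b.
Proof.
have [n [m mh]] := hrep_exists qE sigmaE PhiP H_limit h.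
have [_ [_ em _]] := mh.
have /choice[c cE] (i : 'I_n.+1) := eigen_decomposition (em i.+1 (ltn_ord i)).
have [M /choice[r rE]] := common_denominator valR (fun x : 'I_n.+1 * 'I_N => c x.1 x.2 / piK ^+ kap x.2).
pose c' i b := if insub i is Some i' then r (i', b) else 0.
have [m' [mh' m'E]] := psi_comb n c'.
exists (pi ^+ M), n.+1, c'; split; first by rewrite expf_neq0 // ppi_neq0.
apply: (hrep_ext qE sigmaE PhiP H_limit (hrep_scale (pi ^+ M) mh) mh') => -[//|i] /= ii.
rewrite m'E // (cE (Ordinal ii)) scaler_sumr; apply: eq_bigr => b _.
rewrite scalerA -kstM; congr (kst _ *: _).
rewrite /c' insubT -rE /= mulrA divfK ?rmorphXn // expf_neq0 //; exact: piK_neq0.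
Qed.

Lemma psi_relation b : exists n (c : nat -> R), [/\ (0 < n)%N, c 0%N != 0 &
  \sum_(i < n) c i *: psi i b = 0].
Proof.
have nPhi : nullRmx (Phi z) by case: (PhiP z).
have [[|n] [c [N0 c0 nT]]] := null_relation qE valR unitR localR sigmaE nPhi Phi_nilp dependence
  (eigen_series theta_z (es b)); first by [].
pose mc i : 'rV[KT]_d := kst (c i) *: sT i (s b).
pose T h := \sum_(i < n.+1) mc i *m GK i h.
(* Row 0 is the combination of the rows sigma^i(s) tau^(ei) supplied by [null_relation]. In the rows
   h >= 1 each term is null by itself, thanks to the factor pi^h. *)
have nTh h : nullKrow (T h).
  case: h => [|h].
    rewrite (_ : T 0%N = ncomb n.+1 c (sigma_tau e sigma (s b))) //; apply: eq_bigr => i _.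
    rewrite /mc -scalemxAl; congr (_ *: _); apply/rowP => j.
    by rewrite !GKE mulmx_scalarE !mxE fracT_gser // expr0 subn0.
  apply: nullKrow_sum => i _; rewrite /mc -scalemxAl; apply: nullKrow_scale => //.
  have [C [r [nr rE]]] := tame_row (es b).
  case: (leqP h.+1 i) => hi; last first.
    have -> : GK i h.+1 = 0 by exact: GK_small.
    by rewrite mulmx0 => j; rewrite mxE; apply: (nullK_fin (n := 0%N)).
  have := tame_rowsE rE (hi : (0 < h.+1 <= i)%N).
  rewrite -scalemxAl => tE j; apply: (@nullK_kst_inv S p chR valR (piK ^+ C)).
    by rewrite expf_neq0 // piK_neq0.
  have := congr1 (fun M : 'rV[KT]_d => M 0 j) tE; rewrite mxE [in RHS]mxE => <-.
  exact: (nullK_frac (tame_rows_null i h.+1 j nr)).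
have /choice[C CP] h := nullKrow_integral valR (nTh h).
have /choice[t0 t0P] := CP.
have [M /choice[r rE]] := common_denominator valR (fun i : 'I_n.+1 => c i).
(* One power of pi that clears the denominators of all rows T_h with h <= n and of all coefficients
   c_i. *)
pose D := (\sum_(h < n.+1) C h + M)%N.
pose t h : 'rV[RT]_d := if (h <= n)%N then mono Fr (pi ^+ (D - C h)) 0 *: t0 h else 0.
have CD h : (h <= n)%N -> (C h <= D)%N.
  move=> hn; apply: (@leq_trans (\sum_(h < n.+1) C h)); last exact: leq_addr.
  by rewrite (bigD1 (Ordinal (hn : (h < n.+1)%N))) //= leq_addr.
have nt : null_rows t.
  move=> h j; rewrite /t; case: ifP => _; last by rewrite mxE; exact: null_zero.
  rewrite mxE; apply: nullM; first exact: null_mono.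
  by have [nt0 _] := t0P h; exact: nt0.
have tm : ghostly 0 n t (fun i => kst (piK ^+ D) *: mc i).
  move=> h /andP[_ hn]; rewrite /t hn fracT_scale; have [_ <-] := t0P h.
  rewrite scalerA -kstM tofracXn -exprD subnK ?CD // scaler_sumr.
  by apply: eq_bigr => i _; rewrite scalemxAl.
have [T' T't] := @jrep_exists _ _ _ _ _ _ _ g p chR n _ nt.
have em i : (i <= n)%N -> eigen i (kst (piK ^+ D) *: mc i).
  by move=> _; do 2! apply: eigen_scale; exact: eigen_sT.
have h0 := hrep_phi_image qE sigmaE theta_phi PhiP H_limit T't tm em.
pose c' i := if insub i is Some i' then pi ^+ (D - M) * r i' else 0.
have c'E (i : nat) : (i < n.+1)%N -> tofrac (c' i) = piK ^+ D * c i.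
  move=> ii; rewrite /c' insubT tofracM -rE /= mulrA tofracXn -exprD subnK //.
  by rewrite leq_addl.
exists n.+1, (fun i => phi S (c' i)); split=> //.
  rewrite -tofrac_eq0 -sigmaE fmorph_eq0 c'E // mulf_neq0 // expf_neq0 //; exact: piK_neq0.
have [m [mh mE]] := psi_comb n (fun i b' => if b' == b then phi S (c' i) else 0).
have -> : \sum_(i < n.+1) phi S (c' i) *: psi i b =
    \sum_(i < n.+1) \sum_b' (if b' == b then phi S (c' i) else 0) *: psi i b'.
  apply: eq_bigr => i _; rewrite (bigD1 b) //= eqxx big1 ?addr0 // => b' /negbTE->.
  by rewrite scale0r.
(* The zero class comes from the rows pi^D c_i sigma^i(s), whereas psi carries the factor pi^(kap
   b); the factor is inserted so that the ghost rows agree. *)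
rewrite -[RHS](scaler0 _ (pi ^+ kap b)).
apply: (hrep_ext qE sigmaE PhiP H_limit mh (hrep_scale (pi ^+ kap b) h0)) => -[//|i] /= ii.
rewrite mE // (bigD1 b) //= eqxx big1 => [|b' /negbTE->]; last first.
  by rewrite rmorph0 mul0r kst0 scale0r.
rewrite addr0 sigmaT_scale itm_piK /mc sigmaT_scale sT_S !scalerA -!kstM; congr (kst _ *: _).
by rewrite -sigmaE c'E // rmorphM tofracXn mulrC mulrA; congr (_ * _ * _); rewrite -rmorphXn sigmaE rmorphXn phi_ppi.
Qed.
End Generators.

(** * From relations to an isocrystal *)

Section Restriction.
Variables (K : nzRingType) (s : {rmorphism K -> K}) (V : lmodType K).
(** A map semilinear over s is a linear map into this module, so the universal property of the
    scalar extension also produces sigma-semilinear maps. *)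
Definition restricted_scalars : Type := let _ := s in V.
HB.instance Definition _ := GRing.Zmodule.copy restricted_scalars V.
Definition rscale (a : K) (v : restricted_scalars) : restricted_scalars := s a *: (v : V).
Fact rscaleA a b v : rscale a (rscale b v) = rscale (a * b) v.
Proof. by rewrite /rscale scalerA rmorphM. Qed.
Fact rscale1 : left_id 1 rscale.
Proof. by move=> v; rewrite /rscale rmorph1 scale1r. Qed.
Fact rscaleDr : right_distributive rscale +%R.
Proof. by move=> a u v; rewrite /rscale; exact: scalerDr. Qed.
Fact rscaleDl v : {morph rscale^~ v : a b / a + b}.
Proof. by move=> a b; rewrite /rscale rmorphD; exact: scalerDl. Qed.
HB.instance Definition _ := GRing.Zmodule_isLmodule.Build K restricted_scalars
  rscaleA rscale1 rscaleDr rscaleDl.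
End Restriction.

Lemma semilinear_map0 (R K : nzRingType) (s : {rmorphism R -> K}) (V : lmodType R) (W : lmodType K)
  (f : V -> W) : semilinear_map s f -> f 0 = 0.
Proof.
move=> sf; have := sf 1 0 0; rewrite scale1r addr0 rmorph1 scale1r => /eqP.
by rewrite -subr_eq0 opprD addrA subrr sub0r oppr_eq0 => /eqP.
Qed.

Lemma semilinear_mapZ (R K : nzRingType) (s : {rmorphism R -> K}) (V : lmodType R) (W : lmodType K)
  (f : V -> W) a x : semilinear_map s f -> f (a *: x) = s a *: f x.
Proof. by move=> sf; rewrite -[a *: x]addr0 sf (semilinear_map0 sf) addr0. Qed.

Lemma semilinear_mapD (R K : nzRingType) (s : {rmorphism R -> K}) (V : lmodType R) (W : lmodType K)
  (f : V -> W) x y : semilinear_map s f -> f (x + y) = f x + f y.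
Proof. by move=> sf; have := sf 1 x y; rewrite !scale1r rmorph1 scale1r. Qed.

Lemma semilinear_map_sum (R K : nzRingType) (s : {rmorphism R -> K}) (V : lmodType R) (W : lmodType K)
  (f : V -> W) (I : Type) (r : seq I) (P : pred I) (F : I -> V) : semilinear_map s f ->
  f (\sum_(i <- r | P i) F i) = \sum_(i <- r | P i) f (F i).
Proof.
move=> sf; apply: (big_morph f _ (semilinear_map0 sf)) => x y; exact: semilinear_mapD sf.
Qed.

Definition in_span (K : nzRingType) (V : lmodType K) (I : finType) (e : I -> V) (v : V) :=
  exists c : I -> K, v = \sum_i c i *: e i.

Section Span.
Variables (K : fieldType) (V : lmodType K) (I : finType) (e : I -> V).

Lemma in_span0 : in_span e 0.
Proof. by exists (fun=> 0); rewrite big1 // => i _; rewrite scale0r. Qed.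
Lemma in_spanD u v : in_span e u -> in_span e v -> in_span e (u + v).
Proof.
move=> [c ->] [c' ->]; exists (fun i => c i + c' i); rewrite -big_split.
by apply: eq_bigr => i _; rewrite scalerDl.
Qed.
Lemma in_spanZ a v : in_span e v -> in_span e (a *: v).
Proof.
move=> [c ->]; exists (fun i => a * c i); rewrite scaler_sumr.
by apply: eq_bigr => i _; rewrite scalerA.
Qed.
Lemma in_span_gen i : in_span e (e i).
Proof.
exists (fun j => (j == i)%:R); rewrite (bigD1 i) //= eqxx scale1r big1 ?addr0 // => j /negbTE->.
by rewrite scale0r.
Qed.
Lemma in_span_sum (J : Type) (r : seq J) (P : pred J) (F : J -> V) :
  (forall j, P j -> in_span e (F j)) -> in_span e (\sum_(j <- r | P j) F j).
Proof. by move=> H; apply: big_ind => //; [exact: in_span0 | exact: in_spanD]. Qed.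
Lemma in_span_inv a v : a != 0 -> in_span e (a *: v) -> in_span e v.
Proof. by move=> a0 /(in_spanZ a^-1); rewrite scalerA mulVf // scale1r. Qed.
End Span.

Lemma in_span_trans (K : fieldType) (V : lmodType K) (I J : finType) (e : I -> V) (f : J -> V) v :
  (forall i, in_span f (e i)) -> in_span e v -> in_span f v.
Proof. by move=> ef [c ->]; apply: in_span_sum => i _; apply: in_spanZ. Qed.

Lemma in_span_enum (K : fieldType) (V : lmodType K) (I : finType) (e : I -> V) v :
  in_span e v -> in_span (fun i : 'I_#|I| => e (enum_val i)) v.
Proof.
apply: in_span_trans => i; rewrite -(enum_rankK i).
exact: (in_span_gen (fun i => e (enum_val i))).
Qed.

Section Isocrystal.
Variables (R : idomainType) (phi : {rmorphism R -> R}).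
Local Notation K := {fraction R}.
Variable sigma : {rmorphism K -> K}.
Hypothesis sigmaE : forall x : R, sigma (tofrac x) = tofrac (phi x).
Variables (H : lmodType R) (HK : lmodType K) (j : H -> HK).
Hypothesis HK_extension : is_scalar_extension (@tofrac R) j.

Definition spanning (I : finType) (e : I -> HK) := forall h, in_span e (j h).

Lemma extension_uniq (W : lmodType K) (g g' : {linear HK -> W}) :
  (forall x, g (j x) = g' (j x)) -> g =1 g'.
Proof.
move=> gg'; have [js univ] := HK_extension.
have [|g0 [_ g0u]] := univ W (fun x => g (j x)).
  by move=> a x y; rewrite js linearP.
by move=> v; rewrite (g0u g) // (g0u g').
Qed.

(** Coordinates exist on j(H) and are linear there by freeness; the universal property extends them
    to HK. The resulting expansion agrees with the identity on j(H), hence everywhere by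
    [extension_uniq]. *)
Lemma spanning_coordinates n (e : 'I_n -> HK) : spanning e ->
  (forall c : 'I_n -> K, \sum_i c i *: e i = 0 -> forall i, c i = 0) ->
  exists g : {linear HK -> 'rV[K]_n}, forall v, v = \sum_i g v 0 i *: e i.
Proof.
move=> /choice[c cE] ind; have [js univ] := HK_extension.
have [|g [gj _]] := univ 'rV[K]_n (fun h => \row_i c h i).
  move=> a x y; apply/rowP => i; rewrite !mxE; apply/eqP; rewrite -subr_eq0; apply/eqP.
  apply: (ind (fun i => c (a *: x + y) i - (tofrac a * c x i + c y i))).
  have E : \sum_i (tofrac a * c x i + c y i) *: e i = tofrac a *: j x + j y.
    rewrite (cE x) (cE y) scaler_sumr -big_split; apply: eq_bigr => i' _.
    by rewrite scalerDl scalerA.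
  under eq_bigr do rewrite scalerBl.
  by rewrite sumrB E -cE js subrr.
exists g; pose L (v : HK) := \sum_i g v 0 i *: e i.
have Llin : linear L.
  move=> a u v; rewrite /L linearP scaler_sumr -big_split; apply: eq_bigr => i _.
  by rewrite !mxE scalerDl scalerA.
pose L' : {linear HK -> HK} := HB.pack L (GRing.isLinear.Build _ _ _ _ L Llin).
apply: (@extension_uniq HK idfun L') => h.
by rewrite /= /L gj {1}(cE h); apply: eq_bigr => i _; rewrite mxE.
Qed.

Lemma spanning_minimal_free n (e : 'I_n -> HK) : spanning e ->
  (forall m (f : 'I_m -> HK), spanning f -> (n <= m)%N) ->
  forall c : 'I_n -> K, \sum_i c i *: e i = 0 -> forall i, c i = 0.
Proof.
case: n e => [|n] e se mini c c0 i; first by case: i.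
apply/eqP; apply: contraT => ci; suff : (n.+1 <= n)%N by rewrite ltnn.
apply: (mini n (fun i' => e (lift i i'))) => h; apply: in_span_trans (se h) => i'.
have [->|i'i] := eqVneq i' i; last first.
  have [|i'' -> _] := @unlift_some _ i i'; first by rewrite eq_sym.
  exact: (in_span_gen (fun i' => e (lift i i')) i'').
apply: (in_span_inv ci); move/eqP: c0; rewrite (bigD1 i) //= addr_eq0 => /eqP->.
rewrite -scaleN1r; apply: in_spanZ; apply: in_span_sum => i'' i''i; apply: in_spanZ.
have [|i3 -> _] := @unlift_some _ i i''; first by rewrite eq_sym.
exact: (in_span_gen (fun i' => e (lift i i')) i3).
Qed.

Variable fs : H -> H.
Hypothesis fs_semi : semilinear_map phi fs.
Variables (N : nat) (psi : nat -> 'I_N -> H).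
Hypothesis fs_psi : forall i b, fs (psi i b) = psi i.+1 b.
Hypothesis psi_span : forall h, exists r n (c : nat -> 'I_N -> R), r != 0 /\
  r *: h = \sum_(i < n) \sum_b c i b *: psi i b.
Hypothesis psi_relation : forall b, exists n (c : nat -> R), [/\ (0 < n)%N, c 0%N != 0 &
  \sum_(i < n) c i *: psi i b = 0].

Lemma spanning_psi (I : finType) (e : I -> HK) :
  (forall i b, in_span e (j (psi i b))) -> spanning e.
Proof.
move=> pe h; have [js _] := HK_extension; have [r [n [c [r0 rE]]]] := psi_span h.
apply: (@in_span_inv _ _ _ _ (tofrac r)); first by rewrite tofrac_eq0.
rewrite -(semilinear_mapZ _ _ js) rE (semilinear_map_sum _ _ _ js).
apply: in_span_sum => i _; rewrite (semilinear_map_sum _ _ _ js).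
by apply: in_span_sum => b _; rewrite (semilinear_mapZ _ _ js); apply: in_spanZ.
Qed.

Lemma fK_exists : exists fK : HK -> HK, semilinear_map sigma fK /\ forall h, fK (j h) = j (fs h).
Proof.
have [js univ] := HK_extension.
have [|g [gj _]] := univ (restricted_scalars sigma HK) (fun h => j (fs h)).
  by move=> a x y; rewrite fs_semi js -sigmaE.
by exists g; split=> // a x y; rewrite linearP.
Qed.

(* Uses the last nonzero coefficient of the relation, whereas surjectivity of the
   linearization uses the first one. *)
Lemma relation_top b : exists t, forall i, exists c : nat -> K,
  j (psi (i + t) b) = \sum_(k < t) c k *: j (psi (i + k) b).
Proof.
have [js _] := HK_extension; have [n [c [n0 c0 cE]]] := psi_relation b.
have [t [tn ct tmax]] : exists t, [/\ (t < n)%N, c t != 0 & forall k, (t < k < n)%N -> c k = 0].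
  have ex : exists k, (k < n)%N && (c k != 0) by exists 0%N; rewrite n0.
  have ub k : (k < n)%N && (c k != 0) -> (k <= n)%N by case/andP => /ltnW.
  exists (ex_maxn ex ub); case: ex_maxnP => t /andP[tn ct] tmax; split=> // k /andP[tk kn].
  by apply/eqP; apply: contraTT tk => ck; rewrite -leqNgt; apply: tmax; rewrite kn.
exists t => i; exists (fun k => - ((iter i sigma (tofrac (c t)))^-1 * iter i sigma (tofrac (c k)))).
have itE x : iter i sigma (tofrac x) = tofrac (iter i phi x).
  by elim: i => //= i ->.
have it0 : iter i sigma (tofrac (c t)) != 0.
  by elim: i {itE} => [|i IH] /=; rewrite ?tofrac_eq0 ?fmorph_eq0.
have E : \sum_(k < t.+1) c k *: psi k b = 0.
  rewrite -[RHS]cE (big_ord_widen n (fun k => c k *: psi k b) tn) big_mkcond.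
  apply: eq_bigr => k _; case: leqP => // tk; rewrite tmax ?scale0r // tk ltn_ord //.
have Ei : \sum_(k < t.+1) iter i phi (c k) *: psi (i + k) b = 0.
  elim: i {itE it0} => [|i IH]; first by [].
  have := congr1 fs IH; rewrite (semilinear_map0 fs_semi) (semilinear_map_sum _ _ _ fs_semi) => E'.
  rewrite -[RHS]E'.
  by apply: eq_bigr => k _; rewrite (semilinear_mapZ _ _ fs_semi) fs_psi.
have := congr1 j Ei; rewrite (semilinear_map0 js) (semilinear_map_sum _ _ _ js).
rewrite (eq_bigr (fun k : 'I_t.+1 => iter i sigma (tofrac (c k)) *: j (psi (i + k)%N b))); last first.
  by move=> k _; rewrite (semilinear_mapZ _ _ js) itE.
rewrite big_ord_recr /= => /eqP; rewrite addrC addr_eq0 => /eqP Ej.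
apply: (scalerI it0); rewrite Ej scaler_sumr -sumrN; apply: eq_bigr => k _.
by rewrite scalerA mulrN mulVKf // scaleNr.
Qed.

Lemma spanning_exists : exists n (e : 'I_n -> HK), spanning e.
Proof.
have /choice[t tP] := relation_top; pose T := (\sum_b t b)%N.
have tT b : (t b <= T)%N by rewrite /T (bigD1 b) //= leq_addr.
exists #|{: 'I_T * 'I_N}|, (fun i => (fun x : 'I_T * 'I_N => j (psi x.1 x.2)) (enum_val i)) => h.
apply: (in_span_enum (e := fun x : 'I_T * 'I_N => j (psi x.1 x.2))).
apply: spanning_psi => {h} i b; elim/ltn_ind: i => i IH.
have [iT|Ti] := ltnP i T; first exact: (in_span_gen (fun x : 'I_T * 'I_N => j (psi x.1 x.2)) (Ordinal iT, b)).
have ti := leq_trans (tT b) Ti; have [c cE] := tP b (i - t b)%N.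
rewrite subnK // in cE; rewrite cE; apply: in_span_sum => k _; apply: in_spanZ; apply: IH.
by rewrite -{2}(subnK ti) ltn_add2l.
Qed.

Lemma isocrystal_exists : exists fK : HK -> HK,
  [/\ semilinear_map sigma fK, forall h, fK (j h) = j (fs h) & 
   [/\ bijective_linearization sigma fK, (forall a, exists b, sigma b = a) -> bijective fK &
       is_isocrystal sigma fK]].
Proof.
have [js _] := HK_extension; have [fK [fKs fKj]] := fK_exists; exists fK; split=> //.
have [n [e [se mini]]] : exists n (e : 'I_n -> HK), spanning e /\
    forall m (f : 'I_m -> HK), spanning f -> (n <= m)%N.
  have ex : exists n, `[< exists e : 'I_n -> HK, spanning e >].
    by have [n [e se]] := spanning_exists; exists n; apply/asboolP; exists e.
  case: (ex_minnP ex) => n /asboolP[e se] mini; exists n, e; split=> // m f sf.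
  by apply: mini; apply/asboolP; exists f.
pose w i := fK (e i).
have fK_span v : in_span e v -> in_span w (fK v).
  move=> [c ->]; exists (fun i => sigma (c i)); rewrite (semilinear_map_sum _ _ _ fKs).
  by apply: eq_bigr => i _; rewrite (semilinear_mapZ _ _ fKs).
have sw : spanning w.
  have wS i b : in_span w (j (psi i.+1 b)) by rewrite -fs_psi -fKj; apply: fK_span; exact: se.
  apply: spanning_psi => -[|i] b; last exact: wS.
  have [[|m] [c [m0 c0]]] := psi_relation b; first by [].
  rewrite big_ord_recl => /(congr1 j); rewrite (semilinear_map0 js) (semilinear_mapD _ _ js) => /eqP.
  rewrite addr_eq0 (semilinear_mapZ _ _ js) => /eqP E.
  apply: (@in_span_inv _ _ _ _ (tofrac (c 0%N))); first by rewrite tofrac_eq0.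
  rewrite E -scaleN1r (semilinear_map_sum _ _ _ js); apply: in_spanZ; apply: in_span_sum => i _.
  by rewrite (semilinear_mapZ _ _ js); apply: in_spanZ; exact: wS.
(* The family w = fK(e) has as many members as the minimal spanning family e, so it is minimal too,
   and both are free. *)
have ie := spanning_minimal_free se mini; have iw := spanning_minimal_free sw mini.
have [g gE] := spanning_coordinates se ie; have [h hE] := spanning_coordinates sw iw.
have gK (c : 'rV[K]_n) : g (\sum_i c 0 i *: e i) = c.
  apply/rowP => i; apply/eqP; rewrite -subr_eq0; apply/eqP.
  apply: (ie (fun i => g (\sum_i c 0 i *: e i) 0 i - c 0 i)).
  by under eq_bigr do rewrite scalerBl; rewrite sumrB -gE subrr.
have hK (c : 'rV[K]_n) : h (\sum_i c 0 i *: w i) = c.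
  apply/rowP => i; apply/eqP; rewrite -subr_eq0; apply/eqP.
  apply: (iw (fun i => h (\sum_i c 0 i *: w i) 0 i - c 0 i)).
  by under eq_bigr do rewrite scalerBl; rewrite sumrB -hE subrr.
have fKE v : fK v = \sum_i sigma (g v 0 i) *: w i.
  rewrite {1}[v]gE (semilinear_map_sum _ _ _ fKs).
  by apply: eq_bigr => i _; rewrite (semilinear_mapZ _ _ fKs).
have combl (W : lmodType K) (u : 'I_n -> W) : linear (fun c : 'rV[K]_n => \sum_i c 0 i *: u i).
  move=> a x y; rewrite scaler_sumr -big_split; apply: eq_bigr => i _.
  by rewrite !mxE scalerDl scalerA.
have bl : bijective_linearization sigma fK.
  (* A model of the Frobenius twist of HK: K^n, with v sent to sigma of its coordinates in e. The
     linearization then maps the standard basis to w. *)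
  exists 'rV[K]_n, (fun v => map_mx sigma (g v)); split; first split.
  - by move=> a x y; rewrite linearP; apply/rowP => i; rewrite !mxE rmorphD rmorphM.
  - move=> W f sf.
    pose G : {linear 'rV[K]_n -> W} := HB.pack (fun c : 'rV[K]_n => \sum_i c 0 i *: f (e i))
      (GRing.isLinear.Build _ _ _ _ (fun c : 'rV[K]_n => \sum_i c 0 i *: f (e i)) (combl W (fun i => f (e i)))).
    exists G; split=> [v|G' G'E c].
      rewrite [v in RHS]gE (semilinear_map_sum _ _ _ sf); apply: eq_bigr => i _.
      by rewrite mxE (semilinear_mapZ _ _ sf).
    rewrite {1}[c]row_sum_delta linear_sum; apply: eq_bigr => i _; rewrite linearZ; congr (_ *: _).
    rewrite -G'E; congr (G' _); have -> : g (e i) = delta_mx 0 i.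
      rewrite -[RHS]gK (bigD1 i) //= big1 => [|i' i'i].
        by rewrite mxE !eqxx scale1r addr0.
      by rewrite mxE (negbTE i'i) andbF scale0r.
    by apply/rowP => i'; rewrite !mxE; case: (_ && _); rewrite ?rmorph1 ?rmorph0.
  pose F : {linear 'rV[K]_n -> HK} := HB.pack (fun c : 'rV[K]_n => \sum_i c 0 i *: w i)
      (GRing.isLinear.Build _ _ _ _ (fun c : 'rV[K]_n => \sum_i c 0 i *: w i) (combl HK w)).
  exists F; split=> [v|]; first by rewrite fKE; apply: eq_bigr => i _; rewrite mxE.
  by exists h => [c|v]; [exact: hK | exact: esym (hE v)].
split=> //.
- move=> /choice[tau tauK].
  have tau_s a : tau (sigma a) = a by apply: (fmorph_inj sigma); exact: tauK.
  exists (fun v => \sum_i (map_mx tau (h v)) 0 i *: e i) => v.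
    have -> : h (fK v) = map_mx sigma (g v).
      by rewrite fKE -[RHS]hK; congr (h _); apply: eq_bigr => i _; rewrite mxE.
    by rewrite [RHS]gE; apply: eq_bigr => i _; rewrite !mxE tau_s.
  rewrite fKE gK [RHS]hE; apply: eq_bigr => i _; by rewrite mxE tauK.
- by split=> //; exists n, e => v; exists (fun i => g v 0 i); exact: gE.
Qed.
End Isocrystal.

(** * The hypotheses on E and R *)

Section LieAction.
Variables (A : comNzRingType) (S : base) (theta : {rmorphism A -> S}).
Variables (k : finFieldType) (kA : {rmorphism k -> A}) (E : amod_functor A S) (d : nat).
Variable g : coordinates E theta kA d.
Variable p : nat.
Local Notation R := (base_ring S).
Hypothesis chR : p \in [pchar R].
Local Notation RT := (tps (frob chR)).

Definition eps (r : R) : dual_calg S := (0, r).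

Lemma eps_exp r n : (1 < n)%N -> eps r ^+ n = 0.
Proof.
have eps2 : eps r * eps r = 0.
  rewrite [LHS]/(dual_mul _ _) /dual_mul /= !mul0r !mulr0 addr0.
  by [].
by case: n => [|[|n]] // _; rewrite 2!exprS mulrA eps2 mul0r.
Qed.

(** Since eps^(p^j) = 0 for j > 0, only the constant coefficient acts on tangent vectors. This turns
    the condition on Lie E into nilpotency of the constant term of Phi minus theta. *)
Lemma act_eps (f : RT) r : @act S p f (dual_calg S) (eps r) = eps (f 0%N * r).
Proof.
rewrite /act (nsum_fin (n := 1)) ?big_ord1.
  rewrite expn0 expr1.
  rewrite [LHS]dual_strM mulr0.
  by [].
case=> // j _; rewrite eps_exp ?mulr0 //.
exact: (leq_ltn_trans _ (ltn_expl j.+1 (prime_gt1 (pcharf_prime chR)))).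
Qed.

Definition tangent (u : 'cV[R]_d) : E (dual_calg S) := coordI g (\row_j eps (u j 0)).

Lemma tangent_lie u : lie_vector (tangent u).
Proof.
rewrite /lie_vector /tangent coordI_nat -[RHS](coordI0 g); congr coordI.
by apply/rowP => j; rewrite !mxE.
Qed.

Lemma tangent_eq0 u : tangent u = 0 -> u = 0.
Proof.
move=> /(congr1 (fun x => Defs.coord g x)); rewrite /tangent coordIK coord0 => /rowP u0.
by apply/colP => j; have := u0 j; rewrite !mxE => -[].
Qed.

Lemma tangent_defect a (Phi : 'M[RT]_d) u : is_action_matrix g a Phi ->
  lie_defect theta a (tangent u) = tangent ((mcoef 0 Phi - (theta a)%:M) *m u).
Proof.
move=> [_ PhiE]; apply/eqP; rewrite subr_eq; apply/eqP.
rewrite -[LHS](coordK g) -[RHS](coordK g); congr coordI; rewrite coordD coord_nat /tangent !coordIK.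
apply/rowP => i; rewrite PhiE !mxE.
transitivity (\sum_j eps (Phi i j 0%N * u j 0)).
  by apply: eq_bigr => j _; rewrite coordIK mxE act_eps.
have epsD (x y : R) : eps x + eps y = eps (x + y).
  have -> : eps x + eps y = (0 + 0, x + y) by [].
  by rewrite addr0.
have -> : dual_scale_hom (theta a) (eps (u i 0)) = eps (theta a * u i 0) by [].
rewrite epsD -(big_morph eps (fun x y => esym (epsD x y)) (erefl _)); congr eps.
have -> : theta a * u i 0 = \sum_j (theta a *+ (i == j)) * u j 0.
  rewrite (bigD1 i) //= eqxx mulr1n big1 ?addr0 // => l li.
  by rewrite eq_sym (negbTE li) mulr0n mul0r.
by rewrite -big_split; apply: eq_bigr => j _; rewrite !mxE /= mulrBl subrK.
Qed.

Lemma lie_nilpotent a (Phi : 'M[RT]_d) : is_action_matrix g a Phi ->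
  (forall v : E (dual_calg S), lie_vector v -> iter d (lie_defect theta a) v = 0) ->
  (mcoef 0 Phi - (theta a)%:M) ^+ d = 0.
Proof.
move=> PhiP nil; set M := _ - _.
have it n u : iter n (lie_defect theta a) (tangent u) = tangent (M ^+ n *m u).
  elim: n => [|n IH]; first by rewrite expr0 mul1mx.
  by rewrite iterS IH (tangent_defect _ PhiP) exprS -mulmxE mulmxA.
have M0 (u : 'cV[R]_d) : M ^+ d *m u = 0 by apply: tangent_eq0; rewrite -it; exact/nil/tangent_lie.
by rewrite -[LHS]mulmx1; apply/matrixP => i j; have := congr1 (fun v : 'cV[R]_d => v i 0) (M0 (col j 1%:M)); rewrite colE mulmxA -colE !mxE.
Qed.
End LieAction.

(** * Arithmetic of the base ring and its residue field *)

Section Ground.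
Variables (S : base).
Local Notation R := (base_ring S).
Local Notation pi := (ppi S).

Lemma qhat_prime_power : exists p e, p \in [pchar R] /\ qhat S = (p ^ e)%N.
Proof.
have pr := pdiv_prime (qhat_gt1 S).
have ch : pdiv (qhat S) \in [pchar R].
  by rewrite -(pnatE _ pr); apply: pnat_dvd (qhat_char S); exact: pdiv_dvd.
have : (pdiv (qhat S)).-nat (qhat S) by rewrite -(eq_pnat _ (pcharf_eq ch)) (qhat_char S).
by move=> /p_natP[e qe]; exists (pdiv (qhat S)), e.
Qed.

Hypothesis dvr : discrete_valuation_ring R.

Lemma ppi_nonunit y : pi * y = 1 -> False.
Proof.
move=> piy; have [sep _] := base_complete S.
suff : (1 : R) = 0 by apply/eqP; rewrite oner_eq0.
by apply: sep => n; exists (y ^+ n); rewrite -exprMn piy expr1n.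
Qed.

(** pi is not a unit, since R is separated for the pi-adic topology, so its valuation is positive
    and t divides it. *)
Lemma uniformizer : exists t : R, [/\ t \isn't a GRing.unit, exists s, pi = t * s &
  forall x, x != 0 -> exists n u, u \is a GRing.unit /\ x = u * t ^+ n].
Proof.
have [t [_ tu tP]] := dvr; exists t; split=> //.
have [[|n] [u [uu E]]] := tP pi (ppi_neq0 S); last by exists (u * t ^+ n); rewrite E exprS mulrCA.
by case: (@ppi_nonunit u^-1); rewrite E expr0 mulr1 divrr.
Qed.

Lemma dvr_unit y : exists u, (1 + pi * y) * u = 1.
Proof.
have [t [tu [s piE] tP]] := uniformizer.
have n0 : 1 + pi * y != 0.
  by apply/eqP => /eqP; rewrite addr_eq0 -mulrN => /eqP/esym/ppi_nonunit.
have [[|n] [u [uu E]]] := tP _ n0.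
  by exists u^-1; rewrite E expr0 mulr1 divrr.
case/negP: tu; apply/unitrP; exists (u * t ^+ n - s * y).
have H : t * (u * t ^+ n - s * y) = 1.
  by rewrite mulrBr mulrCA -exprS -E mulrA -piE addrK.
by rewrite mulrC H.
Qed.

Lemma dvr_val (x : R) : x != 0 -> exists N y, x * y = pi ^+ N.
Proof.
have [t [tu [s piE] tP]] := uniformizer => x0.
have [n [u [uu E]]] := tP _ x0; exists n, (u^-1 * s ^+ n).
by rewrite E piE mulrACA divrr // mul1r exprMn.
Qed.
End Ground.

Section Residue.
Variables (S : base) (l : fieldType) (cf : S -> nat -> l).
Hypothesis R_power_series : is_power_series_iso (ppi S) cf.
Local Notation R := (base_ring S).
Local Notation pi := (ppi S).

Definition res (x : R) : l := cf x 0%N.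
Fact res_zmod : zmod_morphism res.
Proof.
have [_ cfD _ _ _] := R_power_series => x y; apply/eqP; rewrite eq_sym subr_eq; apply/eqP.
by rewrite /res -cfD subrK.
Qed.
Fact res_mon : monoid_morphism res.
Proof.
have [_ _ cfM cf1 _] := R_power_series; split=> [|x y]; first by rewrite /res cf1.
by rewrite /res cfM big_ord1.
Qed.
Definition resm : {rmorphism R -> l} := HB.pack res
  (GRing.isZmodMorphism.Build R l res res_zmod) (GRing.isMonoidMorphism.Build R l res res_mon).

Lemma res_pi : resm pi = 0.
Proof. by have [_ _ _ _ cft] := R_power_series; rewrite /= /res cft. Qed.

Lemma res_surj a : exists x, resm x = a.
Proof. by have [[g cfK gK] _ _ _ _] := R_power_series; exists (g (fun=> a)); rewrite /= /res gK. Qed.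

Lemma res_ker x : resm x = 0 -> exists y, x = pi * y.
Proof.
have [[g cfK gK] _ cfM _ cft] := R_power_series => x0; exists (g (fun n => cf x n.+1)).
apply: (can_inj cfK); apply/funext => n; rewrite cfM gK.
case: n => [|n]; first by rewrite big_ord1 cft mul0r.
rewrite big_ord_recl big_ord_recl cft mul0r add0r cft mul1r big1 ?addr0 ?subSS ?subn0 //=.
by move=> i _; rewrite cft mul0r.
Qed.

(** A lift of the inverse residue inverts x modulo pi, and the inverse of some 1 + pi y corrects
    it. *)
Lemma res_local (unitR : forall y : R, exists u, (1 + pi * y) * u = 1) (x : R) :
  (exists y, x = pi * y) \/ (exists y, x * y = 1).
Proof.
have [/res_ker|x0] := eqVneq (resm x) 0; first by left.
right; have [x' x'E] := res_surj (resm x)^-1.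
have [|y yE] := @res_ker (x * x' - 1).
  by rewrite rmorphB rmorphM x'E divff // rmorph1 subrr.
have [u uE] := unitR y; exists (x' * u).
by rewrite mulrA -uE -yE addrC subrK.
Qed.
End Residue.

Local Open Scope classical_set_scope.
Local Open Scope ring_scope.

Theorem theorem1p4
  (k : finFieldType) (L : fieldType) (kL : {rmorphism k -> L})
  (L_function_field : is_function_field kL)
  (L_constants : geometrically_connected kL)
  (Oinf : set L) (Oinf_rational : is_rational_place kL Oinf)
  (A : comNzRingType) (iA : {rmorphism A -> L})
  (A_coordinate_ring : is_coordinate_ring kL Oinf iA)
  (kA : {rmorphism k -> A}) (kA_kL : forall c, iA (kA c) = kL c)
  (p : set A) (p_maximal : maximal_ideal p)
  (f : nat) (p_degree : ideal_degree kA p f)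
  (z : A) (z_in_p : p z) (z_notin_p2 : ~ ideal_pow p 2 z)
  (A_separable : separable_over kL iA z)
  (Ahat : comNzRingType) (c : {rmorphism A -> Ahat})
  (Ahat_completion : is_adic_completion p c)
  (R : base) (qhatE : qhat R = (#|k| ^ f)%N)
  (th : {rmorphism Ahat -> R}) (R_flat : flat th)
  (ppiE : ppi R = th (c z))
  (phi_th : forall x, phi R (th x) = th x)
  (theta : {rmorphism A -> R}) (thetaE : forall a, theta a = th (c a))
  (R_dvr : discrete_valuation_ring R)
  (R_complete : adically_complete (ideal_span (theta @` p)))
  (l : fieldType) (cf : R -> nat -> l)
  (R_power_series : is_power_series_iso (ppi R) cf)
  (phi_cf : forall x n, cf (phi R x) n = cf x n ^+ qhat R)
  (d r : nat) (E : amod_functor A R)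
  (E_anderson : abelian_anderson theta kA E d r)
  (g : coordinates E theta kA d)
  (H : lmodType R)
  (cls : forall m, ntrans (nker E m.+1) (Ga theta) -> H)
  (H_limit : is_HE cls)
  (sigma : {rmorphism {fraction R} -> {fraction R}})
  (sigmaE : forall x : R, sigma (tofrac x) = tofrac (phi R x))
  (HK : lmodType {fraction R}) (j : H -> HK)
  (HK_extension : is_scalar_extension (@tofrac R) j) :
  exists (fs : H -> H) (fK : HK -> HK),
    [/\ is_lateral_operator g cls fs,
        semilinear_map sigma fK &
        forall h, fK (j h) = j (fs h)] /\
    [/\ bijective_linearization sigma fK,
        (forall a : l, exists b : l, b ^+ qhat R = a) -> bijective fK &
        is_isocrystal sigma fK].
Proof.
have [ch [e [chR qE]]] := qhat_prime_power R.
have unitR := dvr_unit R_dvr; have valR := dvr_val R_dvr.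
have localR := res_local R_power_series unitR.
have theta_phi a : phi R (theta a) = theta a by rewrite thetaE phi_th.
have theta_z : theta z = ppi R by rewrite thetaE ppiE.
have /choice[Phi PhiP] a := action_matrix_exists g chR a.
have nilp : (mcoef 0 (Phi z) - (ppi R)%:M) ^+ d = 0.
  by rewrite -theta_z; apply: (lie_nilpotent (PhiP z)); exact: (aa_lie E_anderson).
have chl : ch \in [pchar l].
  rewrite inE (pcharf_prime chR) /= -(rmorph_nat (resm R_power_series)).
  by rewrite (pcharf0 chR) rmorph0.
have nPhi : nullRmx (Phi z) by case: (PhiP z).
have dep := fredholm_dependence valR (res_ker (R_power_series := R_power_series))
  (res_pi R_power_series) (res_surj R_power_series) chl nPhi.
have [fs fsP] := lateral_operator_exists qE sigmaE theta_phi PhiP H_limit.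
have [N [s [es gs]]] := eigen_basis unitR sigmaE theta_z nilp.
have /choice[kap kapP] b := psi_exists g e sigmaE theta_phi valR unitR theta_z nilp cls (es b).
have /choice[psi psiP] (x : nat * 'I_N) := kapP x.2 x.1.
have psiP' i b := psiP (i, b).
have [fK [fKs fKj [bl bij iso]]] := isocrystal_exists sigmaE HK_extension (proj1 fsP)
  (psi := fun i b => psi (i, b)) (fun i b => lateral_psi qE sigmaE theta_phi PhiP H_limit (s := s) (kap := kap) (psi := fun i b => psi (i, b)) psiP' i b fsP)
  (psi_span qE sigmaE theta_phi PhiP valR unitR localR theta_z nilp H_limit gs (kap := kap) (psi := fun i b => psi (i, b)) psiP')
  (psi_relation qE sigmaE theta_phi PhiP valR unitR localR theta_z nilp dep H_limit es (kap := kap) (psi := fun i b => psi (i, b)) psiP').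
exists fs, fK; split; split=> // perfect; apply: bij.
have [[g' cfK gK] _ _ _ _] := R_power_series.
(* phi raises each power series coefficient to the power qhat, so a preimage is found by taking
   roots in l coefficientwise. Surjectivity of sigma follows on fractions. *)
have phi_surj (y : R) : exists x, phi R x = y.
  have /choice[w wE] n := perfect (cf y n); exists (g' w).
  by apply: (can_inj cfK); apply/funext => n; rewrite phi_cf gK wE.
move=> a; have [y [x [x0 aE]]] := fractionP a.
have [x' x'E] := phi_surj x; have [y' y'E] := phi_surj y.
have sx : sigma (tofrac x') = tofrac x by rewrite sigmaE x'E.
exists (tofrac y' / tofrac x'); rewrite fmorph_div /= sx sigmaE y'E -aE mulrC mulKf //.
by rewrite tofrac_eq0.
Qed.
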